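(* Let $X\subseteq\mathbb{R}^d$ be a H\''older set or a simple fat closed subanalytic set. Let $f,g:X\to\mathbb{C}$ be such that, for some $m\in\mathbb{N}_{\ge1}$ and $C,\alpha>0$: (1) $g$, $fg$, $f^m\in\mathcal{C}^\infty(X,\mathbb{C})$, and (2) $|f(x)|\le C|g(x)|^\alpha$ for all $x\in X$. Then $f\in\mathcal{C}^\infty(X,\mathbb{C})$.
   Context: $\mathcal{C}^\infty(X,\mathbb{C})$ is the set of $f:X\to\mathbb{C}$ such that each $x\in X$ has an open neighborhood $V$ in $\mathbb{R}^d$ and a smooth $F:V\to\mathbb{C}$ with $F=f$ on $V\cap X$. A closed set $X$ is fat if $X=\overline{\mathrm{int}(X)}\neq\emptyset$; it is simple if each $x\in X$ has a basis of neighborhoods $\mathscr U$ with $U\cap\mathrm{int}(X)$ connected for all $U\in\mathscr U$. H\''older sets: for $0<\alpha\le1$, $r,h>0$ let $\Gamma^\alpha_d(r,h)=\{(x',x_d)\in\mathbb{R}^{d-1}\times\mathbb{R}: |x'|<r,\ h(|x'|/r)^\alpha<x_d<h\}$. An open $U$ has the uniform cusp property of index $\alpha$ if for every $x\in\partial U$ there are $\epsilon>0$, some $\Gamma=\Gamma^\alpha_d(r,h)$ and $A\in O(d)$ with $y+A\Gamma\subseteq U$ for all $y\in\overline U\cap B(x,\epsilon)$. A H\''older set is a fat closed set whose interior has the uniform cusp property of some index $\alpha\in(0,1]$. Subanalytic is meant in the sense of real analytic geometry. *)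

(* Defs.v *)
From HB Require Import structures.
From mathcomp Require Import all_boot all_order all_algebra.
From mathcomp Require Import all_classical all_reals all_analysis.
From mathcomp Require Import complex.
Import Order.TTheory GRing.Theory Num.Theory.
Import numFieldNormedType.Exports.

Set Implicit Arguments.
Unset Strict Implicit.
Unset Printing Implicit Defensive.

Local Open Scope classical_set_scope.
Local Open Scope ring_scope.

Section Defs.
Variable R : realType.

Definition enorm (d : nat) (x : 'rV[R]_d) : R :=
  Num.sqrt (\sum_(i < d) x ord0 i ^+ 2).

Definition eball (d : nat) (x : 'rV[R]_d) (e : R) : set 'rV[R]_d :=
  [set y | enorm (y - x) < e].

Definition orthogonal_mx (d : nat) (A : 'M[R]_d) : Prop := A *m A^T = 1%:M.

(* x = (x', x_d) in R^(d-1) x R : |x'| and x_d *)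
Definition xprime_norm (d : nat) (x : 'rV[R]_d) : R :=
  Num.sqrt (\sum_(i < d | (i.+1 < d)%N) x ord0 i ^+ 2).
Definition xlast (d : nat) (x : 'rV[R]_d) : R :=
  \sum_(i < d | (i.+1 == d)%N) x ord0 i.

Definition Gamma (d : nat) (alpha r h : R) : set 'rV[R]_d :=
  [set x | xprime_norm x < r /\
           h * (xprime_norm x / r) `^ alpha < xlast x /\ xlast x < h].

Definition uniform_cusp (d : nat) (alpha : R) (U : set 'rV[R]_d) : Prop :=
  forall x, (closure U `\` U) x ->
    exists (eps r h : R) (A : 'M[R]_d),
      0 < eps /\ 0 < r /\ 0 < h /\ orthogonal_mx A /\
      forall y, closure U y -> eball x eps y ->
        forall z : 'rV[R]_d, Gamma alpha r h z -> U (y + z *m A).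

Definition fat (d : nat) (X : set 'rV[R]_d) : Prop :=
  X = closure (interior X) /\ X !=set0.

Definition holder_set (d : nat) (X : set 'rV[R]_d) : Prop :=
  closed X /\ fat X /\
  exists alpha : R, 0 < alpha /\ alpha <= 1 /\ uniform_cusp alpha (interior X).

Definition simple_set (d : nat) (X : set 'rV[R]_d) : Prop :=
  forall x, X x -> forall W, nbhs x W ->
    exists U, nbhs x U /\ U `<=` W /\ connected (U `&` interior X).

Definition monomial (n : nat) (a : {ffun 'I_n -> nat}) (y : 'rV[R]_n) : R :=
  \prod_(i < n) y ord0 i ^+ a i.

Definition cube_idx (n N : nat) (a : {ffun 'I_n -> 'I_N.+1}) : {ffun 'I_n -> nat} :=
  [ffun i => nat_of_ord (a i)].

Definition analytic_at (n : nat) (F : 'rV[R]_n -> R) (x0 : 'rV[R]_n) : Prop :=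
  exists (r : R) (c : {ffun 'I_n -> nat} -> R), 0 < r /\
    forall y, ball x0 r y ->
      (exists M : R, forall N : nat,
         \sum_(a : {ffun 'I_n -> 'I_N.+1})
            `|c (cube_idx a) * monomial (cube_idx a) (y - x0)| <= M) /\
      (fun N : nat => \sum_(a : {ffun 'I_n -> 'I_N.+1})
            c (cube_idx a) * monomial (cube_idx a) (y - x0)) @ \oo --> F y.

Definition analytic_on (n : nat) (U : set 'rV[R]_n) (F : 'rV[R]_n -> R) : Prop :=
  forall x, U x -> analytic_at F x.

Definition semianalytic (n : nat) (A : set 'rV[R]_n) : Prop :=
  forall x : 'rV[R]_n, exists U : set 'rV[R]_n, open U /\ U x /\
    exists (p q : nat) (f g : 'I_p -> 'I_q -> 'rV[R]_n -> R),
      (forall i j, analytic_on U (f i j) /\ analytic_on U (g i j)) /\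
      A `&` U = U `&` [set y | exists i : 'I_p, forall j : 'I_q,
                                  f i j y = 0 /\ 0 < g i j y].

Definition subanalytic (d : nat) (X : set 'rV[R]_d) : Prop :=
  forall x : 'rV[R]_d, exists U : set 'rV[R]_d, open U /\ U x /\
    exists (q : nat) (A : set 'rV[R]_(d + q)),
      semianalytic A /\ compact (closure A) /\
      X `&` U = (@lsubmx R 1 d q) @` A.

Fixpoint Ck_on (d : nat) (k : nat) (V : set 'rV[R]_d) (F : 'rV[R]_d -> R) : Prop :=
  match k with
  | 0 => forall x, V x -> {for x, continuous F}
  | k'.+1 => (forall x, V x -> differentiable F x) /\
             forall v : 'rV[R]_d, Ck_on k' V (fun y => 'D_v F y)
  end.

Definition smooth_on (d : nat) (V : set 'rV[R]_d) (F : 'rV[R]_d -> R) : Prop :=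
  forall k, Ck_on k V F.

Definition csmooth_on (d : nat) (V : set 'rV[R]_d) (F : 'rV[R]_d -> R[i]) : Prop :=
  smooth_on V (fun y => complex.Re (F y)) /\ smooth_on V (fun y => complex.Im (F y)).

Definition Cinf (d : nat) (X : set 'rV[R]_d) (f : 'rV[R]_d -> R[i]) : Prop :=
  forall x, X x -> exists V : set 'rV[R]_d, open V /\ V x /\
    exists F : 'rV[R]_d -> R[i], csmooth_on V F /\
      forall y, V y -> X y -> F y = f y.

Definition cabs (z : R[i]) : R := Num.sqrt (complex.Re z ^+ 2 + complex.Im z ^+ 2).

End Defs.

(* Main.v *)
(** Near each of its points, a set of either kind satisfies a quantitative ball condition: for
    some exponent [M] and all small [delta], every point has within distance [delta] a ball of
    radius [delta ^ M] contained in the set.  For Hoelder sets this is read off the cusps.  For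
    subanalytic sets a failure yields a generalized point of the set, namely an ultrafilter
    which contains all comeager sets.  Local uniformization of the defining analytic functions
    along the ultrafilter (as monomials times units) puts the image of an orthant under an
    analytic map inside the set.  If this map has generic rank less than [d], its image is
    meager, which the ultrafilter excludes; otherwise a quantitative inverse function theorem
    produces the ball.

    At scale [delta] the function [f] is approximated by the Taylor polynomial of
    [(f g) / g] at a nearby point where [|g|] exceeds a fixed power of [delta]; if there is
    none, [f] is small by the second hypothesis and is approximated by [0].  With [q], [h], [p],
    [r] the Taylor expansions of [g], [f g], [f ^ m], [f], one has [q r = h] and [r ^ m = p], so
    [q ^ (m - 1) r ^ l] is bounded for all [l]: this bounds the coefficients of [r] by a power
    of [1 / delta].  The polynomials are glued by partitions of unity at the scales [2 ^ - j];
    the differences between consecutive scales are small on the set, hence, by the ball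
    condition and the Landau inequalities between derivatives, small with all their
    derivatives, and the telescoping sum is a smooth extension of [f]. *)
From HB Require Import structures.
From mathcomp Require Import all_boot all_order all_algebra.
From mathcomp Require Import all_classical all_reals all_analysis.
From mathcomp Require Import complex perm.
From mathcomp Require Import ring lra zify.
Require Import Defs.
Import Order.TTheory GRing.Theory Num.Theory.
Import numFieldNormedType.Exports.
Local Open Scope classical_set_scope.
Local Open Scope ring_scope.
Set Implicit Arguments.
Unset Strict Implicit.
Unset Printing Implicit Defensive.

(** * Germs of analytic functions *)

Section Analytic.
Variable R : realType.
Implicit Types (n m k i : nat) (r s B C : R).

Local Notation pt := (nat -> R).

Definition cube n r : set pt := [set x | forall i, (i < n)%N -> `|x i| <= r].

Definition upd (x : pt) k (a : R) : pt := fun i => if i == k then a else x i.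

Definition sums_to (u : nat -> R) (l : R) : Prop :=
  forall e, 0 < e -> exists N0, forall N, (N0 <= N)%N ->
    `|\sum_(k < N) u k - l| <= e.

(* [an n r F B]: on [cube n r], [F] is the sum of a power series in the first [n]
   variables whose l^1 norm at radius [r] is at most [B]. *)
Inductive an n r : (pt -> R) -> R -> Prop :=
| an_cst c : an n r (fun=> c) `|c|
| an_var i : (i < n)%N -> an n r (fun x => x i) r
| an_add F G B C : an n r F B -> an n r G C ->
    an n r (fun x => F x + G x) (B + C)
| an_mul F G B C : an n r F B -> an n r G C ->
    an n r (fun x => F x * G x) (B * C)
| an_ser (D : nat -> pt -> R) (b : nat -> R) F B :
    (forall k, an n r (D k) (b k)) ->
    (forall N, \sum_(k < N) b k <= B) ->
    (forall x, cube n r x -> sums_to (D^~ x) (F x)) -> an n r F B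
| an_ext F G B C : (forall x, cube n r x -> F x = G x) -> B <= C ->
    an n r F B -> an n r G C.

Lemma sums_to_le (u b : nat -> R) l B : (forall k, `|u k| <= b k) ->
  (forall N, \sum_(k < N) b k <= B) -> sums_to u l -> `|l| <= B.
Proof.
move=> ub bB ul; apply/ler_addgt0Pr => e e0.
have [N0 /(_ _ (leqnn _)) h] := ul _ e0.
have h2 : `|\sum_(k < N0) u k| <= B.
  apply: le_trans (ler_norm_sum _ _ _) _; apply: le_trans (bB N0).
  by apply: ler_sum => k _.
have := ler_normB (\sum_(k < N0) u k) (\sum_(k < N0) u k - l).
rewrite opprB addrC subrK; lra.
Qed.

Lemma sums_toD u v l1 l2 : sums_to u l1 -> sums_to v l2 ->
  sums_to (fun k => u k + v k) (l1 + l2).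
Proof.
move=> ul vl e e0; have e2 : 0 < e / 2 by lra.
have [N1 h1] := ul _ e2; have [N2 h2] := vl _ e2.
exists (maxn N1 N2) => N; rewrite geq_max => /andP[/h1 {}h1 /h2 {}h2].
rewrite big_split /= opprD addrACA; apply: le_trans (ler_normD _ _) _; lra.
Qed.

Lemma sums_toZ a u l : sums_to u l -> sums_to (fun k => a * u k) (a * l).
Proof.
move=> ul e e0; have a0 : 0 < `|a| + 1 by rewrite ltr_wpDl.
have [N1 h1] := ul _ (divr_gt0 e0 a0).
exists N1 => N /h1 {}h1.
rewrite -mulr_sumr -mulrBr normrM.
apply: le_trans (_ : (`|a| + 1) * (e / (`|a| + 1)) <= _); last first.
  by rewrite mulrCA divff ?mulr1 ?gt_eqF.
by apply: ler_pM => //; lra.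
Qed.

Lemma sums_to_uniq u l1 l2 : sums_to u l1 -> sums_to u l2 -> l1 = l2.
Proof.
move=> h1 h2; apply/eqP; rewrite -subr_eq0 -normr_le0.
apply/ler_addgt0Pr => e e0; have e2 : 0 < e / 2 by lra.
have [N1 {}h1] := h1 _ e2; have [N2 {}h2] := h2 _ e2.
have := h1 (maxn N1 N2) (leq_maxl _ _); have := h2 (maxn N1 N2) (leq_maxr _ _).
set S := \sum_(_ < _) _ => {}h2 {}h1.
rewrite add0r (_ : l1 - l2 = (S - l2) - (S - l1)); last by ring.
apply: le_trans (ler_normB _ _) _; lra.
Qed.

Lemma sums_to_ext u v l : u =1 v -> sums_to u l -> sums_to v l.
Proof.
move=> uv h e e0; have [N h1] := h _ e0; exists N => k /h1.
by under eq_bigr do rewrite uv.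
Qed.

Lemma summable_sums_to (u b : nat -> R) B : (forall k, `|u k| <= b k) ->
  (forall N, \sum_(k < N) b k <= B) -> exists l, sums_to u l.
Proof.
move=> ub bB.
have cb : cvgn (series b).
  apply: nondecreasing_is_cvgn.
    apply/nondecreasing_seqP => k; rewrite /series /= big_nat_recr //= lerDl.
    exact: le_trans (ub k).
  exists B => _ [k _ <-]; rewrite /series /= big_mkord; exact: bB.
have cu : cvgn (series u).
  apply: normed_cvg; apply: series_le_cvg cb => //= k; first exact: le_trans (ub k).
exists (limn (series u)) => e e0.
have /cvgrPdist_le /(_ _ e0) [N0 _ h] := cu.
exists N0 => N /h; rewrite /series /= big_mkord distrC; exact.
Qed.

Lemma cube0 n r : 0 <= r -> cube n r (fun=> 0).
Proof. by move=> r0 i _; rewrite normr0. Qed.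

Lemma an_le n r F B : an n r F B -> forall x, cube n r x -> `|F x| <= B.
Proof.
elim=> {F B} [c x _ //|i lin x /(_ _ lin) //|F G B C _ h1 _ h2 x xr
  |F G B C _ h1 _ h2 x xr|D b F B _ h1 h2 h3 x xr|F G B C FG BC _ h x xr].
- by apply: le_trans (ler_normD _ _) _; apply: lerD; [exact: h1|exact: h2].
- by rewrite normrM ler_pM //; [exact: h1|exact: h2].
- by apply: (@sums_to_le (D^~ x) b) => // [k|]; [exact: h1|exact: h3].
- by rewrite -FG //; apply: le_trans BC; exact: h.
Qed.

Lemma an_ge0 n r F B : 0 <= r -> an n r F B -> 0 <= B.
Proof. by move=> r0 /an_le /(_ _ (cube0 r0)); apply: le_trans. Qed.

Lemma an_dep n r F B : an n r F B -> forall x y, cube n r x ->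
  (forall i, (i < n)%N -> x i = y i) -> F x = F y.
Proof.
elim=> {F B} [c//|i lin x y _ ->//|F G B C _ h1 _ h2 x y xr xy
  |F G B C _ h1 _ h2 x y xr xy|D b F B _ h1 h2 h3 x y xr xy|F G B C FG BC _ h x y xr xy].
- by rewrite (h1 _ y) // (h2 _ y).
- by rewrite (h1 _ y) // (h2 _ y).
- have yr : cube n r y by move=> i lin; rewrite -xy // xr.
  apply: sums_to_uniq (h3 _ xr) _; apply: sums_to_ext (h3 _ yr) => k.
  by rewrite (h1 k x y).
- have yr : cube n r y by move=> i lin; rewrite -xy // xr.
  by rewrite -FG // -FG //; exact: h.
Qed.

Lemma an_comp n r F B m s (T : nat -> pt -> R) : an n r F B ->
  (forall i, (i < n)%N -> an m s (T i) r) ->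
  an m s (fun x => F (T^~ x)) B.
Proof.
move=> aF aT; have Tc x : cube m s x -> cube n r (T^~ x).
  by move=> xs i lin; apply: an_le (aT _ lin) _ xs.
elim: aF => {F B} [c|i lin|F G B C _ h1 _ h2|F G B C _ h1 _ h2
  |D b F B _ h1 h2 h3|F G B C FG BC _ h].
- exact: an_cst.
- exact: aT.
- exact: an_add.
- exact: an_mul.
- by apply: (an_ser h1 h2) => x /Tc; exact: h3.
- by apply: (an_ext _ BC h) => x /Tc; exact: FG.
Qed.

Lemma an_weak n r F B C : B <= C -> an n r F B -> an n r F C.
Proof. by move=> BC; exact: an_ext. Qed.

Lemma an_eq n r F G B : F =1 G -> an n r F B -> an n r G B.
Proof. by move=> /funext ->. Qed.

Lemma an_sub n r F B m s : an n r F B -> (n <= m)%N -> s <= r -> an m s F B.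
Proof.
move=> aF nm sr; apply: (@an_comp _ _ _ _ _ _ (fun i x => x i) aF) => i lin.
by apply: an_weak sr _; apply: an_var; exact: leq_trans nm.
Qed.

Lemma an_split n r F B : 0 < r -> an n.+1 r F B -> exists F1 b0 b1,
  [/\ an n r (fun x => F (upd x n 0)) b0, an n.+1 r F1 b1, b0 + r * b1 <= B &
    forall x, cube n.+1 r x -> F x = F (upd x n 0) + x n * F1 x].
Proof.
move=> r0; have u0 x s : 0 <= s -> cube n s x -> cube n.+1 s (upd x n 0).
  move=> s0 xr i; rewrite ltnS leq_eqVlt /upd => /orP[/eqP->|lin].
    by rewrite eqxx normr0.
  by rewrite ltn_eqF // xr.
have uS x s : cube n.+1 s x -> cube n s x by move=> xs i lin; apply: xs; lia.
elim=> {F B} [c|i|F G B C _ [F1 [b0 [b1 [aF0 aF1 bB eF]]]] _ [G1 [c0 [c1 [aG0 aG1 cC eG]]]]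
  |F G B C _ [F1 [b0 [b1 [aF0 aF1 bB eF]]]] _ [G1 [c0 [c1 [aG0 aG1 cC eG]]]]
  |D b F B _ h1 h2 h3|F G B C FG BC _ [F1 [b0 [b1 [aF0 aF1 bB eF]]]]].
- exists (fun=> 0), `|c|, `|0 : R|; split; try exact: an_cst.
    by rewrite normr0 mulr0 addr0.
  by move=> x _; rewrite mulr0 addr0.
- rewrite ltnS leq_eqVlt => /orP[/eqP->|lin].
    exists (fun=> 1), `|0 : R|, `|1 : R|; split; try exact: an_cst.
    + apply: an_ext (an_cst _ _ 0) => // x _; by rewrite /upd eqxx.
    + by rewrite normr0 normr1 add0r mulr1.
    + by move=> x _; rewrite /upd eqxx add0r mulr1.
  exists (fun=> 0), r, `|0 : R|; split; try exact: an_cst.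
  + by apply: an_ext (an_var _ lin) => // x _; rewrite /upd ltn_eqF.
  + by rewrite normr0 mulr0 addr0.
  + by move=> x _; rewrite /upd ltn_eqF // mulr0 addr0.
- exists (fun x => F1 x + G1 x), (b0 + c0), (b1 + c1); split; try exact: an_add.
    by rewrite mulrDr addrACA lerD.
  by move=> x xr; rewrite eF // eG // mulrDr; ring.
- have b00 := an_ge0 (ltW r0) aF0; have c00 := an_ge0 (ltW r0) aG0.
  have b10 := an_ge0 (ltW r0) aF1; have c10 := an_ge0 (ltW r0) aG1.
  have aF0' : an n.+1 r (fun x => F (upd x n 0)) b0 by apply: an_sub aF0 _ _.
  have aG0' : an n.+1 r (fun x => G (upd x n 0)) c0 by apply: an_sub aG0 _ _.
  exists (fun x => F1 x * G (upd x n 0) + F (upd x n 0) * G1 x + x n * (F1 x * G1 x)),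
    (b0 * c0), (b1 * c0 + b0 * c1 + r * (b1 * c1)); split.
  + exact: an_mul.
  + apply: an_add; first by apply: an_add; exact: an_mul.
    by apply: an_mul; [exact: an_var|exact: an_mul].
  + apply: le_trans (_ : (b0 + r * b1) * (c0 + r * c1) <= _).
      by rewrite le_eqVlt; apply/orP; left; apply/eqP; ring.
    by apply: ler_pM => //; rewrite addr_ge0 // mulr_ge0 // ltW.
  + by move=> x xr; rewrite eF // eG //; ring.
- have /choice[f hf] : forall k, exists t : (pt -> R) * R * R,
    [/\ an n r (fun x => D k (upd x n 0)) t.1.2, an n.+1 r t.1.1 t.2,
     t.1.2 + r * t.2 <= b k & forall x, cube n.+1 r x ->
       D k x = D k (upd x n 0) + x n * t.1.1 x].
    by move=> k; have [F1 [b0 [b1 ?]]] := h1 k; exists (F1, b0, b1).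
  have c0 k : 0 <= (f k).1.2 by have [] := hf k; move/(an_ge0 (ltW r0)).
  have c1 k : 0 <= (f k).2 by have [_] := hf k; move/(an_ge0 (ltW r0)).
  have B0 N : \sum_(k < N) (f k).1.2 + r * \sum_(k < N) (f k).2 <= B.
    rewrite mulr_sumr -big_split /=; apply: le_trans (h2 N).
    by apply: ler_sum => k _; have [] := hf k.
  have S0 N : 0 <= \sum_(k < N) (f k).1.2 by apply: sumr_ge0.
  have S1 N : 0 <= \sum_(k < N) (f k).2 by apply: sumr_ge0.
  have B1 N : \sum_(k < N) (f k).1.2 <= B.
    by have := B0 N; have := mulr_ge0 (ltW r0) (S1 N); lra.
  have B2 N : \sum_(k < N) (f k).2 <= B / r.
    by rewrite ler_pdivlMr // mulrC; have := B0 N; have := S0 N; lra.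
  have [b0 sb0] := @summable_sums_to (fun k => (f k).1.2) (fun k => (f k).1.2) B
     (fun k => ltac:(by rewrite ger0_norm)) B1.
  have [b1 sb1] := @summable_sums_to (fun k => (f k).2) (fun k => (f k).2) (B / r)
     (fun k => ltac:(by rewrite ger0_norm)) B2.
  have mono (u : nat -> R) l N : (forall k, 0 <= u k) -> sums_to u l -> \sum_(k < N) u k <= l.
    move=> u_ge0 ul; apply/ler_addgt0Pr => e e0; have [N0 h] := ul _ e0.
    have := h (maxn N N0) (leq_maxr _ _); rewrite ler_norml => /andP[_ h'].
    suff : \sum_(k < N) u k <= \sum_(k < maxn N N0) u k by lra.
    rewrite -[leLHS](big_mkord xpredT u) -[leRHS](big_mkord xpredT u).
    rewrite [leRHS](big_cat_nat (n := N)) ?leq_maxl //= lerDl.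
    exact: sumr_ge0.
  have /choice[F1 hF1] : forall x, exists l, cube n.+1 r x -> sums_to (fun k => (f k).1.1 x) l.
    move=> x; have [xr|xr] := pselect (cube n.+1 r x); last by exists 0.
    have [l hl] := @summable_sums_to (fun k => (f k).1.1 x) (fun k => (f k).2) (B / r)
      (fun k => ltac:(have [_ /an_le h _ _] := hf k; exact: h xr)) B2.
    by exists l.
  exists F1, b0, b1; split.
  + apply: (an_ser (D := fun k x => D k (upd x n 0)) (b := fun k => (f k).1.2)).
    * by move=> k; have [] := hf k.
    * by move=> N; apply: (mono (fun k => (f k).1.2)).
    * by move=> x xr; apply: h3; apply: u0 xr; exact: ltW.
  + apply: (an_ser (D := fun k => (f k).1.1) (b := fun k => (f k).2)).
    * by move=> k; have [] := hf k.
    * by move=> N; apply: (mono (fun k => (f k).2)).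
    * exact: hF1.
  + apply/ler_addgt0Pr => e e0.
    have [N h] := sums_toD sb0 (sums_toZ r sb1) e0.
    have := h _ (leqnn _); rewrite big_split /= -mulr_sumr ler_norml => /andP[h' _].
    by have := B0 N; lra.
  + move=> x xr; apply: sums_to_uniq (h3 _ xr) _.
    apply: sums_to_ext (sums_toD (h3 (upd x n 0) _) (sums_toZ (x n) (hF1 _ xr))).
      by move=> k /=; have [_ _ _ /(_ _ xr) ->] := hf k.
    by apply: u0; [exact: ltW|exact: uS].
- exists F1, b0, b1; split => //; last first.
    move=> x xr; rewrite -FG // -FG; first exact: eF.
    by apply: u0; [exact: ltW|exact: uS].
  + exact: le_trans BC.
  + apply: an_ext aF0 => // x xr; apply: FG; apply: u0 => //; exact: ltW.
Qed.

End Analytic.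

Lemma poly_small_coef0 (K : numFieldType) (P : {poly K}) (C e : K) s : 0 < e ->
  (forall y, 0 < y -> y <= e -> `|P.[y]| <= C * y ^+ s) ->
  forall i, (i < s)%N -> P`_i = 0.
Proof.
move=> e0; elim: s P => [//|s IH] P hP.
have C0 : 0 <= C.
  have := le_trans (normr_ge0 _) (hP _ e0 (lexx _)).
  by rewrite pmulr_lge0 // exprn_gt0.
have [P1 [c PE]] : exists P1 c, P = P1 * 'X + c%:P.
  by elim/poly_ind: P {hP} => [|p c _]; [exists 0, 0; rewrite mul0r addr0|exists p, c].
have bnd (Q : {poly K}) : exists2 M, 0 <= M & forall y, 0 < y -> y <= e -> `|Q.[y]| <= M.
  elim/poly_ind: Q => [|p d [M M0 hM]].
    by exists 0 => // y _ _; rewrite hornerC normr0.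
  exists (M * e + `|d|); first by rewrite addr_ge0 // mulr_ge0 // ltW.
  move=> y y0 ye; rewrite hornerMXaddC (le_trans (ler_normD _ _)) // lerD2r normrM.
  by rewrite ler_pM // ?hM // gtr0_norm.
have [M M0 hM] := bnd P1.
have c0 : c = 0.
  apply/eqP/negPn/negP => cn0.
  have D0 : 0 < M + C * e ^+ s + 1 by rewrite ltr_wpDl // addr_ge0 // mulr_ge0 // exprn_ge0 // ltW.
  pose z := `|c| / (M + C * e ^+ s + 1).
  have z0 : 0 < z by rewrite divr_gt0 // normr_gt0.
  have zr : e >=< z by apply: real_comparable; apply: gtr0_real.
  pose y := if z <= e then z else e.
  have y0 : 0 < y by rewrite /y; case: ifP.
  have ye : y <= e by rewrite /y; case: ifP.
  have yz : y <= z by rewrite /y; case: ifPn => //; rewrite -comparable_ltNge // => /ltW.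
  have h1 := hP _ y0 ye; rewrite PE hornerMXaddC in h1.
  have h2 : `|c| <= y * (M + C * e ^+ s).
    have -> : c = (P1.[y] * y + c) - P1.[y] * y by ring.
    rewrite (le_trans (ler_normB _ _)) // addrC mulrDr lerD //.
      by rewrite normrM mulrC (gtr0_norm y0) ler_pM2l // hM.
    rewrite (le_trans h1) // exprS mulrCA ler_pM2l // ler_wpM2l //.
    by rewrite lerXn2r // nnegrE ltW.
  have h3 : y * (M + C * e ^+ s) < z * (M + C * e ^+ s + 1).
    apply: le_lt_trans (_ : z * (M + C * e ^+ s) < _).
      by rewrite ler_wpM2r // addr_ge0 // mulr_ge0 // exprn_ge0 // ltW.
    by rewrite ltr_pM2l // ltrDl.
  have := le_lt_trans h2 h3; rewrite /z divfK ?gt_eqF //.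
  by rewrite ltxx.
move=> [_|i]; first by rewrite PE c0 addr0 coefMX.
rewrite ltnS => lis; rewrite PE c0 addr0 coefMX /=; apply: IH lis => y y0 ye.
have := hP _ y0 ye; rewrite PE c0 addr0 hornerMX normrM (gtr0_norm y0) exprS mulrCA mulrC.
by rewrite ler_pM2l.
Qed.

Section Germs.
Variable R : realType.
Implicit Types (n m k i : nat) (r s B C : R).
Local Notation pt := (nat -> R).
Local Notation O := (fun=> 0 : R).

Definition nr n (P : pt -> Prop) := exists2 r : R, 0 < r & forall x, cube n r x -> P x.

Lemma cubeS n m r s (x : pt) : (m <= n)%N -> r <= s -> cube n r x -> cube m s x.
Proof. by move=> mn rs h i im; apply: le_trans rs; apply: h; lia. Qed.

Lemma nrW n (P Q : pt -> Prop) : (forall x, P x -> Q x) -> nr n P -> nr n Q.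
Proof. by move=> PQ [r r0 h]; exists r => // x /h /PQ. Qed.

Lemma nr_and n (P Q : pt -> Prop) : nr n P -> nr n Q -> nr n (fun x => P x /\ Q x).
Proof.
move=> [r r0 h] [s s0 h']; exists (Num.min r s); first by rewrite lt_min r0.
by move=> x hx; split; [apply: h|apply: h']; apply: cubeS hx => //; rewrite ge_min lexx ?orbT.
Qed.

Lemma nr_all n k (P : nat -> pt -> Prop) : (forall i, (i < k)%N -> nr n (P i)) ->
  nr n (fun x => forall i, (i < k)%N -> P i x).
Proof.
elim: k => [|k IH] h; first by exists 1.
apply: nrW (nr_and (IH (fun i ik => h i (ltnW ik))) (h k (leqnn _))) => x [h1 h2] i.
by rewrite ltnS leq_eqVlt => /orP[/eqP->//|]; exact: h1.
Qed.

Lemma nr_sub n m (P : pt -> Prop) : (m <= n)%N -> nr m P -> nr n P.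
Proof. by move=> mn [r r0 h]; exists r => // x hx; apply: h; apply: cubeS hx. Qed.

Lemma nr_O n (P : pt -> Prop) : nr n P -> P O.
Proof. by move=> [r r0]; apply; apply: cube0; exact: ltW. Qed.

Definition germ n (F : pt -> R) := exists r B, 0 < r /\ an n r F B.
Definition gz n (F : pt -> R) := nr n (fun x => F x = 0).

Lemma germ_ext n F G : nr n (fun x => F x = G x) -> germ n F -> germ n G.
Proof.
move=> [r r0 h] [s [B [s0 a]]]; exists (Num.min r s), B; split; first by rewrite lt_min r0.
apply: (an_ext (F := F) _ (lexx B)).
  by move=> x hx; apply: h; apply: cubeS hx => //; rewrite ge_min lexx.
by apply: an_sub a _ _ => //; rewrite ge_min lexx orbT.
Qed.

Lemma germ_eq n F G : F =1 G -> germ n F -> germ n G.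
Proof. by move=> /funext ->. Qed.

Lemma germ_cst n c : germ n (fun=> c).
Proof. by exists 1, `|c|; split => //; exact: an_cst. Qed.

Lemma germ_var n i : (i < n)%N -> germ n (fun x => x i).
Proof. by exists 1, 1; split => //; exact: an_var. Qed.

Lemma germ_add n F G : germ n F -> germ n G -> germ n (fun x => F x + G x).
Proof.
move=> [r [B [r0 a]]] [s [C [s0 b]]]; exists (Num.min r s), (B + C); split.
  by rewrite lt_min r0.
apply: an_add; [apply: an_sub a _ _|apply: an_sub b _ _] => //; by rewrite ge_min lexx ?orbT.
Qed.

Lemma germ_mul n F G : germ n F -> germ n G -> germ n (fun x => F x * G x).
Proof.
move=> [r [B [r0 a]]] [s [C [s0 b]]]; exists (Num.min r s), (B * C); split.
  by rewrite lt_min r0.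
apply: an_mul; [apply: an_sub a _ _|apply: an_sub b _ _] => //; by rewrite ge_min lexx ?orbT.
Qed.

Lemma germ_opp n F : germ n F -> germ n (fun x => - F x).
Proof.
move=> h; apply: germ_ext (germ_mul (germ_cst n (-1)) h).
by exists 1 => // x _; rewrite mulN1r.
Qed.

Lemma germ_sub n F G : germ n F -> germ n G -> germ n (fun x => F x - G x).
Proof. by move=> h h'; apply: germ_add => //; exact: germ_opp. Qed.

Lemma germ_exp n F k : germ n F -> germ n (fun x => F x ^+ k).
Proof.
move=> h; elim: k => [|k IH]; first exact: germ_cst.
by apply: germ_eq (germ_mul h IH) => x; rewrite exprS.
Qed.

Lemma germ_sum n (I : Type) (s : seq I) (P : pred I) (F : I -> pt -> R) :
  (forall i : I, P i -> germ n (F i)) -> germ n (fun x => \sum_(i <- s | P i) F i x).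
Proof.
move=> h; elim: s => [|i s IH]; first by apply: germ_eq (germ_cst n 0) => x; rewrite big_nil.
have [Pi|Pi] := boolP (P i).
  by apply: germ_eq (germ_add (h _ Pi) IH) => x; rewrite big_cons Pi.
by apply: germ_eq IH => x; rewrite big_cons (negbTE Pi).
Qed.

Lemma germ_prod n (I : Type) (s : seq I) (P : pred I) (F : I -> pt -> R) :
  (forall i : I, P i -> germ n (F i)) -> germ n (fun x => \prod_(i <- s | P i) F i x).
Proof.
move=> h; elim: s => [|i s IH]; first by apply: germ_eq (germ_cst n 1) => x; rewrite big_nil.
have [Pi|Pi] := boolP (P i).
  by apply: germ_eq (germ_mul (h _ Pi) IH) => x; rewrite big_cons Pi.
by apply: germ_eq IH => x; rewrite big_cons (negbTE Pi).
Qed.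

Lemma germ_lift n m F : (n <= m)%N -> germ n F -> germ m F.
Proof. by move=> nm [r [B [r0 a]]]; exists r, B; split => //; exact: an_sub a nm _. Qed.

Lemma germ_dep n F : germ n F -> exists2 r : R, 0 < r & forall x y, cube n r x ->
  (forall i, (i < n)%N -> x i = y i) -> F x = F y.
Proof. by move=> [r [B [r0 a]]]; exists r => //; exact: an_dep a. Qed.

Lemma an_small n r F B : 0 < r -> an n r F B -> exists2 b : R, 0 <= b &
  forall s, 0 < s -> s <= r -> an n s F (`|F O| + s * b).
Proof.
move=> r0 a.
have aT : an n.+1 r (fun x => F (fun i => x i * x n * r^-1)) B.
  apply: (an_comp (T := fun i x => x i * x n * r^-1) a) => i lin.
  apply: an_ext (an_mul (an_mul (an_var r (ltnW lin : (i < n.+1)%N)) (an_var r (ltnSn n))) (an_cst _ _ r^-1)) => //.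
  rewrite ger0_norm ?invr_ge0 ?(ltW r0) //. rewrite mulfK ?gt_eqF //.
have [F1 [b0 [b1 [h0 h1 h2 h3]]]] := an_split r0 aT.
exists b1; first exact: an_ge0 (ltW r0) h1.
move=> s s0 sr.
have a1 : an n s (fun y => F1 (fun i => if i == n then s else y i * (r / s))) b1.
  apply: (an_comp (T := fun i y => if i == n then s else y i * (r / s)) h1) => i.
  rewrite ltnS leq_eqVlt => /orP[/eqP->|lin].
    rewrite eqxx; apply: an_weak (an_cst _ _ s); by rewrite ger0_norm // ltW.
  rewrite ltn_eqF //; apply: an_weak (an_mul (an_var s lin) (an_cst _ _ (r / s))).
  by rewrite ger0_norm ?(divr_ge0 (ltW r0) (ltW s0)) // mulrCA divff ?mulr1 ?gt_eqF.
apply: an_ext (an_add (an_cst n s (F O)) (an_mul (an_cst n s s) a1)); last by rewrite (gtr0_norm s0).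
move=> y ys /=.
pose z := fun i => if i == n then s else y i * (r / s).
have zr : cube n.+1 r z.
  move=> i; rewrite /z; case: eqP => [_ _|ne]; first by rewrite ger0_norm // ltW.
  move=> lin; rewrite normrM (ger0_norm (divr_ge0 (ltW r0) (ltW s0))).
  apply: le_trans (_ : s * (r / s) <= _); last by rewrite mulrCA divff ?mulr1 ?gt_eqF.
  by rewrite ler_pM2r ?divr_gt0 // ys //; lia.
have := h3 _ zr; rewrite {1}/z {1}/z {3}/z eqxx => h4.
have e1 : F (fun i => z i * z n / r) = F y.
  apply/esym; apply: (an_dep a) => [i lin|i lin].
    by apply: le_trans sr; exact: ys.
  rewrite /z eqxx ltn_eqF //; field; by rewrite !gt_eqF.
rewrite -e1 (_ : (fun i => z i * z n / r) = (fun i => (if i == n then s else y i * (r / s)) * s / r)); last first.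
  by apply/funext => i; rewrite /z eqxx.
rewrite h4; congr (_ + _); apply: (an_dep a); first by move=> i _; rewrite normr0 ltW.
by move=> i lin; rewrite /upd eqxx mulr0 mul0r.
Qed.

Lemma germ_small m T : germ m T -> T O = 0 -> forall e : R, 0 < e ->
  exists2 s0, 0 < s0 & forall s, 0 < s -> s <= s0 -> an m s T e.
Proof.
move=> [r [B [r0 a]]] T0 e e0; have [b b0 h] := an_small r0 a.
have b1 : 0 < b + 1 by lra.
exists (Num.min r (e / (b + 1))); first by rewrite lt_min r0 divr_gt0.
move=> s s0; rewrite le_min => /andP[sr se]; apply: an_weak (h _ s0 sr).
rewrite T0 normr0 add0r; apply: le_trans (_ : s * (b + 1) <= _).
  by rewrite ler_pM2l //; lra.
by rewrite -ler_pdivlMr.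
Qed.

Lemma germ_comp n F m (T : nat -> pt -> R) : germ n F ->
  (forall i, (i < n)%N -> germ m (T i) /\ T i O = 0) -> germ m (fun x => F (T^~ x)).
Proof.
move=> [r [B [r0 a]]] hT.
have [s s0 hs] : exists2 s, 0 < s & forall i, (i < n)%N -> an m s (T i) r.
  elim: {a} n hT => [|n IH] hT; first by exists 1.
  have [s s0 hs] := IH (fun i h => hT i (ltnW h)).
  have [gn g0] := hT n (leqnn _); have [t t0 ht] := germ_small gn g0 r0.
  exists (Num.min s t); first by rewrite lt_min s0.
  move=> i; rewrite ltnS leq_eqVlt => /orP[/eqP->|lin].
    by apply: ht; rewrite ?lt_min ?s0 // ge_min lexx orbT.
  by apply: an_sub (hs _ lin) _ _ => //; rewrite ge_min lexx.
by exists s, B; split => //; exact: an_comp a _.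
Qed.

Lemma germ_cont n F : germ n F -> forall e : R, 0 < e -> nr n (fun x => `|F x - F O| <= e).
Proof.
move=> h e e0; have gS : germ n (fun x => F x - F O) by apply: germ_sub => //; exact: germ_cst.
have [s s0 /(_ s s0 (lexx _)) /an_le hs] := germ_small gS (subrr _) e0.
by exists s.
Qed.

Lemma germ_bnd n F : germ n F -> exists2 B, 0 < B & nr n (fun x => `|F x| <= B).
Proof.
move=> [r [B [r0 a]]]; exists (B + 1); first by have := an_ge0 (ltW r0) a; lra.
by exists r => // x /(an_le a); lra.
Qed.

Lemma nr_comp n (P : pt -> Prop) m (T : nat -> pt -> R) : nr n P ->
  (forall i, (i < n)%N -> germ m (T i) /\ T i O = 0) -> nr m (fun x => P (T^~ x)).
Proof.
move=> [r r0 h] hT.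
apply: nrW (nr_all (k := n) (P := fun i x => `|T i x| <= r) _).
  by move=> x hx; apply: h => i; exact: hx.
move=> i /hT[g g0]; apply: nrW (germ_cont g r0) => x; by rewrite g0 subr0.
Qed.

Lemma germ_unit n F : germ n F -> F O != 0 -> nr n (fun x => F x != 0).
Proof.
move=> h F0; have e0 : 0 < `|F O| / 2 by rewrite divr_gt0 // normr_gt0.
apply: nrW (germ_cont h e0) => x; apply: contraTneq => ->.
rewrite sub0r normrN -ltNge; have := normr_ge0 (F O); rewrite -normr_gt0 in F0; lra.
Qed.

Lemma an_expand n r F B : 0 < r -> an n.+1 r F B -> exists U : nat -> pt -> R,
  U 0%N = F /\ forall i, [/\ an n r (fun x => U i (upd x n 0)) (B / r ^+ i),
    an n.+1 r (U i) (B / r ^+ i) &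
    forall x, cube n.+1 r x -> U i x = U i (upd x n 0) + x n * U i.+1 x].
Proof.
move=> r0 a.
have /choice[st hst] : forall p : (pt -> R) * R, exists F1, an n.+1 r p.1 p.2 ->
  [/\ an n r (fun x => p.1 (upd x n 0)) p.2, an n.+1 r F1 (p.2 / r) &
    forall x, cube n.+1 r x -> p.1 x = p.1 (upd x n 0) + x n * F1 x].
  move=> [G C] /=; have [aG|] := pselect (an n.+1 r G C); last by exists O.
  have [F1 [b0 [b1 [h0 h1 h2 h3]]]] := an_split r0 aG.
  have b00 := an_ge0 (ltW r0) h0; have b10 := an_ge0 (ltW r0) h1.
  exists F1 => _; split => //.
    by apply: an_weak h0; have := mulr_ge0 (ltW r0) b10; lra.
  by apply: an_weak h1; rewrite ler_pdivlMr // mulrC; lra.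
pose V := fix V i := if i is i'.+1 then (st (V i'), (V i').2 / r) else (F, B).
have aV i : an n.+1 r (V i).1 (V i).2 by elim: i => [//|i /hst[]].
have V2 i : (V i).2 = B / r ^+ i.
  elim: i => [|i IH] /=; first by rewrite divr1.
  by rewrite IH exprSr invfM mulrA.
exists (fun i => (V i).1); split => // i; have [h1 h2 h3] := hst _ (aV i).
by rewrite -V2; split => //; exact: aV.
Qed.

Lemma expand_sum n (U : nat -> pt -> R) (x : pt) k :
  (forall i, (i < k)%N -> U i x = U i (upd x n 0) + x n * U i.+1 x) ->
  U 0%N x = \sum_(i < k) x n ^+ i * U i (upd x n 0) + x n ^+ k * U k x.
Proof.
elim: k => [|k IH] h; first by rewrite big_ord0 add0r mul1r.
rewrite IH; last by move=> i ik; apply: h; lia.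
by rewrite big_ord_recr /= h // mulrDr exprSr; ring.
Qed.

Lemma germ_expand n F k : germ n.+1 F -> exists (a : nat -> pt -> R) U,
  [/\ forall i, germ n (a i), germ n.+1 U &
   nr n.+1 (fun x => F x = \sum_(i < k) x n ^+ i * a i x + x n ^+ k * U x)].
Proof.
move=> [r [B [r0 a]]]; have [U [U0 hU]] := an_expand r0 a.
exists (fun i x => U i (upd x n 0)), (U k); split.
- by move=> i; have [h _ _] := hU i; exists r, (B / r ^+ i).
- by have [_ h _] := hU k; exists r, (B / r ^+ k).
- exists r => // x xr; rewrite -U0; apply: expand_sum => i _.
  by have [_ _] := hU i; apply.
Qed.

Lemma germ_split n F : germ n.+1 F -> exists F1, [/\ germ n (fun x => F (upd x n 0)),
   germ n.+1 F1 & nr n.+1 (fun x => F x = F (upd x n 0) + x n * F1 x)].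
Proof.
move=> [r [B [r0 a]]]; have [F1 [b0 [b1 [h0 h1 _ h3]]]] := an_split r0 a.
exists F1; split; [by exists r, b0|by exists r, b1|by exists r].
Qed.

Lemma cube_upd n r (x : pt) t : cube n r x -> `|t| <= r -> cube n.+1 r (upd x n t).
Proof.
move=> h tr i; rewrite ltnS leq_eqVlt /upd => /orP[/eqP->|lin]; first by rewrite eqxx.
by rewrite ltn_eqF // h.
Qed.

Lemma upd_upd (x : pt) n a b : upd (upd x n a) n b = upd x n b.
Proof. by apply/funext => i; rewrite /upd; case: eqP. Qed.

Lemma upd_eq (x : pt) n a : upd x n a n = a.
Proof. by rewrite /upd eqxx. Qed.

Lemma upd_ne (x : pt) n a i : i != n -> upd x n a i = x i.
Proof. by rewrite /upd => /negbTE ->. Qed.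

Lemma upd_id (x : pt) n : upd x n (x n) = x.
Proof. by apply/funext => i; rewrite /upd; case: eqP => [->|]. Qed.

Lemma gz_mulX n H : germ n.+1 H -> gz n.+1 (fun x => x n * H x) -> gz n.+1 H.
Proof.
move=> gH [r r0 h]; have [F1 [_ g1 [s s0 hs]]] := germ_split gH.
have [M M0 [t t0 ht]] := germ_bnd g1.
pose q := Num.min r (Num.min s t).
have q0 : 0 < q by rewrite !lt_min r0 s0.
have qr : q <= r by rewrite ge_min lexx.
have qs : q <= s by rewrite !ge_min lexx orbT.
have qt : q <= t by rewrite !ge_min lexx !orbT.
exists q => // x xq.
have nz y : cube n.+1 q y -> y n != 0 -> H y = 0.
  move=> yq yn; have := h _ (cubeS (leqnn _) qr yq) => /eqP.
  by rewrite mulf_eq0 (negbTE yn) /= => /eqP.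
have [xn|xn] := eqVneq (x n) 0; last exact: nz.
apply/eqP; rewrite -normr_le0; apply/ler_addgt0Pr => e e0.
pose u := Num.min q (e / M).
have u0 : 0 < u by rewrite lt_min q0 divr_gt0.
have uq : u <= q by rewrite ge_min lexx.
have xu : cube n.+1 q (upd x n u).
  apply: cube_upd; [exact: cubeS xq|by rewrite gtr0_norm].
have := hs _ (cubeS (leqnn _) qs xu); rewrite (nz _ xu); last by rewrite /upd eqxx gt_eqF.
have -> : upd (upd x n u) n 0 = x by rewrite upd_upd -xn upd_id.
have -> : upd x n u n = u by rewrite /upd eqxx.
move=> /eqP; rewrite eq_sym addr_eq0 => /eqP ->.
rewrite normrN normrM (gtr0_norm u0) add0r.
apply: le_trans (_ : u * M <= _).
  by rewrite ler_pM2l // ht //; apply: cubeS xu.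
by rewrite -ler_pdivlMr // ge_min lexx orbT.
Qed.

Lemma expand_gz n r F B (U : nat -> pt -> R) : 0 < r -> an n.+1 r F B ->
  U 0%N = F -> (forall i, [/\ an n r (fun x => U i (upd x n 0)) (B / r ^+ i),
    an n.+1 r (U i) (B / r ^+ i) &
    forall x, cube n.+1 r x -> U i x = U i (upd x n 0) + x n * U i.+1 x]) ->
  gz n.+1 F -> forall i, gz n (fun x => U i (upd x n 0)).
Proof.
move=> r0 a U0 hU zF.
have gU i : germ n.+1 (U i) by have [_ h _] := hU i; exists r, (B / r ^+ i).
have z0 i : gz n.+1 (U i) -> gz n (fun x => U i (upd x n 0)).
  by move=> [s s0 h]; exists s => // x xs; apply: h; apply: cube_upd; rewrite ?normr0 ?ltW.
suff hz i : gz n.+1 (U i) by move=> i; exact: z0.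
elim: i => [|i IH]; first by rewrite U0.
apply: gz_mulX => //; apply: nrW (nr_and (nr_and (nr_sub (leqnSn n) (z0 _ IH)) IH)
   (ex_intro2 _ _ r r0 (fun x h => h))) => x [[h1 h2] h3].
have [_ _ /(_ _ h3)] := hU i; rewrite h1 h2 add0r => <- //.
Qed.

Lemma le0_geom (A B : R) : (forall k, `|A| <= B / 2 ^+ k) -> A = 0.
Proof.
move=> h; apply/eqP; rewrite -normr_le0; apply/ler_addgt0Pr => e e0; rewrite add0r.
have B0 : 0 <= B by have := le_trans (normr_ge0 _) (h 0%N); rewrite divr1.
have := archi_boundP (divr_ge0 B0 (ltW e0)).
set k := Num.bound _ => hk; apply: le_trans (h k) _.
rewrite ler_pdivrMr ?exprn_gt0 // mulrC -ler_pdivrMr //; apply: le_trans (ltW hk) _.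
by rewrite -natrX ler_nat ltnW // ltn_expl.
Qed.

Lemma an_gz n r F B : 0 < r -> an n r F B -> gz n F ->
  forall x, cube n (r / 2) x -> F x = 0.
Proof.
elim: n r F B => [|n IH] r F B r0 a zF x xr.
  rewrite -(nr_O zF); apply: (an_dep a) => //; exact: cubeS xr.
have [U [U0 hU]] := an_expand r0 a.
have zU := expand_gz r0 a U0 hU zF.
have r2 : r / 2 <= r by lra.
apply: (@le0_geom _ B) => k; rewrite -U0 (@expand_sum n U x k); last first.
  by move=> i _; have [_ _] := hU i; apply; apply: cubeS xr.
rewrite big1 ?add0r => [|i _]; last first.
  have [aU _ _] := hU i; rewrite (IH _ _ _ r0 aU (zU i)) ?mulr0 //; exact: cubeS xr.
rewrite normrM normrX; have [_ aU _] := hU k.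
have h1 : `|U k x| <= B / r ^+ k by apply: (an_le aU); exact: cubeS xr.
have h2 : `|x n| ^+ k <= (r / 2) ^+ k.
  by apply: lerXn2r; rewrite ?nnegrE //; [lra|exact: xr].
apply: le_trans (ler_pM _ _ h2 h1) _; rewrite ?exprn_ge0 //.
rewrite exprMn exprVn le_eqVlt; apply/orP; left; apply/eqP; field.
by rewrite ?expf_neq0 // gt_eqF.
Qed.

Lemma expand_nz n r F B (U : nat -> pt -> R) : 0 < r -> an n.+1 r F B ->
  U 0%N = F -> (forall i, [/\ an n r (fun x => U i (upd x n 0)) (B / r ^+ i),
    an n.+1 r (U i) (B / r ^+ i) &
    forall x, cube n.+1 r x -> U i x = U i (upd x n 0) + x n * U i.+1 x]) ->
  ~ gz n.+1 F -> exists i, ~ gz n (fun x => U i (upd x n 0)).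
Proof.
move=> r0 a U0 hU; apply: contra_notP => /forallNP h.
have {}h i : gz n (fun x => U i (upd x n 0)) by have := h i => /contrapT.
exists (r / 2); first by rewrite divr_gt0.
have r2 : r / 2 <= r by lra.
move=> x xr; apply: (@le0_geom _ B) => k; rewrite -U0 (@expand_sum n U x k); last first.
  by move=> i _; have [_ _] := hU i; apply; apply: cubeS xr.
rewrite big1 ?add0r => [|i _]; last first.
  have [aU _ _] := hU i; rewrite (an_gz r0 aU (h i)) ?mulr0 //; exact: cubeS xr.
rewrite normrM normrX; have [_ aU _] := hU k.
have h1 : `|U k x| <= B / r ^+ k by apply: (an_le aU); exact: cubeS xr.
have h2 : `|x n| ^+ k <= (r / 2) ^+ k.
  by apply: lerXn2r; rewrite ?nnegrE //; [lra|exact: xr].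
apply: le_trans (ler_pM _ _ h2 h1) _; rewrite ?exprn_ge0 //.
rewrite exprMn exprVn le_eqVlt; apply/orP; left; apply/eqP; field.
by rewrite ?expf_neq0 // gt_eqF.
Qed.

Lemma germ_lead n F : germ n.+1 F -> ~ gz n.+1 F -> exists i (a U : pt -> R),
  [/\ germ n a, ~ gz n a, germ n.+1 U, nr n.+1 (fun x => F x = x n ^+ i * U x) &
   forall x, U (upd x n 0) = a x].
Proof.
move=> [r [B [r0 a]]] nz; have [U [U0 hU]] := an_expand r0 a.
have [i0 hi0] := expand_nz r0 a U0 hU nz.
pose P i := `[< ~ gz n (fun x => U i (upd x n 0)) >].
have exP : exists i, P i by exists i0; exact/asboolP.
case: (ex_minnP exP) => i /asboolP hi imin.
exists i, (fun x => U i (upd x n 0)), (U i); split => //.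
- by have [h _ _] := hU i; exists r, (B / r ^+ i).
- by have [_ h _] := hU i; exists r, (B / r ^+ i).
exists (r / 2); first by rewrite divr_gt0.
have r2 : r / 2 <= r by lra.
move=> x xr; rewrite -{1}U0 (@expand_sum n U x i); last first.
  by move=> k _; have [_ _] := hU k; apply; apply: cubeS xr.
rewrite big1 ?add0r // => k _.
have [aU _ _] := hU k.
have zk : gz n (fun x => U k (upd x n 0)).
  apply: contrapT => /asboolP hk; have := imin _ hk; by have := ltn_ord k; lia.
by rewrite (an_gz r0 aU zk) ?mulr0 //; exact: cubeS xr.
Qed.

Lemma germ_domain n F G : germ n F -> germ n G -> gz n (fun x => F x * G x) ->
  gz n F \/ gz n G.
Proof.
elim: n F G => [|n IH] F G gF gG zFG.
  have [r r0 hF] := germ_dep gF; have [s s0 hG] := germ_dep gG.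
  have := nr_O zFG => /eqP; rewrite mulf_eq0 => /orP[/eqP h|/eqP h]; [left|right].
    by exists r => // x xr; rewrite -h; exact: hF.
  by exists s => // x xs; rewrite -h; exact: hG.
have [?|nF] := pselect (gz n.+1 F); first by left.
have [?|nG] := pselect (gz n.+1 G); first by right.
have [i [a [U [ga na gU hF ea]]]] := germ_lead gF nF.
have [j [b [V [gb nb gV hG eb]]]] := germ_lead gG nG.
have : gz n.+1 (fun x => U x * V x).
  have : gz n.+1 (fun x => x n ^+ (i + j) * (U x * V x)).
    apply: nrW (nr_and (nr_and hF hG) zFG) => x [[h1 h2]]; rewrite h1 h2 => <-.
    by rewrite exprD; ring.
  elim: (i + j)%N => [|k IHk]; first by apply: nrW => x; rewrite mul1r.
  move=> h; apply: IHk; apply: gz_mulX.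
    by apply: germ_mul; [apply: germ_exp; exact: germ_var|exact: germ_mul].
  by apply: nrW h => x; rewrite exprS -mulrA.
move=> [r r0 h]; have [//|//] : gz n a \/ gz n b.
apply: IH => //; exists r => // x xr; rewrite -ea -eb h //.
by apply: cube_upd; rewrite ?normr0 ?ltW.
Qed.

End Germs.

Lemma lt2P i n : (i < n.+2)%N -> i = n.+1 \/ i = n \/ (i < n)%N.
Proof. by lia. Qed.

Lemma ltn_neq i n : (i < n)%N -> i != n.
Proof. by lia. Qed.

Lemma ltn_neqS i n : (i < n)%N -> i != n.+1.
Proof. by lia. Qed.

Section Mono.
Variable R : realType.
Implicit Types (n m k i j : nat) (r s B C : R).
Local Notation pt := (nat -> R).
Local Notation O := (fun=> 0 : R).

Lemma germ_ift n (E0 E1 : pt -> R) : germ n E0 -> germ n.+1 E1 -> E0 O = 0 -> E1 O != 0 ->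
  exists theta, [/\ germ n theta, theta O = 0 &
    nr n (fun x => E0 x + theta x * E1 (upd x n (theta x)) = 0)].
Proof.
move=> g0 g1 E00 c0; set c := E1 O in c0.
pose T i (x : pt) := if i == n then x n + x n.+1 else x i.
have gT i : (i < n.+1)%N -> germ n.+2 (T i) /\ T i O = 0.
  rewrite ltnS leq_eqVlt /T => /orP[/eqP->|lin].
    rewrite eqxx addr0; split => //; apply: germ_add; apply: germ_var; lia.
  rewrite ltn_eqF //; split => //; apply: germ_var; lia.
have gG := germ_comp g1 gT; set G := fun x => _ in gG.
have [G1 [_ gG1 hG]] := germ_split gG.
pose K x := 1 - (G x + x n * G1 x) / c.
have gK : germ n.+2 K.
  apply: germ_sub; first exact: germ_cst.
  apply: germ_mul; last exact: germ_cst.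
  apply: germ_add => //; apply: germ_mul => //; apply: germ_var; lia.
have GO : G O = c by rewrite /G /T; congr E1; apply/funext => i; rewrite addr0; case: eqP.
have K0 : K O = 0 by rewrite /K GO mul0r addr0 divff // subrr.
have h12 : 0 < 1 / 2 :> R by lra.
have [s0 s00 aK] := germ_small gK K0 h12.
have [s1 s10 dE1] := germ_dep g1; have [s2 s20 dG] := hG.
pose sg := Num.min s0 (Num.min (s1 / 2) s2).
have sg0 : 0 < sg by rewrite !lt_min s00 s20 divr_gt0.
have sgs0 : sg <= s0 by rewrite ge_min lexx.
have sgs1 : sg <= s1 / 2 by rewrite !ge_min lexx orbT.
have sgs2 : sg <= s2 by rewrite !ge_min lexx !orbT.
have {}aK := aK _ sg0 sgs0.
pose Tz (x : pt) z := z - (E0 x + z * E1 (upd x n z)) / c.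
have TzK x z t : cube n sg x -> `|z| <= sg -> `|t| <= sg ->
    Tz x (z + t) - Tz x z = t * K (upd (upd x n z) n.+1 t).
  move=> xs zs ts; set y := upd _ _ _.
  have yc : cube n.+2 s2 y.
    by apply: cubeS (cube_upd (cube_upd xs zs) ts).
  have n1 : n != n.+1 by rewrite neq_ltn ltnSn.
  have yn : y n = z by rewrite /y upd_ne // upd_eq.
  have yn1 : y n.+1 = t by rewrite /y upd_eq.
  have yi i : (i < n)%N -> y i = x i by move=> lin; rewrite /y upd_ne ?upd_ne //; clear -lin; lia.
  have y0n : upd y n.+1 0 n = z by rewrite upd_ne.
  have y0n1 : upd y n.+1 0 n.+1 = 0 by rewrite upd_eq.
  have y0i i : (i < n)%N -> upd y n.+1 0 i = x i by move=> lin; rewrite upd_ne ?yi //; clear -lin; lia.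
  have Gy : G y = E1 (upd x n (z + t)).
    rewrite /G; apply: dE1 => [i lin|i lin]; rewrite /T.
      case: eqP => [_|ne]; first by rewrite yn yn1; apply: le_trans (ler_normD _ _) _; lra.
      by rewrite yi; [apply: le_trans (xs i _) _; [clear -lin ne; lia|lra]|clear -lin ne; lia].
    case: eqP => [->|ne]; first by rewrite yn yn1 upd_eq.
    by rewrite yi ?upd_ne //; clear -lin ne; lia.
  have Gy0 : G (upd y n.+1 0) = E1 (upd x n z).
    rewrite /G; apply: dE1 => [i lin|i lin]; rewrite /T.
      case: eqP => [_|ne]; first by rewrite y0n y0n1 addr0; lra.
      by rewrite y0i; [apply: le_trans (xs i _) _; [clear -lin ne; lia|lra]|clear -lin ne; lia].
    case: eqP => [->|ne]; first by rewrite y0n y0n1 addr0 upd_eq.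
    by rewrite y0i ?upd_ne //; clear -lin ne; lia.
  have := dG _ yc; rewrite Gy Gy0 yn1 => h.
  rewrite /K yn Gy /Tz.
  rewrite h; field; exact: c0.
have gd0 : germ n (fun x => - E0 x / c) by apply: germ_mul; [exact: germ_opp|exact: germ_cst].
have sg4 : 0 < sg / 4 by lra.
have d00 : - E0 O / c = 0 by rewrite E00 oppr0 mul0r.
have [r0 r00 ad0] := germ_small gd0 d00 sg4.
pose r := Num.min r0 sg.
have r_gt0 : 0 < r by rewrite lt_min r00.
have rsg : r <= sg by rewrite ge_min lexx orbT.
have rr0 : r <= r0 by rewrite ge_min lexx.
have {}ad0 := ad0 r r_gt0 rr0.
pose P := fix P k : (pt -> R) * (pt -> R) := if k is k'.+1 then
   (fun x => (P k').1 x + (P k').2 x,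
    fun x => (P k').2 x * K (upd (upd x n ((P k').1 x)) n.+1 ((P k').2 x)))
  else (O, fun x => - E0 x / c).
have e2 k : (2 ^+ k : R) > 0 by rewrite exprn_gt0.
have aP k : an n r (P k).1 (sg / 2 * (1 - (2 ^+ k)^-1)) /\ an n r (P k).2 (sg / 4 / 2 ^+ k).
  elim: k => [|k [IH1 IH2]].
    split; first by apply: an_weak (an_cst _ _ 0); rewrite normr0 expr0 invr1 subrr mulr0.
    by rewrite expr0 divr1.
  have v0 : 0 <= (2 ^+ k : R)^-1 by rewrite invr_ge0 ltW.
  have v1 : (2 ^+ k : R)^-1 <= 1 by rewrite invf_le1 // exprn_ege1 // ler1n.
  have w0 := mulr_ge0 (ltW sg0) v0; have w1 := ler_wpM2l (ltW sg0) v1.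
  have eS : (2 ^+ k.+1 : R)^-1 = (2 ^+ k)^-1 / 2 by rewrite exprS invfM mulrC.
  split => /=.
    apply: an_weak (an_add IH1 IH2); rewrite eS.
    rewrite le_eqVlt; apply/orP; left; apply/eqP; field; by rewrite gt_eqF.
  apply: an_weak (an_mul IH2 (_ : an n r _ (1 / 2))).
    rewrite eS le_eqVlt; apply/orP; left; apply/eqP; field; by rewrite gt_eqF.
  apply: (an_comp (T := fun i x => upd (upd x n ((P k).1 x)) n.+1 ((P k).2 x) i) aK) => i.
  move=> lin; have [->|[->|{}lin]] := lt2P lin.
  - by apply: an_eq (an_weak _ IH2) => [x|]; [rewrite upd_eq|lra].
  - by apply: an_eq (an_weak _ IH1) => [x|]; [rewrite upd_ne ?upd_eq // neq_ltn ltnSn|lra].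
  apply: an_eq (an_weak rsg (an_var _ lin)) => x.
  by rewrite (upd_ne _ _ (ltn_neqS lin)) (upd_ne _ _ (ltn_neq lin)).
pose b k := sg / 4 / 2 ^+ k.
have sb N : \sum_(k < N) b k = sg / 2 * (1 - (2 ^+ N)^-1).
  elim: N => [|N IH]; first by rewrite big_ord0 expr0 invr1 subrr mulr0.
  rewrite big_ord_recr /= IH /b exprS invfM; field; by rewrite gt_eqF.
have sb2 N : \sum_(k < N) b k <= sg / 2.
  have v0 : 0 <= (2 ^+ N : R)^-1 by rewrite invr_ge0 ltW.
  by rewrite sb; have := mulr_ge0 (ltW sg0) v0; lra.
have P1E k x : (P k).1 x = \sum_(j < k) (P j).2 x.
  by elim: k => [|k IH]; rewrite ?big_ord0 // big_ord_recr /= IH.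
have /choice[th hth] : forall x, exists l, cube n r x -> sums_to (fun k => (P k).2 x) l.
  move=> x; have [xr|] := pselect (cube n r x); last by exists 0.
  have [l hl] := @summable_sums_to _ (fun k => (P k).2 x) b (sg / 2)
    (fun k => ltac:(exact: (an_le (proj2 (aP k)) xr))) sb2.
  by exists l.
have ath : an n r th (sg / 2).
  by apply: (an_ser (D := fun k => (P k).2) (b := b)) => // k; have [] := aP k.
have TP k x : cube n r x -> Tz x ((P k).1 x) = (P k.+1).1 x.
  move=> xr; elim: k => [|k IH].
    by rewrite /Tz /= mul0r addr0 !add0r mulNr.
  have [a1 a2] := aP k; have h1 := an_le a1 xr; have h2 := an_le a2 xr.
  have v0 : 0 <= (2 ^+ k : R)^-1 by rewrite invr_ge0 ltW.
  have v1 : (2 ^+ k : R)^-1 <= 1 by rewrite invf_le1 // exprn_ege1 // ler1n.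
  have w0 := mulr_ge0 (ltW sg0) v0; have w1 := ler_wpM2l (ltW sg0) v1.
  have h1' : `|(P k).1 x| <= sg by lra.
  have h2' : `|(P k).2 x| <= sg by lra.
  have := TzK x _ _ (cubeS (leqnn _) rsg xr) h1' h2'.
  rewrite IH /= => /eqP; rewrite subr_eq => /eqP ->; ring.
exists th; split; first by exists r, (sg / 2).
  apply: sums_to_uniq (hth _ (@cube0 R n r (ltW r_gt0))) _.
  have z k : (P k).2 O = 0.
    by elim: k => [|k IH] /=; [rewrite E00 oppr0 mul0r|rewrite IH mul0r].
  move=> e e0; exists 0%N => N _; rewrite big1 ?subr0 ?normr0 ?ltW // => k _; exact: z.
exists r => // x xr.
have thx := an_le ath xr.
suff : Tz x (th x) = th x.
  rewrite /Tz => /eqP; rewrite -subr_eq0 addrAC subrr sub0r oppr_eq0 mulf_eq0 invr_eq0 (negbTE c0) orbF.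
  by move/eqP.
apply/eqP; rewrite -subr_eq0 -normr_le0; apply/ler_addgt0Pr => e e0; rewrite add0r.
have e3 : 0 < e / 3 by lra.
have [N0 hN] := hth _ xr _ e3.
have d1 := hN N0 (leqnn _); have d2 := hN N0.+1 (leqnSn _).
rewrite -P1E in d1; rewrite -P1E in d2.
have [a1 _] := aP N0; have p1 := an_le a1 xr.
have v0 : 0 <= (2 ^+ N0 : R)^-1 by rewrite invr_ge0 ltW.
have p1' : `|(P N0).1 x| <= sg / 2 by have := mulr_ge0 (ltW sg0) v0; lra.
have tt : `|th x - (P N0).1 x| <= sg by apply: le_trans (ler_normB _ _) _; lra.
have p1'' : `|(P N0).1 x| <= sg by lra.
have := TzK x _ _ (cubeS (leqnn _) rsg xr) p1'' tt.
rewrite (addrC ((P N0).1 x)) subrK TP // => h.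
have hk : `|K (upd (upd x n ((P N0).1 x)) n.+1 (th x - (P N0).1 x))| <= 1 / 2.
  by apply: (an_le aK); apply: cube_upd => //; apply: cube_upd => //; exact: cubeS xr.
have -> : Tz x (th x) - th x = (Tz x (th x) - (P N0.+1).1 x) + ((P N0.+1).1 x - th x) by ring.
apply: le_trans (ler_normD _ _) _; rewrite h normrM.
rewrite distrC in d1; have := ler_pM (normr_ge0 _) (normr_ge0 _) d1 hk; lra.
Qed.

Definition mono n (b : nat -> nat) (x : pt) : R := \prod_(i < n) x i ^+ b i.

Definition mu n (F : pt -> R) := exists (b : nat -> nat) u,
  [/\ germ n u, u O != 0 & nr n (fun x => F x = mono n b x * u x)].

Lemma germ_mono n b : germ n (mono n b).
Proof. by apply: germ_prod => i _; apply: germ_exp; exact: germ_var. Qed.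

Lemma monoD n b c x : mono n (fun i => b i + c i)%N x = mono n b x * mono n c x.
Proof. by rewrite /mono -big_split; apply: eq_bigr => i _; rewrite exprD. Qed.

Lemma mono0 n x : mono n (fun=> 0%N) x = 1.
Proof. by rewrite /mono big1. Qed.

Lemma mono_exp n b k x : mono n (fun i => k * b i)%N x = mono n b x ^+ k.
Proof. by rewrite /mono -prodrXl; apply: eq_bigr => i _; rewrite mulnC exprM. Qed.

Lemma mono1 n j x : (j < n)%N -> mono n (fun i => (i == j) : nat) x = x j.
Proof.
move=> jn; rewrite /mono (bigD1 (Ordinal jn)) //= eqxx expr1 big1 ?mulr1 // => i ne.
by rewrite (_ : (i == j :> nat) = false) // ; apply/negbTE; apply: contra ne => /eqP e; apply/eqP/val_inj.
Qed.

Lemma mono_nz n b x : (forall i, (i < n)%N -> (0 < b i)%N -> x i != 0) -> mono n b x != 0.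
Proof.
move=> h; rewrite /mono; apply/prodf_neq0 => i _.
case e : (b i) => [|k]; first by rewrite expr0 oner_neq0.
by rewrite expf_neq0 // h // e.
Qed.

Lemma mono_z n b x i : (i < n)%N -> (0 < b i)%N -> x i = 0 -> mono n b x = 0.
Proof.
move=> lin bi xi; rewrite /mono (bigD1 (Ordinal lin)) //= xi.
by case: (b i) bi => // k _; rewrite exprS !mul0r.
Qed.

Lemma eq_mono n b c x : (forall i, (i < n)%N -> b i = c i) -> mono n b x = mono n c x.
Proof. by move=> h; apply: eq_bigr => i _; rewrite h. Qed.

Lemma mu_near n F G : nr n (fun x => F x = G x) -> mu n F -> mu n G.
Proof.
move=> h [b [u [gu u0 e]]]; exists b, u; split => //.
by apply: nrW (nr_and h e) => x [<-].
Qed.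

Lemma mu_eq n F G : F =1 G -> mu n F -> mu n G.
Proof. by move=> /funext ->. Qed.

Lemma mu_unit n F : germ n F -> F O != 0 -> mu n F.
Proof. by move=> gF F0; exists (fun=> 0%N), F; split => //; exists 1 => // x _; rewrite mono0 mul1r. Qed.

Lemma mu_mono n b : mu n (mono n b).
Proof.
exists b, (fun=> 1); split; [exact: germ_cst|exact: oner_neq0|].
by exists 1 => // x _; rewrite mulr1.
Qed.

Lemma mu_var n i : (i < n)%N -> mu n (fun x => x i).
Proof. by move=> lin; apply: mu_eq (mu_mono n (fun k => (k == i) : nat)) => x; rewrite mono1. Qed.

Lemma mu_mul n F G : mu n F -> mu n G -> mu n (fun x => F x * G x).
Proof.
move=> [b [u [gu u0 e]]] [c [v [gv v0 e']]].
exists (fun i => b i + c i)%N, (fun x => u x * v x); split.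
- exact: germ_mul.
- by rewrite mulf_neq0.
- by apply: nrW (nr_and e e') => x [-> ->]; rewrite monoD mulrACA.
Qed.

Lemma mu_exp n F k : mu n F -> mu n (fun x => F x ^+ k).
Proof.
move=> h; elim: k => [|k IH].
  by apply: mu_unit; [exact: germ_cst|exact: oner_neq0].
by apply: mu_eq (mu_mul h IH) => x; rewrite exprS.
Qed.

Lemma mu_prod n (I : Type) (s : seq I) (F : I -> pt -> R) :
  (forall i : I, mu n (F i)) -> mu n (fun x => \prod_(i <- s) F i x).
Proof.
move=> h; elim: s => [|i s IH].
  apply: mu_eq (mu_unit (germ_cst n 1) (oner_neq0 _)) => x; by rewrite big_nil.
by apply: mu_eq (mu_mul (h i) IH) => x; rewrite big_cons.
Qed.

Lemma mu_germ n F : mu n F -> germ n F.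
Proof.
move=> [b [u [gu u0 e]]]; apply: germ_ext (germ_mul (germ_mono n b) gu).
by apply: nrW e => x ->.
Qed.

Lemma mu_comp n F m (T : nat -> pt -> R) : mu n F ->
  (forall i, (i < n)%N -> [/\ germ m (T i), T i O = 0 & mu m (T i)]) ->
  mu m (fun x => F (T^~ x)).
Proof.
move=> [b [u [gu u0 e]]] hT.
have hT' i : (i < n)%N -> germ m (T i) /\ T i O = 0 by move=> /hT[].
have gu' := germ_comp gu hT'.
have [s s0 hs] := germ_dep gu.
have TO : u (T^~ O) = u O.
  apply/esym/hs; first by move=> i _; rewrite normr0 ltW.
  by move=> i /hT'[_ ->].
apply: (mu_near (F := fun x => mono n b (T^~ x) * u (T^~ x))).
  by apply: nrW (nr_comp e hT') => x ->.
apply: mu_mul; last by apply: mu_unit => //; rewrite TO.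
apply: (mu_eq (F := fun x => \prod_(i <- index_enum 'I_n) T i x ^+ b i)) => [x //|].
by apply: mu_prod => i; apply: mu_exp; have [] := hT _ (ltn_ord i).
Qed.

Lemma mono_ngz n b : ~ gz n (mono n b).
Proof.
move=> [r r0 h]; have := h (fun=> r) (fun i _ => ltac:(by rewrite gtr0_norm)).
by apply/eqP; apply: mono_nz => i _ _; rewrite gt_eqF.
Qed.

Lemma germ_splitv n j (F : pt -> R) : (j < n)%N -> germ n F -> exists F1,
  [/\ germ n (fun x => F (upd x j 0)), germ n F1 &
   nr n (fun x => F x = F (upd x j 0) + x j * F1 x)].
Proof.
case: n => // n jn gF.
pose t i := if i == j then n else if i == n then j else i.
have tt i : t (t i) = i.
  rewrite /t; have [->|ij] := eqVneq i j; first by case: eqP => [//|_]; rewrite eqxx.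
  have [->|i_n] := eqVneq i n; first by rewrite eqxx.
  by rewrite (negbTE ij) (negbTE i_n).
have tj i : (t i == n) = (i == j).
  rewrite /t; have [_|ij] := eqVneq i j; first by rewrite eqxx.
  have [i_n|i_n] := eqVneq i n; last by rewrite (negbTE i_n).
  by apply/negbTE; rewrite -i_n eq_sym.
pose T i (x : pt) := x (t i).
have hT i : (i < n.+1)%N -> germ n.+1 (T i) /\ T i O = 0.
  by move=> lin; split => //; apply: germ_var; rewrite /t; case: eqP => // _; case: eqP.
have [G1 [_ g1 hG]] := germ_split (germ_comp gF hT).
exists (fun x => G1 (T^~ x)); split.
- apply: (germ_comp (T := fun i x => upd x j 0 i) gF) => i lin; rewrite /upd.
  by case: eqP => _; split => //; [exact: germ_cst|exact: germ_var].
- exact: (germ_comp g1 hT).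
- apply: nrW (nr_comp hG hT) => x.
  rewrite (_ : T^~ (T^~ x) = x); last by apply/funext => i; rewrite /T tt.
  rewrite (_ : T^~ (upd (T^~ x) n 0) = upd x j 0); last first.
    by apply/funext => i; rewrite /T /upd tt tj.
  by have -> : T n x = x j by rewrite /T /t; case: eqP => [->|_]; rewrite ?eqxx.
Qed.

Lemma mu_factor n (F G : pt -> R) : germ n F -> germ n G -> mu n (fun x => F x * G x) -> mu n F.
Proof.
move=> gF gG [b [u [gu u0 e]]].
elim: {b}(\sum_(i < n) b i)%N {-2}b (erefl (\sum_(i < n) b i)%N) F G gF gG e => [|k IH] b bk F G gF gG e.
  have b0 i : (i < n)%N -> b i = 0%N.
    by move=> lin; move/eqP: bk; rewrite sum_nat_eq0 => /forallP /(_ (Ordinal lin)) /eqP.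
  apply: mu_unit => //; have := nr_O e; rewrite (eq_mono _ b0) mono0 mul1r => h.
  by apply: contraNneq u0 => F0; rewrite -h F0 mul0r.
have [j jn bj] : exists2 j, (j < n)%N & (0 < b j)%N.
  have : (\sum_(i < n) b i != 0)%N by rewrite bk.
  by rewrite sum_nat_eq0 negb_forall => /existsP[j]; rewrite -lt0n => h; exists j.
pose b' i := (b i - (i == j))%N.
have bE i : b i = (b' i + (i == j))%N by rewrite /b'; case: eqP => [->|]; lia.
have mE x : mono n b x = x j * mono n b' x.
  by rewrite mulrC -(mono1 x jn) -monoD; apply: eq_mono => i _; rewrite bE.
have bk' : (\sum_(i < n) b' i = k)%N.
  have : (\sum_(i < n) b i = \sum_(i < n) b' i + 1)%N.
    under eq_bigr do rewrite bE; rewrite big_split /=; congr addn.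
    rewrite (bigD1 (Ordinal jn)) //= eqxx big1 // => i ne.
    by rewrite (_ : (i == j :> nat) = false) //; apply/negbTE; apply: contra ne => /eqP h; apply/eqP/val_inj.
  by rewrite bk; lia.
have [F1 [gF0 gF1 hF]] := germ_splitv jn gF.
have [G1 [gG0 gG1 hG]] := germ_splitv jn gG.
have cancel (A : pt -> R) : germ n A -> gz n (fun x => x j * A x) -> gz n A.
  move=> gA /(germ_domain (germ_var R jn) gA)[] // h; exfalso.
  by apply: (@mono_ngz n (fun i => (i == j) : nat)); apply: nrW h => x; rewrite mono1.
have : gz n (fun x => F (upd x j 0) * G (upd x j 0)).
  move: e => [r r0 h]; exists r => // x xr; rewrite h ?mE ?{1}/upd ?eqxx ?mul0r //.
  by move=> i lin; rewrite /upd; case: eqP => _; rewrite ?normr0 ?(ltW r0) // xr.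
have gm := germ_mul (germ_mono n b') gu.
case/(germ_domain gF0 gG0) => z0.
- have e' : nr n (fun x => F1 x * G x = mono n b' x * u x).
    apply: nrW (cancel (fun x => F1 x * G x - mono n b' x * u x) _ _).
    + by move=> x /eqP; rewrite subr_eq0 => /eqP.
    + by apply: germ_sub => //; exact: germ_mul.
    + apply: nrW (nr_and e (nr_and hF z0)) => x [h1 [h2 h3]].
      by move: h1; rewrite h2 h3 add0r mE => h1; rewrite mulrBr !mulrA h1 subrr.
  have m1 := IH b' bk' F1 G gF1 gG e'.
  apply: mu_near (mu_mul (mu_var jn) m1).
  by apply: nrW (nr_and hF z0) => x [-> ->]; rewrite add0r.
- have e' : nr n (fun x => F x * G1 x = mono n b' x * u x).
    apply: nrW (cancel (fun x => F x * G1 x - mono n b' x * u x) _ _).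
    + by move=> x /eqP; rewrite subr_eq0 => /eqP.
    + by apply: germ_sub => //; exact: germ_mul.
    + apply: nrW (nr_and e (nr_and hG z0)) => x [h1 [h2 h3]].
      by move: h1; rewrite h2 h3 add0r mE => h1; rewrite mulrBr !mulrA -h1; ring.
  exact: IH b' bk' F G1 gF gG1 e'.
Qed.

Lemma mono_comparable n b c u v : germ n u -> germ n v -> u O != 0 -> v O != 0 ->
  let D := fun x => mono n b x * u x - mono n c x * v x in gz n D \/ mu n D ->
  (forall i, (i < n)%N -> (b i <= c i)%N) \/ (forall i, (i < n)%N -> (c i <= b i)%N).
Proof.
move=> gu gv u0 v0 D hD.
have [?|/existsNP[i /not_implyP[lin /negP]]] := pselect (forall i, (i < n)%N -> (b i <= c i)%N); first by left.
have [?|/existsNP[j /not_implyP[ljn /negP]]] := pselect (forall i, (i < n)%N -> (c i <= b i)%N); first by right.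
rewrite -!ltnNge => bcj cbi; exfalso.
pose m k := minn (b k) (c k); pose b' k := (b k - m k)%N; pose c' k := (c k - m k)%N.
pose h x := mono n b' x * u x - mono n c' x * v x.
have gh : germ n h by apply: germ_sub; apply: germ_mul => //; exact: germ_mono.
have DE x : D x = h x * mono n m x.
  rewrite /D /h (eq_mono (b := b) (c := fun k => b' k + m k)%N) => [|k _]; last by rewrite /b' /m; lia.
  rewrite (eq_mono (b := c) (c := fun k => c' k + m k)%N) => [|k _]; last by rewrite /c' /m; lia.
  by rewrite !monoD; ring.
have bi : (0 < b' i)%N /\ c' i = 0%N by rewrite /b' /c' /m; lia.
have cj : (0 < c' j)%N /\ b' j = 0%N by rewrite /b' /c' /m; lia.
have nru := germ_unit gu u0; have nrv := germ_unit gv v0.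
have [r r0 hr] := nr_and nru nrv.
pose z (S : pred nat) s : pt := fun k => if k \in S then 0 else s.
have zc S s : 0 < s -> cube n s (z S s).
  by move=> s0 k _; rewrite /z; case: ifP => _; rewrite ?normr0 ?gtr0_norm ?(ltW s0).
have hnz S s : 0 < s -> s <= r ->
   ((exists2 k, (k < n)%N & (k \in S) && (0 < b' k)%N) /\ (forall k, (k < n)%N -> k \in S -> c' k = 0%N)) \/
   ((exists2 k, (k < n)%N & (k \in S) && (0 < c' k)%N) /\ (forall k, (k < n)%N -> k \in S -> b' k = 0%N)) ->
   h (z S s) != 0.
  move=> s0 sr; have [hu hv] := hr _ (cubeS (leqnn _) sr (zc S s s0)).
  have nz d : (forall k, (k < n)%N -> k \in S -> d k = 0%N) -> mono n d (z S s) != 0.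
    move=> hd; apply: mono_nz => k kn dk; rewrite /z; case: ifPn => [/hd|_]; last by rewrite gt_eqF.
    by move=> /(_ kn) dk0; rewrite dk0 in dk.
  case=> [[[k kn /andP[kS bk]] hc]|[[k kn /andP[kS bk]] hc]]; rewrite /h.
    rewrite (@mono_z n b' _ k) ?mul0r ?sub0r ?oppr_eq0 ?mulf_neq0 ?nz // /z kS //.
  by rewrite (@mono_z n c' _ k) ?mul0r ?subr0 ?mulf_neq0 ?nz // /z kS.
case: hD => hD.
- have : gz n (fun x => h x * mono n m x) by apply: nrW hD => x <-.
  case/(germ_domain gh (germ_mono n m)) => [[s s0 hs]|/mono_ngz //].
  pose q := Num.min s r.
  have q0 : 0 < q by rewrite lt_min s0.
  have qs : q <= s by rewrite ge_min lexx.
  have qr : q <= r by rewrite ge_min lexx orbT.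
  have /eqP := hs _ (cubeS (leqnn _) qs (zc (pred1 i) _ q0)).
  apply/negP; apply: hnz => //; left; split; first by exists i; rewrite ?inE ?eqxx; tauto.
  by move=> k _; rewrite inE => /eqP ->; tauto.
- have : mu n (fun x => h x * mono n m x) by apply: mu_eq hD => x; rewrite DE.
  move=> /(mu_factor gh (germ_mono n m)) [e [w [gw w0 [s s0 hs]]]].
  pose q := Num.min s r.
  have q0 : 0 < q by rewrite lt_min s0.
  have qs : q <= s by rewrite ge_min lexx.
  have qr : q <= r by rewrite ge_min lexx orbT.
  have hO : h O = 0.
    rewrite /h (@mono_z n b' _ i) ?(@mono_z n c' _ j) ?mul0r ?subrr //; tauto.
  have [k kn ek] : exists2 k, (k < n)%N & (0 < e k)%N.
    apply: contrapT => /forall2NP H.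
    have := hs _ (@cube0 R n s (ltW s0)); rewrite hO (eq_mono (c := fun=> 0%N)) ?mono0 ?mul1r.
      by move=> /eqP; rewrite eq_sym (negbTE w0).
    by move=> k kn; have [//|/negP] := H k; rewrite -eqn0Ngt => /eqP.
  have key S : k \in S -> ~ (h (z S q) != 0).
    move=> kS; rewrite (hs _ (cubeS (leqnn _) qs (zc S _ q0))).
    by rewrite (@mono_z n e _ k) ?mul0r ?eqxx // /z kS.
  have [bk|bk] := posnP (b' k); last first.
    apply: (key (pred1 k)); rewrite ?inE //; apply: hnz => //; left; split.
      by exists k => //; rewrite inE eqxx.
    by move=> l _; rewrite inE => /eqP ->; move: bk; rewrite /b' /c' /m; lia.
  have [ck|ck] := posnP (c' k); last first.
    apply: (key (pred1 k)); rewrite ?inE //; apply: hnz => //; right; split.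
      by exists k => //; rewrite inE eqxx.
    by move=> l _; rewrite inE => /eqP ->.
  apply: (key (pred2 k i)); rewrite ?inE ?eqxx //; apply: hnz => //; left; split.
    by exists i => //; rewrite inE eqxx orbT; tauto.
  by move=> l _; rewrite inE => /orP[] /eqP -> //; tauto.
Qed.

End Mono.

(** * Local uniformization along an ultrafilter *)

Section GenPoints.
Variables (R : realType) (W : Type) (U : set_system W).
Hypothesis UU : UltraFilter U.
Implicit Types (n m k i j : nat) (r B C : R).
Local Notation pt := (nat -> R).
Local Notation O := (fun=> 0 : R).
Local Notation gp := (W -> pt).

Definition ae (P : W -> Prop) := U P.

Lemma ae_true (P : W -> Prop) : (forall w, P w) -> ae P.
Proof. by move=> h; apply: filterS filterT => w _; exact: h. Qed.

Lemma aeW (P Q : W -> Prop) : (forall w, P w -> Q w) -> ae P -> ae Q.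
Proof. by move=> h; exact: filterS. Qed.

Lemma ae_and (P Q : W -> Prop) : ae P -> ae Q -> ae (fun w => P w /\ Q w).
Proof. exact: filterI. Qed.

Lemma ae_ex (P : W -> Prop) : ae P -> exists w, P w.
Proof. exact: filter_ex. Qed.

Lemma ae_not (P : W -> Prop) : ~ ae P -> ae (fun w => ~ P w).
Proof. by have [h|h] := in_ultra_setVsetC P UU. Qed.

Lemma ae_all n (P : nat -> W -> Prop) : (forall i, (i < n)%N -> ae (P i)) ->
  ae (fun w => forall i, (i < n)%N -> P i w).
Proof.
elim: n => [|n IH] h; first exact: ae_true.
apply: aeW (ae_and (IH (fun i ik => h i (ltnW ik))) (h n (leqnn _))) => x [h1 h2] i.
by rewrite ltnS leq_eqVlt => /orP[/eqP->//|]; exact: h1.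
Qed.

Definition infr (y : W -> R) := forall e, 0 < e -> ae (fun w => `|y w| <= e).

Lemma standard_part (y : W -> R) M : ae (fun w => `|y w| <= M) ->
  exists l, infr (fun w => y w - l).
Proof.
move=> yM; pose S := [set t | ae (fun w => t <= y w)].
have S0 : S (- M) by apply: aeW yM => w; rewrite ler_norml => /andP[].
have SM t : S t -> t <= M.
  move=> St; have [w [h1 h2]] := ae_ex (ae_and St yM).
  by apply: le_trans h1 _; move: h2; rewrite ler_norml => /andP[].
have hS : has_sup S by split; [exists (- M)|exists M => t /SM].
exists (sup S) => e e0.
have [t St te] := sup_adherent e0 hS.
have : ~ S (sup S + e).
  by move=> /(ub_le_sup (proj2 hS)); lra.
move=> /ae_not h2; apply: aeW (ae_and St h2) => w [h3 /negP h4].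
rewrite -ltNge in h4; rewrite ler_norml; lra.
Qed.

Definition infpt n (x : gp) := forall i, (i < n)%N -> infr (x^~ i).

Lemma infpt_cube n x : infpt n x -> forall e, 0 < e -> ae (fun w => cube n e (x w)).
Proof. by move=> h e e0; apply: ae_all => i lin; exact: h. Qed.

Lemma infpt_nr n x (P : pt -> Prop) : infpt n x -> nr n P -> ae (fun w => P (x w)).
Proof. by move=> h [r r0 hP]; apply: aeW (infpt_cube h r0) => w; exact: hP. Qed.

Definition gmap n m (p : nat -> pt -> R) := forall i, (i < n)%N -> germ m (p i) /\ p i O = 0.

Definition fac n (x : gp) m (w : gp) (p : nat -> pt -> R) :=
  [/\ infpt m w, gmap n m p & ae (fun o => forall i, (i < n)%N -> x o i = p i (w o))].

(* Points not contained, along the ultrafilter, in an analytic image of a space of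
   lower dimension. *)
Definition full n (x : gp) := infpt n x /\ forall m w p, (m < n)%N -> ~ fac n x m w p.

Lemma fac_comp n x m w p l v q : fac n x m w p -> fac m w l v q ->
  fac n x l v (fun i z => p i (fun k => q k z)).
Proof.
move=> [iw gpp e1] [iv gq e2]; split => //.
  move=> i lin; have [g0 p0] := gpp _ lin; split; first exact: (germ_comp g0 gq).
  have [r r0 h] := germ_dep g0; transitivity (p i O) => //; apply/esym/h.
    by move=> k _; rewrite normr0 ltW.
  by move=> k /gq[_ q0] /=; rewrite q0.
have hd : ae (fun o => forall i, (i < n)%N -> forall y, (forall k, (k < m)%N -> w o k = y k) -> p i (w o) = p i y).
  apply: ae_all => i lin; have [g0 p0] := gpp _ lin; have [r r0 h] := germ_dep g0.
  by apply: aeW (infpt_cube iw r0) => o ho y; exact: h.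
apply: aeW (ae_and e1 (ae_and e2 hd)) => o [h1 [h2 h3]] i lin.
by rewrite h1 //; apply: h3 => // k km; rewrite h2.
Qed.

Lemma full_fac n x w p : full n x -> fac n x n w p -> full n w.
Proof.
move=> [_ h] f1; split; first by have [] := f1.
move=> m v q mn f2; exact: (h _ _ _ mn (fac_comp f1 f2)).
Qed.

Lemma fac_id n x : infpt n x -> fac n x n x (fun i z => z i).
Proof.
move=> h; split => //; first by move=> i lin; split => //; exact: germ_var.
exact: ae_true.
Qed.

Lemma full_neq0 n x i : full n x -> (i < n)%N -> ae (fun o => x o i != 0).
Proof.
move=> [ix h] lin; apply: contrapT => /ae_not hz.
case: n lin ix h => // n lin ix h.
apply: (h n (fun o k => x o (bump i k)) (fun k z => if k == i then 0 else z (unbump i k))) => //.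
split.
- by move=> k kn; apply: ix; rewrite /bump; case: (i <= k)%N; lia.
- move=> k kn; case: eqP => ki; split => //; first exact: germ_cst.
  by apply: germ_var; rewrite /unbump; case: ltnP; lia.
- apply: aeW hz => o /negP; rewrite negbK => /eqP xi k kn.
  by case: eqP => [->//|/eqP ki]; rewrite unbumpK // inE eq_sym.
Qed.

Lemma full_proj n x : full n.+1 x -> full n x.
Proof.
move=> [ix h]; split; first by move=> i lin; apply: ix; exact: ltnW.
move=> m w p mn [iw gpp e].
apply: (h m.+1 (fun o => upd (w o) m (x o n)) (fun i z => if i == n then z m else p i z)) => //.
split.
- move=> i; rewrite ltnS leq_eqVlt => /orP[/eqP->|lim] e' e0.
    by apply: aeW (ix n (ltnSn n) _ e0) => o; rewrite upd_eq.
  by apply: aeW (iw i lim _ e0) => o; rewrite upd_ne // ltn_neq.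
- move=> i lin; case: eqP => ine; first by split => //; exact: germ_var.
  have [g0 p0] : germ m (p i) /\ p i O = 0 by apply: gpp; lia.
  by split => //; exact: germ_lift g0.
- have hd : ae (fun o => forall i, (i < n)%N -> forall y, (forall k, (k < m)%N -> w o k = y k) -> p i (w o) = p i y).
    apply: ae_all => i lin; have [g0 p0] := gpp _ lin; have [r r0 hh] := germ_dep g0.
    by apply: aeW (infpt_cube iw r0) => o ho y; exact: hh.
  apply: aeW (ae_and e hd) => o [h1 h2] i lin; case: eqP => [->|ine]; first by rewrite upd_eq.
  have {}lin : (i < n)%N by lia.
  by rewrite h1 //; apply: h2 => // k km; rewrite upd_ne // ltn_neq.
Qed.

Definition LU n (x : gp) (F L : pt -> R) := exists w p,
  [/\ fac n x n w p, mu n (fun z => F (p^~ z)) & mu n (fun z => L (p^~ z))].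

Lemma LU_step n x w p F L : fac n x n w p ->
  LU n w (fun z => F (p^~ z)) (fun z => L (p^~ z)) -> LU n x F L.
Proof.
move=> f1 [v [q [f2 m1 m2]]].
by exists v, (fun i z => p i (q^~ z)); split => //; exact: fac_comp f2.
Qed.

Lemma LU_id n x F L : infpt n x -> mu n F -> mu n L -> LU n x F L.
Proof. by move=> ix mF mL; exists x, (fun i z => z i); split => //; exact: fac_id. Qed.

Lemma LU_ext n x F F' L : nr n (fun z => F z = F' z) -> LU n x F L -> LU n x F' L.
Proof.
move=> h [w [p [f m1 m2]]]; exists w, p; split => //.
have [_ gpp _] := f; apply: (mu_near (F := fun z => F (p^~ z))) m1.
exact: (nr_comp h gpp).
Qed.

Lemma LU_extr n x F L L' : nr n (fun z => L z = L' z) -> LU n x F L -> LU n x F L'.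
Proof.
move=> h [w [p [f m1 m2]]]; exists w, p; split => //.
have [_ gpp _] := f; apply: (mu_near (F := fun z => L (p^~ z))) m2.
exact: (nr_comp h gpp).
Qed.

Lemma LU_pull n x F L M k : germ n L -> germ n M ->
  LU n x F (fun z => L z * M z) -> LU n x (fun z => M z ^+ k * F z) L.
Proof.
move=> gL gM [w [p [f m1 m2]]]; have [_ gpp _] := f.
have gL' := germ_comp gL gpp; have gM' := germ_comp gM gpp.
have mL := mu_factor gL' gM' m2.
have mM : mu n (fun z => M (p^~ z)) by apply: mu_factor gM' gL' _; apply: mu_eq m2 => z; rewrite mulrC.
by exists w, p; split => //; apply: mu_mul => //; exact: mu_exp.
Qed.

Definition reg n s (F : pt -> R) := exists (a : nat -> pt -> R) V,
  [/\ forall i, germ n (a i), germ n.+1 V, forall i, (i < s)%N -> a i O = 0, V O != 0 &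
   nr n.+1 (fun x => F x = \sum_(i < s) x n ^+ i * a i x + x n ^+ s * V x)].

Lemma reg_of_exp n K k0 (F V : pt -> R) (b : nat -> pt -> R) :
  (forall i, germ n (b i)) -> germ n.+1 V ->
  nr n.+1 (fun x => F x = \sum_(i < K) x n ^+ i * b i x + x n ^+ K * V x) ->
  (k0 < K)%N -> b k0 O != 0 -> exists2 s, (s <= k0)%N & reg n s F.
Proof.
move=> gb gV hF k0K bk0.
have exP : exists k, b k O != 0 by exists k0.
case: (ex_minnP exP) => s bs smin; exists s; first exact: smin.
have sK : (s < K)%N by apply: leq_ltn_trans k0K; exact: smin.
exists b, (fun x => \sum_(k < K - s) x n ^+ k * b (s + k)%N x + x n ^+ (K - s) * V x); split => //.
- apply: germ_add.
    apply: germ_sum => k _; apply: germ_mul; first by apply: germ_exp; exact: germ_var.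
    exact: germ_lift (gb _).
  by apply: germ_mul => //; apply: germ_exp; exact: germ_var.
- move=> i lis; apply/eqP; apply: contraTT lis => /smin; by rewrite -leqNgt.
- rewrite -(subnSK sK) big_ord_recl /= addn0 mul1r big1; last first.
    by move=> k _; rewrite exprS !mul0r.
  by rewrite exprS !mul0r !addr0.
- apply: nrW hF => x ->; rewrite mulrDr mulrA -exprD subnKC ?(ltnW sK) // addrA; congr (_ + _).
  rewrite mulr_sumr -(subnKC (ltnW sK)) big_split_ord /= addKn; congr (_ + _).
  by apply: eq_bigr => k _; rewrite exprD mulrA.
Qed.

Lemma reg_germ n s F : reg n s F -> germ n.+1 F.
Proof.
move=> [a [V [ga gV _ _ hF]]].
apply: (germ_ext (F := fun x => \sum_(i < s) x n ^+ i * a i x + x n ^+ s * V x)).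
  by apply: nrW hF => x ->.
apply: germ_add; last by apply: germ_mul => //; apply: germ_exp; exact: germ_var.
apply: germ_sum => k _; apply: germ_mul; first by apply: germ_exp; exact: germ_var.
exact: germ_lift (ga _).
Qed.

End GenPoints.

Lemma coefXaddCn (K : comNzRingType) (l : K) n k :
  (('X + l%:P) ^+ n)`_k = l ^+ (n - k) *+ 'C(n, k).
Proof.
rewrite addrC exprDn coef_sum.
have [kn|kn] := leqP k n.
  rewrite (bigD1 (inord k)) //= inordK ?ltnS // big1 ?addr0 => [|i ne].
    by rewrite coefMn -polyC_exp coefCM coefXn eqxx mulr1.
  rewrite coefMn -polyC_exp coefCM coefXn.
  rewrite (_ : k == i = false) ?mulr0 ?mul0rn //.
  by apply/negbTE; apply: contra ne => /eqP ->; rewrite inord_val.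
rewrite bin_small // mulr0n big1 // => i _.
rewrite coefMn -polyC_exp coefCM coefXn (_ : k == i = false) ?mulr0 ?mul0rn //.
by have := ltn_ord i; lia.
Qed.

Section LocalUnif.
Variables (R : realType) (W : Type) (U : set_system W).
Hypothesis UU : UltraFilter U.
Implicit Types (n m k i j s : nat).
Local Notation pt := (nat -> R).
Local Notation O := (fun=> 0 : R).
Local Notation gp := (W -> pt).
Local Notation LU := (LU U).
Local Notation full := (full U).
Local Notation fac := (fac U).

Lemma germ_ngz n (u : pt -> R) : germ n u -> u O != 0 -> ~ gz n u.
Proof. by move=> _ u0 z; move: u0; rewrite (nr_O z) eqxx. Qed.

Lemma mu_ngz n (F : pt -> R) : mu n F -> ~ gz n F.
Proof.
move=> [b [u [gu u0 e]]] z.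
have : gz n (fun x => mono n b x * u x) by apply: nrW (nr_and e z) => x [<-].
by case/(germ_domain (germ_mono R n b) gu) => [/mono_ngz//|/(germ_ngz gu u0)].
Qed.

Lemma mu_lift n (F : pt -> R) : mu n F -> mu n.+1 F.
Proof.
move=> [b [u [gu u0 e]]]; exists (fun i => if (i < n)%N then b i else 0%N), u; split => //.
  exact: germ_lift gu.
apply: nrW (nr_sub (leqnSn n) e) => x ->; congr (_ * _).
rewrite /mono big_ord_recr /= ltnn expr0 mulr1; apply: eq_bigr => i _; by rewrite ltn_ord.
Qed.

Lemma near_dep n m (A : pt -> R) (p : nat -> pt -> R) : (n <= m)%N -> germ n A ->
  (forall i z, (i < n)%N -> p i z = z i) -> nr m (fun z => A (p^~ z) = A z).
Proof.
move=> nm /germ_dep[r r0 h] hp; exists r => // z zr; apply/esym/h.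
  exact: cubeS zr.
by move=> i lin; rewrite hp.
Qed.

Lemma mono_blow n b j c (z : pt) : (j < n)%N ->
  mono n b (fun i => if i == j then z j * c else z i) = mono n b z * c ^+ b j.
Proof.
move=> jn; rewrite /mono (bigD1 (Ordinal jn)) //= eqxx exprMn.
rewrite [in RHS](bigD1 (Ordinal jn)) //= -!mulrA; congr (_ * _).
rewrite mulrC; congr (_ * _); apply: eq_bigr => i ne.
rewrite (_ : (i == j :> nat) = false) //; apply/negbTE.
by apply: contra ne => /eqP h; apply/eqP/val_inj.
Qed.

Lemma mono_pow1 n j k (z : pt) : (j < n)%N -> mono n (fun i => k * (i == j))%N z = z j ^+ k.
Proof. by move=> jn; rewrite (mono_exp n (fun i => (i == j) : nat)) mono1. Qed.

Definition shape n s (c : nat -> nat) (F : pt -> R) := exists (a : nat -> pt -> R) V,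
  [/\ forall i, germ n (a i), germ n.+1 V, V O != 0, gz n (a s.-1) &
    exists2 i0, (i0 < s)%N & a i0 O != 0] /\
  nr n.+1 (fun x => F x = x n ^+ s * V x +
    \sum_(i < s) mono n (fun k => (s - i) * c k)%N x * a i x * x n ^+ i).

Definition Cprop n s := forall x (F L : pt -> R), full n.+1 x -> reg n s F -> germ n L ->
  ~ gz n L -> LU n.+1 x F L.

Lemma loop n s : (forall s', (s' < s)%N -> Cprop n s') ->
  forall N (c : nat -> nat) (x : gp) (F L : pt -> R), (\sum_(k < n) c k)%N = N -> full n.+1 x -> shape n s c F ->
  mu n L -> LU n.+1 x F L.
Proof.
move=> IHC; elim=> [|N IH] c x F L cN fx [a [V [[ga gV V0 az [i0 i0s ai0]] hF]]] mL.
  have c0 i : (i < n)%N -> c i = 0%N.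
    by move=> lin; move/eqP: cN; rewrite sum_nat_eq0 => /forallP /(_ (Ordinal lin)) /eqP.
  have [s' s'i0 rF] : exists2 s', (s' <= i0)%N & reg n s' F.
    apply: (reg_of_exp ga gV _ i0s ai0); apply: nrW hF => z ->; rewrite addrC; congr (_ + _).
    apply: eq_bigr => i _; rewrite (eq_mono (c := fun=> 0%N)) ?mono0 ?mul1r 1?mulrC //.
    by move=> k kn; rewrite c0 // muln0.
  apply: (IHC s') => //; [exact: leq_ltn_trans i0s|exact: mu_germ|exact: mu_ngz].
have [j jn cj] : exists2 j, (j < n)%N & (0 < c j)%N.
  have : (\sum_(i < n) c i != 0)%N by rewrite cN.
  by rewrite sum_nat_eq0 negb_forall => /existsP[j]; rewrite -lt0n => h; exists j.
have ix := proj1 fx; have gL := mu_germ mL.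
have jn1 : (j < n.+1)%N by rewrite ltnS ltnW.
have jnn : j != n by rewrite ltn_neq.
have xj := full_neq0 UU fx jn1; have xn := full_neq0 UU fx (ltnSn n).
have [[M hM]|hM] := pselect (exists M, ae U (fun o => `|x o n / x o j| <= M)); last first.
  pose w o := upd (x o) j (x o j / x o n).
  pose p i (z : pt) := if i == j then z j * z n else z i.
  have gpp : gmap n.+1 n.+1 p.
    move=> i lin; rewrite /p; case: eqP => _; split => //; rewrite ?mul0r //.
      by apply: germ_mul; exact: germ_var.
    exact: germ_var.
  have f1 : fac n.+1 x n.+1 w p.
    split => //.
      move=> i lin e e0; have [->|ij] := eqVneq i j; last first.
        by apply: aeW (ix i lin _ e0) => o; rewrite /w upd_ne.
      have h : ae U (fun o => ~ (`|x o n / x o j| <= e^-1)).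
        by apply: (ae_not UU) => h; apply: hM; exists e^-1.
      apply: aeW (ae_and UU h (ae_and UU xj xn)) => o [/negP]; rewrite -ltNge => h1 [h2 h3].
      rewrite /w upd_eq -[x o j / x o n]invf_div normfV -[e]invrK lef_pV2 ?ltW //.
        by rewrite posrE normr_gt0 mulf_neq0 // invr_eq0.
      by rewrite posrE invr_gt0.
    apply: aeW xn => o h i lin; rewrite /p /w; case: eqP => [->|/eqP ij].
      by rewrite upd_eq upd_ne ?divfK // eq_sym.
    by rewrite upd_ne.
  apply: (LU_step UU f1); apply: LU_id => //; first by have [] := f1.
    pose V' z := V (p^~ z) + \sum_(i < s) mono n (fun k => (s - i) * c k)%N z *
       z n ^+ ((s - i) * (c j - 1)) * a i (p^~ z).
    have gV' : germ n.+1 V'.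
      apply: germ_add; first exact: (germ_comp gV gpp).
      apply: germ_sum => i _; apply: germ_mul; last first.
        exact: (germ_comp (germ_lift (leqnSn n) (ga i)) gpp).
      apply: germ_mul; first exact: germ_lift (germ_mono R n _).
      by apply: germ_exp; exact: germ_var.
    have V'0 : V' O != 0.
      rewrite /V' big1 ?addr0.
        have [r r0 h] := germ_dep gV; rewrite -(h O) //; first exact: (cube0 (ltW r0)).
        by move=> i lin; rewrite /p; case: eqP; rewrite ?mulr0.
      move=> i _; rewrite (@mono_z _ n _ _ j) ?mul0r // muln_gt0 cj andbT subn_gt0; exact: ltn_ord.
    apply: (mu_near (F := fun z => z n ^+ s * V' z)).
      apply: nrW (nr_comp hF gpp) => z ->; rewrite /V' mulrDr.
      have -> : p n z = z n by rewrite /p eq_sym (negbTE jnn).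
      congr (_ + _); rewrite mulr_sumr; apply: eq_bigr => i _.
      rewrite /p mono_blow //; set A := a i _; set m1 := mono _ _ _.
      have -> : z n ^+ s = z n ^+ (s - i) * z n ^+ i by rewrite -exprD subnK // ltnW.
      have -> : ((s - i) * c j = (s - i) * (c j - 1) + (s - i))%N by rewrite -mulnSr subn1 prednK.
      by rewrite exprD; ring.
    by apply: mu_mul; [apply: mu_exp; exact: mu_var|exact: mu_unit].
  apply: (mu_comp mL) => i lin; have lin1 : (i < n.+1)%N by rewrite ltnS ltnW.
  have [g0 p0] := gpp _ lin1; split => //.
  rewrite /p; case: eqP => _; last exact: mu_var.
  by apply: mu_mul; exact: mu_var.
have [l hl] := standard_part UU hM.
pose w o := upd (x o) n (x o n / x o j - l).
pose p i (z : pt) := if i == n then z j * (l + z n) else z i.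
have gpp : gmap n.+1 n.+1 p.
  move=> i lin; rewrite /p; case: eqP => _; split => //; rewrite ?mul0r //.
    apply: germ_mul; first exact: germ_var.
    by apply: germ_add; [exact: germ_cst|exact: germ_var].
  exact: germ_var.
have f1 : fac n.+1 x n.+1 w p.
  split => //.
    move=> i lin; have [->|i_n] := eqVneq i n.
      by move=> e e0; apply: aeW (hl e e0) => o; rewrite /w upd_eq.
    by move=> e e0; apply: aeW (ix i lin e e0) => o; rewrite /w upd_ne.
  apply: aeW xj => o h i lin; rewrite /p /w; case: eqP => [->|/eqP i_n]; last by rewrite upd_ne.
  by rewrite upd_eq upd_ne // addrC subrK mulrC divfK.
have fw := full_fac UU fx f1; have iw := proj1 fw.
have pi i z : (i < n)%N -> p i z = z i by move=> lin; rewrite /p (negbTE (ltn_neq lin)).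
have pn z : p n z = z j * (l + z n) by rewrite /p eqxx.
have mp b z : mono n b (p^~ z) = mono n b z.
  by rewrite /mono; apply: eq_bigr => i _; rewrite pi.
pose c' k := (c k - (k == j))%N.
have cE k : c k = (c' k + (k == j))%N by rewrite /c'; case: eqP => [->|]; lia.
have c'N : (\sum_(k < n) c' k)%N = N.
  have : (\sum_(i < n) c i = \sum_(i < n) c' i + 1)%N.
    under eq_bigr do rewrite cE; rewrite big_split /=; congr addn.
    rewrite (bigD1 (Ordinal jn)) //= eqxx big1 // => i ne.
    by rewrite (_ : (i == j :> nat) = false) //; apply/negbTE; apply: contra ne => /eqP h; apply/eqP/val_inj.
  by rewrite cN addn1 => -[].
pose V' z := V (p^~ z).
have gV' : germ n.+1 V' by exact: (germ_comp gV gpp).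
have V'0 : V' O = V O.
  have [r r0 h] := germ_dep gV; apply/esym/h; first exact: (cube0 (ltW r0)).
  by move=> i lin; rewrite /p; case: eqP; rewrite ?mul0r.
pose F' z := (l + z n) ^+ s * V' z +
    \sum_(i < s) mono n (fun k => (s - i) * c' k)%N z * a i z * (l + z n) ^+ i.
have gln : germ n.+1 (fun z => l + z n) by apply: germ_add; [exact: germ_cst|exact: germ_var].
have gF' : germ n.+1 F'.
  apply: germ_add; first by apply: germ_mul => //; exact: germ_exp.
  apply: germ_sum => i _; apply: germ_mul; last exact: germ_exp.
  by apply: germ_mul; [exact: germ_lift (germ_mono R n _)|exact: germ_lift (ga i)].
have FF' : nr n.+1 (fun z => z j ^+ s * F' z = F (p^~ z)).
  have ha : nr n.+1 (fun z => forall i, (i < s)%N -> a i (p^~ z) = a i z).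
    by apply: nr_all => i _; exact: (near_dep (leqnSn n) (ga i) pi).
  apply: nrW (nr_and (nr_comp hF gpp) ha) => z [-> hz].
  rewrite /F' /V' pn exprMn mulrDr mulrA; congr (_ + _).
  rewrite mulr_sumr; apply: eq_bigr => i _.
  rewrite mp (hz _ (ltn_ord i)) (eq_mono (b := (fun k => (s - i) * c k)%N) (c := (fun k => (s - i) * c' k + (s - i) * (k == j))%N)); last first.
    by move=> k _; rewrite {1}cE mulnDr.
  rewrite monoD mono_pow1 // exprMn.
  have -> : z j ^+ s = z j ^+ (s - i) * z j ^+ i by rewrite -exprD subnK // ltnW.
  by ring.
have LL' : nr n.+1 (fun z => L z = L (p^~ z)).
  by apply: nrW (near_dep (leqnSn n) gL pi) => z ->.
apply: (LU_step UU f1); apply: LU_ext FF' _; apply: LU_extr LL' _.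
have gj : germ n.+1 (fun z : pt => z j) by exact: germ_var.
have gL1 := germ_lift (leqnSn n) gL.
have mLj : mu n (fun z => L z * z j) by apply: mu_mul => //; exact: mu_var.
have [l0|l0] := eqVneq l 0.
  apply: (LU_pull (M := fun z => z j)) => //; apply: (IH c') => //.
  exists a, V'; split; first by split => //; [rewrite V'0|exists i0].
  by exists 1 => // z _; rewrite /F' l0 add0r.
have [[k kn ck]|hc] := pselect (exists2 k, (k < n)%N & (0 < c' k)%N).
  apply: LU_id => //; last exact: mu_lift.
  apply: mu_mul; first by apply: mu_exp; exact: mu_var.
  apply: mu_unit => //; rewrite /F' addr0 big1 ?addr0.
    by rewrite mulf_neq0 ?expf_neq0 // V'0.
  move=> i _; rewrite (@mono_z _ n _ _ k) ?mul0r // muln_gt0 ck andbT subn_gt0; exact: ltn_ord.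
have c'0 k : (k < n)%N -> c' k = 0%N.
  by move=> kn; apply/eqP; rewrite -leqn0 leqNgt; apply/negP => h; apply: hc; exists k.
have s0 : (0 < s)%N by exact: leq_ltn_trans i0s.
have [b [V1 [gb gV1 hF']]] := germ_expand s gF'.
have [k0 k0s bk0] : exists2 k, (k < s)%N & b k O != 0.
  apply: contrapT => /forall2NP hb.
  have {}hb k : (k < s)%N -> b k O = 0.
    by move=> ks; have [//|/negP] := hb k; rewrite negbK => /eqP.
  pose P : {poly R} := V O *: ('X + l%:P) ^+ s + \sum_(i < s) a i O *: ('X + l%:P) ^+ i.
  have [r1 r10 dV] := germ_dep gV.
  have [r2 r20 da] : nr n (fun z => forall y, (forall i, (i < n)%N -> z i = y i) -> forall i, (i < s)%N -> a i z = a i y).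
    have : nr n (fun z => forall i, (i < s)%N -> forall y, (forall i, (i < n)%N -> z i = y i) -> a i z = a i y).
      apply: nr_all => i _; have [r r0 h] := germ_dep (ga i); exists r => // z zr y; exact: h.
    by apply: nrW => z h y zy i lis; apply: h.
  have [r3 r30 db] : nr n (fun z => forall y, (forall i, (i < n)%N -> z i = y i) -> forall i, (i < s)%N -> b i z = b i y).
    have : nr n (fun z => forall i, (i < s)%N -> forall y, (forall i, (i < n)%N -> z i = y i) -> b i z = b i y).
      apply: nr_all => i _; have [r r0 h] := germ_dep (gb i); exists r => // z zr y; exact: h.
    by apply: nrW => z h y zy i lis; apply: h.
  have [B B0 [r4 r40 hB]] := germ_bnd gV1.
  have [r5 r50 hF5] := hF'.
  pose e := Num.min r4 r5.
  have e0 : 0 < e by rewrite lt_min r40.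
  have hP : forall y, 0 < y -> y <= e -> `|P.[y]| <= B * y ^+ s.
    move=> y y0 ye; pose z : pt := upd O n y.
    have zc : cube n.+1 e z by apply: cube_upd; [exact: (cube0 (ltW e0))|rewrite gtr0_norm].
    have zn : z n = y by rewrite /z upd_eq.
    have zi i : (i < n)%N -> 0 = z i by move=> lin; rewrite /z upd_ne // ltn_neq.
    have := hF5 z (cubeS (leqnn _) _ zc); rewrite ge_min lexx orbT => /(_ isT).
    rewrite big1 ?add0r => [|i _]; last first.
      by rewrite -(db O (cube0 (ltW r30)) z zi i (ltn_ord i)) hb // mulr0.
    rewrite zn => hz.
    have -> : P.[y] = F' z.
      rewrite /F' zn /P hornerD hornerZ horner_exp hornerD hornerX hornerC (addrC l) mulrC.
      congr (_ + _).
        congr (_ * _); rewrite /V'; apply: dV; first exact: (cube0 (ltW r10)).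
        move=> i lin; rewrite /p; case: eqP => [_|/eqP i_n]; last by apply: zi; clear -lin i_n; lia.
        by rewrite -(zi _ jn) mul0r.
      rewrite horner_sum; apply: eq_bigr => i _.
      rewrite (eq_mono (c := fun=> 0%N)) ?mono0 ?mul1r; last by move=> k kn; rewrite c'0 // muln0.
      rewrite hornerZ horner_exp hornerD hornerX hornerC; congr (_ * _).
      by rewrite (da O (cube0 (ltW r20)) z zi i (ltn_ord i)).
    rewrite hz normrM mulrC ler_pM ?normr_ge0 //.
      by apply: hB; apply: cubeS zc => //; rewrite ge_min lexx.
    by rewrite gtr0_norm ?exprn_gt0.
  have := poly_small_coef0 e0 hP (_ : (s.-1 < s)%N); rewrite prednK // leqnn => /(_ isT).
  rewrite /P coefD coefZ coefXaddCn coef_sum big1 ?addr0 => [|i _]; last first.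
    rewrite coefZ coefXaddCn; have [is1|is1] := eqVneq (i : nat) s.-1.
      by rewrite is1 (nr_O az) mul0r.
    by rewrite bin_small ?mulr0n ?mulr0 //; have lis := ltn_ord i; clear -lis is1; lia.
  rewrite (_ : (s - s.-1 = 1)%N); last by rewrite -{1}(prednK s0) subSnn.
  have -> : 'C(s, s.-1) = s by rewrite -{1}(prednK s0) binSn prednK.
  rewrite expr1 => /eqP; rewrite mulf_eq0 (negbTE V0) /= mulrn_eq0 (negbTE l0) orbF => /eqP ss.
  by rewrite ss in s0.
have [s' s'k0 rF'] := reg_of_exp gb gV1 hF' k0s bk0.
apply: (LU_pull (M := fun z => z j)) => //; apply: (IHC s') => //.
- exact: leq_ltn_trans k0s.
- exact: mu_germ.
- exact: mu_ngz.
Qed.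

End LocalUnif.

Section LocalUnif2.
Variables (R : realType) (W : Type) (U : set_system W).
Hypothesis UU : UltraFilter U.
Implicit Types (n m k i j s : nat).
Local Notation pt := (nat -> R).
Local Notation O := (fun=> 0 : R).
Local Notation gp := (W -> pt).
Local Notation LU := (LU U).
Local Notation full := (full U).
Local Notation fac := (fac U).
Local Notation Cprop := (@Cprop R W U).

Lemma near_O n r : 0 < r -> cube n r (O : pt).
Proof. by move=> r0; exact: (cube0 (ltW r0)). Qed.

Lemma ramify n v K : (0 < K)%N -> full n v -> exists (e : nat -> R) t,
  (forall i, e i != 0) /\ fac n v n t (fun i z => e i * z i ^+ K).
Proof.
move=> K0 fv.
have /choice[e he] : forall i, exists e : R, (e == 1) || (e == -1) /\
    ((i < n)%N -> ae U (fun o => v o i = e * `|v o i|)).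
  move=> i; have [h|/(ae_not UU) h] := pselect (ae U (fun o => 0 <= v o i)).
    exists 1; rewrite eqxx; split => // _; apply: aeW h => o h.
    by rewrite mul1r ger0_norm.
  exists (-1); rewrite eqxx orbT; split => // _; apply: aeW h => o /negP; rewrite -ltNge => h.
  by rewrite mulN1r ltr0_norm // opprK.
have e0 i : e i != 0 by have [/orP[]/eqP -> _] := he i; rewrite ?oppr_eq0 oner_neq0.
pose rt (a : R) := `|a| `^ (K%:R^-1).
have rtK a : rt a ^+ K = `|a|.
  by rewrite -powR_mulrn ?powR_ge0 // /rt -powRrM mulVf ?powRr1 // pnatr_eq0 -lt0n.
have rt0 a : 0 <= rt a by exact: powR_ge0.
exists e, (fun o i => rt (v o i)); split => //; split.
- move=> i lin d d0; apply: aeW ((proj1 fv) i lin (d ^+ K) (exprn_gt0 _ d0)) => o h.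
  rewrite ger0_norm // leNgt; apply/negP => dl.
  have : d ^+ K < rt (v o i) ^+ K by rewrite (ltrXn2r _ (ltW d0) dl) -lt0n.
  by rewrite rtK ltNge h.
- move=> i lin; split; last by rewrite expr0n -leqn0 leqNgt K0 mulr0.
  by apply: germ_mul; [exact: germ_cst|apply: germ_exp; exact: germ_var].
- apply: (ae_all UU) => i lin; have [_ /(_ lin)] := he i; apply: aeW => o {1}->.
  by rewrite rtK.
Qed.

Lemma poly_coef_near (P : {poly R}) (B e : R) s : 0 < e ->
  (forall y, 0 < y -> y <= e -> `|P.[y]| <= B * y ^+ s) -> forall i, (i < s)%N -> P`_i = 0.
Proof. exact: poly_small_coef0. Qed.

Lemma tschirn n s F : (0 < s)%N -> reg n s F -> exists theta (b : nat -> pt -> R) V,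
  [/\ germ n theta /\ theta O = 0, forall i, germ n (b i), germ n.+1 V /\ V O != 0,
   gz n (b s.-1) &
   nr n.+1 (fun x => F (upd x n (x n + theta x)) = \sum_(i < s) x n ^+ i * b i x + x n ^+ s * V x)].
Proof.
move=> s0 rF; have gF := reg_germ rF; case: rF => a [V0 [ga gV0 a0 V00 hF]].
pose T i (x : pt) := if i == n then x n + x n.+1 else x i.
have gT i : (i < n.+1)%N -> germ n.+2 (T i) /\ T i O = 0.
  move=> lin; rewrite /T; case: eqP => _; rewrite ?addr0; split => //.
    by apply: germ_add; apply: germ_var; rewrite // ltnS ltnW.
  by apply: germ_var; exact: ltnW.
have gG := germ_comp gV0 gT.
have [u [V2 [gu gV2 hG]]] := germ_expand s gG.
have u0 : u 0%N O = V0 O.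
  have [r r0 d] := germ_dep gV0.
  rewrite (d O (T^~ O)) ?(nr_O hG); last 2 first.
  - exact: near_O.
  - by move=> i lin; rewrite /T; case: eqP; rewrite ?addr0.
  rewrite -(prednK s0) big_ord_recl /= mul1r big1 ?addr0 => [|i _]; last by rewrite exprS !mul0r.
  by rewrite exprS !mul0r addr0.
pose E1 z := \sum_(i < s) 'C(s, i)%:R * z n ^+ (s - i).-1 * u (s.-1 - i)%N z.
have gE1 : germ n.+1 E1.
  apply: germ_sum => i _; apply: germ_mul => //.
  by apply: germ_mul; [exact: germ_cst|apply: germ_exp; exact: germ_var].
have s1 : (s.-1 < s)%N by rewrite prednK.
have E10 : E1 O != 0.
  rewrite /E1 (bigD1 (Ordinal s1)) //= big1 ?addr0 => [|i ine].
    rewrite subnn u0 (_ : (s - s.-1).-1 = 0%N); last by rewrite -{1}(prednK s0) subSnn.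
    rewrite expr0 mulr1 mulf_neq0 // -{1}(prednK s0) binSn pnatr_eq0 //.
  have lis : ((i : nat) < s.-1)%N.
    rewrite ltn_neqAle -ltnS prednK // ltn_ord andbT; apply: contra ine => /eqP h.
    by apply/eqP/val_inj.
  rewrite (_ : (s - i).-1 = (s - i).-2.+1); last by rewrite prednK // -subn1 subn_gt0; lia.
  by rewrite exprS mul0r mulr0 mul0r.
have [theta [gth th0 hth]] := germ_ift (ga s.-1) gE1 (a0 _ s1) E10.
pose p i (z : pt) := if i == n then z n + theta z else z i.
have gpp : gmap n.+1 n.+1 p.
  move=> i lin; rewrite /p; case: eqP => _; rewrite ?add0r; split => //.
    by apply: germ_add; [exact: germ_var|exact: germ_lift gth].
  exact: germ_var.
have gF1 := germ_comp gF gpp.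
have [b [V3 [gb gV3 hF1]]] := germ_expand s.+1 gF1.
(* the generalized point (x', theta x', y) *)
pose q i (z : pt) := if i == n.+1 then z n else if i == n then theta z else z i.
have gq : gmap n.+2 n.+1 q.
  move=> i lin; rewrite /q; case: eqP => i_n1; first by split => //; exact: germ_var.
  case: eqP => i_n; first by split => //; exact: germ_lift gth.
  by split => //; apply: germ_var; lia.
have hGq := nr_comp hG gq; have hFp := nr_comp hF gpp.
have [B2 B20 hB2] := germ_bnd (germ_comp gV2 gq); have [B3 B30 hB3] := germ_bnd gV3.
have hdep (A : nat -> pt -> R) k m : (forall i, germ m (A i)) ->
    nr m (fun z => forall i, (i < k)%N -> forall y, (forall l, (l < m)%N -> z l = y l) -> A i z = A i y).
  move=> gA; apply: nr_all => i _; have [r r0 h] := germ_dep (gA i).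
  by exists r => // z zr y; exact: h.
have [r0 r00 da] := hdep a s n ga; have [r1 r10 db] := hdep b s.+1 n gb.
have gth' : gmap n.+1 n.+1 (fun i z => if i == n then theta z else z i).
  move=> i lin; case: eqP => i_n; first by split => //; exact: germ_lift gth.
  by split => //; exact: germ_var.
have [r2 r20 du] := nr_comp (hdep u s n.+1 gu) gth'.
have [rt rt0 dth] := germ_dep gth.
have [rV rV0 dV0] := nr_comp (hdep (fun=> V0) 1%N n.+1 (fun=> gV0)) gpp.
have [r3 r30 h3] := nr_and hGq (nr_and hFp (nr_and hF1 (nr_and hB2 hB3))).
pose e := Num.min (Num.min r0 r1) (Num.min (Num.min r2 rt) (Num.min rV r3)).
have e0 : 0 < e by rewrite /e !lt_min r00 r10 r20 rt0 rV0 r30.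
have er0 : e <= r0 by rewrite /e !ge_min lexx.
have er1 : e <= r1 by rewrite /e !ge_min lexx ?orbT.
have er2 : e <= r2 by rewrite /e !ge_min lexx ?orbT.
have ert : e <= rt by rewrite /e !ge_min lexx ?orbT.
have erV : e <= rV by rewrite /e !ge_min lexx ?orbT.
have er3 : e <= r3 by rewrite /e !ge_min lexx ?orbT.
pose Q (x : pt) : {poly R} := \sum_(i < s) a i x *: ('X + (theta x)%:P) ^+ i +
  ('X + (theta x)%:P) ^+ s * \sum_(i < s) u i (upd x n (theta x)) *: 'X^i.
pose B (x : pt) : {poly R} := \sum_(i < s.+1) b i x *: 'X^i.
have key x y : cube n e x -> 0 < y -> y <= e ->
    (Q x - B x).[y] = y ^+ s.+1 * V3 (upd x n y) - (y + theta x) ^+ s * (y ^+ s * V2 (q^~ (upd x n y))).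
  move=> xe y0 ye; pose z := upd x n y.
  have zc : cube n.+1 e z by apply: cube_upd => //; rewrite gtr0_norm.
  have zn : z n = y by rewrite /z upd_eq.
  have zi i : (i < n)%N -> x i = z i by move=> lin; rewrite /z upd_ne // ltn_neq.
  have [k1 [k2 [k3 _]]] := h3 z (cubeS (leqnn _) er3 zc).
  have thz : theta z = theta x by apply/esym/dth => //; exact: cubeS xe.
  have pz : p n z = y + theta x by rewrite /p eqxx zn thz.
  have qz : q n.+1 z = y by rewrite /q eqxx zn.
  rewrite pz in k2; rewrite zn in k3; rewrite qz in k1.
  rewrite hornerD hornerN.
  have -> : (B x).[y] = \sum_(i < s.+1) y ^+ i * b i z.
    rewrite horner_sum; apply: eq_bigr => i _; rewrite hornerZ hornerXn mulrC; congr (_ * _).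
    by apply: db => //; exact: cubeS xe.
  have -> : (Q x).[y] = \sum_(i < s) (y + theta x) ^+ i * a i (p^~ z) +
      (y + theta x) ^+ s * \sum_(i < s) y ^+ i * u i (q^~ z).
    rewrite hornerD hornerM horner_exp hornerD hornerX hornerC !horner_sum.
    congr (_ + _ * _); apply: eq_bigr => i _.
      rewrite hornerZ horner_exp hornerD hornerX hornerC mulrC; congr (_ * _).
      apply: da => //; first exact: cubeS xe.
      by move=> l ln; rewrite /p (negbTE (ltn_neq ln)) zi.
    rewrite hornerZ hornerXn mulrC; congr (_ * _).
    have -> : upd x n (theta x) = (fun k => if k == n then theta z else x k).
      by apply/funext => k; rewrite /upd thz.
    have <- : (fun k => if k == n then theta z else z k) = (fun k => if k == n then theta z else x k).
      apply/funext => k; rewrite /z /upd; by case: eqP.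
    apply: (du z (cubeS (leqnn _) er2 zc)) => // l ln; rewrite /q.
    by rewrite (ltn_eqF (ln : (l < n.+1)%N)).
  have VE : V0 (p^~ z) = V0 (T^~ (q^~ z)).
    apply: (dV0 z (cubeS (leqnn _) erV zc) 0%N isT) => l ln.
    rewrite /p /T /q; case: eqP => [_|ne].
      by rewrite eqxx addrC (ltn_eqF (ltnSn n)) eqxx.
    by rewrite (ltn_eqF (ln : (l < n.+1)%N)).
  move: k2 k3; rewrite VE k1 => -> h.
  rewrite mulrDr addrA in h.
  have -> : \sum_(i < s.+1) y ^+ i * b i z = (\sum_(i < s) (y + theta x) ^+ i * a i (p^~ z) +
     (y + theta x) ^+ s * \sum_(i < s) y ^+ i * u i (q^~ z) +
     (y + theta x) ^+ s * (y ^+ s * V2 (q^~ z))) - y ^+ s.+1 * V3 z by rewrite h; ring.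
  by rewrite /z; ring.
have bounds x y : cube n e x -> 0 < y -> y <= e -> `|V3 (upd x n y)| <= B3 /\ `|V2 (q^~ (upd x n y))| <= B2.
  move=> xe y0 ye; have zc : cube n.+1 e (upd x n y) by apply: cube_upd => //; rewrite gtr0_norm.
  by have [_ [_ [_ [h4 h5]]]] := h3 _ (cubeS (leqnn _) er3 zc).
exists theta, b, (fun x => b s x + x n * V3 x); split => //.
- split.
    by apply: germ_add; [exact: germ_lift (gb s)|apply: germ_mul => //; exact: germ_var].
  rewrite mul0r addr0.
  have Oe : cube n e (O : pt) by exact: near_O.
  have hP : forall y, 0 < y -> y <= e -> `|(Q O - B O).[y]| <= (B3 + B2 * e ^+ s.-1) * y ^+ s.+1.
    move=> y y0 ye; rewrite key // th0 addr0; have [b3 b2] := bounds O y Oe y0 ye.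
    have -> : y ^+ s * (y ^+ s * V2 (q^~ (upd O n y))) = y ^+ s.+1 * (y ^+ s.-1 * V2 (q^~ (upd O n y))).
      by rewrite !mulrA -!exprD addSn -addnS prednK.
    rewrite -mulrBr normrM mulrC (gtr0_norm (exprn_gt0 _ y0)) ler_pM2r ?exprn_gt0 //.
    apply: le_trans (ler_normB _ _) _; apply: lerD => //.
    rewrite normrM mulrC ler_pM ?normr_ge0 // (gtr0_norm (exprn_gt0 _ y0)).
    by rewrite lerXn2r // nnegrE ltW.
  have := poly_coef_near e0 hP (ltnSn s); rewrite coefB => /eqP; rewrite subr_eq0.
  rewrite /B coef_sum (bigD1 ord_max) //= coefZ coefXn eqxx mulr1 big1 ?addr0; last first.
    move=> i ne; rewrite coefZ coefXn (_ : (s == i) = false) ?mulr0 //.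
    by apply/negbTE; rewrite eq_sym; apply: contra ne => /eqP h; apply/eqP/val_inj.
  rewrite /Q th0 polyC0 !addr0 coefD coef_sum big1 ?add0r => [|i _]; last first.
    by rewrite a0 // scale0r coef0.
  rewrite coefXnM ltnn subnn coef_sum (bigD1 (Ordinal s0)) //= coefZ coefXn eqxx mulr1.
  rewrite big1 ?addr0 => [/eqP <-|i ne]; last first.
    rewrite coefZ coefXn (_ : (0%N == i) = false) ?mulr0 //.
    by apply/negbTE; rewrite eq_sym; apply: contra ne => /eqP h; apply/eqP/val_inj.
  have -> : upd O n 0 = O by apply/funext => k; rewrite /upd; case: eqP.
  by rewrite u0.
- apply: nrW (nr_and hth (ex_intro2 _ _ e e0 (fun x h => h))) => x [hx xe].
  have hP : forall y, 0 < y -> y <= e -> `|(Q x - B x).[y]| <=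
      (e * B3 + (e + `|theta x|) ^+ s * B2) * y ^+ s.
    move=> y y0 ye; rewrite key //; have [b3 b2] := bounds x y xe y0 ye.
    have -> : y ^+ s.+1 * V3 (upd x n y) - (y + theta x) ^+ s * (y ^+ s * V2 (q^~ (upd x n y))) =
      y ^+ s * (y * V3 (upd x n y) - (y + theta x) ^+ s * V2 (q^~ (upd x n y))) by rewrite exprS; ring.
    rewrite normrM mulrC (gtr0_norm (exprn_gt0 _ y0)) ler_pM2r ?exprn_gt0 //.
    apply: le_trans (ler_normB _ _) _; apply: lerD; rewrite normrM ler_pM ?normr_ge0 //.
      by rewrite gtr0_norm.
    rewrite normrX lerXn2r ?nnegrE ?normr_ge0 ?addr_ge0 ?normr_ge0 ?(ltW e0) //.
    by apply: le_trans (ler_normD _ _) _; rewrite lerD2r gtr0_norm.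
  have := poly_coef_near e0 hP s1; rewrite coefB => /eqP; rewrite subr_eq0.
  have s1' : (s.-1 < s.+1)%N by exact: ltnW.
  rewrite /B coef_sum (bigD1 (Ordinal s1')) //= coefZ coefXn eqxx mulr1 big1 ?addr0; last first.
    move=> i ne; rewrite coefZ coefXn (_ : (s.-1 == i) = false) ?mulr0 //.
    by apply/negbTE; rewrite eq_sym; apply: contra ne => /eqP h; apply/eqP/val_inj.
  move=> /eqP <-; rewrite /Q coefD coef_sum (bigD1 (Ordinal s1)) //= big1 ?addr0; last first.
    move=> i ne; rewrite coefZ coefXaddCn bin_small ?mulr0n ?mulr0 //.
    rewrite ltn_neqAle -ltnS prednK // ltn_ord andbT; apply: contra ne => /eqP h.
    by apply/eqP/val_inj.
  rewrite coefZ coefXaddCn subnn binn expr0 mulr1n mulr1 -[RHS]hx; congr (_ + _).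
  rewrite coefM (prednK s0) /E1 mulr_sumr; apply: eq_bigr => i _.
  rewrite coefXaddCn coef_sum upd_eq.
  have lis : (s.-1 - i < s)%N by apply: leq_ltn_trans s1; rewrite leq_subr.
  rewrite (bigD1 (Ordinal lis)) //= coefZ coefXn eqxx mulr1 big1 ?addr0; last first.
    move=> k ne; rewrite coefZ coefXn (_ : (s.-1 - i == k)%N = false) ?mulr0 //.
    by apply/negbTE; rewrite eq_sym; apply: contra ne => /eqP h; apply/eqP/val_inj.
  have si : (0 < s - i)%N by rewrite subn_gt0 ltn_ord.
  by rewrite -{1}(prednK si) exprS -mulr_natl; ring.
- apply: nrW hF1 => x; rewrite big_ord_recr /= => hx.
  have -> : upd x n (x n + theta x) = p^~ x by apply/funext => i; rewrite /upd /p.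
  by rewrite hx exprSr; ring.
Qed.

End LocalUnif2.

Section LocalUnif3.
Variables (R : realType) (W : Type) (U : set_system W).
Hypothesis UU : UltraFilter U.
Implicit Types (n m k i j s : nat).
Local Notation pt := (nat -> R).
Local Notation O := (fun=> 0 : R).
Local Notation gp := (W -> pt).
Local Notation LU := (LU U).
Local Notation full := (full U).
Local Notation fac := (fac U).
Local Notation Cprop := (@Cprop R W U).

Definition Sprop n := forall x (F : pt -> R), full n x -> germ n F -> ~ gz n F ->
  exists w p, fac n x n w p /\ mu n (fun z => F (p^~ z)).

Lemma fac_lift n (x : gp) w p : infpt U n.+1 x -> fac n x n w p ->
  fac n.+1 x n.+1 (fun o => upd (w o) n (x o n)) (fun i z => if i == n then z n else p i z).
Proof.
move=> ix [iw gpp e]; split.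
- move=> i lin; have [->|i_n] := eqVneq i n.
    by move=> d d0; apply: aeW (ix n (ltnSn n) d d0) => o; rewrite upd_eq.
  have lin' : (i < n)%N by lia.
  move=> d d0; apply: aeW (iw i lin' d d0) => o.
  by rewrite upd_ne.
- move=> i lin; case: eqP => i_n; first by split => //; exact: germ_var.
  have [g0 p0] : germ n (p i) /\ p i O = 0 by apply: gpp; lia.
  by split => //; exact: germ_lift g0.
- have hd : ae U (fun o => forall i, (i < n)%N -> forall y, (forall k, (k < n)%N -> w o k = y k) -> p i (w o) = p i y).
    apply: (ae_all UU) => i lin; have [g0 p0] := gpp _ lin; have [r r0 hh] := germ_dep g0.
    by apply: aeW (infpt_cube UU iw r0) => o ho y; exact: hh.
  apply: aeW (ae_and UU e hd) => o [h1 h2] i lin; case: eqP => [->|i_n]; first by rewrite upd_eq.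
  have {}lin : (i < n)%N by lia.
  by rewrite h1 //; apply: h2 => // k km; rewrite upd_ne // ltn_neq.
Qed.

Lemma near_lift n (L : pt -> R) (p : nat -> pt -> R) : germ n L -> gmap n n p ->
  nr n.+1 (fun z => L (p^~ z) = L (fun i => if i == n then z n else p i z)).
Proof.
move=> gL gpp; have [r r0 h] := germ_dep gL.
have : nr n (fun z => cube n r (p^~ z)) by apply: nr_comp gpp; exists r.
move=> /(nr_sub (leqnSn n)); apply: nrW => z zc; apply: h => // i lin.
by rewrite (ltn_eqF lin).
Qed.

Lemma ngz_mul n (F G : pt -> R) : germ n F -> germ n G -> ~ gz n F -> ~ gz n G ->
  ~ gz n (fun x => F x * G x).
Proof. by move=> gF gG nF nG /(germ_domain gF gG)[]. Qed.

Lemma ngz_prod n (I : Type) (s : seq I) (F : I -> pt -> R) :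
  (forall i : I, germ n (F i)) -> (forall i : I, ~ gz n (F i)) -> ~ gz n (fun x => \prod_(i <- s) F i x).
Proof.
move=> gF nF; elim: s => [|i s IH].
  by apply: germ_ngz; [apply: germ_prod|rewrite big_nil oner_neq0].
move=> h; have : gz n (fun x => F i x * \prod_(i <- s) F i x).
  by apply: nrW h => x; rewrite big_cons.
by apply: ngz_mul => //; apply: germ_prod.
Qed.

Lemma mu_prod_factor n k (F : 'I_k -> pt -> R) : (forall i : 'I_k, germ n (F i)) ->
  mu n (fun x => \prod_(i < k) F i x) -> forall i : 'I_k, mu n (F i).
Proof.
move=> gF h i; apply: (mu_factor (gF i) (G := fun x => \prod_(j < k | j != i) F j x)).
  by apply: germ_prod.
by apply: mu_eq h => x; rewrite (bigD1 i).
Qed.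

Lemma sum_le_eq n (b c : nat -> nat) : (forall i, (i < n)%N -> (b i <= c i)%N) ->
  (\sum_(i < n) c i <= \sum_(i < n) b i)%N -> forall i, (i < n)%N -> (c i <= b i)%N.
Proof.
elim: n => [//|n IH] h; rewrite !big_ord_recr /= => hs.
have h1 : (\sum_(i < n) b i <= \sum_(i < n) c i)%N.
  by apply: leq_sum => i _; exact: (h i (ltnW (ltn_ord i))).
have h2 := h n (ltnSn n).
move=> i lin; have [->|lin'] : i = n \/ (i < n)%N by lia.
  by move: hs h1; move: (\sum_(i < n) c i)%N (\sum_(i < n) b i)%N => x y; lia.
apply: IH => // [k kn|]; first exact: (h k (ltnW kn)).
by move: hs h2; move: (\sum_(i < n) c i)%N (\sum_(i < n) b i)%N => x y; lia.
Qed.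

Lemma Cprop_all n : Sprop n -> forall s, Cprop n s.
Proof.
move=> Sn s; elim/ltn_ind: s => s IHC x F L fx rF gL nL.
have fx' := full_proj UU fx; have ix := proj1 fx.
have base G : (exists2 V, germ n.+1 V /\ V O != 0 & nr n.+1 (fun z => G z = z n ^+ s * V z)) ->
    forall y, full n.+1 y -> LU n.+1 y G L.
  move=> [V [gV V0] hG] y fy; have [w [p [f1 m1]]] := Sn _ _ (full_proj UU fy) gL nL.
  have f2 := fac_lift (proj1 fy) f1; have [_ gq _] := f2; have [_ gpp _] := f1.
  do 2!eexists; split; first exact: f2.
    apply: (mu_near (F := fun z => z n ^+ s * V (fun i => if i == n then z n else p i z))).
      by apply: nrW (nr_comp hG gq) => z ->; rewrite eqxx.
    apply: mu_mul; first by apply: mu_exp; exact: mu_var.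
    apply: mu_unit; first exact: (germ_comp gV gq).
    have [r r0 h] := germ_dep gV; rewrite -(h O) //; first exact: near_O.
    by move=> i lin; have [_ ->] := gq _ lin.
  apply: mu_near (near_lift gL gpp) _; exact: mu_lift.
have [s0|s0] := posnP s.
  apply: base => //; case: rF => a [V [_ gV _ V0 hF]]; exists V => //.
  by apply: nrW hF => z ->; rewrite s0 big_ord0 add0r.
have [th [b [V [[gth th0] gb [gV V0] bz hF]]]] := tschirn s0 rF.
pose p1 i (z : pt) := if i == n then z n + th z else z i.
have gp1 : gmap n.+1 n.+1 p1.
  move=> i lin; rewrite /p1; case: eqP => _; rewrite ?add0r; split => //.
    by apply: germ_add; [exact: germ_var|exact: germ_lift gth].
  exact: germ_var.
pose w1 o := upd (x o) n (x o n - th (x o)).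
have f1 : fac n.+1 x n.+1 w1 p1.
  have [rt rt0 dth] := germ_dep gth.
  split => //.
    move=> i lin; have [->|i_n] := eqVneq i n; last first.
      by move=> d d0; apply: aeW (ix i lin d d0) => o; rewrite /w1 upd_ne.
    move=> d d0; have d2 : 0 < d / 2 by rewrite divr_gt0.
    have h := infpt_nr UU (proj1 fx') (germ_cont gth d2).
    apply: aeW (ae_and UU (ix n (ltnSn n) _ d2) h) => o [h1]; rewrite th0 subr0 => h2.
    rewrite /w1 upd_eq; apply: le_trans (ler_normB _ _) _; lra.
  apply: aeW (infpt_cube UU (proj1 fx') rt0) => o ho i lin; rewrite /p1 /w1.
  case: eqP => [->|/eqP i_n]; last by rewrite upd_ne.
  rewrite upd_eq -(dth (x o)) ?subrK // => k kn; by rewrite upd_ne // ltn_neq.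
have fw1 := full_fac UU fx f1.
pose F1 z := F (p1^~ z).
have hF1 : nr n.+1 (fun z => F1 z = \sum_(i < s) z n ^+ i * b i z + z n ^+ s * V z).
  apply: nrW hF => z <-; rewrite /F1; congr F; apply/funext => i; by rewrite /p1 /upd.
apply: (LU_step UU f1); apply: (LU_extr (L := L)).
  have : nr n.+1 (fun z => L (p1^~ z) = L z).
    apply: (near_dep (leqnSn n) gL) => i z lin; by rewrite /p1 (ltn_eqF lin).
  by apply: nrW => z ->.
change (LU n.+1 w1 F1 L).
have [/forallP hI|] := boolP [forall i : 'I_s, `[< gz n (b i) >]].
  apply: base => //; exists V => //.
  have : nr n.+1 (fun z => forall i, (i < s)%N -> b i z = 0).
    apply: nr_all => i lis; apply: (nr_sub (leqnSn n)); exact/asboolP/(hI (Ordinal lis)).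
  move=> h; apply: nrW (nr_and hF1 h) => z [-> hz].
  by rewrite big1 ?add0r // => i _; rewrite hz ?mulr0 // ltn_ord.
rewrite negb_forall => /existsP[ii hii].
pose I i := (i < s)%N && ~~ `[< gz n (b i) >].
have Iii : I ii by rewrite /I ltn_ord.
pose kk i := (s`! %/ (s - i))%N.
have kkE i : (i < s)%N -> ((s - i) * kk i = s`!)%N.
  move=> lis; rewrite /kk mulnC divnK //; apply: dvdn_fact; rewrite subn_gt0 lis; exact: leq_subr.
pose E i j (z : pt) := b i z ^+ kk i - b j z ^+ kk j.
have gE i j : germ n (E i j) by apply: germ_sub; exact: germ_exp.
pose A i : pt -> R := if I i then b i else (fun=> 1).
have gA i : germ n (A i) by rewrite /A; case: ifP => _ //; exact: germ_cst.
have n1 : ~ gz n (fun=> 1 : R) by apply: germ_ngz; [exact: germ_cst|exact: oner_neq0].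
have nA i : ~ gz n (A i) by rewrite /A /I; case: ifPn => // /andP[_ /asboolP].
pose D i j : pt -> R := if `[< gz n (E i j) >] then (fun=> 1) else E i j.
have gD i j : germ n (D i j) by rewrite /D; case: ifP => _ //; exact: germ_cst.
have nD i j : ~ gz n (D i j) by rewrite /D; case: ifPn => // /asboolP.
pose PA (z : pt) := \prod_(i < s) A i z.
pose PD (z : pt) := \prod_(i < s) \prod_(j < s) D i j z.
have gPA : germ n PA by apply: germ_prod.
have nPA : ~ gz n PA by apply: ngz_prod => i; [exact: gA|exact: nA].
have gPDi i : germ n (fun z => \prod_(j < s) D i j z) by apply: germ_prod.
have gPD : germ n PD by apply: germ_prod => i _; exact: gPDi.
have nPD : ~ gz n PD.
  apply: (@ngz_prod n 'I_s _ (fun (i : 'I_s) z => \prod_(j < s) D i j z)) => i; first exact: gPDi.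
  by apply: ngz_prod => j; [exact: gD|exact: nD].
have gPP := germ_mul gPA gPD; have nPP := ngz_mul gPA gPD nPA nPD.
have fw1' := full_proj UU fw1.
have [w [p [f2 m2]]] := Sn _ _ fw1' (germ_mul gL gPP) (ngz_mul gL gPP nL nPP).
have [_ gpp _] := f2.
have cg G : germ n G -> germ n (fun z => G (p^~ z)) by move=> gG; exact: (germ_comp gG gpp).
have mL : mu n (fun z => L (p^~ z)) := mu_factor (cg _ gL) (cg _ gPP) m2.
have mPP : mu n (fun z => PA (p^~ z) * PD (p^~ z)).
  by apply: (mu_factor (cg _ gPP) (cg _ gL)); apply: mu_eq m2 => z; rewrite mulrC.
have mPA : mu n (fun z => PA (p^~ z)) := mu_factor (cg _ gPA) (cg _ gPD) mPP.
have mPD : mu n (fun z => PD (p^~ z)).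
  by apply: (mu_factor (cg _ gPD) (cg _ gPA)); apply: mu_eq mPP => z; rewrite mulrC.
have mA i : (i < s)%N -> mu n (fun z => A i (p^~ z)).
  move=> lis; exact: (mu_prod_factor (F := fun (i : 'I_s) z => A i (p^~ z)) (fun i : 'I_s => cg _ (gA i)) mPA (Ordinal lis)).
have mD i j : (i < s)%N -> (j < s)%N -> mu n (fun z => D i j (p^~ z)).
  move=> lis ljs.
  have h := mu_prod_factor (F := fun (i : 'I_s) z => \prod_(j < s) D i j (p^~ z))
     (fun i : 'I_s => cg _ (gPDi i)) mPD (Ordinal lis).
  exact: (mu_prod_factor (F := fun (j : 'I_s) z => D i j (p^~ z)) (fun j : 'I_s => cg _ (gD i j)) h (Ordinal ljs)).
have /choice[be hbe] : forall i, exists bu : (nat -> nat) * (pt -> R), I i ->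
   [/\ germ n bu.2, bu.2 O != 0 & nr n (fun z => b i (p^~ z) = mono n bu.1 z * bu.2 z)].
  move=> i; have [Ii|_] := boolP (I i); last by exists (fun=> 0%N, O).
  have := mA i (proj1 (andP Ii)); rewrite /A Ii => -[bb [u [gu u0 h]]].
  by exists (bb, u).
pose ka i k := (kk i * (be i).1 k)%N.
have cmp i j : I i -> I j -> (forall k, (k < n)%N -> (ka i k <= ka j k)%N) \/
    (forall k, (k < n)%N -> (ka j k <= ka i k)%N).
  move=> Ii Ij; have [gu u0 hu] := hbe _ Ii; have [gv v0 hv] := hbe _ Ij.
  apply: (mono_comparable (germ_exp (kk i) gu) (germ_exp (kk j) gv)); rewrite ?expf_neq0 //.
  have eqn : nr n (fun z => E i j (p^~ z) = mono n (ka i) z * (be i).2 z ^+ kk i -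
       mono n (ka j) z * (be j).2 z ^+ kk j).
    by apply: nrW (nr_and hu hv) => z [h1 h2]; rewrite /E h1 h2 !exprMn !mono_exp.
  have [/asboolP zE|/asboolP nE] := boolP `[< gz n (E i j) >].
    left; apply: nrW (nr_and eqn (nr_comp zE gpp)) => z [<-] //.
  right; apply: (mu_near eqn); have := mD i j (proj1 (andP Ii)) (proj1 (andP Ij)).
  by rewrite /D; case: ifPn => // /asboolP.
have [i0 Ii0 hi0] : exists2 i0, I i0 & forall i, I i -> forall k, (k < n)%N -> (ka i0 k <= ka i k)%N.
  pose Q N := `[< exists2 i, I i & (\sum_(k < n) ka i k)%N = N >].
  have exQ : exists N, Q N by exists (\sum_(k < n) ka ii k)%N; apply/asboolP; exists ii.
  case: (ex_minnP exQ) => N /asboolP[i0 Ii0 eN] Nmin; exists i0 => // i Ii.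
  have hN : (N <= \sum_(k < n) ka i k)%N by apply: Nmin; apply/asboolP; exists i.
  have [//|h] := cmp i0 i Ii0 Ii; apply: sum_le_eq h _; by rewrite eN.
have K0 : (0 < s`!)%N by exact: fact_gt0.
have fw := full_fac UU fw1' f2.
have [ee [t [ee0 f3]]] := ramify UU K0 fw.
have [_ grho _] := f3; set rho := (fun i z => _) in f3 grho.
have f4 := fac_comp UU f2 f3; set P := (fun i z => _) in f4.
have [_ gP _] := f4.
have f5 := fac_lift (proj1 fw1) f4; have [_ gQ _] := f5; set Qm := (fun i z => _) in f5 gQ.
have fl := full_fac UU fw1 f5.
apply: (LU_step UU f5); apply: (LU_extr (near_lift gL gP)).
apply: (loop UU (n := n) (s := s) IHC (c := ka i0)) => //; last first.
  apply: (mu_comp mL) => i lin; have [g0 r0] := grho _ lin; split => //.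
  apply: mu_mul; first by apply: mu_unit; [exact: germ_cst|exact: ee0].
  by apply: mu_exp; exact: mu_var.
pose a i (z : pt) := if I i then (\prod_(k < n) ee k ^+ (be i).1 k) *
   mono n (fun k => (s - i) * (ka i k - ka i0 k))%N z * (be i).2 (rho^~ z) else 0.
have ga i : germ n (a i).
  rewrite /a; have [Ii|_] := boolP (I i); last exact: germ_cst.
  have [gu _ _] := hbe _ Ii; apply: germ_mul; last exact: (germ_comp gu grho).
  by apply: germ_mul; [exact: germ_cst|exact: germ_mono].
exists a, (fun z => V (Qm^~ z)); split.
  split => //.
  - exact: (germ_comp gV gQ).
  - have [r r0 h] := germ_dep gV; rewrite -(h O) //; first exact: near_O.
    by move=> i lin; have [_ ->] := gQ _ lin.
  - have nI : I s.-1 = false.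
      by apply/negbTE; rewrite /I negb_and negbK; apply/orP; right; exact/asboolP.
    by exists 1 => // z _; rewrite /a nI.
  - exists i0; first by case/andP: Ii0.
    have [gu u0 _] := hbe _ Ii0.
    rewrite /a Ii0 mulf_neq0 // ?mulf_neq0 //.
    + by apply/prodf_neq0 => k _; rewrite expf_neq0.
    + by rewrite (eq_mono (c := fun=> 0%N)) ?mono0 ?oner_neq0 // => k _; rewrite subnn muln0.
    + have [r r0 h] := germ_dep gu; rewrite -(h O) //; first exact: near_O.
      by move=> i lin; have [_ ->] := grho _ lin.
have hb : nr n.+1 (fun z => forall i, (i < s)%N ->
    b i (Qm^~ z) = mono n (fun k => (s - i) * ka i0 k)%N z * a i z).
  apply: nr_all => i lis.
  have e1 := near_lift (gb i) gP.
  have [Ii|nIi] := boolP (I i); last first.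
    have zb : gz n (b i) by move: nIi; rewrite /I lis /= negbK => /asboolP.
    have zb' := nr_sub (leqnSn n) (nr_comp zb gP).
    apply: nrW (nr_and e1 zb') => z [h1 h2].
    by rewrite /a (negbTE nIi) mulr0 -h2 h1.
  have [gu u0 hu] := hbe _ Ii.
  have hu' := nr_sub (leqnSn n) (nr_comp hu grho).
  apply: nrW (nr_and e1 hu') => z [h1 h2].
  have -> : b i (Qm^~ z) = b i (P^~ z) by rewrite h1.
  rewrite (h2 : b i (P^~ z) = _) /a Ii !mulrA; congr (_ * _).
  rewrite (mulrC (mono _ _ _)) -mulrA -monoD.
  rewrite (eq_mono (b := (fun k => (s - i) * ka i0 k + (s - i) * (ka i k - ka i0 k))%N)
     (c := (fun k => s`! * (be i).1 k)%N)); last first.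
    by move=> k kn; rewrite -mulnDr subnKC ?hi0 // /ka mulnA kkE.
  rewrite /mono -big_split /=; apply: eq_bigr => k _.
  by rewrite /rho exprMn -exprM.
apply: nrW (nr_and (nr_comp hF1 gQ) hb) => z [-> hz].
have -> : Qm n z = z n by rewrite /Qm eqxx.
rewrite addrC; congr (_ + _); apply: eq_bigr => i _.
by rewrite hz // mulrC.
Qed.

End LocalUnif3.

Section LocalUnif4.
Variables (R : realType) (W : Type) (U : set_system W).
Hypothesis UU : UltraFilter U.
Implicit Types (n m k i j s : nat).
Local Notation pt := (nat -> R).
Local Notation O := (fun=> 0 : R).
Local Notation gp := (W -> pt).
Local Notation LU := (LU U).
Local Notation full := (full U).
Local Notation fac := (fac U).

Lemma germ_radial n (F : pt -> R) : germ n F -> exists (f : nat -> pt -> R) (r : R),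
  [/\ 0 < r, forall k, germ n (f k), (forall k, exists2 B, 0 <= B & forall v t, cube n r v -> `|t| <= r ->
      `|F (fun i => t * v i) - \sum_(i < k) t ^+ i * f i v| <= B * `|t| ^+ k) &
   forall v, cube n r v -> (forall k, f k v = 0) -> forall t, `|t| <= r / 2 -> F (fun i => t * v i) = 0].
Proof.
move=> [r0 [B0 [r00 a0]]]; pose r := Num.min r0 1.
have r_gt0 : 0 < r by rewrite lt_min r00 ltr01.
have rr0 : r <= r0 by rewrite ge_min lexx.
have r1 : r <= 1 by rewrite ge_min lexx orbT.
have a := an_sub a0 (leqnn n) rr0.
have aT : an n.+1 r (fun x => F (fun i => x n * x i)) B0.
  apply: (an_comp (T := fun i x => x n * x i) a) => i lin.
  apply: an_weak (an_mul (an_var r (ltnSn n)) (an_var r (ltnW lin : (i < n.+1)%N))).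
  by rewrite ler_piMl // ltW.
have [V [V0 hV]] := an_expand r_gt0 aT.
have B00 : 0 <= B0 by exact: an_ge0 (ltW r_gt0) a.
exists (fun k x => V k (upd x n 0)), r; split => //.
- by move=> k; have [h _ _] := hV k; exists r, (B0 / r ^+ k).
- have key k v t : cube n r v -> `|t| <= r -> F (fun i => t * v i) =
      \sum_(i < k) t ^+ i * V i (upd v n 0) + t ^+ k * V k (upd v n t).
    move=> vr tr; have zc : cube n.+1 r (upd v n t) by exact: cube_upd.
    have := @expand_sum R n V (upd v n t) k (fun i _ => ltac:(have [_ _ h] := hV i; exact: h)).
    rewrite V0 upd_eq (eq_bigr (fun i : 'I_k => t ^+ i * V i (upd v n 0))); last by move=> i _; rewrite upd_upd.
    move=> <-; apply: (an_dep a).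
      move=> i lin; rewrite normrM; apply: le_trans (_ : r * r <= _); last by rewrite ler_piMl // ltW.
      by apply: ler_pM => //; exact: vr.
    by move=> i lin; rewrite upd_ne // ltn_neq.
  move=> k; exists (B0 / r ^+ k); first by rewrite divr_ge0 // exprn_ge0 // ltW.
  move=> v t vr tr; rewrite (key k) // addrAC subrr add0r normrM normrX mulrC.
  rewrite ler_wpM2r ?exprn_ge0 //; have [_ h _] := hV k; apply: (an_le h); exact: cube_upd.
- move=> v vr fv t tr; apply: (@le0_geom _ _ B0) => k.
  have tr' : `|t| <= r by apply: le_trans tr _; move: r_gt0; move: (r) => q; lra.
  have zc : cube n.+1 r (upd v n t) by exact: cube_upd.
  have := @expand_sum R n V (upd v n t) k (fun i _ => ltac:(have [_ _ h] := hV i; exact: h)).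
  rewrite V0 upd_eq big1 ?add0r => [|i _]; last by rewrite upd_upd fv mulr0.
  have -> : F (fun i => t * upd v n t i) = F (fun i => t * v i).
    apply/esym/(an_dep a) => [i lin|i lin]; last by rewrite upd_ne // ltn_neq.
    rewrite normrM; apply: le_trans (_ : r * r <= _); last by rewrite ler_piMl // ltW.
    by apply: ler_pM => //; exact: vr.
  move=> ->; rewrite normrM normrX.
  have [_ h _] := hV k; have h1 := an_le h zc.
  apply: le_trans (_ : (r / 2) ^+ k * (B0 / r ^+ k) <= _).
    apply: ler_pM => //; rewrite ?exprn_ge0 //.
    by apply: lerXn2r => //; rewrite nnegrE // divr_ge0 // ltW.
  rewrite exprMn exprVn le_eqVlt; apply/orP; left; apply/eqP; field.
  by rewrite ?expf_neq0 // gt_eqF.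
Qed.

Lemma regular_direction n (F : pt -> R) : germ n.+1 F -> ~ gz n.+1 F ->
  exists j (v : pt) s, [/\ (j < n.+1)%N, v j != 0 &
   reg n s (fun z => F (fun i => (if i == j then 0 else if i == n then z j else z i) + v i * z n))].
Proof.
move=> gF nF; have [f [r [r0 gf hf hz]]] := germ_radial gF.
have [v [k [vr fk]]] : exists v k, cube n.+1 r v /\ f k v != 0.
  apply: contrapT => H; apply: nF; pose q := Num.min (r / 2) 1.
  have q0 : 0 < q by rewrite lt_min ltr01 divr_gt0.
  exists (q * q); first by rewrite mulr_gt0.
  move=> x xq; have q1 : q <= 1 by rewrite ge_min lexx orbT.
  have qr : q <= r / 2 by rewrite ge_min lexx.
  pose v i := x i / q.
  have vc : cube n.+1 r v.
    move=> i lin; rewrite normrM normfV (gtr0_norm q0) ler_pdivrMr //.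
    apply: le_trans (xq i lin) _; rewrite ler_pM2r //; apply: le_trans qr _; lra.
  have := hz v vc _ q; rewrite (gtr0_norm q0) => /(_ _ qr) <-.
    by congr F; apply/funext => i; rewrite /v mulrCA divff ?mulr1 ?gt_eqF.
  by move=> k; apply/eqP/negPn/negP => h; apply: H; exists v, k.
pose A j i (z : pt) := (if i == j then 0 else if i == n then z j else z i) + v i * z n.
have gA j : (j < n.+1)%N -> gmap n.+1 n.+1 (A j).
  move=> jn i lin; rewrite /A; split; last first.
    by rewrite mulr0 addr0; case: eqP => // _; case: eqP.
  apply: germ_add; last by apply: germ_mul; [exact: germ_cst|exact: germ_var].
  case: eqP => _; first exact: germ_cst.
  by case: eqP => _; exact: germ_var.
have [[j jn vj]|hv] := pselect (exists2 j, (j < n.+1)%N & v j != 0); last first.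
  have v0 i : (i < n.+1)%N -> v i = 0.
    by move=> lin; apply/eqP/negPn/negP => h; apply: hv; exists i.
  have FO : F O != 0.
    apply: contra fk => /eqP FO.
    have [B B0 hB] := hf k.+1.
    pose P : {poly R} := \sum_(i < k.+1) f i v *: 'X^i.
    have PE y : P.[y] = \sum_(i < k.+1) y ^+ i * f i v.
      by rewrite horner_sum; apply: eq_bigr => i _; rewrite hornerZ hornerXn mulrC.
    have hP : forall y, 0 < y -> y <= r -> `|P.[y]| <= B * y ^+ k.+1.
      move=> y y0 yr; have := hB v y vr; rewrite (gtr0_norm y0) => /(_ yr).
      have [e e0 d] := germ_dep gF.
      have -> : F (fun i => y * v i) = 0.
        rewrite -FO; apply/esym/d; first exact: near_O.
        by move=> i lin; rewrite v0 ?mulr0.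
      by rewrite sub0r normrN PE.
    have := poly_small_coef0 r0 hP (ltnSn k).
    rewrite /P coef_sum (bigD1 ord_max) //= coefZ coefXn eqxx mulr1 big1 ?addr0 => [->//|i ne].
    rewrite coefZ coefXn (_ : (k == i) = false) ?mulr0 //.
    by apply/negbTE; rewrite eq_sym; apply: contra ne => /eqP h; apply/eqP/val_inj.
  exists n, (fun=> 1), 0%N; split => //.
  pose p i (z : pt) := (if i == n then 0 else if i == n then z n else z i) + 1 * z n.
  have gpp : gmap n.+1 n.+1 p.
    move=> i lin; rewrite /p; split; last by rewrite mulr0 addr0; case: eqP.
    apply: germ_add; last by apply: germ_mul; [exact: germ_cst|exact: germ_var].
    by case: eqP => _; [exact: germ_cst|exact: germ_var].
  exists (fun=> O), (fun z => F (p^~ z)); split => //.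
  + by move=> i; exact: germ_cst.
  + exact: (germ_comp gF gpp).
  + have [e e0 d] := germ_dep gF; rewrite -(d O) //; first exact: near_O.
    by move=> i lin; have [_ ->] := gpp _ lin.
  + by exists 1 => // z _; rewrite big_ord0 add0r expr0 [RHS]mul1r.
exists j, v.
have gFA := germ_comp gF (gA j jn).
have [b [V [gb gV hb]]] := germ_expand k.+1 gFA.
have [s sk hs] : exists2 s, (s <= k)%N & reg n s (fun z => F (A j ^~ z)).
  apply: (reg_of_exp gb gV hb (ltnSn k)).
  suff -> : b k O = f k v by [].
  have [B B0 hB] := hf k.+1; have [C C0 hC] := germ_bnd gV.
  have [e1 e10 h1] := nr_and hb hC.
  have [e2 e20 h2] : nr n (fun z => forall i, (i < k.+1)%N -> forall y, (forall l, (l < n)%N -> z l = y l) -> b i z = b i y).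
    apply: nr_all => i _; have [e e0 h] := germ_dep (gb i); exists e => // z zr y; exact: h.
  have [e3 e30 h3] := germ_dep gF.
  pose e := Num.min r e1.
  have e0 : 0 < e by rewrite lt_min r0.
  have er : e <= r by rewrite ge_min lexx.
  have ee1 : e <= e1 by rewrite ge_min lexx orbT.
  have [e4 e40 h4] := nr_comp (ex_intro2 _ _ e3 e30 (fun x h => h) : nr n.+1 (cube n.+1 e3)) (gA j jn).
  pose e' := Num.min e e4.
  have e'0 : 0 < e' by rewrite lt_min e0.
  pose P : {poly R} := \sum_(i < k.+1) (f i v - b i O) *: 'X^i.
  have hP : forall y, 0 < y -> y <= e' -> `|P.[y]| <= (B + C) * y ^+ k.+1.
    move=> y y0 ye'; have ye : y <= e by apply: le_trans ye' _; rewrite ge_min lexx.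
    pose z := upd O n y.
    have zc' : cube n.+1 e' z by apply: cube_upd; [exact: near_O|rewrite gtr0_norm].
    have zc : cube n.+1 e z by apply: cubeS zc' => //; rewrite ge_min lexx.
    have zc4 : cube n.+1 e4 z by apply: cubeS zc' => //; rewrite ge_min lexx orbT.
    have zn : z n = y by rewrite /z upd_eq.
    have [k1 k2] := h1 _ (cubeS (leqnn _) ee1 zc); rewrite zn in k1.
    have yr := le_trans ye er.
    have := hB v y vr; rewrite (gtr0_norm y0) => /(_ yr).
    have -> : F (fun i => y * v i) = F (A j ^~ z).
      apply/esym/h3; first exact: h4.
      move=> i lin; rewrite /A zn mulrC -[RHS]add0r; congr (_ + _).
      case: eqP => // /eqP ij; case: eqP => [i_n|/eqP i_n].
        by rewrite /z upd_ne // eq_sym -i_n.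
      by rewrite /z upd_ne.
    rewrite k1; have -> : \sum_(i < k.+1) y ^+ i * b i z = \sum_(i < k.+1) y ^+ i * b i O.
      apply: eq_bigr => i _; congr (_ * _); apply/esym/h2 => //; first exact: near_O.
      by move=> l ln; rewrite /z upd_ne // ltn_neq.
    have -> : P.[y] = \sum_(i < k.+1) y ^+ i * f i v - \sum_(i < k.+1) y ^+ i * b i O.
      rewrite horner_sum -sumrB; apply: eq_bigr => i _; by rewrite hornerZ hornerXn -mulrBr mulrC.
    set S1 := \sum_(_ < _) _ * f _ _; set S2 := \sum_(_ < _) _ * b _ _ => h.
    have -> : S1 - S2 = - (S2 + y ^+ k.+1 * V z - S1) + y ^+ k.+1 * V z by ring.
    apply: le_trans (ler_normD _ _) _; rewrite normrN mulrDl lerD //.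
    by rewrite normrM mulrC (gtr0_norm (exprn_gt0 _ y0)) ler_pM2r ?exprn_gt0.
  have := poly_small_coef0 e'0 hP (ltnSn k).
  rewrite /P coef_sum (bigD1 ord_max) //= coefZ coefXn eqxx mulr1 big1 ?addr0 => [/eqP|i ne].
    by rewrite subr_eq0 => /eqP ->.
  rewrite coefZ coefXn (_ : (k == i) = false) ?mulr0 //.
  by apply/negbTE; rewrite eq_sym; apply: contra ne => /eqP h; apply/eqP/val_inj.
by exists s; split.
Qed.

Lemma Sprop_all n : @Sprop R W U n.
Proof.
elim: n => [|n IH] x F fx gF nF.
  exists x, (fun i z => z i); split; first exact: fac_id (proj1 fx).
  apply: mu_unit => //; apply/eqP => FO; apply: nF.
  by have [r r0 h] := germ_dep gF; exists r => // z zr; rewrite -FO; exact: h.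
have [j [v [s [jn vj rg]]]] := regular_direction gF nF.
pose p i (z : pt) := (if i == j then 0 else if i == n then z j else z i) + v i * z n.
pose w o : pt := fun i => if i == n then x o j / v j else
   if i == j then x o n - v n * (x o j / v j) else x o i - v i * (x o j / v j).
have ix := proj1 fx.
have infD (f g : W -> R) : infr U f -> infr U g -> infr U (fun o => f o + g o).
  move=> hf hg e e0; have e2 : 0 < e / 2 by rewrite divr_gt0.
  apply: aeW (ae_and UU (hf _ e2) (hg _ e2)) => o [h1 h2].
  by apply: le_trans (ler_normD _ _) _; lra.
have infZ (f : W -> R) a : infr U f -> infr U (fun o => a * f o).
  move=> hf e e0; have a0 : 0 < `|a| + 1 by rewrite ltr_wpDl.
  apply: aeW (hf _ (divr_gt0 e0 a0)) => o h; rewrite normrM.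
  apply: le_trans (_ : (`|a| + 1) * (e / (`|a| + 1)) <= _); last by rewrite mulrCA divff ?mulr1 ?gt_eqF.
  by apply: ler_pM => //; lra.
have f1 : fac n.+1 x n.+1 w p.
  split.
  - move=> i lin; rewrite /w; case: eqP => _.
      by move=> e e0; apply: aeW (infZ _ (v j)^-1 (ix j jn) e e0) => o; rewrite mulrC.
    case: eqP => _ e e0.
      apply: aeW (infD _ _ (ix n (ltnSn n)) (infZ _ (- (v n / v j)) (ix j jn)) e e0) => o.
      by have -> : x o n + - (v n / v j) * x o j = x o n - v n * (x o j / v j) by field.
    apply: aeW (infD _ _ (ix i lin) (infZ _ (- (v i / v j)) (ix j jn)) e e0) => o.
    by have -> : x o i + - (v i / v j) * x o j = x o i - v i * (x o j / v j) by field.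
  - move=> i lin; rewrite /p; split; last first.
      by rewrite mulr0 addr0; case: eqP => // _; case: eqP.
    apply: germ_add; last by apply: germ_mul; [exact: germ_cst|exact: germ_var].
    case: eqP => _; first exact: germ_cst.
    by case: eqP => _; exact: germ_var.
  - apply: (ae_true UU) => o i lin; rewrite /p /w eqxx.
    rewrite ?eqxx; have [->|ij] := eqVneq i j; first by rewrite add0r mulrC divfK.
    have [i_n|i_n] := eqVneq i n; last by rewrite subrK.
    have jnn : j != n by rewrite -i_n eq_sym.
    by rewrite (negbTE jnn) i_n subrK.
have fw := full_fac UU fx f1.
have [w' [p' [f2 m1 _]]] := Cprop_all UU IH fw rg (germ_cst n 1) (germ_ngz (germ_cst n 1) (oner_neq0 _)).
exists w', (fun i z => p i (p'^~ z)); split; first exact: (fac_comp UU f1 f2).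
exact: m1.
Qed.

Lemma full_germ_neq0 n x (F : pt -> R) : full n x -> germ n F -> ~ gz n F ->
  ae U (fun o => F (x o) != 0).
Proof.
move=> fx gF nF; have [w [p [f m1]]] := Sprop_all fx gF nF.
have [iw gpp e] := f; have fw := full_fac UU fx f.
case: m1 => b [u [gu u0 hu]].
have h1 : ae U (fun o => forall i, (i < n)%N -> w o i != 0).
  by apply: (ae_all UU) => i lin; exact: (full_neq0 UU fw).
have [r r0 d] := germ_dep gF.
have h2 := infpt_cube UU (proj1 fx) r0.
have h3 := infpt_nr UU iw (nr_and hu (germ_unit gu u0)).
apply: aeW (ae_and UU (ae_and UU e h1) (ae_and UU h2 h3)) => o [[k1 k2] [k3 [k4 k5]]].
rewrite (d _ (p^~ (w o)) k3 k1) k4 mulf_neq0 //; apply: mono_nz => i lin _; exact: k2.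
Qed.

End LocalUnif4.

(** * Generic rank and balls in images of orthants *)

Lemma lagrange_interp (K : numFieldType) (D : nat) : exists L : 'I_D.+1 -> {poly K},
  forall P : {poly K}, (size P <= D.+1)%N -> P = \sum_(l < D.+1) P.[l.+1%:R / D.+1%:R] *: L l.
Proof.
pose t (l : 'I_D.+1) : K := l.+1%:R / D.+1%:R.
have D0 : D.+1%:R != 0 :> K by rewrite pnatr_eq0.
have tinj l j : t l = t j -> l = j.
  move=> /(mulIf (invr_neq0 D0)) /eqP; rewrite eqr_nat eqSS => /eqP h; exact: val_inj.
pose L (l : 'I_D.+1) : {poly K} := \prod_(j < D.+1 | j != l) ((t l - t j)^-1 *: ('X - (t j)%:P)).
have Lt l j : (L l).[t j] = (l == j)%:R.
  rewrite horner_prod; have [->|lj] := eqVneq l j.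
    rewrite big1 // => i ij; rewrite hornerZ hornerXsubC mulVf // subr_eq0.
    by apply: contra ij => /eqP/tinj ->.
  rewrite (bigD1 j) /= 1?eq_sym // hornerZ hornerXsubC subrr mulr0 mul0r //.
have sL l : (size (L l) <= D.+1)%N.
  apply: leq_trans (size_poly_prod_leq _ _) _.
  have h : (\sum_(j < D.+1 | j != l) size ((t l - t j)^-1 *: ('X - (t j)%:P)) <= \sum_(j < D.+1 | j != l) 2)%N.
    by apply: leq_sum => j _; apply: leq_trans (size_scale_leq _ _) _; rewrite size_XsubC.
  apply: leq_trans (leq_sub (_ : _ <= (\sum_(j < D.+1 | j != l) 2).+1)%N (leqnn _)) _; first by rewrite ltnS.
  have cD : #|(fun j : 'I_D.+1 => j != l)| = D.
    by have := cardC1 l; rewrite card_ord /= => cD; rewrite -[RHS]cD; apply: eq_card => j; rewrite !inE.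
  rewrite sum_nat_const cD; lia.
exists L => P sP.
apply/eqP; rewrite -subr_eq0; apply/negPn/negP => nz.
set rs := [seq t l | l <- enum 'I_D.+1].
have ur : uniq rs by rewrite map_inj_uniq ?enum_uniq.
have hr : all (root (P - \sum_(l < D.+1) P.[t l] *: L l)) rs.
  apply/allP => _ /mapP[j _ ->]; rewrite rootE hornerD hornerN horner_sum (bigD1 j) //=.
  rewrite hornerZ Lt eqxx mulr1 big1 ?addr0 ?subrr // => l lj.
  by rewrite hornerZ Lt (negbTE lj) mulr0.
have := max_poly_roots nz hr ur; rewrite size_map size_enum_ord ltnNge => /negP; apply.
apply: leq_trans (size_polyD _ _) _; rewrite geq_max sP size_polyN.
apply: leq_trans (size_sum _ _ _) _; apply/bigmax_leqP => l _.
exact: leq_trans (size_scale_leq _ _) (sL l).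
Qed.

Lemma lagrange_coef_bound (K : numFieldType) (D : nat) : exists2 C : K, 0 <= C &
  forall (P : {poly K}) (B : K), (size P <= D.+1)%N ->
    (forall l : 'I_D.+1, `|P.[l.+1%:R / D.+1%:R]| <= B) -> forall i, `|P`_i| <= C * B.
Proof.
have [L hL] := lagrange_interp K D.
exists (\sum_(l < D.+1) \sum_(i < D.+1) `|(L l)`_i|).
  by apply: sumr_ge0 => l _; apply: sumr_ge0.
move=> P B sP hP i.
have [iD|iD] := leqP D.+1 i.
  have B0 : 0 <= B := le_trans (normr_ge0 _) (hP ord0).
  rewrite nth_default ?(leq_trans sP) // normr0 mulr_ge0 //.
  by apply: sumr_ge0 => l _; apply: sumr_ge0.
have -> : P`_i = \sum_(l < D.+1) P.[l.+1%:R / D.+1%:R] * (L l)`_i.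
  by rewrite {1}(hL P sP) coef_sum; apply: eq_bigr => l _; rewrite coefZ.
apply: le_trans (ler_norm_sum _ _ _) _; rewrite mulr_suml; apply: ler_sum => l _.
rewrite normrM [leLHS]mulrC; apply: ler_pM => //.
by rewrite (bigD1 (Ordinal iD)) //= lerDl sumr_ge0.
Qed.

Section GermCalc.
Variable R : realType.
Implicit Types (n m k i j : nat).
Local Notation pt := (nat -> R).
Local Notation O := (fun=> 0 : R).

Definition mixp (x y : pt) k : pt := fun i => if (i < k)%N then y i else x i.

Lemma germ_step n j (F : pt -> R) : (j < n)%N -> germ n F -> exists2 D, germ n.+1 D &
  nr n.+1 (fun z => F (upd z j (z j + z n)) = F z + z n * D z).
Proof.
move=> jn gF.
pose T i (z : pt) := if i == j then z j + z n else z i.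
have gT : gmap n n.+1 T.
  move=> i lin; rewrite /T; case: eqP => _; rewrite ?addr0; split => //.
    by apply: germ_add; apply: germ_var => //; exact: ltnW.
  by apply: germ_var; exact: ltnW.
have [D [_ gD hD]] := germ_split (germ_comp gF gT).
exists D => //; have [r r0 d] := germ_dep gF.
apply: nrW (nr_and hD (nr_sub (leqnSn n) (ex_intro2 _ _ r r0 (fun x h => h) : nr n (cube n r)))) => z [h1 h2].
have -> : upd z j (z j + z n) = T^~ z by apply/funext => i; rewrite /upd /T.
rewrite h1; congr (_ + _); apply/esym/d => // i lin.
by rewrite /T upd_eq addr0 !upd_ne ?ltn_neq //; case: eqP => [->|].
Qed.

Lemma germ_tele n (F : pt -> R) : germ n F -> exists (D : nat -> pt -> R) (r : R),
  [/\ 0 < r, forall k, germ n.+1 (D k) & forall x y, cube n r x -> cube n r y ->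
   F y - F x = \sum_(k < n) (y k - x k) * D k (upd (mixp x y k) n (y k - x k))].
Proof.
move=> gF.
have /choice[D hD] : forall k, exists D, germ n.+1 D /\ ((k < n)%N ->
    nr n.+1 (fun z => F (upd z k (z k + z n)) = F z + z n * D z)).
  move=> k; have [kn|kn] := boolP (k < n)%N; last by exists O; split => //; exact: germ_cst.
  by have [D gD h] := germ_step kn gF; exists D.
have [r r0 hr] : nr n.+1 (fun z => forall k, (k < n)%N -> F (upd z k (z k + z n)) = F z + z n * D k z).
  by apply: nr_all => k kn; have [_] := hD k; apply.
have [s s0 d] := germ_dep gF.
pose q := Num.min (r / 2) s.
have q0 : 0 < q by rewrite lt_min s0 divr_gt0.
have qr : q <= r / 2 by rewrite ge_min lexx.
have qs : q <= s by rewrite ge_min lexx orbT.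
exists D, q; split => //; first by move=> k; have [] := hD k.
move=> x y xq yq.
have mq k : cube n q (mixp x y k) by move=> i lin; rewrite /mixp; case: ifP => _; [exact: yq|exact: xq].
have st k : (k < n)%N -> F (mixp x y k.+1) = F (mixp x y k) + (y k - x k) * D k (upd (mixp x y k) n (y k - x k)).
  move=> kn; set z := upd _ _ _.
  have zc : cube n.+1 r z.
    apply: cube_upd.
      by apply: cubeS (mq k) => //; apply: le_trans qr _; rewrite ler_pdivrMr // ler_peMr ?ler1n // ltW.
    by apply: le_trans (ler_normB _ _) _; have := xq k kn; have := yq k kn; lra.
  have := hr z zc k kn; have -> : z n = y k - x k by rewrite /z upd_eq.
  have -> : F z = F (mixp x y k).
    by apply/esym/d; [exact: cubeS (mq k)|move=> i lin; rewrite /z upd_ne // ltn_neq].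
  move=> <-; apply: d; first exact: cubeS (mq k.+1).
  move=> i lin; rewrite /upd /z; have [->|ik] := eqVneq i k.
    by rewrite upd_ne ?ltn_neq // /mixp ltnn ltnSn; ring.
  by rewrite upd_ne ?ltn_neq // /mixp ltnS leq_eqVlt (negbTE ik).
have st' k : (k <= n)%N -> F (mixp x y k) - F x = \sum_(i < k) (y i - x i) * D i (upd (mixp x y i) n (y i - x i)).
  elim: k => [|k IH] kn.
    by rewrite big_ord0 (_ : mixp x y 0 = x) ?subrr //; apply/funext.
  by rewrite big_ord_recr /= -IH ?(ltnW kn) // st //; ring.
rewrite -st' //; congr (_ - _); apply: d; first exact: cubeS yq.
by move=> i lin; rewrite /mixp lin.
Qed.

Lemma germ_lip n (F : pt -> R) : germ n F -> exists (C r : R), [/\ 0 <= C, 0 < r &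
  forall x y (e : R), cube n r x -> cube n r y -> (forall i, (i < n)%N -> `|y i - x i| <= e) ->
    `|F y - F x| <= C * e].
Proof.
move=> gF; have [D [r [r0 gD h]]] := germ_tele gF.
have /choice[B hB] : forall k, exists B, 0 < B /\ nr n.+1 (fun z => `|D k z| <= B).
  by move=> k; have [B B0 hB] := germ_bnd (gD k); exists B.
have [s s0 hs] : nr n.+1 (fun z => forall k, (k < n)%N -> `|D k z| <= B k).
  by apply: nr_all => k _; have [] := hB k.
pose q := Num.min r (s / 2).
have q0 : 0 < q by rewrite lt_min r0 divr_gt0.
have qr : q <= r by rewrite ge_min lexx.
have qs : q <= s / 2 by rewrite ge_min lexx orbT.
exists (\sum_(k < n) B k), q; split => //.
  by apply: sumr_ge0 => k _; apply: ltW; have [] := hB k.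
move=> x y e xq yq xye; rewrite (h _ _ (cubeS (leqnn _) qr xq) (cubeS (leqnn _) qr yq)).
apply: le_trans (ler_norm_sum _ _ _) _; rewrite mulr_suml; apply: ler_sum => k _.
rewrite normrM mulrC ler_pM //; last exact: xye.
apply: hs => //; apply: cube_upd.
  move=> i lin; rewrite /mixp; case: ifP => _; first by have := yq i lin; lra.
  by have := xq i lin; lra.
by apply: le_trans (ler_normB _ _) _; have := xq k (ltn_ord k); have := yq k (ltn_ord k); lra.
Qed.


Lemma germ_taylor2 n (F : pt -> R) : germ n F -> exists (dF : nat -> pt -> R) (C r : R),
  [/\ 0 <= C, 0 < r, forall k, germ n (dF k) &
  forall x y (e : R), cube n r x -> cube n r y -> (forall i, (i < n)%N -> `|y i - x i| <= e) ->
    `|F y - F x - \sum_(k < n) (y k - x k) * dF k x| <= C * e ^+ 2].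
Proof.
move=> gF; have [D [r [r0 gD h]]] := germ_tele gF.
have /choice[CL hCL] : forall k, exists p : R * R, [/\ 0 <= p.1, 0 < p.2 &
   forall x y (e : R), cube n.+1 p.2 x -> cube n.+1 p.2 y -> (forall i, (i < n.+1)%N -> `|y i - x i| <= e) ->
    `|D k y - D k x| <= p.1 * e].
  by move=> k; have [C [s [C0 s0 hs]]] := germ_lip (gD k); exists (C, s).
have [s s0 hs] : nr n.+1 (fun z => forall k, (k < n)%N -> cube n.+1 (CL k).2 z).
  by apply: nr_all => k _; have [_ p0 _] := hCL k; exists (CL k).2.
pose q := Num.min r (s / 2).
have q0 : 0 < q by rewrite lt_min r0 divr_gt0.
have qr : q <= r by rewrite ge_min lexx.
have qs : q <= s / 2 by rewrite ge_min lexx orbT.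
exists (fun k x => D k (upd x n 0)), (\sum_(k < n) (CL k).1), q; split => //.
- by apply: sumr_ge0 => k _; have [] := hCL k.
- by move=> k; have [F1 [g _ _]] := germ_split (gD k).
move=> x y e xq yq xye; rewrite (h _ _ (cubeS (leqnn _) qr xq) (cubeS (leqnn _) qr yq)).
rewrite -sumrB; apply: le_trans (ler_norm_sum _ _ _) _; rewrite mulr_suml; apply: ler_sum => k _.
rewrite -mulrBr normrM expr2 mulrCA ler_pM //; first exact: xye.
have [_ _ hc] := hCL k; have e0 : 0 <= e := le_trans (normr_ge0 _) (xye k (ltn_ord k)).
apply: hc.
- apply: hs => //; apply: cube_upd; last by rewrite normr0 ltW.
  by move=> i lin; have := xq i lin; lra.
- apply: hs => //; apply: cube_upd.
    move=> i lin; rewrite /mixp; case: ifP => _; first by have := yq i lin; lra.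
    by have := xq i lin; lra.
  by apply: le_trans (ler_normB _ _) _; have := xq k (ltn_ord k); have := yq k (ltn_ord k); lra.
- move=> i; rewrite ltnS leq_eqVlt => /orP[/eqP->|lin]; first by rewrite !upd_eq subr0 xye.
  rewrite !upd_ne ?ltn_neq // /mixp; case: ifP => _; first exact: xye.
  by rewrite subrr normr0.
Qed.

Lemma germ_det n k (M : 'I_k -> 'I_k -> pt -> R) : (forall a b, germ n (M a b)) ->
  germ n (fun x => \det (\matrix_(a, b) M a b x)).
Proof.
move=> gM; apply: (germ_eq (F := fun x => \sum_(s : 'S_k) (-1) ^+ s * \prod_(a < k) M a (s a) x)).
  by move=> x; apply: eq_bigr => s _; congr (_ * _); apply: eq_bigr => a _; rewrite mxE.
apply: germ_sum => s _; apply: germ_mul; first exact: germ_cst.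
by apply: germ_prod.
Qed.

Lemma germ_adj n k (M : 'I_k -> 'I_k -> pt -> R) : (forall a b, germ n (M a b)) ->
  forall a b, germ n (fun x => (\adj (\matrix_(a, b) M a b x)) a b).
Proof.
move=> gM a b; apply: (germ_eq (F := fun x => (-1) ^+ (b + a) *
   \det (\matrix_(c, d) M (lift b c) (lift a d) x))).
  move=> x; rewrite !mxE /cofactor; congr (_ * \det _); apply/matrixP => c d; by rewrite !mxE.
by apply: germ_mul; [exact: germ_cst|apply: germ_det].
Qed.

End GermCalc.

HB.instance Definition _ (R : realType) (m n : nat) := Complete.on 'M[R]_(m, n).

Section RowNorm.
Variable R : realType.

Lemma rV_norm_le d (v : 'rV[R]_d) c : 0 <= c -> (forall j, `|v ord0 j| <= c) -> `|v| <= c.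
Proof.
move=> c0 h; rewrite -[`|v|]/(mx_norm v) mx_normrE; apply/bigmax_leP; split => // -[i j] _ /=.
by rewrite (ord1 i); exact: h.
Qed.

Lemma rV_coord_le d (v : 'rV[R]_d) j : `|v ord0 j| <= `|v|.
Proof. by rewrite -[leRHS]/(mx_norm v) mx_normrE; apply: (le_bigmax 0 (fun p : 'I_1 * 'I_d => `|v p.1 p.2|) (ord0, j)). Qed.

Lemma rV_mulmx_le d k (v : 'rV[R]_d) (A : 'M[R]_(d, k)) b : 0 <= b ->
  (forall i j, `|A i j| <= b) -> `|v *m A| <= d%:R * b * `|v|.
Proof.
move=> b0 hA; apply: rV_norm_le; first by rewrite !mulr_ge0.
move=> j; rewrite mxE; apply: le_trans (ler_norm_sum _ _ _) _.
apply: le_trans (_ : \sum_(i < d) b * `|v| <= _); last first.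
  by rewrite sumr_const card_ord -mulrA mulr_natl.
by apply: ler_sum => i _; rewrite normrM mulrC ler_pM // rV_coord_le.
Qed.

Lemma local_inverse d (Psi : 'rV[R]_d -> 'rV[R]_d) (A : 'M[R]_d) (K e rho : R) :
  A \in unitmx -> 0 < K -> 0 <= e -> 0 < rho -> (forall v : 'rV[R]_d, `|v *m invmx A| <= K * `|v|) ->
  (forall y y', `|y| <= rho -> `|y'| <= rho -> `|Psi y - Psi y' - (y - y') *m A| <= e * `|y - y'|) ->
  K * e <= 1 / 2 ->
  (forall y y', `|y| <= rho -> `|y'| <= rho -> `|y - y'| <= 2 * K * `|Psi y - Psi y'|) /\
  (forall u, `|u - Psi 0| <= rho / (2 * K) -> exists2 y, `|y| <= rho & Psi y = u).
Proof.
move=> uA K0 e0 rho0 hK hP Ke; split.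
  move=> y y' yr y'r.
  have h1 : `|y - y'| <= K * `|(y - y') *m A| by rewrite -{1}(mulmxK uA (y - y')); exact: hK.
  have h2 : `|(y - y') *m A| <= `|Psi y - Psi y'| + e * `|y - y'|.
    have -> : (y - y') *m A = (Psi y - Psi y') - (Psi y - Psi y' - (y - y') *m A).
      by rewrite subKr.
    by apply: le_trans (ler_normB _ _) _; rewrite lerD2l; exact: hP.
  have := ler_wpM2l (ltW K0) h2; rewrite mulrDr mulrA => h3.
  have := ler_wpM2r (normr_ge0 (y - y')) Ke; lra.
move=> u hu; pose B := [set y : 'rV[R]_d | `|y| <= rho].
pose T (y : 'rV[R]_d) := y - (Psi y - u) *m invmx A.
have lipT y y' : B y -> B y' -> `|T y - T y'| <= 1 / 2 * `|y - y'|.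
  move=> yr y'r; have -> : T y - T y' = - ((Psi y - Psi y' - (y - y') *m A) *m invmx A).
    rewrite [in RHS]mulmxBl mulmxK // /T !mulmxBl.
    move: (Psi y *m _) (Psi y' *m _) (u *m _) => a c b.
    by apply/rowP => j; rewrite !mxE; ring.
  rewrite normrN; apply: le_trans (hK _) _.
  apply: le_trans (ler_wpM2l (ltW K0) (hP _ _ yr y'r)) _.
  by rewrite mulrA; apply: ler_wpM2r.
have T0 : `|T 0| <= rho / 2.
  rewrite /T sub0r normrN; apply: le_trans (hK _) _.
  rewrite distrC; apply: le_trans (ler_wpM2l (ltW K0) hu) _.
  have -> : K * (rho / (2 * K)) = rho / 2 by field; rewrite gt_eqF.
  exact: lexx.
have TB : {homo T : y / B y >-> B y}.
  move=> y yr; have B0 : B 0 by rewrite /B /= normr0 ltW.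
  have := lipT _ _ yr B0; rewrite subr0 => h.
  have := ler_normD (T y - T 0) (T 0); rewrite subrK; rewrite /B /= in yr *; lra.
pose fT : {fun B >-> B} := HB.pack T (isFun.Build _ _ B B T TB).
have [y yB Ty] : exists2 p, B p & p = fT p.
  apply: banach_fixed_point.
  - exists (1 / 2)%:nng; split => /=; first lra.
    by move=> [y y'] [/= h1 h2]; exact: lipT.
  - have -> : B = closed_ball_ (fun x => `|x|) 0 rho.
      by apply/seteqP; split => y; rewrite /B /closed_ball_ /= sub0r normrN.
    exact: closed_closed_ball_.
  - by exists 0; rewrite /B /= normr0 ltW.
exists y => //; move: Ty; rewrite /fT /= /T => /eqP.
rewrite -subr_eq0 opprB addrCA subrr addr0 => /eqP h.
have : (Psi y - u) *m invmx A *m A = 0 by rewrite h mul0mx.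
by rewrite mulmxKV // => /eqP; rewrite subr_eq0 => /eqP.
Qed.

End RowNorm.

Section Rank.
Variable R : realType.
Implicit Types (n : nat).
Local Notation pt := (nat -> R).
Local Notation O := (fun=> 0 : R).

Definition closep m (e : R) (x y : pt) := forall l, (l < m)%N -> `|y l - x l| <= e.

Lemma closep_sym m e x y : closep m e x y -> closep m e y x.
Proof. by move=> h l lm; rewrite distrC; exact: h. Qed.

Lemma closep_trans m e f x y z : closep m e x y -> closep m f y z -> closep m (e + f) x z.
Proof.
move=> h1 h2 l lm; have -> : z l - x l = (y l - x l) + (z l - y l) by ring.
by apply: le_trans (ler_normD _ _) _; rewrite lerD //; [exact: h1|exact: h2].
Qed.

Lemma closep_cube m e r x y : closep m e x y -> cube m r x -> cube m (r + e) y.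
Proof.
move=> h1 h2 l lm; have -> : y l = x l + (y l - x l) by ring.
by apply: le_trans (ler_normD _ _) _; rewrite lerD //; [exact: h2|exact: h1].
Qed.

Lemma closepW m e f x y : e <= f -> closep m e x y -> closep m f x y.
Proof. by move=> ef h l lm; apply: le_trans ef; exact: h. Qed.

Lemma fin_min_pos (I : finType) (f : I -> R) : (forall i, 0 < f i) ->
  exists2 r, 0 < r & forall i, r <= f i.
Proof.
move=> f0.
have : exists2 r, 0 < r & forall i, i \in enum I -> r <= f i.
  elim: (enum I) => [|a s [r r0 IH]]; first by exists 1.
  exists (Num.min r (f a)); first by rewrite lt_min r0 f0.
  by move=> i; rewrite inE => /orP[/eqP->|/IH h]; rewrite ge_min ?lexx ?h ?orbT.
by move=> [r r0 h]; exists r => // i; apply: h; rewrite mem_enum.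
Qed.

Lemma fin_sum_bound (I : finType) (f : I -> R) : (forall i, 0 <= f i) ->
  exists2 C, 0 < C & forall i, f i <= C.
Proof.
move=> f0; exists (1 + \sum_i f i); first by rewrite ltr_pwDl // sumr_ge0.
move=> i; rewrite (bigD1 i) //= addrCA lerDl addr_ge0 // sumr_ge0 //.
Qed.

Lemma germs_lip (I : finType) m (F : I -> pt -> R) : (forall i, germ m (F i)) ->
  exists C r, [/\ 0 < C, 0 < r, forall i x, cube m r x -> `|F i x| <= C &
   forall (i : I) x y (e : R), 0 <= e -> cube m r x -> cube m r y -> closep m e x y ->
    `|F i y - F i x| <= C * e].
Proof.
move=> gF.
have /choice[p hp] : forall i, exists p : R * R, [/\ 0 < p.1, 0 < p.2,
   forall x, cube m p.2 x -> `|F i x| <= p.1 &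
   forall x y (e : R), 0 <= e -> cube m p.2 x -> cube m p.2 y -> closep m e x y ->
    `|F i y - F i x| <= p.1 * e].
  move=> i; have [C [r [C0 r0 h]]] := germ_lip (gF i).
  have [B B0 [s s0 hs]] := germ_bnd (gF i).
  exists (C + B, Num.min r s) => /=; split; rewrite ?lt_min ?r0 ?s0 //; first lra.
    move=> x xc; have : `|F i x| <= B by apply: hs; apply: cubeS xc => //; rewrite ge_min lexx orbT.
    lra.
  move=> x y e e0 xc yc xye.
  have : `|F i y - F i x| <= C * e.
    by apply: h => //; [apply: cubeS xc|apply: cubeS yc]; rewrite // ge_min lexx.
  move=> hh; apply: le_trans hh _; apply: ler_wpM2r => //; lra.
have [C C0 hC] := @fin_sum_bound I (fun i => (p i).1) (fun i => ltac:(have [h _ _ _] := hp i; exact: ltW h)).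
have [r r0 hr] := @fin_min_pos I (fun i => (p i).2) (fun i => ltac:(have [_ h _ _] := hp i; exact: h)).
exists C, r; split => //.
  move=> i x xr; apply: le_trans (hC i); have [_ _ h _] := hp i; apply: h; exact: cubeS xr.
move=> i x y e e0 xr yr xye; apply: le_trans (_ : (p i).1 * e <= _); last by rewrite ler_wpM2r.
have [_ _ _ h] := hp i; apply: h => //; [exact: cubeS xr|exact: cubeS yr].
Qed.

Lemma germs_taylor (I : finType) m (F : I -> pt -> R) : (forall i, germ m (F i)) ->
  exists (dF : I -> nat -> pt -> R) C r, [/\ 0 < C, 0 < r, forall i k, germ m (dF i k) &
   forall (i : I) x y (e : R), 0 <= e -> cube m r x -> cube m r y -> closep m e x y ->
    `|F i y - F i x - \sum_(k < m) (y k - x k) * dF i k x| <= C * e ^+ 2].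
Proof.
move=> gF.
have /choice[p hp] : forall i, exists p : (nat -> pt -> R) * R * R, [/\ 0 <= p.1.2, 0 < p.2,
   forall k, germ m (p.1.1 k) &
   forall x y (e : R), cube m p.2 x -> cube m p.2 y -> closep m e x y ->
    `|F i y - F i x - \sum_(k < m) (y k - x k) * p.1.1 k x| <= p.1.2 * e ^+ 2].
  by move=> i; have [dF [C [r h]]] := germ_taylor2 (gF i); exists (dF, C, r).
have [C C0 hC] := @fin_sum_bound I (fun i => (p i).1.2) (fun i => ltac:(have [h _ _ _] := hp i; exact: h)).
have [r r0 hr] := @fin_min_pos I (fun i => (p i).2) (fun i => ltac:(have [_ h _ _] := hp i; exact: h)).
exists (fun i => (p i).1.1), C, r; split => //; first by move=> i k; have [_ _ h _] := hp i.
move=> i x y e e0 xr yr xye; apply: le_trans (_ : (p i).1.2 * e ^+ 2 <= _); last by rewrite ler_wpM2r // exprn_ge0.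
have [_ _ _ h] := hp i; apply: h => //; [exact: cubeS xr|exact: cubeS yr].
Qed.

Lemma lip_path (f : R -> R) (M1 C : R) : 0 <= C ->
  (forall s t : R, 0 <= s -> s <= 1 -> 0 <= t -> t <= 1 -> `|f s - f t| <= M1 * `|s - t| + C * `|s - t| ^+ 2) ->
  `|f 1 - f 0| <= M1.
Proof.
move=> C0 h; apply/ler_addgt0Pr => e e0.
have := archi_boundP (divr_ge0 C0 (ltW e0)).
set N := Num.bound _ => hN.
have N0 : 0 < N%:R :> R by apply: le_lt_trans hN; rewrite divr_ge0 // ltW.
have hk k : (k <= N)%N -> `|f (k%:R / N%:R) - f 0| <= k%:R * (M1 / N%:R + C / N%:R ^+ 2).
  elim: k => [|k IH] kN; first by rewrite mul0r subrr normr0 mul0r.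
  have -> : f (k.+1%:R / N%:R) - f 0 = (f (k.+1%:R / N%:R) - f (k%:R / N%:R)) + (f (k%:R / N%:R) - f 0) by ring.
  apply: le_trans (ler_normD _ _) _; rewrite -[in leRHS]natr1 [_ + 1]addrC mulrDl mul1r.
  apply: lerD; last exact: IH (ltnW kN).
  have k1 l : (l <= N)%N -> (0 <= l%:R / N%:R :> R) /\ (l%:R / N%:R <= 1 :> R).
    by move=> lN; split; [rewrite divr_ge0 // (ltW N0)|]; rewrite ler_pdivrMr // mul1r ler_nat.
  have [a1 a2] := k1 _ kN; have [b1 b2] := k1 _ (ltnW kN).
  have e1 : k.+1%:R / N%:R - k%:R / N%:R = N%:R^-1 :> R by rewrite -mulrBl -natr1 addrAC subrr add0r mul1r.
  have := h _ _ a1 a2 b1 b2.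
  have n0 : 0 <= N%:R^-1 :> R by rewrite invr_ge0 ltW.
  by rewrite e1 (ger0_norm n0) exprVn.
have := hk _ (leqnn N); rewrite divff ?gt_eqF // => h1; apply: le_trans h1 _.
rewrite mulrDr mulrCA divff ?gt_eqF // mulr1 lerD2l expr2 invfM.
have -> : N%:R * (C * (N%:R^-1 / N%:R)) = C / N%:R by field; rewrite gt_eqF.
by rewrite ler_pdivrMr // mulrC -ler_pdivrMr // ltW.
Qed.

Definition shiftp k m (J : 'I_k -> 'I_m) (x : pt) (y : 'rV[R]_k) : pt :=
  fun l => x l + \sum_(a < k) ((l == J a :> nat)%:R * y ord0 a).

Lemma shift_close k m (J : 'I_k -> 'I_m) x (y y' : 'rV[R]_k) :
  closep m (k%:R * `|y - y'|) (shiftp J x y') (shiftp J x y).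
Proof.
move=> l _; rewrite /shiftp opprD addrACA subrr add0r -sumrB.
apply: le_trans (ler_norm_sum _ _ _) _.
apply: le_trans (_ : \sum_(a < k) `|y - y'| <= _); last by rewrite sumr_const card_ord mulr_natl.
apply: ler_sum => a _; rewrite -mulrBr normrM; apply: le_trans (_ : 1 * `|y - y'| <= _); last by rewrite mul1r.
apply: ler_pM => //; first by case: eqP; rewrite ?normr1 ?normr0.
by have := rV_coord_le (y - y') a; rewrite !mxE.
Qed.

Lemma shiftp0 k m (J : 'I_k -> 'I_m) x : shiftp J x 0 = x.
Proof. by apply/funext => l; rewrite /shiftp big1 ?addr0 // => a _; rewrite mxE mulr0. Qed.

Lemma shift_sum k m (J : 'I_k -> 'I_m) x (y y' : 'rV[R]_k) (D : nat -> R) :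
  \sum_(l < m) (shiftp J x y l - shiftp J x y' l) * D l = \sum_(a < k) (y - y') ord0 a * D (J a).
Proof.
under eq_bigr do rewrite /shiftp opprD addrACA subrr add0r -sumrB mulr_suml.
rewrite exchange_big /=; apply: eq_bigr => a _.
rewrite (bigD1 (J a)) //= eqxx !mul1r !mxE big1 ?addr0 // => l ne.
by rewrite (_ : (l == J a :> nat) = false) ?mul0r ?subrr ?mul0r //; apply/negbTE.
Qed.

End Rank.

Section ConstRank.
Variables (R : realType) (m d k : nat).
Local Notation pt := (nat -> R).
Variables (phi : 'I_d -> pt -> R) (dphi : 'I_d -> nat -> pt -> R) (C r : R).
Hypothesis C0 : 0 < C.
Hypothesis r0 : 0 < r.
Hypothesis T2 : forall i x y (e : R), 0 <= e -> cube m r x -> cube m r y -> closep m e x y ->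
    `|phi i y - phi i x - \sum_(l < m) (y l - x l) * dphi i l x| <= C * e ^+ 2.
Hypothesis LP : forall i x y (e : R), 0 <= e -> cube m r x -> cube m r y -> closep m e x y ->
    `|phi i y - phi i x| <= C * e.
Hypothesis LD : forall i (l : 'I_m) x y (e : R), 0 <= e -> cube m r x -> cube m r y -> closep m e x y ->
    `|dphi i l y - dphi i l x| <= C * e.
Variables (I : 'I_k -> 'I_d) (J : 'I_k -> 'I_m).

Definition Amat (x : pt) : 'M[R]_k := \matrix_(a, b) dphi (I b) (J a) x.
Definition Psi (x : pt) (y : 'rV[R]_k) : 'rV[R]_k := \row_b phi (I b) (shiftp J x y).

Lemma Psi_lin w0 x (y y' : 'rV[R]_k) (e1 : R) : 0 <= e1 -> cube m r w0 ->
  cube m r (shiftp J x y) -> cube m r (shiftp J x y') -> closep m e1 w0 (shiftp J x y') ->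
  `|Psi x y - Psi x y' - (y - y') *m Amat w0| <=
    (C * k%:R * e1 + C * k%:R ^+ 2 * `|y - y'|) * `|y - y'|.
Proof.
move=> e10 w0r yr y'r hc.
have kr0 : 0 <= k%:R :> R by rewrite ler0n.
apply: rV_norm_le.
  by rewrite mulr_ge0 // addr_ge0 // !mulr_ge0 ?exprn_ge0 // (ltW C0).
move=> b; rewrite !mxE.
have E : \sum_(a < k) (y - y') ord0 a * Amat w0 a b =
   \sum_(l < m) (shiftp J x y l - shiftp J x y' l) * dphi (I b) l (shiftp J x y') -
   \sum_(a < k) (y - y') ord0 a * (dphi (I b) (J a) (shiftp J x y') - dphi (I b) (J a) w0).
  rewrite (shift_sum J x y y' (fun l => dphi (I b) l (shiftp J x y'))) -sumrB.
  by apply: eq_bigr => a _; rewrite !mxE; ring.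
rewrite E; set S1 := \sum_(l < m) _; set S2 := \sum_(a < k) _.
set f1 := phi _ _; set f2 := phi _ _.
have -> : f1 - f2 - (S1 - S2) = S2 + (f1 - f2 - S1) by ring.
apply: le_trans (ler_normD _ _) _; rewrite mulrDl; apply: lerD.
  apply: le_trans (ler_norm_sum _ _ _) _.
  apply: le_trans (_ : \sum_(a < k) `|y - y'| * (C * e1) <= _); last first.
    by rewrite sumr_const card_ord -mulr_natl le_eqVlt; apply/orP; left; apply/eqP; ring.
  by apply: ler_sum => a _; rewrite normrM ler_pM // ?rV_coord_le // LD.
have := @T2 (I b) (shiftp J x y') (shiftp J x y) (k%:R * `|y - y'|) _ y'r yr (shift_close _ _ _ _).
rewrite mulr_ge0 // => /(_ isT) h; apply: le_trans h _.
by rewrite le_eqVlt; apply/orP; left; apply/eqP; ring.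
Qed.

Lemma row_phi_lip x x' (e : R) : 0 <= e -> cube m r x -> cube m r x' -> closep m e x x' ->
  forall y, cube m r (shiftp J x y) -> cube m r (shiftp J x' y) -> `|Psi x' y - Psi x y| <= C * e.
Proof.
move=> e0 xr x'r hc y yr y'r; apply: rV_norm_le; first by rewrite mulr_ge0 // ltW.
move=> b; rewrite !mxE; apply: LP => // l lm.
by rewrite /shiftp opprD addrACA subrr addr0; exact: hc.
Qed.

Lemma const_rank (i0 : 'I_d) w0 (kap Bc : R) : cube m (r / 2) w0 -> 0 < kap -> kap <= r / 2 -> 0 <= Bc ->
  Amat w0 \in unitmx ->
  (forall x, closep m kap w0 x -> exists c : 'I_k -> R, (forall b, `|c b| <= Bc) /\
     forall l : 'I_m, dphi i0 l x = \sum_(b < k) c b * dphi (I b) l x) ->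
  exists eta L : R, [/\ 0 < eta, 0 <= L & forall w w', closep m eta w0 w -> closep m eta w0 w' ->
    `|phi i0 w' - phi i0 w| <= L * `|Psi w' 0 - Psi w 0|].
Proof.
move=> w0r kap0 kapr Bc0 uA hrel; set A := Amat w0 in uA.
have [b b0 hb] := @fin_sum_bound R ('I_k * 'I_k)%type (fun p => `|invmx A p.1 p.2|) (fun p => normr_ge0 _).
have kr0 : 0 <= k%:R :> R by rewrite ler0n.
pose K := k%:R * b + 1.
have K0 : 0 < K by rewrite /K ltr_wpDl // mulr_ge0 // ltW.
have hK (v : 'rV[R]_k) : `|v *m invmx A| <= K * `|v|.
  apply: le_trans (rV_mulmx_le v (ltW b0) (fun i j => hb (i, j) : `|invmx A i j| <= b)) _.
  by apply: ler_wpM2r => //; rewrite /K lerDl.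
pose D : R := k%:R + 1.
have D1 : 1 <= D by rewrite /D lerDr.
have D0 : 0 < D by apply: lt_le_trans D1.
pose rho := Num.min (kap / (2 * D)) (1 / (6 * K * C * D ^+ 2)).
have rho0 : 0 < rho by rewrite lt_min !divr_gt0 // !mulr_gt0 // exprn_gt0.
have rho1 : D * rho <= kap / 2.
  have : rho <= kap / (2 * D) by rewrite ge_min lexx.
  by move=> h; apply: le_trans (ler_wpM2l (ltW D0) h) _; rewrite le_eqVlt; apply/orP; left; apply/eqP; field; rewrite gt_eqF.
have rho2 : K * (3 * C * D ^+ 2 * rho) <= 1 / 2.
  have : rho <= 1 / (6 * K * C * D ^+ 2) by rewrite ge_min lexx orbT.
  have p0 : 0 <= K * (3 * C * D ^+ 2) by rewrite !mulr_ge0 ?exprn_ge0 // ltW.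
  move=> h; have -> : K * (3 * C * D ^+ 2 * rho) = K * (3 * C * D ^+ 2) * rho by ring.
  apply: le_trans (ler_wpM2l p0 h) _.
  by rewrite le_eqVlt; apply/orP; left; apply/eqP; field; rewrite !gt_eqF.
pose eta := Num.min rho (rho / (8 * K * C)).
have eta0 : 0 < eta by rewrite lt_min rho0 divr_gt0 // !mulr_gt0.
have eta1 : eta <= rho by rewrite ge_min lexx.
have eta2 : 2 * C * eta <= rho / (2 * K).
  have h : eta <= rho / (8 * K * C) by rewrite ge_min lexx orbT.
  have c20 : 0 <= 2 * C by rewrite mulr_ge0 // ltW.
  apply: le_trans (ler_wpM2l c20 h) _.
  have -> : 2 * C * (rho / (8 * K * C)) = (rho / (2 * K)) / 2 by field; rewrite !gt_eqF.
  have : 0 <= rho / (2 * K) by rewrite divr_ge0 ?mulr_ge0 ?(ltW rho0) ?(ltW K0).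
  lra.
exists eta, (k%:R * Bc); split => //; first by rewrite mulr_ge0.
move=> w w' wc w'c.
set u := Psi w 0; set u' := Psi w' 0.
pose xt (t : R) : pt := fun l => w l + t * (w' l - w l).
have ww' : closep m (2 * eta) w w'.
  by apply: closepW (closep_trans (closep_sym wc) w'c); rewrite mulr_natl mulr2n.
have xtc t : 0 <= t -> t <= 1 -> closep m eta w0 (xt t).
  move=> t0 t1 l lm; have -> : xt t l - w0 l = (1 - t) * (w l - w0 l) + t * (w' l - w0 l) by rewrite /xt; ring.
  apply: le_trans (ler_normD _ _) _; rewrite !normrM (ger0_norm t0) ger0_norm; last by rewrite subr_ge0.
  have h1 := wc l lm; have h2 := w'c l lm.
  have s0 : 0 <= 1 - t by rewrite subr_ge0.
  have := ler_wpM2l s0 h1; have := ler_wpM2l t0 h2; lra.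
have shc t y : 0 <= t -> t <= 1 -> `|y| <= rho -> closep m (D * rho) w0 (shiftp J (xt t) y).
  move=> t0 t1 yr; have h := shift_close J (xt t) y 0; rewrite shiftp0 subr0 in h.
  apply: closepW (closep_trans (xtc t t0 t1) h).
  have := ler_wpM2l kr0 yr; rewrite /D mulrDl mul1r; lra.
have cr x : closep m kap w0 x -> cube m r x.
  move=> h; apply: cubeS (closep_cube h w0r) => //; lra.
have shk t y : 0 <= t -> t <= 1 -> `|y| <= rho -> closep m kap w0 (shiftp J (xt t) y).
  by move=> t0 t1 yr; apply: closepW (shc t y t0 t1 yr); lra.
have shr t y : 0 <= t -> t <= 1 -> `|y| <= rho -> cube m r (shiftp J (xt t) y).
  by move=> t0 t1 yr; apply: cr; exact: shk.
have z_rho : `|0 : 'rV[R]_k| <= rho by rewrite normr0 ltW.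
have xr t : 0 <= t -> t <= 1 -> cube m r (xt t).
  by move=> t0 t1; have := shr t 0 t0 t1 z_rho; rewrite shiftp0.
have w0r' : cube m r w0 by apply: cubeS w0r => //; lra.
have inv t : 0 <= t -> t <= 1 ->
  (forall y y', `|y| <= rho -> `|y'| <= rho -> `|y - y'| <= 2 * K * `|Psi (xt t) y - Psi (xt t) y'|) /\
  (forall v, `|v - Psi (xt t) 0| <= rho / (2 * K) -> exists2 y, `|y| <= rho & Psi (xt t) y = v).
  move=> t0 t1; apply: (local_inverse (A := A) (e := 3 * C * D ^+ 2 * rho)) => //.
    by rewrite !mulr_ge0 ?exprn_ge0 // ltW.
  move=> y y' yr y'r.
  have h := Psi_lin (ltW (mulr_gt0 D0 rho0)) w0r' (shr t y t0 t1 yr) (shr t y' t0 t1 y'r) (shc t y' t0 t1 y'r).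
  apply: le_trans h _; apply: ler_wpM2r => //.
  have h2 : `|y - y'| <= 2 * rho by apply: le_trans (ler_normB _ _) _; lra.
  have kD : k%:R <= D by rewrite /D lerDl.
  have kD2 : k%:R ^+ 2 <= D ^+ 2 by rewrite lerXn2r ?nnegrE // ltW.
  have h3 : C * k%:R * (D * rho) <= C * D ^+ 2 * rho.
    rewrite expr2 -!mulrA ler_pM2l // ler_wpM2r //; by rewrite mulr_ge0 // ltW.
  have h4 : C * k%:R ^+ 2 * `|y - y'| <= C * D ^+ 2 * (2 * rho).
    by apply: ler_pM => //; rewrite ?mulr_ge0 ?exprn_ge0 ?ler_pM2l // ltW.
  lra.
pose tg (t : R) := u + t *: (u' - u).
have x01 : xt 0 = w by apply/funext => l; rewrite /xt mul0r addr0.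
have x1 : xt 1 = w' by apply/funext => l; rewrite /xt mul1r addrC subrK.
have xlip s t : 0 <= s -> s <= 1 -> 0 <= t -> t <= 1 -> closep m (2 * eta * `|s - t|) (xt t) (xt s).
  move=> s0 s1 t0 t1 l lm.
  have -> : xt s l - xt t l = (s - t) * (w' l - w l) by rewrite /xt; ring.
  by rewrite normrM mulrC ler_pM // ww'.
have /choice[yt hyt] : forall t, exists y, 0 <= t -> t <= 1 -> `|y| <= rho /\ Psi (xt t) y = tg t.
  move=> t; have [t01|] := pselect (0 <= t /\ t <= 1); last by move=> h; exists 0 => t0 t1; case: h.
  have [t0 t1] := t01; have [_ hex] := inv t t0 t1.
  have [y yr hy] : exists2 y, `|y| <= rho & Psi (xt t) y = tg t; last by exists y.
  apply: hex; apply: le_trans _ eta2.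
  have -> : tg t - Psi (xt t) 0 = (1 - t) *: (u - Psi (xt t) 0) + t *: (u' - Psi (xt t) 0).
    by apply/rowP => a; rewrite !mxE; ring.
  have dist s : 0 <= s -> s <= 1 -> `|Psi (xt s) 0 - Psi (xt t) 0| <= 2 * C * eta.
    move=> s0 s1.
    have hc : closep m (2 * eta) (xt t) (xt s).
      apply: closepW (xlip s t s0 s1 t0 t1); rewrite ler_piMr //; first by rewrite mulr_ge0 // ltW.
      rewrite ler_norml; lra.
    have := row_phi_lip (_ : 0 <= 2 * eta) (xr t t0 t1) (xr s s0 s1) hc (shr t 0 t0 t1 z_rho) (shr s 0 s0 s1 z_rho).
    rewrite mulr_ge0 ?(ltW eta0) // => /(_ isT); by rewrite mulrA (mulrC C).
  have h0 := dist 0 (lexx _) ler01; have h1 := dist 1 ler01 (lexx _).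
  rewrite x01 -/u in h0; rewrite x1 -/u' in h1.
  apply: le_trans (ler_normD _ _) _; rewrite !normrZ (ger0_norm t0) ger0_norm; last by rewrite subr_ge0.
  have s0 : 0 <= 1 - t by rewrite subr_ge0.
  have := ler_wpM2l s0 h0; have := ler_wpM2l t0 h1; lra.
pose f t := phi i0 (shiftp J (xt t) (yt t)).
have y0 : yt 0 = 0.
  have [h1 h2] := hyt 0 (lexx _) ler01; have [hu _] := inv 0 (lexx _) ler01.
  have := hu _ _ h1 z_rho; rewrite h2 /tg scale0r addr0 x01 subrr normr0 mulr0 subr0 normr_le0 => /eqP //.
have y1 : yt 1 = 0.
  have [h1 h2] := hyt 1 ler01 (lexx _); have [hu _] := inv 1 ler01 (lexx _).
  have tg1 : tg 1 = u' by rewrite /tg scale1r addrC subrK.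
  have := hu _ _ h1 z_rho; rewrite h2 tg1 x1 subrr normr0 mulr0 subr0 normr_le0 => /eqP //.
have -> : phi i0 w = f 0 by rewrite /f y0 shiftp0 x01.
have -> : phi i0 w' = f 1 by rewrite /f y1 shiftp0 x1.
pose L1 := 2 * K * (`|u' - u| + C * (2 * eta)).
have L10 : 0 <= L1.
  by rewrite /L1 !mulr_ge0 ?(ltW K0) // addr_ge0 // !mulr_ge0 // ltW.
pose L2 := 2 * eta + k%:R * L1.
have L20 : 0 <= L2 by rewrite /L2 addr_ge0 // mulr_ge0 // ltW.
apply: (@lip_path _ f _ (k%:R * Bc * (C * L2 ^+ 2) + C * L2 ^+ 2)).
  by rewrite addr_ge0 // !mulr_ge0 ?exprn_ge0 // ltW.
move=> s t s0 s1 t0 t1.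
have [ys hs] := hyt s s0 s1; have [yt' ht] := hyt t t0 t1.
have ylip : `|yt s - yt t| <= L1 * `|s - t|.
  have [hu _] := inv s s0 s1; apply: le_trans (hu _ _ ys yt') _.
  rewrite /L1 -[leRHS]mulrA ler_pM2l ?mulr_gt0 // mulrDl.
  have -> : Psi (xt s) (yt s) - Psi (xt s) (yt t) = (tg s - tg t) - (Psi (xt s) (yt t) - Psi (xt t) (yt t)).
    rewrite hs ht; move: (tg s) (tg t) (Psi _ _) => a1 a2 a3.
    by apply/rowP => a; rewrite !mxE; ring.
  apply: le_trans (ler_normB _ _) _; apply: lerD.
    have -> : tg s - tg t = (s - t) *: (u' - u) by apply/rowP => a; rewrite !mxE; ring.
    by rewrite normrZ mulrC.
  rewrite -mulrA; apply: row_phi_lip => //.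
  - by rewrite mulr_ge0 // mulr_ge0 // ltW.
  - exact: xr.
  - exact: xr.
  - exact: xlip.
  - exact: shr.
  - exact: shr.
have pc : closep m (L2 * `|s - t|) (shiftp J (xt t) (yt t)) (shiftp J (xt s) (yt s)).
  have c1 := xlip s t s0 s1 t0 t1.
  have c1' : closep m (2 * eta * `|s - t|) (shiftp J (xt t) (yt t)) (shiftp J (xt s) (yt t)).
    by move=> l lm; rewrite /shiftp opprD addrACA subrr addr0; exact: c1.
  have c2 := shift_close J (xt s) (yt s) (yt t).
  apply: closepW (closep_trans c1' c2).
  have -> : L2 * `|s - t| = 2 * eta * `|s - t| + k%:R * (L1 * `|s - t|) by rewrite /L2; ring.
  by rewrite lerD2l; exact: ler_wpM2l.
have [c [hc1 hc2]] := hrel _ (shk t _ t0 t1 yt').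
set P := shiftp J (xt t) (yt t) in pc hc2 *; set Q := shiftp J (xt s) (yt s) in pc *.
have Pr : cube m r P by exact: shr.
have Qr : cube m r Q by exact: shr.
have e0 : 0 <= L2 * `|s - t| by rewrite mulr_ge0.
have t2 i := T2 i e0 Pr Qr pc.
have -> : f s - f t = (phi i0 Q - phi i0 P - \sum_(l < m) (Q l - P l) * dphi i0 l P) +
   \sum_(b < k) c b * ((phi (I b) Q - phi (I b) P) - (phi (I b) Q - phi (I b) P - \sum_(l < m) (Q l - P l) * dphi (I b) l P)).
  have -> : \sum_(l < m) (Q l - P l) * dphi i0 l P = \sum_(b < k) c b * \sum_(l < m) (Q l - P l) * dphi (I b) l P.
    under [RHS]eq_bigr do rewrite mulr_sumr.
    rewrite exchange_big /=; apply: eq_bigr => l _; rewrite hc2 mulr_sumr.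
    by apply: eq_bigr => a _; ring.
  under [X in _ = _ + X]eq_bigr do rewrite subKr.
  by rewrite /f subrK.
apply: le_trans (ler_normD _ _) _; rewrite mulrDl addrA addrC; apply: lerD; last first.
  apply: le_trans (ler_norm_sum _ _ _) _.
  have -> : k%:R * Bc * `|u' - u| * `|s - t| + k%:R * Bc * (C * L2 ^+ 2) * `|s - t| ^+ 2 =
     \sum_(b < k) (Bc * (`|u' - u| * `|s - t| + C * (L2 * `|s - t|) ^+ 2)).
    by rewrite sumr_const card_ord -mulr_natl; ring.
  apply: ler_sum => a _; rewrite normrM ler_pM //.
  apply: le_trans (ler_normB _ _) _; apply: lerD; last exact: t2.
  have -> : phi (I a) Q - phi (I a) P = (tg s - tg t) ord0 a by rewrite -hs -ht !mxE.
  have -> : tg s - tg t = (s - t) *: (u' - u) by apply/rowP => a'; rewrite !mxE; ring.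
  apply: le_trans (rV_coord_le _ _) _; by rewrite normrZ mulrC.
apply: le_trans (t2 i0) _; by rewrite exprMn mulrA.
Qed.

End ConstRank.

Section GenericRank.
Variable R : realType.
Local Notation pt := (nat -> R).

Lemma bordered_det k (A : 'M[R]_k) (c : 'cV[R]_k) (l : 'rV[R]_k) (s : 'M[R]_1) :
  A \in unitmx -> \det (block_mx A c l s) = 0 -> s = l *m (invmx A *m c).
Proof.
move=> uA.
have -> : block_mx A c l s = block_mx A 0 l (s - l *m (invmx A *m c)) *m block_mx 1%:M (invmx A *m c) 0 1%:M.
  rewrite mulmx_block !mulmx0 !mulmx1 !addr0 mulmxA mulmxV // mul1mx.
  by rewrite addrC subrK.
rewrite det_mulmx det_lblock det_ublock !det1 !mulr1 => /eqP; rewrite mulf_eq0.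
have dA : \det A != 0 by move: uA; rewrite unitmxE unitfE.
rewrite (negbTE dA) /= => /eqP h; apply/eqP; rewrite -subr_eq0; apply/eqP.
by apply/matrixP => i j; move: h; rewrite det_mx11 !ord1 !mxE.
Qed.

Lemma Amat_det_inj m d k (dphi : 'I_d -> nat -> pt -> R) (I : 'I_k -> 'I_d) (J : 'I_k -> 'I_m) :
  ~ gz m (fun x => \det (Amat dphi I J x)) -> injective I.
Proof.
move=> nz b b' e; apply/eqP/negP => /negP ne; apply: nz; exists 1 => // x _.
by rewrite -det_tr; apply: (determinant_alternate ne) => a; rewrite !mxE e.
Qed.

Definition lipdep d k (I : 'I_k -> 'I_d) (i0 : 'I_d) (L : R) (E : set 'rV[R]_d) :=
  forall v v', E v -> E v' ->
   `|v' ord0 i0 - v ord0 i0| <= L * `|(\row_b (v' ord0 (I b)) : 'rV[R]_k) - \row_b (v ord0 (I b))|.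

Lemma lipdep_dense d k (I : 'I_k -> 'I_d) (i0 : 'I_d) (L : R) (E : set 'rV[R]_d) :
  0 <= L -> (forall b, I b != i0) -> lipdep I i0 L E -> dense (~` closure E).
Proof.
move=> L0 hI hE O [v Ov] oO; apply: contrapT => hno.
have OE : O `<=` closure E.
  by move=> u Ou; apply: contrapT => nc; apply: hno; exists u.
have := open_nbhs_nbhs (conj oO Ov); rewrite -nbhs_ballE /= => -[e e0 he]; rewrite /= in e0.
pose v' : 'rV[R]_d := v + (e / 2) *: delta_mx ord0 i0.
have Ov' : O v'.
  apply: he; rewrite -ball_normE /= /v' opprD addrA subrr add0r normrN.
  apply: le_lt_trans (_ : `|e / 2| * 1 < _).
    rewrite normrZ; apply: ler_wpM2l => //; apply: rV_norm_le => // j; rewrite mxE /=.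
    by case: eqP; rewrite ?normr1 ?normr0.
  rewrite mulr1 gtr0_norm ?divr_gt0 //; lra.
pose eta := e / (8 * (L + 1)).
have eta0 : 0 < eta by rewrite divr_gt0 // mulr_gt0 // ltr_wpDl.
have near u : O u -> exists2 y, E y & forall j, `|y ord0 j - u ord0 j| <= eta.
  move=> /OE /(_ (ball u eta)) [|y [Ey yu]]; first exact: nbhsx_ballx.
  exists y => // j; have := rV_coord_le (u - y) j; rewrite !mxE distrC => h.
  apply: le_trans h _; apply: ltW; by move: yu; rewrite -ball_normE.
have [y Ey hy] := near _ Ov; have [y' Ey' hy'] := near _ Ov'.
have h1 : e / 2 - 2 * eta <= `|y' ord0 i0 - y ord0 i0|.
  have := hy i0; have := hy' i0; rewrite !mxE !eqxx /= mulr1.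
  move: (y ord0 i0) (y' ord0 i0) (v ord0 i0) => a b c hb ha.
  have := ler_norm (b - a); move: ha hb; rewrite !ler_norml => /andP[? ?] /andP[? ?]; lra.
have h2 : `|(\row_b (y' ord0 (I b)) : 'rV[R]_k) - \row_b (y ord0 (I b))| <= 2 * eta.
  apply: rV_norm_le; first by rewrite mulr_ge0 // ltW.
  move=> b; rewrite !mxE; have := hy (I b); have := hy' (I b); rewrite !mxE eqxx /= (negbTE (hI b)) mulr0 addr0.
  rewrite !ler_norml => /andP[? ?] /andP[? ?]; apply/andP; split; lra.
have h3 := le_trans (le_trans h1 (hE _ _ Ey Ey')) (ler_wpM2l L0 h2).
have : (L + 1) * eta = e / 8 by rewrite /eta; field; apply/eqP; lra.
nra.
Qed.

Lemma rank_dichotomy m d (phi : 'I_d -> pt -> R) (dphi : 'I_d -> nat -> pt -> R) (C0 r0 : R) :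
  0 < C0 -> 0 < r0 -> (forall i, germ m (phi i)) -> (forall i l, germ m (dphi i l)) ->
  (forall (i : 'I_d) x y (e : R), 0 <= e -> cube m r0 x -> cube m r0 y -> closep m e x y ->
    `|phi i y - phi i x - \sum_(l < m) (y l - x l) * dphi i l x| <= C0 * e ^+ 2) ->
  (exists J : 'I_d -> 'I_m, ~ gz m (fun x => \det (\matrix_(a, b) dphi b (J a) x))) \/
  (exists (h : pt -> R) (D : nat -> set 'rV[R]_d) (r : R), [/\ germ m h, ~ gz m h, 0 < r,
     forall n, open (D n) /\ dense (D n) &
     forall w, cube m r w -> h w != 0 -> exists n, ~ D n (\row_i phi i w)]).
Proof.
move=> C00 r00 gphi gd T20.
pose P k := `[< exists (I : 'I_k -> 'I_d) (J : 'I_k -> 'I_m), ~ gz m (fun x => \det (Amat dphi I J x)) >].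
have P0 : exists k, P k.
  exists 0%N; apply/asboolP.
  have v0 T : 'I_0 -> T by case.
  exists (v0 _), (v0 _) => -[r rp /(_ (fun=> 0))] h.
  suff /h : cube m r (fun=> 0) by rewrite det_mx00 => /eqP; rewrite oner_eq0.
  exact: cube0 (ltW rp).
have Pb k : P k -> (k <= d)%N.
  by move=> /asboolP[I [J /Amat_det_inj /leq_card]]; rewrite !card_ord.
case: (ex_maxnP P0 Pb) => k Pk kmax; have kd := Pb _ Pk; move/asboolP: Pk => [I [J nz]].
have Iinj := Amat_det_inj nz.
have [kd'|kd'] := eqVneq k d.
  left; move: (kd'); move=> ekd; subst k; exists J => -[r rp hz]; apply: nz; exists r => // x xr.
  have -> : Amat dphi I J x = col_perm (perm Iinj) (\matrix_(a, b) dphi b (J a) x).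
    by apply/matrixP => a b; rewrite !mxE permE.
  by rewrite col_permE det_mulmx hz // mul0r.
right.
have [i0 hi0] : exists i0, forall b, I b != i0.
  apply: contrapT => hno; have : (d <= k)%N.
    have /choice[g hg] : forall i, exists b, I b = i.
      by move=> i; apply: contrapT => h; apply: hno; exists i => b; apply/eqP => e; apply: h; exists b.
    have := leq_card g (can_inj hg); by rewrite !card_ord.
  by move=> dk; move: kd'; rewrite eqn_leq kd dk.
pose I' (b : 'I_(k + 1)) := match fintype.split b with inl b => I b | inr _ => i0 end.
pose J' l (a : 'I_(k + 1)) := match fintype.split a with inl a => J a | inr _ => l end.
have gz' l : gz m (fun x => \det (Amat dphi I' (J' l) x)).
  apply: contrapT => h; suff : P (k + 1)%N by move=> /kmax; rewrite addn1 ltnn.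
  by apply/asboolP; exists I', (J' l).
have blk l x : Amat dphi I' (J' l) x = block_mx (Amat dphi I J x) (\col_a dphi i0 (J a) x)
   (\row_b dphi (I b) l x) (dphi i0 l x)%:M.
  apply/matrixP => a b; rewrite mxE /I' /J'; case: (split_ordP a) => a' ->; case: (split_ordP b) => b' ->.
  - by rewrite block_mxEul !mxE.
  - by rewrite block_mxEur !mxE.
  - by rewrite block_mxEdl !mxE.
  - by rewrite block_mxEdr !mxE !ord1 eqxx mulr1n.
have [r1 r10 hz] : nr m (fun x => forall l : 'I_m, \det (Amat dphi I' (J' l) x) = 0).
  have [rr] := choice (fun l => (let: ex_intro2 r a b := gz' l in ex_intro _ r (conj a b)) :
     exists r : R, 0 < r /\ forall x, cube m r x -> \det (Amat dphi I' (J' l) x) = 0).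
  move=> hr; have [r1 r10 h1] := fin_min_pos (fun l => proj1 (hr l)).
  exists r1 => // x xr l; apply: (proj2 (hr l)); exact: cubeS (leqnn _) (h1 l) xr.
have gA a b : germ m (fun x => Amat dphi I J x a b).
  by apply: (germ_eq (F := dphi (I b) (J a))) => // x; rewrite mxE.
pose h x := \det (Amat dphi I J x).
have gh : germ m h.
  by apply: (germ_det (M := fun a b => dphi (I b) (J a))).
have [C1 [s1 [C10 s10 _ L1]]] := germs_lip gphi.
have [C2 [s2 [C20 s20 B2 L2]]] := @germs_lip _ ('I_d * 'I_m)%type m (fun p => dphi p.1 p.2) (fun p => gd _ _).
have [C3 [s3 [C30 s30 _ L3]]] := @germs_lip _ unit m (fun _ => h) (fun _ => gh).
have gadj : forall p : 'I_k * 'I_k, germ m (fun x => (\adj (Amat dphi I J x)) p.1 p.2).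
  by move=> p; apply: (germ_adj (M := fun a b => dphi (I b) (J a))).
have [C4 [s4 [C40 s40 B4 _]]] := germs_lip gadj.
pose r := Num.min (Num.min r0 r1) (Num.min (Num.min s1 s2) (Num.min s3 s4)).
have [rp [[rr0 rr1] [[rs1 rs2] [rs3 rs4]]]] : 0 < r /\ (r <= r0 /\ r <= r1) /\ (r <= s1 /\ r <= s2) /\ (r <= s3 /\ r <= s4).
  by rewrite /r; split; [rewrite !lt_min r00 r10 s10 s20 s30|rewrite !ge_min !lexx ?orbT].
pose C := Num.max C0 (Num.max C1 C2).
have [c0 [c1 c2]] : C0 <= C /\ C1 <= C /\ C2 <= C by rewrite /C !le_max !lexx ?orbT.
have Cp : 0 < C by apply: lt_le_trans c0.
have cW s x : r <= s -> cube m r x -> cube m s x by move=> rs; exact: cubeS.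
have T2 (i : 'I_d) x y (e : R) : 0 <= e -> cube m r x -> cube m r y -> closep m e x y ->
    `|phi i y - phi i x - \sum_(l < m) (y l - x l) * dphi i l x| <= C * e ^+ 2.
  move=> e0 xr yr cl; apply: le_trans (T20 i x y e e0 (cW _ _ rr0 xr) (cW _ _ rr0 yr) cl) _.
  by apply: ler_wpM2r => //; exact: exprn_ge0.
have LP (i : 'I_d) x y (e : R) : 0 <= e -> cube m r x -> cube m r y -> closep m e x y ->
    `|phi i y - phi i x| <= C * e.
  move=> e0 xr yr cl; apply: le_trans (L1 i x y e e0 (cW _ _ rs1 xr) (cW _ _ rs1 yr) cl) _.
  by apply: ler_wpM2r.
have LD (i : 'I_d) (l : 'I_m) x y (e : R) : 0 <= e -> cube m r x -> cube m r y -> closep m e x y ->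
    `|dphi i l y - dphi i l x| <= C * e.
  move=> e0 xr yr cl; apply: le_trans (L2 (i, l) x y e e0 (cW _ _ rs2 xr) (cW _ _ rs2 yr) cl) _.
  by apply: ler_wpM2r.
have loc w0 : cube m (r / 2) w0 -> h w0 != 0 -> exists eta L : R, [/\ 0 < eta, 0 <= L &
   forall w w', closep m eta w0 w -> closep m eta w0 w' ->
    `|phi i0 w' - phi i0 w| <= L * `|Psi phi I J w' 0 - Psi phi I J w 0|].
  move=> w0r hw0; pose kap := Num.min (r / 2) (`|h w0| / (2 * C3)).
  have n0 : 0 < `|h w0| by rewrite normr_gt0.
  have kp : 0 < kap by rewrite lt_min !divr_gt0 // mulr_gt0.
  have k1 : kap <= r / 2 by rewrite ge_min lexx.
  have k2 : C3 * kap <= `|h w0| / 2.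
    have hk : kap <= `|h w0| / (2 * C3) by rewrite ge_min lexx orbT.
    apply: le_trans (ler_wpM2l (ltW C30) hk) _; rewrite le_eqVlt; apply/orP; left; apply/eqP; field.
    by rewrite gt_eqF.
  have w0r' : cube m r w0 by apply: cubeS w0r => //; lra.
  have hlow x : closep m kap w0 x -> cube m r x /\ `|h w0| / 2 <= `|h x|.
    move=> cx; have xr : cube m r x by apply: cubeS (closep_cube cx w0r) => //; lra.
    split => //; have := L3 tt w0 x kap (ltW kp) (cW _ _ rs3 w0r') (cW _ _ rs3 xr) cx.
    have := ler_normD (h x) (h w0 - h x); rewrite addrC subrK distrC; lra.
  apply: (const_rank Cp T2 LP LD (I := I) (J := J) (kap := kap) (Bc := k%:R * (2 / `|h w0| * C4 * C2))) => //.
    by rewrite !mulr_ge0 ?invr_ge0 // ltW.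
    by rewrite unitmxE unitfE.
  move=> x /hlow[xr hx].
  have uA : Amat dphi I J x \in unitmx.
    rewrite unitmxE unitfE -normr_gt0; apply: lt_le_trans hx; by rewrite divr_gt0.
  exists (fun b => (invmx (Amat dphi I J x) *m (\col_a dphi i0 (J a) x)) b ord0); split.
    move=> b; rewrite mxE; apply: le_trans (ler_norm_sum _ _ _) _.
    apply: le_trans (_ : \sum_(a < k) (2 / `|h w0| * C4 * C2) <= _); last first.
      by rewrite sumr_const card_ord -[X in X <= _]mulr_natl lexx.
    apply: ler_sum => a _; rewrite normrM mxE; apply: ler_pM => //; last by apply: (B2 (i0, J a)); exact: cW.
    rewrite /invmx uA mxE normrM; apply: ler_pM => //; last by apply: (B4 (b, a)); exact: cW.
    rewrite normfV -[leRHS]invf_div lef_pV2 // ?posrE ?divr_gt0 //.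
    by rewrite normr_gt0; move: uA; rewrite unitmxE unitfE.
  move=> l; have := hz x (cW _ _ rr1 xr) l; rewrite blk => /(bordered_det uA) /matrixP /(_ ord0 ord0).
  by rewrite !mxE eqxx mulr1n => ->; apply: eq_bigr => b _; rewrite !mxE mulrC.
pose ball_of (p : seq rat * nat) : set pt := [set w | closep m (1 / p.2.+1%:R) (fun i => ratr (nth 0 p.1 i)) w].
pose E p : set 'rV[R]_d := [set \row_i phi i w | w in ball_of p].
pose D n := if unpickle n is Some p then
   (if `[< exists L, 0 <= L /\ lipdep I i0 L (E p) >] then ~` closure (E p) else setT) else setT.
exists h, D, (r / 2); split => //; first by rewrite divr_gt0.
  move=> n; rewrite /D; case: unpickle => [p|]; last by split; [exact: openT|move=> O [x Ox] _; exists x].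
  case: asboolP => [[L [L0 hL]]|_]; last by split; [exact: openT|move=> O [x Ox] _; exists x].
  split; last exact: lipdep_dense L0 hi0 hL.
  by rewrite openC; exact: closed_closure.
move=> w wr hw; have [eta [L [eta0 L0 hL]]] := loc w wr hw.
pose n := Num.bound (2 / eta).
have hn : 2 / n.+1%:R <= eta.
  have := archi_boundP (_ : 0 <= 2 / eta); rewrite divr_ge0 ?(ltW eta0) // => /(_ isT) hb.
  rewrite ler_pdivrMr // mulrC -ler_pdivrMr //; apply: le_trans (ltW hb) _; by rewrite ler_nat.
have n0 : 0 < 1 / n.+1%:R :> R by rewrite divr_gt0.
have /choice[q hq] : forall l, exists q : rat, `|w l - ratr q| <= 1 / n.+1%:R.
  move=> l; move: (1 / _) n0 => de n0; have [|q] := @rat_in_itvoo R (w l - de) (w l + de); first by lra.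
  by rewrite in_itv /= => /andP[? ?]; exists q; rewrite ler_norml; apply/andP; split; lra.
pose p : seq rat * nat := (mkseq q m, n).
have wp : ball_of p w by move=> l lm; rewrite nth_mkseq.
exists (pickle p); rewrite /D pickleK; case: asboolP; last first.
  case; exists L; split => // _ _ [v hv <-] [v' hv' <-].
  have cl u : ball_of p u -> closep m eta w u.
    move=> hu; apply: closepW (closep_trans (closep_sym wp) hu); by apply: le_trans hn; rewrite -mulrDl.
  have := hL v v' (cl _ hv) (cl _ hv'); rewrite !mxE; congr (_ <= _ * `|_|).
  by apply/rowP => b; rewrite !mxE !shiftp0.
by move=> _; apply; apply: subset_closure; exists w.
Qed.

End GenericRank.

Section Submersive.
Variable R : realType.
Local Notation pt := (nat -> R).
Implicit Types (x w v : pt).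

Definition orth n (sg : pt) : set pt := [set x | forall l, (l < n)%N -> 0 < sg l * x l].

Lemma orth_nonzero (sg : pt) n (F : pt -> R) : (forall l, `|sg l| = 1) -> germ n F -> ~ gz n F ->
  forall r, 0 < r -> exists x, [/\ cube n r x, orth n sg x & F x != 0].
Proof.
move=> hsg; elim: n F => [|n IH] F gF nz r r0.
  apply: contrapT => h; apply: nz; exists r => // x xr; apply/eqP/negPn/negP => Fx; apply: h.
  by exists x; split.
have [i [a [U [ga nza gU [s s0 hs] hU]]]] := germ_lead gF nz.
have [C [t [C0 t0 hC]]] := germ_lip gU.
pose q := Num.min r (Num.min s t).
have q0 : 0 < q by rewrite !lt_min r0 s0.
have [qr [qs qt]] : q <= r /\ q <= s /\ q <= t by rewrite /q !ge_min !lexx ?orbT.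
have [x [xq ox ax]] := IH a ga nza q q0.
have na : 0 < `|a x| by rewrite normr_gt0.
pose tau := Num.min q (`|a x| / (2 * (C + 1))).
have C1 : 0 < C + 1 by rewrite ltr_wpDl.
have tau0 : 0 < tau by rewrite lt_min q0 divr_gt0 // mulr_gt0.
have tauq : tau <= q by rewrite ge_min lexx.
have tauC : C * tau < `|a x|.
  have h : tau <= `|a x| / (2 * (C + 1)) by rewrite ge_min lexx orbT.
  have : (C + 1) * tau <= `|a x| / 2.
    apply: le_trans (ler_wpM2l (ltW C1) h) _; rewrite le_eqVlt; apply/orP; left; apply/eqP; field.
    by rewrite gt_eqF.
  nra.
have nt : `|sg n * tau| = tau by rewrite normrM hsg mul1r gtr0_norm.
have cu z : `|z| <= q -> cube n.+1 q (upd x n z).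
  move=> zq l; rewrite ltnS leq_eqVlt /upd; case: eqP => //= _ ln; exact: xq.
have y_q : cube n.+1 q (upd x n (sg n * tau)) by apply: cu; rewrite nt.
exists (upd x n (sg n * tau)); split.
- by apply: cubeS y_q.
- move=> l; rewrite ltnS leq_eqVlt /upd; case: eqP => [-> _|_ /=]; last exact: ox.
  have -> : sg n * (sg n * tau) = `|sg n| ^+ 2 * tau by rewrite real_normK ?num_real //; ring.
  by rewrite hsg expr1n mul1r.
rewrite hs; last exact: cubeS qs y_q.
rewrite mulf_neq0 //.
  by rewrite expf_neq0 // /upd eqxx -normr_eq0 nt gt_eqF.
have z_q : cube n.+1 q (upd x n 0) by apply: cu; rewrite normr0 ltW.
have := hC _ _ tau (cubeS (leqnn _) qt z_q) (cubeS (leqnn _) qt y_q).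
rewrite hU => /(_ _) h; apply/eqP => U0; move: h; rewrite U0 sub0r normrN => h.
have : `|a x| <= C * tau; last by rewrite leNgt tauC.
apply: h => l ln; rewrite /upd; case: eqP => _; first by rewrite subr0 nt.
by rewrite subrr normr0 ltW.
Qed.

Lemma orth_lower (sg : pt) m (h : pt -> R) : (forall l, `|sg l| = 1) -> germ m h -> ~ gz m h ->
  exists v k c r, [/\ orth m sg v, cube m 1 v, 0 < c, 0 < r &
    forall w (de : R), cube m r w -> 0 < de -> de <= r -> exists t, [/\ de * c <= t, t <= de &
      c * de ^+ k <= `|h (fun l => w l + t * v l)|]].
Proof.
move=> hsg gh nz; have [f [r1 [r10 gf hf hz]]] := germ_radial gh.
pose r2 := Num.min r1 1.
have r20 : 0 < r2 by rewrite lt_min r10 ltr01.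
have [r21 r2le1] : r2 <= r1 /\ r2 <= 1 by rewrite /r2 !ge_min !lexx ?orbT.
have r22 : 0 < r2 ^+ 2 / 2 by rewrite divr_gt0 // exprn_gt0.
have [w0 [w0c ow0 hw0]] := orth_nonzero hsg gh nz r22.
pose v : pt := fun l => w0 l / (r2 / 2).
have q0 : 0 < r2 / 2 by rewrite divr_gt0.
have vr2 : cube m r2 v.
  move=> l lm; rewrite /v normrM normfV (gtr0_norm q0) ler_pdivrMr //.
  by apply: le_trans (w0c l lm) _; rewrite expr2 mulrA.
have ov : orth m sg v by move=> l lm; rewrite /v mulrA divr_gt0 // ow0.
have [k fk] : exists k, f k v != 0.
  apply: contrapT => hno; move/eqP: hw0; apply.
  have -> : w0 = (fun i => (r2 / 2) * v i) by apply/funext => l; rewrite /v mulrC divfK // gt_eqF.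
  apply: hz; first exact: cubeS vr2.
    by move=> k; apply/eqP/negPn/negP => fk; apply: hno; exists k.
  by rewrite gtr0_norm // ler_pM2r.
pose T i (z : pt) := z i + z m * v i.
have gT : forall i, (i < m)%N -> germ m.+1 (T i) /\ T i (fun=> 0) = 0.
  move=> i im; rewrite /T mul0r addr0; split => //; apply: germ_add; first by apply: germ_var; exact: ltnW.
  by apply: germ_mul; [exact: germ_var|exact: germ_cst].
have [a [U [ga gU [s1 s10 hs1]]]] := germ_expand k.+1 (germ_comp gh gT).
have [s2 s20 dep_h] := germ_dep gh.
have [s3 s30 dep_a] : nr m (fun z => forall i, (i < k.+1)%N -> forall y, (forall l, (l < m)%N -> z l = y l) -> a i z = a i y).
  by apply: nr_all => i _; have [e e0 hd] := germ_dep (ga i); exists e => // z zr y; exact: hd.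
have [B B0 [s4 s40 hB]] := germ_bnd gU.
pose s := Num.min (Num.min s1 (s2 / 2)) (Num.min (Num.min s3 s4) (Num.min (r1) 1)).
have s0 : 0 < s by rewrite !lt_min s10 divr_gt0 // s30 s40 r10 ltr01.
have [[ss1 ss2] [[ss3 ss4] [sr1 sle1]]] : (s <= s1 /\ s <= s2 / 2) /\ (s <= s3 /\ s <= s4) /\ s <= r1 /\ s <= 1.
  by rewrite /s !ge_min !lexx ?orbT.
clearbody s.
have v1 : cube m 1 v by apply: cubeS vr2.
have expa w (t : R) : cube m s w -> `|t| <= s ->
   `|h (fun l => w l + t * v l) - \sum_(i < k.+1) t ^+ i * a i w| <= B * `|t| ^+ k.+1.
  move=> ws ts; pose z := upd w m t.
  have zs : cube m.+1 s z by move=> l; rewrite ltnS leq_eqVlt /z /upd; case: eqP => //= _ lm; exact: ws.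
  have zm : z m = t by rewrite /z /upd eqxx.
  have zl l : (l < m)%N -> z l = w l by move=> lm; rewrite /z /upd ltn_eqF.
  have := hs1 z (cubeS (leqnn _) ss1 zs); rewrite zm.
  have -> : h (T^~ z) = h (fun l => w l + t * v l).
    apply: dep_h.
      move=> l lm; rewrite /T zl // zm; apply: le_trans (ler_normD _ _) _; rewrite normrM.
      have := ler_pM (normr_ge0 _) (normr_ge0 _) ts (v1 l lm); have := ws l lm; lra.
    by move=> l lm; rewrite /T zl // zm.
  have -> : \sum_(i < k.+1) t ^+ i * a i z = \sum_(i < k.+1) t ^+ i * a i w.
    apply: eq_bigr => i _; congr (_ * _); apply: dep_a => //.
    exact: cubeS (leqnSn m) ss3 zs.
  move=> ->; rewrite addrC addKr normrM normrX mulrC ler_wpM2r // ?exprn_ge0 //.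
  by apply: hB; apply: cubeS ss4 zs.
have [i0 i0k ai0] : exists2 i0, (i0 <= k)%N & a i0 (fun=> 0) != 0.
  apply: contrapT => hno; move/eqP: fk; apply.
  have [B1 B10 hB1] := hf k.+1.
  have := @poly_small_coef0 R (\poly_(i < k.+1) f i v) (B + B1) s k.+1 s0 _ k (ltnSn k).
  rewrite coef_poly ltnSn; apply => y y0 ys; rewrite horner_poly.
  have ny : `|y| = y by rewrite gtr0_norm.
  have e1 := expa (fun=> 0) y (cube0 (ltW s0)); rewrite ny in e1; have {}e1 := e1 ys.
  rewrite big1 ?subr0 in e1; last first.
    move=> i _; apply/eqP; rewrite mulf_eq0; apply/orP; right; apply/negPn/negP => ai; apply: hno.
    by exists i => //; rewrite -ltnS.
  have e2 := hB1 v y; rewrite ny in e2; have {}e2 := e2 (cubeS (leqnn _) r21 vr2) (le_trans ys sr1).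
  have E : (fun l => 0 + y * v l) = (fun i => y * v i) by apply/funext => l; rewrite add0r.
  rewrite E in e1; rewrite mulrDl.
  have -> : \sum_(i < k.+1) f i v * y ^+ i = h (fun i => y * v i) - (h (fun i => y * v i) - \sum_(i < k.+1) y ^+ i * f i v).
    by rewrite subKr; apply: eq_bigr => i _; rewrite mulrC.
  by apply: le_trans (ler_normB _ _) _; exact: lerD.
have [CL CL0 hL] := lagrange_coef_bound R k.
have na : 0 < `|a i0 (fun=> 0)| by rewrite normr_gt0.
have na2 : 0 < `|a i0 (fun=> 0)| / 2 by rewrite divr_gt0.
have [s5 s50 hs5] := germ_cont (ga i0) na2.
pose c0 := `|a i0 (fun=> 0)| / 2.
pose c1 := c0 / (2 * (CL + 1)).
have CL1 : 0 < CL + 1 by rewrite ltr_wpDl.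
have c10 : 0 < c1 by rewrite divr_gt0 // mulr_gt0.
pose c := Num.min (c1 / 2) (1 / k.+1%:R).
have cp : 0 < c by rewrite lt_min; apply/andP; split; apply: divr_gt0; rewrite ?ltr0n.
pose r := Num.min (Num.min s s5) (c1 / (2 * (B + 1))).
have B1 : 0 < B + 1 by rewrite ltr_wpDl // ltW.
have rp : 0 < r by rewrite !lt_min s0 s50 divr_gt0 // mulr_gt0.
have [[rs rs5] rB] : (r <= s /\ r <= s5) /\ r <= c1 / (2 * (B + 1)) by rewrite /r !ge_min !lexx ?orbT.
exists v, k, c, r; split => // w de wr de0 der.
have al : c0 <= `|a i0 w|.
  have := hs5 w (cubeS (leqnn _) rs5 wr); have := ler_normD (a i0 w) (a i0 (fun=> 0) - a i0 w).
  by rewrite addrC subrK distrC /c0; lra.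
have de1 : de <= 1 by lra.
have [l hl] : exists l : 'I_k.+1, c1 * de ^+ k < `|\sum_(i < k.+1) (de * (l.+1%:R / k.+1%:R)) ^+ i * a i w|.
  apply: contrapT => hno.
  have := hL (\poly_(i < k.+1) (de ^+ i * a i w)) (c1 * de ^+ k) (size_poly _ _) _ i0.
  rewrite coef_poly ltnS i0k normrM normrX (gtr0_norm de0) => hq.
  have {}hq : de ^+ i0 * `|a i0 w| <= CL * (c1 * de ^+ k).
    apply: hq => l; rewrite leNgt; apply/negP => hl; apply: hno; exists l; apply: lt_le_trans hl _.
    rewrite horner_poly le_eqVlt; apply/orP; left; apply/eqP; congr `|_|.
    by apply: eq_bigr => i _; rewrite [in RHS]exprMn mulrAC.
  have d1 : de ^+ k <= de ^+ i0 by apply: ler_wiXn2l => //; exact: ltW.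
  have d0 : 0 < de ^+ i0 by rewrite exprn_gt0.
  have c1e : (CL + 1) * c1 = c0 / 2 by rewrite /c1; field; rewrite gt_eqF.
  have e1 : c0 * de ^+ i0 <= de ^+ i0 * `|a i0 w| by rewrite mulrC ler_pM2l.
  have e2 : CL * (c1 * de ^+ k) <= CL * c1 * de ^+ i0.
    by rewrite -mulrA; do 2!apply: ler_wpM2l => //; exact: ltW.
  have e3 : CL * c1 * de ^+ i0 <= c0 / 2 * de ^+ i0.
    by apply: ler_wpM2r; [exact: ltW|rewrite -c1e; nra].
  have c00 : 0 < c0 * de ^+ i0 by rewrite mulr_gt0.
  lra.
have kp : 0 < k.+1%:R :> R by [].
have t0 : 0 < de * (l.+1%:R / k.+1%:R) by rewrite mulr_gt0 // divr_gt0.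
have tde : de * (l.+1%:R / k.+1%:R) <= de.
  by rewrite ler_piMr ?(ltW de0) // ler_pdivrMr // mul1r ler_nat ltn_ord.
exists (de * (l.+1%:R / k.+1%:R)); split => //.
  rewrite ler_pM2l //; apply: le_trans (_ : 1 / k.+1%:R <= _); first by rewrite ge_min lexx orbT.
  by rewrite ler_pM2r ?invr_gt0 // ler1n.
set t := de * _ in hl t0 tde *.
have ts : `|t| <= s by rewrite gtr0_norm //; lra.
have := expa w t (cubeS (leqnn _) rs wr) ts; set S := \sum_(i < k.+1) _ in hl *; set H := h _ => hH.
have tk : `|t| ^+ k.+1 <= de ^+ k * de.
  by rewrite -exprSr lerXn2r ?nnegrE // ?(ltW de0) // gtr0_norm.
have dk : 0 < de ^+ k by rewrite exprn_gt0.
have Bd : B * de <= c1 / 2.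
  have : (B + 1) * r <= c1 / 2.
    apply: le_trans (ler_wpM2l (ltW B1) rB) _; rewrite le_eqVlt; apply/orP; left; apply/eqP; field.
    by rewrite gt_eqF.
  have := ler_wpM2l (ltW B0) der; nra.
have e4 : B * `|t| ^+ k.+1 <= c1 / 2 * de ^+ k.
  apply: le_trans (ler_wpM2l (ltW B0) tk) _.
  by rewrite [de ^+ k * de]mulrC mulrA ler_pM2r.
have cc : c * de ^+ k <= c1 / 2 * de ^+ k by rewrite ler_pM2r // ge_min lexx.
have := ler_normD H (S - H); rewrite addrC subrK distrC; lra.
Qed.

End Submersive.

Lemma submersive_ball (R : realType) m d (phi : 'I_d -> (nat -> R) -> R) (dphi : 'I_d -> nat -> (nat -> R) -> R)
   (C0 r0 : R) (J : 'I_d -> 'I_m) (sg : nat -> R) (rho0 : R) :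
  0 < C0 -> 0 < r0 -> (forall i l, germ m (dphi i l)) ->
  (forall (i : 'I_d) x y (e : R), 0 <= e -> cube m r0 x -> cube m r0 y -> closep m e x y ->
    `|phi i y - phi i x - \sum_(l < m) (y l - x l) * dphi i l x| <= C0 * e ^+ 2) ->
  ~ gz m (fun x => \det (\matrix_(a, b) dphi b (J a) x)) -> (forall l, `|sg l| = 1) -> 0 < rho0 ->
  exists (M : nat) (r : R), 0 < r /\ forall w (de : R), cube m r w -> orth m sg w -> 0 < de -> de <= r ->
    exists w', [/\ closep m de w w', cube m rho0 w' & forall u : 'rV[R]_d, `|u - \row_i phi i w'| <= de ^+ M ->
      exists w'', [/\ cube m rho0 w'', orth m sg w'' & \row_i phi i w'' = u]].
Proof.
move=> C00 r00 gd T20 nz hsg rho00.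
have gh : germ m (fun x => \det (\matrix_(a, b) dphi b (J a) x)).
  exact: (germ_det (M := fun a b => dphi b (J a))).
have [v [k [c [r1 [ov v1 c0 r10 low]]]]] := orth_lower hsg gh nz.
have [C2 [s2 [C20 s20 _ L2]]] := @germs_lip _ ('I_d * 'I_m)%type m (fun p => dphi p.1 p.2) (fun p => gd _ _).
have gadj : forall p : 'I_d * 'I_d, germ m (fun x => (\adj (\matrix_(a, b) dphi b (J a) x)) p.1 p.2).
  by move=> p; apply: (germ_adj (M := fun a b => dphi b (J a))).
have [C4 [s4 [C40 s40 B4 _]]] := germs_lip gadj.
have [vm vm0 hvm] := fin_min_pos (fun l : 'I_m => ov l (ltn_ord l)).
pose q := Num.min (Num.min r0 r1) (Num.min (Num.min s2 s4) rho0).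
have q0 : 0 < q by rewrite !lt_min r00 r10 s20 s40.
have [[qr0 qr1] [[qs2 qs4] qrho]] : (q <= r0 /\ q <= r1) /\ (q <= s2 /\ q <= s4) /\ q <= rho0.
  by rewrite /q !ge_min !lexx ?orbT.
clearbody q.
pose C := C0 + C2.
have Cp : 0 < C by rewrite addr_gt0.
have cW s x : q <= s -> cube m q x -> cube m s x by move=> rs; exact: cubeS.
have T2 (i : 'I_d) x y (e : R) : 0 <= e -> cube m q x -> cube m q y -> closep m e x y ->
    `|phi i y - phi i x - \sum_(l < m) (y l - x l) * dphi i l x| <= C * e ^+ 2.
  move=> e0 xr yr cl; apply: le_trans (T20 i x y e e0 (cW _ _ qr0 xr) (cW _ _ qr0 yr) cl) _.
  by apply: ler_wpM2r; [exact: exprn_ge0|rewrite lerDl ltW].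
have LD (i : 'I_d) (l : 'I_m) x y (e : R) : 0 <= e -> cube m q x -> cube m q y -> closep m e x y ->
    `|dphi i l y - dphi i l x| <= C * e.
  move=> e0 xr yr cl; apply: le_trans (L2 (i, l) x y e e0 (cW _ _ qs2 xr) (cW _ _ qs2 yr) cl) _.
  by apply: ler_wpM2r => //; rewrite lerDr ltW.
pose D : R := d%:R + 1.
have dr0 : 0 <= d%:R :> R by rewrite ler0n.
have D0 : 0 < D by rewrite ltr_wpDl.
have [C5 C5E] : exists C5, C5 = D * C4 / c by eexists.
have C50 : 0 < C5 by rewrite C5E divr_gt0 // mulr_gt0.
have D20 : 0 < D ^+ 2 by rewrite exprn_gt0.
have Q1 : 0 < 2 * C5 by rewrite mulr_gt0.
have Q2 : 0 < 6 * C5 * C * D ^+ 2.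
  by rewrite -!mulrA mulr_gt0 // mulr_gt0 // mulr_gt0.
have Q3 : 0 < 2 * D / (c * vm) by rewrite divr_gt0 ?mulr_gt0.
pose Q := 1 + D + 2 * C5 + 6 * C5 * C * D ^+ 2 + 2 * D / (c * vm).
have Q0 : 0 < Q by rewrite /Q; lra.
pose r := Num.min (q / 3) (1 / Q).
have rp : 0 < r by rewrite lt_min !divr_gt0.
have rq : r <= q / 3 by rewrite ge_min lexx.
have rQ : Q * r <= 1.
  have h : r <= 1 / Q by rewrite ge_min lexx orbT.
  by apply: le_trans (ler_wpM2l (ltW Q0) h) _; rewrite mulrCA divff ?gt_eqF ?mulr1.
exists (k + k + 3)%N, r; split => // w de wr ow de0 der.
have deQ : Q * de <= 1 by apply: le_trans rQ; rewrite ler_pM2l.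
have small X : 0 <= X -> X <= Q -> X * de <= 1.
  by move=> X0 XQ; apply: le_trans deQ; rewrite ler_pM2r.
have de1 : de <= 1 by have := small 1 ler01; rewrite mul1r; apply; rewrite /Q; lra.
have deD : D * de <= 1 by apply: small; [exact: ltW|rewrite /Q; lra].
have deC5 : 2 * C5 * de <= 1 by apply: small; [exact: ltW|rewrite /Q; lra].
have deC : 6 * C5 * C * D ^+ 2 * de <= 1 by apply: small; [exact: ltW|rewrite /Q; lra].
have deV : 2 * D * de <= c * vm.
  have : 2 * D / (c * vm) * de <= 1 by apply: small; [exact: ltW|rewrite /Q; lra].
  by rewrite mulrAC ler_pdivrMr ?mulr_gt0 // mul1r.
have rr1 : r <= r1 by lra.
have [t [tl tu ht]] := low w de (cubeS (leqnn _) rr1 wr) de0 (le_trans der rr1).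
have t0 : 0 < t by apply: lt_le_trans tl; rewrite mulr_gt0.
pose w' l := w l + t * v l.
have ww' : closep m de w w'.
  move=> l lm; rewrite /w' addrC addKr normrM (gtr0_norm t0) -[leRHS]mulr1 ler_pM ?(ltW t0) //.
  exact: v1.
have w'q2 : cube m (r + de) w' := closep_cube ww' wr.
have dk0 : 0 < de ^+ k by rewrite exprn_gt0.
pose rho := de ^+ (k + 2).
have rhop : 0 < rho by rewrite exprn_gt0.
have rho2 : rho <= de ^+ 2.
  by rewrite /rho exprD ler_piMl ?exprn_ge0 ?(ltW de0) // exprn_ile1 // ltW.
have Drho : D * rho <= de * 1.
  apply: le_trans (ler_wpM2l (ltW D0) rho2) _; rewrite expr2 mulrA mulrC ler_pM2l //.
have shc y : `|y| <= rho -> closep m (D * rho) w' (shiftp J w' y).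
  move=> yr; have h := shift_close J w' y 0; rewrite shiftp0 subr0 in h.
  apply: closepW h; apply: le_trans (ler_wpM2l dr0 yr) _; by rewrite ler_pM2r // lerDl.
have shq y : `|y| <= rho -> cube m q (shiftp J w' y).
  by move=> yr; apply: cubeS (closep_cube (shc y yr) w'q2) => //; lra.
have w'q : cube m q w' by apply: cubeS w'q2 => //; lra.
exists w'; split => //; first exact: cW qrho w'q.
pose A := Amat dphi id J w'.
have AE : A = \matrix_(a, b) dphi b (J a) w' by [].
have hp : 0 < c * de ^+ k by rewrite mulr_gt0.
have dA : c * de ^+ k <= `|\det A| by rewrite AE.
have uA : A \in unitmx by rewrite unitmxE unitfE -normr_gt0; apply: lt_le_trans dA.
pose b := C4 / (c * de ^+ k).
have b0 : 0 < b by rewrite divr_gt0.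
have hb i j : `|invmx A i j| <= b.
  rewrite /invmx uA mxE normrM normfV mulrC; apply: ler_pM => //.
    by rewrite AE; apply: (B4 (i, j)); exact: cW.
  by rewrite lef_pV2 // ?posrE // normr_gt0; move: uA; rewrite unitmxE unitfE.
pose K := D * b.
have K0 : 0 < K by rewrite mulr_gt0.
have KE : K = C5 / de ^+ k by rewrite /K /b C5E; field; rewrite !gt_eqF.
have hK (u : 'rV[R]_d) : `|u *m invmx A| <= K * `|u|.
  apply: le_trans (rV_mulmx_le u (ltW b0) hb) _.
  by apply: ler_wpM2r => //; rewrite /K ler_pM2r // lerDl.
have [_ hsur] : (forall y y', `|y| <= rho -> `|y'| <= rho -> `|y - y'| <= 2 * K * `|Psi phi id J w' y - Psi phi id J w' y'|) /\
  (forall u, `|u - Psi phi id J w' 0| <= rho / (2 * K) -> exists2 y, `|y| <= rho & Psi phi id J w' y = u).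
  apply: (local_inverse (A := A) (e := 3 * C * D ^+ 2 * rho)) => //.
  - by rewrite !mulr_ge0 ?exprn_ge0 // ltW.
  - move=> y y' yr y'r.
    have h := @Psi_lin _ m d d phi dphi C q Cp T2 LD id J w' w' y y' _ (ltW (mulr_gt0 D0 rhop)) w'q (shq y yr) (shq y' y'r) (shc y' y'r).
    apply: le_trans h _; apply: ler_wpM2r => //.
    have h2 : `|y - y'| <= 2 * rho by apply: le_trans (ler_normB _ _) _; clear -yr y'r; lra.
    have kD : d%:R <= D by rewrite /D lerDl.
    have kD2 : d%:R ^+ 2 <= D ^+ 2 by rewrite lerXn2r ?nnegrE // ltW.
    have h3 : C * d%:R * (D * rho) <= C * D ^+ 2 * rho.
      rewrite expr2 -!mulrA ler_pM2l // ler_wpM2r //; by rewrite mulr_ge0 // ltW.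
    have h4 : C * d%:R ^+ 2 * `|y - y'| <= C * D ^+ 2 * (2 * rho).
      by apply: ler_pM => //; rewrite ?mulr_ge0 ?exprn_ge0 ?ler_pM2l // ltW.
    clear -h3 h4; lra.
  rewrite KE /rho exprD.
  have -> : C5 / de ^+ k * (3 * C * D ^+ 2 * (de ^+ k * de ^+ 2)) = (6 * C5 * C * D ^+ 2 * de) * de / 2.
    by field; rewrite gt_eqF.
  rewrite ler_pM2r ?invr_gt0 // -[leRHS]mulr1; apply: ler_pM => //; last exact: ltW.
  by rewrite mulr_ge0 // ltW.
move=> u hu.
have [y yr hy] : exists2 y, `|y| <= rho & Psi phi id J w' y = u.
  apply: hsur; have -> : Psi phi id J w' 0 = \row_i phi i w' by apply/rowP => i; rewrite !mxE shiftp0.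
  apply: le_trans hu _; rewrite KE /rho.
  have -> : de ^+ (k + 2) / (2 * (C5 / de ^+ k)) = de ^+ (k + k + 2) / (2 * C5).
    by rewrite !exprD; field; rewrite !gt_eqF.
  rewrite ler_pdivlMr ?mulr_gt0 // addnS exprS mulrAC ler_piMl ?exprn_ge0 ?(ltW de0) //.
  by rewrite mulrC.
exists (shiftp J w' y); split; first exact: cW qrho (shq y yr).
  move=> l lm; have h1 := shc y yr l lm; set s := shiftp J w' y l in h1 *.
  have h2 : - (D * rho) <= sg l * (s - w' l).
    have : `|sg l * (s - w' l)| <= D * rho by rewrite normrM hsg mul1r.
    by rewrite ler_norml => /andP[].
  have h3 : t * vm <= sg l * w' l.
    rewrite /w' mulrDr; have := ow l lm; have := ler_wpM2l (ltW t0) (hvm (Ordinal lm)) => /=.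
    by rewrite mulrCA; clear; lra.
  have h4 : de * c * vm <= t * vm by rewrite ler_pM2r.
  have h5 : D * rho <= de * (D * de).
    by apply: le_trans (ler_wpM2l (ltW D0) rho2) _; rewrite expr2 mulrCA.
  have h6 : de * (2 * D * de) <= de * (c * vm) by rewrite ler_pM2l.
  have h7 : 0 < de * (D * de) by rewrite !mulr_gt0.
  have -> : sg l * s = sg l * (s - w' l) + sg l * w' l by ring.
  clear -h2 h3 h4 h5 h6 h7; lra.
by rewrite -hy; apply/rowP => i; rewrite !mxE.
Qed.

Section AnalyticGerm.
Variable R : realType.
Local Notation pt := (nat -> R).

Definition torow n (w : pt) : 'rV[R]_n := \row_i w i.
Definition ofrow n (v : 'rV[R]_n) : pt := fun i => if insub i is Some j then v ord0 j else 0.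

Lemma ofrowE n (v : 'rV[R]_n) (i : 'I_n) : ofrow v i = v ord0 i.
Proof. by rewrite /ofrow valK. Qed.

Lemma an_prod n r (I : Type) (s : seq I) (F : I -> pt -> R) (b : I -> R) :
  (forall i : I, an n r (F i) (b i)) -> an n r (fun x => \prod_(i <- s) F i x) (\prod_(i <- s) b i).
Proof.
move=> h; elim: s => [|i s IH].
  by apply: (an_ext (F := fun=> 1)) (an_cst _ _ 1) => [x _|]; rewrite big_nil ?normr1.
rewrite big_cons; apply: (an_ext _ (lexx _)) (an_mul (h i) IH) => x _; by rewrite big_cons.
Qed.

Lemma an_sum n r (I : Type) (s : seq I) (P : pred I) (F : I -> pt -> R) (b : I -> R) :
  (forall i : I, an n r (F i) (b i)) ->
  an n r (fun x => \sum_(i <- s | P i) F i x) (\sum_(i <- s | P i) b i).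
Proof.
move=> h; elim: s => [|i s IH].
  by apply: (an_ext (F := fun=> 0)) (an_cst _ _ 0) => [x _|]; rewrite big_nil ?normr0.
rewrite big_cons; case: ifP => Pi.
  by apply: (an_ext _ (lexx _)) (an_add (h i) IH) => x _; rewrite big_cons Pi.
by apply: (an_ext _ (lexx _)) IH => x _; rewrite big_cons Pi.
Qed.

Definition shell n (H : {ffun 'I_n -> nat} -> R) k :=
  \sum_(a : {ffun 'I_n -> 'I_k.+1} | (k == 0%N) || [exists i, a i == k :> nat]) H (cube_idx a).

Lemma cube_sum n (H : {ffun 'I_n -> nat} -> R) N :
  \sum_(a : {ffun 'I_n -> 'I_N.+1}) H (cube_idx a) = \sum_(k < N.+1) shell H k.
Proof.
elim: N => [|N IH]; first by rewrite big_ord_recl big_ord0 addr0 /shell.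
rewrite big_ord_recr /= -IH (bigID (fun a : {ffun 'I_n -> 'I_N.+2} => [exists i, a i == N.+1 :> nat])) /=.
rewrite addrC; congr (_ + _).
pose h (b : {ffun 'I_n -> 'I_N.+1}) : {ffun 'I_n -> 'I_N.+2} := [ffun i => widen_ord (leqnSn _) (b i)].
pose h' (a : {ffun 'I_n -> 'I_N.+2}) : {ffun 'I_n -> 'I_N.+1} := [ffun i => inord (a i)].
rewrite (reindex_onto h h') /=.
  apply: eq_big => [b|b _].
    apply/andP; split.
      by apply/existsP => -[k]; rewrite ffunE /= ltn_eqF.
    by apply/eqP/ffunP => i; apply/val_inj; rewrite !ffunE /= inordK.
  by congr H; apply/ffunP => i; rewrite !ffunE.
move=> a /existsPn ha; apply/ffunP => i; apply/val_inj; rewrite !ffunE /= inordK //.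
by have := ltn_ord (a i); rewrite ltnS leq_eqVlt (negbTE (ha i)).
Qed.

Lemma analytic_germ n (F : 'rV[R]_n -> R) x0 : analytic_at F x0 ->
  germ n (fun w => F (x0 + torow n w)).
Proof.
move=> [r [c [r0 h]]]; pose rho := r / 2.
have rho0 : 0 < rho by rewrite divr_gt0.
have inb w : cube n rho w -> ball x0 r (x0 + torow n w).
  move=> wr; rewrite -ball_normE /= opprD addrA subrr add0r normrN.
  apply: le_lt_trans (_ : rho < r); last by rewrite /rho; lra.
  by apply: rV_norm_le => [|j]; [exact: ltW|rewrite mxE; exact: wr].
have mE w a : monomial a (x0 + torow n w - x0) = \prod_(i < n) w i ^+ a i.
  by rewrite /monomial; apply: eq_bigr => i _; rewrite addrC addKr mxE.
have [|[M hM] _] := h (x0 + torow n (fun=> rho)).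
  by apply: inb => i _; rewrite gtr0_norm.
pose G a (w : pt) := c a * \prod_(i < n) w i ^+ a i.
pose b a := `|c a| * \prod_(i < n) rho ^+ a i.
have aG a : an n rho (G a) (b a).
  apply: an_mul; first exact: an_cst.
  apply: an_prod => i; elim: (a i) => [|k IH].
    by apply: (an_ext (F := fun=> 1)) (an_cst _ _ 1) => [x _|]; rewrite expr0 ?normr1.
  apply: (an_ext _ _ (an_mul (an_var rho (ltn_ord i)) IH)) => [x _|]; by rewrite exprS.
exists rho, M; split => //.
apply: (an_ser (D := fun k w => shell (G^~ w) k) (b := shell b)).
- by move=> k; apply: (an_sum _ _ (F := fun a => G (cube_idx a))).
- have bM N : \sum_(k < N.+1) shell b k <= M.
    rewrite -cube_sum; apply: le_trans (hM N); apply: ler_sum => a _.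
    rewrite normrM mE ler_pM //; first by apply: prodr_ge0 => i _; rewrite exprn_ge0 // ltW.
    by rewrite ger0_norm // prodr_ge0 // => i _; rewrite exprn_ge0 // ltW.
  case=> [|N]; last exact: bM.
  rewrite big_ord0; apply: le_trans (bM 0%N); rewrite big_ord_recl big_ord0 addr0.
  apply: sumr_ge0 => a _; rewrite mulr_ge0 //; apply: prodr_ge0 => i _; by rewrite exprn_ge0 // ltW.
- move=> w wr e e0; have [_ /cvgrPdist_le /(_ _ e0) [N0 _ hN]] := h _ (inb w wr).
  exists N0.+1 => -[|N] // NN; rewrite -cube_sum distrC.
  have := hN N NN; congr (`| _ - _| <= _); apply: eq_bigr => a _; by rewrite mE.
Qed.

End AnalyticGerm.

(** * The ball condition for subanalytic sets *)

Section SemianalyticParametrization.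
Variable R : realType.
Local Notation pt := (nat -> R).

Lemma mu_sign m (G : pt -> R) (sg : pt) : mu m G ->
  nr m (fun x => nr m (fun x' => orth m sg x -> orth m sg x' -> 0 < G x -> 0 < G x')).
Proof.
move=> [b [u [gu u0 hG]]].
have n0 : 0 < `|u (fun=> 0)| / 2 by rewrite divr_gt0 // normr_gt0.
have [r r0 h] := nr_and hG (germ_cont gu n0).
have us x : cube m r x -> 0 < u (fun=> 0) * u x.
  move=> /h[_]; set a := u (fun=> 0) in u0 n0 *; move: (u x) => c hc.
  have : `|a * (c - a)| <= `|a| * (`|a| / 2) by rewrite normrM; apply: ler_wpM2l.
  have a2 : `|a| * `|a| = a * a by rewrite -normrM ger0_norm // -expr2 sqr_ge0.
  have : 0 < a * a by rewrite -expr2 exprn_even_gt0.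
  rewrite ler_norml mulrA a2 => ? /andP[]; lra.
have ms x : orth m sg x -> 0 < mono m b sg * mono m b x.
  move=> hx; rewrite /mono -big_split /=; apply: prodr_gt0 => i _; rewrite -exprMn exprn_gt0 //.
  exact: hx.
exists r => // x xr; exists r => // x' x'r ox ox'; have [-> _] := h x xr; have [-> _] := h x' x'r.
have := ms x ox; have := ms x' ox'; have := us x xr; have := us x' x'r.
move: (mono m b sg) (mono m b x) (mono m b x') (u _) (u x) (u x') => s a a' v c c' h1 h2 h3 h4 h5.
have : 0 < (s * v) * (a' * c').
  have -> : (s * v) * (a' * c') = (s * a') * (v * c') by ring.
  by rewrite mulr_gt0.
have : 0 < (s * v) * (a * c).
  have -> : (s * v) * (a * c) = (s * a) * (v * c) by ring.
  by rewrite mulr_gt0.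
by rewrite (pmulr_lgt0 _ h5) => sv; rewrite (pmulr_rgt0 _ sv).
Qed.

Lemma semianalytic_param (W : Type) (U : set_system W) (UU : UltraFilter U) N
   (A : set 'rV[R]_N) (z : W -> 'rV[R]_N) (B : R) :
  semianalytic A -> ae U (fun y => A (z y)) -> ae U (fun y => `|z y| <= B) ->
  exists m w (psi : nat -> pt -> R) (sg : pt) rho, [/\ full U m w /\ (forall i, (i < N)%N -> germ m (psi i)),
    (forall l, `|sg l| = 1), 0 < rho, ae U (fun y => orth m sg (w y) /\ z y = torow N (psi^~ (w y))) &
    forall v, cube m rho v -> orth m sg v -> A (torow N (psi^~ v))].
Proof.
move=> sA zA zB.
have FU : ProperFilter U by apply: ultra_proper.
have /choice[zl hzl] : forall j : 'I_N, exists l, infr U (fun y => z y ord0 j - l).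
  move=> j; apply: (standard_part UU (M := B)); apply: aeW zB => y; apply: le_trans; exact: rV_coord_le.
pose zi : 'rV[R]_N := \row_j zl j.
have [N0 [oN [Nz [p [q [f [g [hfg AE]]]]]]]] := sA zi.
pose x y := ofrow (z y - zi).
have ix : infpt U N x.
  move=> i lin e e0; apply: aeW (hzl (Ordinal lin) e e0) => y.
  by rewrite /x (ofrowE _ (Ordinal lin)) !mxE.
have zx y : z y = zi + torow N (x y).
  by apply/rowP => j; rewrite !mxE /x ofrowE !mxE addrC subrK.
have nN : nr N (fun v => N0 (zi + torow N v)).
  have := open_nbhs_nbhs (conj oN Nz); rewrite -nbhs_ballE => -[e /= e0 he].
  exists (e / 2); first by rewrite divr_gt0.
  move=> v vr; apply: he; rewrite -ball_normE /= opprD addrA subrr add0r normrN.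
  apply: le_lt_trans (_ : e / 2 < _); last by lra.
  by apply: rV_norm_le => [|j]; [rewrite ltW // divr_gt0|rewrite mxE; exact: vr].
have exm : exists m, `[< exists w psi, fac U N x m w psi >].
  by exists N; apply/asboolP; exists x, (fun i v => v i); exact: fac_id.
case: (ex_minnP exm) => m /asboolP[w [psi f1]] mmin.
have fw : full U m w.
  split; first by case: f1.
  move=> m' w' p' m'm f2; have : (m <= m')%N; last by rewrite leqNgt m'm.
  by apply: mmin; apply/asboolP; exists w', (fun i v => psi i (p'^~ v)); exact: (fac_comp UU f1 f2).
have [i hi] : exists i : 'I_p, ae U (fun y => forall j, f i j (z y) = 0 /\ 0 < g i j (z y)).
  apply: contrapT => hno.
  have /filter_forall h1 : forall i : 'I_p, ae U (fun y => ~ forall j, f i j (z y) = 0 /\ 0 < g i j (z y)).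
    by move=> i; apply: (ae_not UU) => hi; apply: hno; exists i.
  have h2 := infpt_nr UU ix nN.
  have [y [[h3 h4] h5]] := ae_ex UU (ae_and UU (ae_and UU h2 zA) h1).
  have : (A `&` N0) (z y) by split => //; rewrite zx.
  by rewrite AE => -[_ [k hk]]; exact: (h5 k hk).
pose F j v := f i j (zi + torow N v).
pose G j v := g i j (zi + torow N v).
have gF j : germ N (F j) by apply: analytic_germ; have [h _] := hfg i j; exact: h.
have gG j : germ N (G j) by apply: analytic_germ; have [_ h] := hfg i j; exact: h.
have depF j : nr N (fun v => forall v', (forall l, (l < N)%N -> v l = v' l) -> F j v = F j v').
  by have [r r0 h] := germ_dep (gF j); exists r => // v vr v'; exact: h.
have depG j : nr N (fun v => forall v', (forall l, (l < N)%N -> v l = v' l) -> G j v = G j v').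
  by have [r r0 h] := germ_dep (gG j); exists r => // v vr v'; exact: h.
have [iw gpsi e1] := f1.
have aeF j : ae U (fun y => F j (psi^~ (w y)) = 0 /\ 0 < G j (psi^~ (w y))).
  apply: aeW (ae_and UU (ae_and UU e1 hi) (ae_and UU (infpt_nr UU ix (depF j)) (infpt_nr UU ix (depG j)))).
  move=> y [[h1 /(_ j)[h2 h3]] [h4 h5]]; rewrite -(h4 _ h1) -(h5 _ h1) /F /G -zx; split => //.
have gzF j : gz m (fun v => F j (psi^~ v)).
  apply: contrapT => /(full_germ_neq0 UU fw (germ_comp (gF j) gpsi)) h.
  have [y [h1 [h2 _]]] := ae_ex UU (ae_and UU h (aeF j)); by move/eqP: h1.
have ngG j : ~ gz m (fun v => G j (psi^~ v)).
  move=> /(infpt_nr UU iw) h; have [y [h1 [_ h2]]] := ae_ex UU (ae_and UU h (aeF j)).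
  by move: h2; rewrite h1 ltxx.
have gG' j : germ m (fun v => G j (psi^~ v)) by exact: germ_comp (gG j) gpsi.
have ngP : ~ gz m (fun v => \prod_(j <- index_enum 'I_q) G j (psi^~ v)) by exact: ngz_prod.
have gP : germ m (fun v => \prod_(j <- index_enum 'I_q) G j (psi^~ v)) by apply: germ_prod.
have [w2 [p2 [f2 muP]]] := Sprop_all UU fw gP ngP.
have fw2 := full_fac UU fw f2; have f3 := fac_comp UU f1 f2.
pose psi2 i v := psi i (p2^~ v).
have [iw2 gpsi2 e2] := f3; have [_ gp2 e2'] := f2.
have muG j : mu m (fun v => G j (psi2^~ v)).
  apply: (mu_factor (G := fun v => \prod_(k <- index_enum 'I_q | k != j) G k (psi2^~ v))).
  - exact: (germ_comp (gG j) gpsi2).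
  - by apply: germ_prod => k _; exact: (germ_comp (gG k) gpsi2).
  - by apply: mu_eq muP => v; rewrite (bigD1 j).
pose sg l : R := if `[< ae U (fun y => 0 < w2 y l) >] then 1 else -1.
have hsg l : `|sg l| = 1 by rewrite /sg; case: asboolP => _; rewrite ?normrN normr1.
have ow2 : ae U (fun y => orth m sg (w2 y)).
  apply: (ae_all UU) => l lm; have h1 := full_neq0 UU fw2 lm.
  rewrite /sg; case: asboolP => [h|/(ae_not UU) h]; last first.
    by apply: aeW (ae_and UU h h1) => y [/negP h2 h3]; rewrite mulN1r oppr_gt0 lt_neqAle h3 leNgt.
  by apply: aeW h => y; rewrite mul1r.
have /choice[r1 hr1] : forall j, exists r : R, 0 < r /\ forall v, cube m r v ->
    F j (psi2^~ v) = 0 /\ (orth m sg v -> 0 < G j (psi2^~ v)).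
  move=> j; have [r r0 h] := nr_and (nr_comp (gzF j) gp2) (mu_sign sg (muG j)).
  have aeG : ae U (fun y => 0 < G j (psi2^~ (w2 y))).
    apply: aeW (ae_and UU (ae_and UU e2 hi) (infpt_nr UU ix (depG j))).
    by move=> y [[h1 /(_ j)[_ h3]] h5]; rewrite -(h5 _ h1) /G -zx.
  have [y [[h1 h2] h3]] := ae_ex UU (ae_and UU (ae_and UU aeG ow2) (infpt_cube UU iw2 r0)).
  have [_ [s s0 hs]] := h _ h3.
  exists (Num.min r s); split; first by rewrite lt_min r0.
  move=> v vr; have vr' : cube m r v by apply: cubeS vr => //; rewrite ge_min lexx.
  have [h4 _] := h v vr'; split => // ov.
  by apply: (hs v) => //; apply: cubeS vr => //; rewrite ge_min lexx orbT.
have [r2 r20 hr2] := fin_min_pos (fun j => proj1 (hr1 j)).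
have [r3 r30 hr3] := nr_comp nN gpsi2.
exists m, w2, (fun i v => ofrow zi i + psi2 i v), sg, (Num.min r2 r3).
have E v : torow N (fun k => ofrow zi k + psi2 k v) = zi + torow N (psi2^~ v).
  by apply/rowP => k; rewrite !mxE ofrowE mxE.
split => //.
- by split => // k kN; apply: germ_add; [exact: germ_cst|exact: (proj1 (gpsi2 k kN))].
- by rewrite lt_min r20.
- apply: aeW (ae_and UU ow2 e2) => y [h1 h2]; split => //; rewrite E zx; congr (_ + _).
  by apply/rowP => k; rewrite !mxE h2.
- move=> v vr ov; rewrite E.
  have vr2 : cube m r2 v by apply: cubeS vr => //; rewrite ge_min lexx.
  have vr3 : cube m r3 v by apply: cubeS vr => //; rewrite ge_min lexx orbT.
  have Nv : N0 (zi + torow N (psi2^~ v)) by exact: hr3.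
  suff : (A `&` N0) (zi + torow N (psi2^~ v)) by case.
  rewrite AE; split => //; exists i => j; have [_ h] := hr1 j.
  by have [h1 h2] := h v (cubeS (leqnn _) (hr2 j) vr2); split; [exact: h1|exact: h2].
Qed.

End SemianalyticParametrization.

Section WellBalled.
Variable R : realType.
Local Notation pt := (nat -> R).

Definition WB d (X : set 'rV[R]_d) (x : 'rV[R]_d) := exists (M : nat) (rho : R), 0 < rho /\
  forall a (de : R), X a -> `|a - x| < rho -> 0 < de -> de < rho ->
    exists b, `|b - a| <= de /\ forall y, `|y - b| <= de ^+ M -> X y.

Lemma baire_ultra d (V : nat -> set 'rV[R]_d) : (forall j, open (V j) /\ V j !=set0) ->
  exists U : set_system 'rV[R]_d, [/\ UltraFilter U,
    forall j0, U [set y | exists2 j, (j0 <= j)%N & V j y] &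
    forall D : nat -> set 'rV[R]_d, (forall n, open (D n) /\ dense (D n)) -> U [set y | forall n, D n y]].
Proof.
move=> hV.
pose F : set_system 'rV[R]_d := fun S => exists (j0 : nat) (D : nat -> set 'rV[R]_d),
  (forall n, open (D n) /\ dense (D n)) /\ forall y j, (j0 <= j)%N -> V j y -> (forall n, D n y) -> S y.
have dT : dense ([set: 'rV[R]_d]) by move=> O [x Ox] _; exists x.
have FF : ProperFilter F.
  split.
    move=> [j0 [D [hD h]]]; have [oV V0] := hV j0.
    by have [y [Vy Dy]] := Baire hD V0 oV; apply: (h y j0) => // n; exact: Dy.
  split.
  - by exists 0%N, (fun=> setT); split => // n; split; [exact: openT|].
  - move=> S S' [j0 [D [hD h]]] [j1 [D' [hD' h']]].
    exists (maxn j0 j1), (fun n => D n `&` D' n); split.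
      move=> n; have [? ?] := hD n; have [? ?] := hD' n; split; first exact: openI.
      exact: denseI.
    move=> y j; rewrite geq_max => /andP[h0 h1] Vy DD; split.
      by apply: (h y j) => // n; have [] := DD n.
    by apply: (h' y j) => // n; have [] := DD n.
  - move=> S S' SS' [j0 [D [hD h]]]; exists j0, D; split => // y j h0 Vy Dy; apply: SS'; exact: (h y j).
have [U [UU FU]] := ultraFilterLemma FF.
exists U; split => //.
- move=> j0; apply: FU; exists j0, (fun=> setT); split; last by move=> y j h Vy _; exists j.
  by move=> n; split; [exact: openT|].
- by move=> D hD; apply: FU; exists 0%N, D; split => // y j _ _; apply.
Qed.

Lemma subanalytic_WB d (X : set 'rV[R]_d) x : X = closure (interior X) -> subanalytic X -> WB X x.
Proof.
move=> fX sX; apply: contrapT => nWB.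
have /choice[ad had] : forall j : nat, exists p : 'rV[R]_d * R, [/\ X p.1, `|p.1 - x| < 1 / j.+1%:R, 0 < p.2, p.2 < 1 / j.+1%:R &
    forall b, `|b - p.1| <= p.2 -> exists2 y, `|y - b| <= p.2 ^+ j & ~ X y].
  move=> j; apply: contrapT => hno; apply: nWB; exists j, (1 / j.+1%:R); split; first by rewrite divr_gt0 ?ltr0n.
  move=> a de Xa ax de0 de1; apply: contrapT => hb; apply: hno; exists (a, de); split => // b ba.
  apply: contrapT => hy; apply: hb; exists b; split => // y yb.
  by apply: contrapT => nXy; apply: hy; exists y.
pose V j := (ad j).1.
pose O j := interior X `&` ball (ad j).1 ((ad j).2 / 2).
have hO j : open (O j) /\ O j !=set0.
  have [h1 h2 h3 h4 h5] := had j; split.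
    by apply: openI; [exact: open_interior|exact: ball_open].
  by move: h1; rewrite fX => /(_ (ball (ad j).1 ((ad j).2 / 2))); apply; apply: nbhsx_ballx; rewrite divr_gt0.
have [U [UU UO UD]] := baire_ultra hO.
have [N [oN [Nx [q [A [sA [cA AE]]]]]]] := sX x.
have aX : ae U X.
  by apply: aeW (UO 0%N) => y [j _ [/interior_subset]].
have aN : ae U N.
  have := open_nbhs_nbhs (conj oN Nx); rewrite -nbhs_ballE => -[e /= e0 he].
  pose j0 := Num.bound (2 / e).
  have hj0 : 2 / j0.+1%:R <= e.
    have := archi_boundP (_ : 0 <= 2 / e); rewrite divr_ge0 ?(ltW e0) // => /(_ isT) hb.
    rewrite ler_pdivrMr // mulrC -ler_pdivrMr //; apply: le_trans (ltW hb) _; by rewrite ler_nat.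
  apply: aeW (UO j0) => y [j jj [_ yj]]; apply: he; rewrite -ball_normE /=.
  have [_ h2 h3 h4 _] := had j; move: yj; rewrite -ball_normE /= => yj.
  have h5 : 1 / j.+1%:R <= 1 / j0.+1%:R :> R by rewrite !mul1r lef_pV2 ?posrE ?ltr0n // ler_nat.
  have h6 : 2 / j0.+1%:R = 1 / j0.+1%:R + 1 / j0.+1%:R :> R by rewrite -mulrDl.
  have := ler_distD (ad j).1 x y; rewrite (distrC x (ad j).1).
  rewrite h6 in hj0; move: (1 / j.+1%:R) (1 / j0.+1%:R) h2 h4 h5 hj0 => c1 c2 *; lra.
have /choice[z hz] : forall y, exists z, (X `&` N) y -> A z /\ lsubmx z = y.
  move=> y; have [h|h] := pselect ((X `&` N) y); last by exists 0.
  by move: (h); rewrite AE => -[z Az zy]; exists z.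
have aA : ae U (fun y => A (z y) /\ lsubmx (z y) = y).
  by apply: aeW (ae_and UU aX aN) => y; exact: hz.
have [B hB] : exists B, forall v, A v -> `|v| <= B.
  have [B [_ hB]] := compact_bounded cA; exists (B + 1) => v Av; apply: (hB (B + 1)); first by rewrite ltrDl.
  exact: subset_closure.
have aA1 : ae U (fun y => A (z y)) by apply: aeW aA => y [].
have aB : ae U (fun y => `|z y| <= B) by apply: aeW aA1 => y; exact: hB.
have [m [w [psi [sg [rho [[fw gpsi] hsg rho0 hw hA]]]]]] := semianalytic_param UU sA aA1 aB.
pose phi (i : 'I_d) v := psi i v.
have gphi i : germ m (phi i) by apply: gpsi; rewrite ltn_addr.
have phiE v : \row_i phi i v = lsubmx (torow (d + q) (psi^~ v)).
  by apply/rowP => i; rewrite !mxE.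
have Xphi v : cube m rho v -> orth m sg v -> X (\row_i phi i v).
  move=> vr ov; have : (X `&` N) (\row_i phi i v); last by case.
  by rewrite AE phiE; exists (torow (d + q) (psi^~ v)) => //; exact: hA.
have yphi : ae U (fun y => y = \row_i phi i (w y)).
  by apply: aeW (ae_and UU aA hw) => y [[_ h1] [_ h2]]; rewrite phiE -h2.
have [dphi [C [r [C0 r0 gd T2]]]] := germs_taylor gphi.
have [[J nz]|[h [D [r' [gh nh r'0 hD hm]]]]] := rank_dichotomy C0 r0 gphi gd T2; last first.
  have h1 := infpt_cube UU (proj1 fw) r'0; have h2 := full_germ_neq0 UU fw gh nh.
  have [y [[h3 h4] [h5 h6]]] := ae_ex UU (ae_and UU (ae_and UU h1 h2) (ae_and UU yphi (UD D hD))).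
  by have [n] := hm _ h3 h4; rewrite -h5; apply; exact: h6.
have [CL [rL [CL0 rL0 _ LP]]] := germs_lip gphi.
pose rho1 := Num.min rho rL.
have rho10 : 0 < rho1 by rewrite lt_min rho0.
have [rr1 rr2] : rho1 <= rho /\ rho1 <= rL by rewrite /rho1 !ge_min !lexx orbT.
clearbody rho1.
have [M [s [s0 hs]]] := submersive_ball C0 r0 gd T2 nz hsg rho10.
pose K := 2 * CL + 1.
have K1 : 1 <= K by rewrite /K; lra.
have K0 : 0 < K by apply: lt_le_trans K1.
pose s1 := Num.min s (1 / K ^+ M).
have KM : 0 < K ^+ M by rewrite exprn_gt0.
have s10 : 0 < s1 by rewrite lt_min s0 divr_gt0.
have [s1s s1K] : s1 <= s /\ s1 <= 1 / K ^+ M by rewrite /s1 !ge_min !lexx orbT.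
clearbody s1.
pose j0 := maxn M.+1 (Num.bound (1 / s1)).
have hj0 : 1 / j0.+1%:R <= s1.
  have := archi_boundP (_ : 0 <= 1 / s1); rewrite divr_ge0 ?(ltW s10) // => /(_ isT) hb.
  rewrite ler_pdivrMr ?ltr0n // mulrC -ler_pdivrMr //; apply: le_trans (ltW hb) _; rewrite ler_nat.
  exact: leqW (leq_maxr _ _).
have q0 : 0 < Num.min s rho1 by rewrite lt_min s0.
have [y [[[j jj Oy] h1] [h2 [h3 _]]]] := ae_ex UU (ae_and UU (ae_and UU (UO j0) yphi)
   (ae_and UU (infpt_cube UU (proj1 fw) q0) hw)).
have [Xa _ de0 de1 viol] := had j; set a := (ad j).1 in Xa viol; set de := (ad j).2 in de0 de1 viol.
have des : de <= s1.
  apply: ltW; apply: lt_le_trans de1 _; apply: le_trans hj0.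
  by rewrite !mul1r lef_pV2 ?posrE ?ltr0n // ler_nat.
have deK : de / K <= de by rewrite ler_pdivrMr // ler_peMr // ltW.
have deK0 : 0 < de / K by rewrite divr_gt0.
have h2s : cube m s (w y) by apply: cubeS h2 => //; rewrite ge_min lexx.
have h2r : cube m rL (w y) by apply: cubeS h2 => //; rewrite ge_min rr2 orbT.
have [w' [c1 c2 c3]] := hs (w y) (de / K) h2s h3 deK0 (le_trans deK (le_trans des s1s)).
have de_1 : de <= 1.
  apply: le_trans des (le_trans s1K _); rewrite ler_pdivrMr // mul1r exprn_ege1 //.
have [|y' y'1 y'2] := viol (\row_i phi i w').
  have d1 : `|\row_i phi i w' - y| <= de / 2.
    rewrite {1}h1; apply: rV_norm_le; first by rewrite divr_ge0 // ltW.
    move=> i; rewrite !mxE; apply: le_trans (LP i _ _ _ (ltW deK0) h2r (cubeS (leqnn _) rr2 c2) c1) _.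
    rewrite mulrCA ler_pM2l // ler_pdivrMr // /K; lra.
  have [_ ] := Oy; rewrite -ball_normE /= -/a -/de distrC => d2.
  have := ler_distD y (\row_i phi i w') a; lra.
have [|w'' [e1 e2 e3]] := c3 y'.
  apply: le_trans y'1 _.
  have jM : (M.+1 <= j)%N by apply: leq_trans jj; exact: leq_maxl.
  apply: le_trans (_ : de ^+ M.+1 <= _); first by apply: ler_wiXn2l => //; exact: ltW.
  rewrite exprS expr_div_n mulrC ler_pM2l ?exprn_gt0 //; apply: le_trans des _.
  by rewrite -[leRHS]mul1r.
by apply: y'2; rewrite -e3; apply: Xphi => //; exact: cubeS rr1 e1.
Qed.

End WellBalled.

(** * Functions with bounded derivatives *)

Section CbCalculus.
Variables (R : realType) (d : nat).
Local Notation V := 'rV[R]_d.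
Implicit Types (O : set V) (F G : V -> R) (p q c : V) (B Q r : R) (n : nat).

Definition bl c r : set V := [set p | `|p - c| < r].

Definition t1 O F (dF : 'I_d -> V -> R) Q := forall p q, O p -> O q ->
  `|F q - F p - \sum_i (q - p) ord0 i * dF i p| <= Q * `|q - p| ^+ 2.

(* [cb n O B F]: the partial derivatives of [F] up to order [n] exist on [O], where they are
   bounded by [B]; differentiability is expressed by a quadratic Taylor remainder. *)
Fixpoint cb n O B F : Prop := (forall p, O p -> `|F p| <= B) /\
  if n is n'.+1 then exists dF Q, t1 O F dF Q /\ forall i, cb n' O B (dF i) else True.

Lemma cb_bd n O B F : cb n O B F -> forall p, O p -> `|F p| <= B.
Proof. by case: n => [|n] []. Qed.

Lemma cb_le n n' O O' B B' F : (n' <= n)%N -> O' `<=` O -> B <= B' -> cb n O B F -> cb n' O' B' F.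
Proof.
elim: n n' F => [|n IH] [|n'] F //= nn OO BB [h1 h2].
- by split=> // p /OO /h1 h; exact: le_trans h BB.
- by split=> // p /OO /h1 h; exact: le_trans h BB.
have [dF [Q [t h]]] := h2; split; first by move=> p /OO /h1 h'; exact: le_trans h' BB.
exists dF, Q; split; first by move=> p q /OO Op /OO Oq; exact: t.
by move=> i; exact: IH (h i).
Qed.

Lemma cb_ext n O B F G : (forall p, O p -> F p = G p) -> cb n O B F -> cb n O B G.
Proof.
move=> FG; case: n => [|n] /= [h1 h2]; (split; first by move=> p Op; rewrite -FG //; exact: h1) => //.
have [dF [Q [t h]]] := h2; exists dF, Q; split=> // p q Op Oq; rewrite -!FG //; exact: t.
Qed.

Lemma cb_eq n O B F G : F =1 G -> cb n O B F -> cb n O B G.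
Proof. by move=> /funext ->. Qed.

Lemma cb_cst n O (c : R) B : `|c| <= B -> cb n O B (fun=> c).
Proof.
elim: n c => [|n IH] c cB /=; split=> //.
exists (fun _ _ => 0), 0; split.
  by move=> p q _ _; rewrite subrr sub0r normrN big1 ?normr0 ?mul0r // => i _; rewrite mulr0.
by move=> i; apply: IH; rewrite normr0; apply: le_trans cB.
Qed.

Lemma cb_add n O B B' F G : cb n O B F -> cb n O B' G -> cb n O (B + B') (fun p => F p + G p).
Proof.
elim: n F G => [|n IH] F G /= [h1 h2] [h1' h2'].
  by split=> // p Op; apply: le_trans (ler_normD _ _) _; rewrite lerD // ?h1 // h1'.
split; first by move=> p Op; apply: le_trans (ler_normD _ _) _; rewrite lerD // ?h1 // h1'.
have [dF [Q [t h]]] := h2; have [dG [Q' [t' h']]] := h2'.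
exists (fun i p => dF i p + dG i p), (Q + Q'); split; last by move=> i; exact: IH.
move=> p q Op Oq.
have -> : F q + G q - (F p + G p) - \sum_i (q - p) ord0 i * (dF i p + dG i p) =
   (F q - F p - \sum_i (q - p) ord0 i * dF i p) + (G q - G p - \sum_i (q - p) ord0 i * dG i p).
  under eq_bigr do rewrite mulrDr; rewrite big_split /=; ring.
by apply: le_trans (ler_normD _ _) _; rewrite mulrDl lerD // ?t // t'.
Qed.

Lemma cb_scale n O B F (a : R) : cb n O B F -> cb n O (`|a| * B) (fun p => a * F p).
Proof.
elim: n F => [|n IH] F /= [h1 h2]; (split; first by move=> p Op; rewrite normrM ler_wpM2l // h1) => //.
have [dF [Q [t h]]] := h2; exists (fun i p => a * dF i p), (`|a| * Q); split; last by move=> i; exact: IH.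
move=> p q Op Oq.
have -> : a * F q - a * F p - \sum_i (q - p) ord0 i * (a * dF i p) =
   a * (F q - F p - \sum_i (q - p) ord0 i * dF i p).
  by rewrite !mulrBr mulr_sumr; congr (_ - _); apply: eq_bigr => i _; ring.
by rewrite normrM -mulrA ler_wpM2l // t.
Qed.

Lemma cb_sub n O B B' F G : cb n O B F -> cb n O B' G -> cb n O (B + B') (fun p => F p - G p).
Proof.
move=> hF hG; apply: (cb_eq (F := fun p => F p + -1 * G p)); first by move=> p; rewrite mulN1r.
by apply: cb_add => //; have := cb_scale (-1) hG; rewrite normrN1 mul1r.
Qed.

Lemma cb_sum n O (I : Type) (s : seq I) (F : I -> V -> R) (B : I -> R) :
  (forall i, cb n O (B i) (F i)) -> cb n O (\sum_(i <- s) B i) (fun p => \sum_(i <- s) F i p).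
Proof.
move=> h; elim: s => [|i s IH].
  by apply: (cb_eq (F := fun=> 0)) => [p|]; rewrite big_nil //; apply: cb_cst; rewrite normr0.
by rewrite big_cons; apply: (cb_eq _ (cb_add (h i) IH)) => p; rewrite big_cons.
Qed.

Lemma sum_row_le (v : V) (c : 'I_d -> R) B : (forall i, `|c i| <= B) ->
  `|\sum_i v ord0 i * c i| <= d%:R * B * `|v|.
Proof.
move=> h; apply: le_trans (ler_norm_sum _ _ _) _.
apply: le_trans (_ : \sum_(i < d) `|v| * B <= _).
  by apply: ler_sum => i _; rewrite normrM ler_pM // rV_coord_le.
by rewrite sumr_const card_ord -[X in X <= _]mulr_natl le_eqVlt; apply/orP; left; apply/eqP; ring.
Qed.

Lemma t1_incr O F dF Q B : t1 O F dF Q -> (forall p, O p -> `|F p| <= B) ->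
  (forall i p, O p -> `|dF i p| <= B) -> forall p q, O p -> O q ->
  `|F q - F p| <= (`|Q| + d%:R * B + 2 * B) * Num.min 1 `|q - p|.
Proof.
move=> t h1 h2 p q Op Oq.
have B0 : 0 <= B by apply: le_trans (h1 p Op).
have dB : 0 <= d%:R * B by rewrite mulr_ge0.
have [h|h] := leP 1 `|q - p|.
  rewrite mulr1; apply: le_trans (ler_normB _ _) _.
  have := h1 p Op; have := h1 q Oq; have := normr_ge0 Q; lra.
have -> : F q - F p = (F q - F p - \sum_i (q - p) ord0 i * dF i p) + \sum_i (q - p) ord0 i * dF i p by rewrite subrK.
apply: le_trans (ler_normD _ _) _.
have h3 := t p q Op Oq; have h4 := sum_row_le (q - p) (fun i => h2 i p Op).
have n0 := normr_ge0 (q - p).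
have h5 : Q * `|q - p| ^+ 2 <= `|Q| * `|q - p|.
  rewrite expr2 mulrA; apply: le_trans (_ : `|Q| * `|q - p| * `|q - p| <= _).
    by apply: ler_wpM2r => //; apply: ler_wpM2r => //; exact: ler_norm.
  by rewrite ler_piMr ?mulr_ge0 // ltW.
have h6 : 0 <= 2 * B * `|q - p| by rewrite !mulr_ge0.
lra.
Qed.

Lemma t1_incr2 O F G dF dG Q Q' B B' : t1 O F dF Q -> t1 O G dG Q' -> (forall p, O p -> `|F p| <= B) ->
  (forall i p, O p -> `|dF i p| <= B) -> (forall p, O p -> `|G p| <= B') ->
  (forall i p, O p -> `|dG i p| <= B') -> forall p q, O p -> O q ->
  `|(F q - F p) * (G q - G p)| <= (`|Q| + d%:R * B + 2 * B) * (`|Q'| + d%:R * B' + 2 * B') * `|q - p| ^+ 2.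
Proof.
move=> t t' h1 h2 h3 h4 p q Op Oq.
have B0 : 0 <= B by apply: le_trans (h1 p Op).
have B0' : 0 <= B' by apply: le_trans (h3 p Op).
have k0 : 0 <= `|Q| + d%:R * B + 2 * B by rewrite !addr_ge0 // mulr_ge0.
have k0' : 0 <= `|Q'| + d%:R * B' + 2 * B' by rewrite !addr_ge0 // mulr_ge0.
rewrite normrM expr2 mulrACA; apply: ler_pM => //.
  apply: le_trans (t1_incr t h1 h2 Op Oq) _; apply: ler_wpM2l => //; by rewrite ge_min lexx orbT.
apply: le_trans (t1_incr t' h3 h4 Op Oq) _; apply: ler_wpM2l => //; by rewrite ge_min lexx orbT.
Qed.

Lemma cb_mul n O B B' F G : cb n O B F -> cb n O B' G -> cb n O (2 ^+ n * (B * B')) (fun p => F p * G p).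
Proof.
elim: n F G => [|n IH] F G hF hG.
  by case: hF hG => h1 _ [h1' _]; split=> // p Op; rewrite expr0 mul1r normrM ler_pM // ?h1 // h1'.
have hF' := cb_le (leqnSn n) (@subset_refl _ O) (lexx B) hF.
have hG' := cb_le (leqnSn n) (@subset_refl _ O) (lexx B') hG.
case: (hF) => h1 [dF [Q [t h]]]; case: (hG) => h1' [dG [Q' [t' h']]].
split.
  move=> p Op; rewrite normrM; apply: le_trans (ler_pM _ _ (h1 p Op) (h1' p Op)) _ => //.
  have b0 := le_trans (normr_ge0 _) (h1 p Op); have b0' := le_trans (normr_ge0 _) (h1' p Op).
  by rewrite ler_peMl ?mulr_ge0 // exprn_ege1 // ler1n.
exists (fun i p => dF i p * G p + F p * dG i p).
exists (`|Q| * `|B'| + `|B| * `|Q'| + (`|Q| + d%:R * B + 2 * B) * (`|Q'| + d%:R * B' + 2 * B')); split; last first.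
  move=> i; have := cb_add (IH _ _ (h i) hG') (IH _ _ hF' (h' i)); apply: cb_le => //.
  by rewrite exprS le_eqVlt; apply/orP; left; apply/eqP; ring.
move=> p q Op Oq; have bF := h1 p Op; have bG := h1' p Op.
set S := \sum_i _.
have -> : F q * G q - F p * G p - S =
  (F q - F p - \sum_i (q - p) ord0 i * dF i p) * G p + F p * (G q - G p - \sum_i (q - p) ord0 i * dG i p) +
  (F q - F p) * (G q - G p).
  have -> : S = (\sum_i (q - p) ord0 i * dF i p) * G p + F p * (\sum_i (q - p) ord0 i * dG i p).
    rewrite mulr_suml mulr_sumr -big_split /=; apply: eq_bigr => i _; ring.
  ring.
apply: le_trans (ler_normD _ _) _; rewrite [leRHS]mulrDl; apply: lerD; last first.
  exact: (t1_incr2 t t' h1 (fun i z => cb_bd (h i) (p := z)) h1' (fun i z => cb_bd (h' i) (p := z)) Op Oq).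
apply: le_trans (ler_normD _ _) _; rewrite [leRHS]mulrDl; apply: lerD; rewrite normrM.
  rewrite mulrAC; apply: ler_pM => //; last by apply: le_trans bG _; exact: ler_norm.
  by apply: le_trans (t p q Op Oq) _; apply: ler_wpM2r; [exact: exprn_ge0|exact: ler_norm].
rewrite -mulrA; apply: ler_pM => //; first by apply: le_trans bF _; exact: ler_norm.
by apply: le_trans (t' p q Op Oq) _; apply: ler_wpM2r; [exact: exprn_ge0|exact: ler_norm].
Qed.

Lemma cb_prod n O (I : Type) (s : seq I) (F : I -> V -> R) B : 1 <= B ->
  (forall i, cb n O B (F i)) -> cb n O ((2 ^+ n * B) ^+ size s) (fun p => \prod_(i <- s) F i p).
Proof.
move=> B1 h; elim: s => [|i s IH].
  by apply: (cb_eq (F := fun=> 1)) => [p|]; rewrite ?big_nil // expr0; apply: cb_cst; rewrite normr1.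
rewrite /= exprS -mulrA; apply: (cb_eq _ (cb_mul (h i) IH)) => p; by rewrite big_cons.
Qed.

Lemma cb_inv n : exists (K : R) (N : nat), 1 <= K /\ forall O B F, 1 <= B -> cb n O B F ->
  (forall p, O p -> B^-1 <= F p) -> cb n O (K * B ^+ N) (fun p => (F p)^-1).
Proof.
elim: n => [|n [K [N [K1 IH]]]].
  exists 1, 1%N; split=> // O B F B1 [hF _] lF; split=> // p Op.
  have B0 : 0 < B by apply: lt_le_trans B1.
  have F0 : 0 < F p by apply: lt_le_trans (lF p Op); rewrite invr_gt0.
  by rewrite mul1r expr1 gtr0_norm ?invr_gt0 // -[leRHS]invrK lef_pV2 ?posrE ?invr_gt0 // lF.
have E1 : 1 <= 2 ^+ n * (2 ^+ n * K * K).
  have e2 : 1 <= 2 ^+ n :> R by rewrite exprn_ege1 // ler1n.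
  by apply: mulr_ege1 => //; apply: mulr_ege1 => //; apply: mulr_ege1.
exists (2 ^+ n * (2 ^+ n * K * K)), (N + N + 1)%N; split=> //.
move=> O B F B1 hF lF.
have hF' := cb_le (leqnSn n) (@subset_refl _ O) (lexx B) hF.
have hG := IH O B F B1 hF' lF.
have B0 : 0 < B by apply: lt_le_trans B1.
have Fp p : O p -> 0 < F p by move=> Op; apply: lt_le_trans (lF p Op); rewrite invr_gt0.
have iF p : O p -> (F p)^-1 <= B.
  by move=> Op; rewrite -[leRHS]invrK lef_pV2 ?posrE ?invr_gt0 ?Fp // lF.
case: (hF) => h1 [dF [Q [t h]]]; split.
  move=> p Op; rewrite gtr0_norm ?invr_gt0 ?Fp //; apply: le_trans (iF p Op) _.
  by rewrite exprD expr1 mulrA ler_peMl ?(ltW B0) // mulr_ege1 // ?exprn_ege1.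
exists (fun i p => -1 * dF i p * ((F p)^-1 * (F p)^-1)).
exists (B * B * `|Q| + B * B * B * ((`|Q| + d%:R * B + 2 * B) * (`|Q| + d%:R * B + 2 * B))); split; last first.
  move=> i; have := cb_mul (cb_scale (-1) (h i)) (cb_mul hG hG); rewrite normrN1 mul1r.
  apply: cb_le => //; rewrite exprD expr1 exprD le_eqVlt; apply/orP; left; apply/eqP; ring.
move=> p q Op Oq.
have Fp0 := Fp p Op; have Fq0 := Fp q Oq.
have -> : (F q)^-1 - (F p)^-1 - \sum_i (q - p) ord0 i * (-1 * dF i p * ((F p)^-1 * (F p)^-1)) =
  - ((F p)^-1 * (F p)^-1 * (F q - F p - \sum_i (q - p) ord0 i * dF i p)) +
  ((F p)^-1 * (F p)^-1 * (F q)^-1) * ((F q - F p) * (F q - F p)).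
  have -> : \sum_i (q - p) ord0 i * (-1 * dF i p * ((F p)^-1 * (F p)^-1)) =
    - ((F p)^-1 * (F p)^-1) * \sum_i (q - p) ord0 i * dF i p.
    by rewrite mulr_sumr; apply: eq_bigr => i _; ring.
  by field; rewrite !gt_eqF.
have jB : `|(F p)^-1 * (F p)^-1| <= B * B.
  by rewrite normrM !gtr0_norm ?invr_gt0 // ler_pM ?invr_ge0 ?(ltW Fp0) // iF.
apply: le_trans (ler_normD _ _) _; rewrite [leRHS]mulrDl normrN; apply: lerD; rewrite normrM.
  rewrite -[leRHS]mulrA; apply: ler_pM => //.
  by apply: le_trans (t p q Op Oq) _; apply: ler_wpM2r; [exact: exprn_ge0|exact: ler_norm].
rewrite -[leRHS]mulrA; apply: ler_pM => //.
  by rewrite normrM ler_pM // gtr0_norm ?invr_gt0 // iF.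
exact: (t1_incr2 t t h1 (fun i z => cb_bd (h i) (p := z)) h1 (fun i z => cb_bd (h i) (p := z)) Op Oq).
Qed.

End CbCalculus.

Section CbBalls.
Variables (R : realType) (d : nat).
Local Notation V := 'rV[R]_d.
Implicit Types (O : set V) (F G : V -> R) (p q c : V) (B Q r : R) (n : nat).

Lemma bl_seg c r p q (t : R) : bl c r p -> bl c r q -> 0 <= t -> t <= 1 -> bl c r (p + t *: (q - p)).
Proof.
rewrite /bl /= => hp hq t0 t1.
have -> : p + t *: (q - p) - c = (1 - t) *: (p - c) + t *: (q - c) by apply/rowP => i; rewrite !mxE; ring.
apply: le_lt_trans (ler_normD _ _) _; rewrite !normrZ (ger0_norm t0) ger0_norm ?subr_ge0 //.
have [->|tn] := eqVneq t 0; first by rewrite subr0 mul1r mul0r addr0.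
have tp : 0 < t by rewrite lt_def tn.
have s0 : 0 <= 1 - t by lra.
have := ler_wpM2l s0 (ltW hp).
have : t * `|q - c| < t * r by rewrite ltr_pM2l.
lra.
Qed.

Lemma bl_open c r : open (bl c r).
Proof.
rewrite (_ : bl c r = ball c r); first exact: ball_open.
by apply/seteqP; split => p; rewrite /bl /= -ball_normE /= distrC.
Qed.

Lemma t1_mvt c r F dF Q p q (k : 'I_d -> R) B : t1 (bl c r) F dF Q -> bl c r p -> bl c r q ->
  (forall (t : R) i, 0 <= t -> t <= 1 -> `|dF i (p + t *: (q - p)) - k i| <= B) ->
  `|F q - F p - \sum_i (q - p) ord0 i * k i| <= d%:R * B * `|q - p|.
Proof.
move=> T bp bq hk; pose z (t : R) := p + t *: (q - p).
pose f t := F (z t) - t * \sum_i (q - p) ord0 i * k i.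
have -> : F q - F p - \sum_i (q - p) ord0 i * k i = f 1 - f 0.
  have z1 : z 1 = q by apply/rowP => i; rewrite !mxE; ring.
  have z0 : z 0 = p by apply/rowP => i; rewrite !mxE; ring.
  by rewrite /f z1 z0; ring.
apply: (@lip_path _ f _ (`|Q| * `|q - p| ^+ 2)); first by rewrite mulr_ge0 ?exprn_ge0.
move=> s t s0 s1 t0 t1.
have zst : z s - z t = (s - t) *: (q - p) by apply/rowP => i; rewrite !mxE; ring.
have -> : f s - f t = \sum_i (z s - z t) ord0 i * (dF i (z t) - k i) +
   (F (z s) - F (z t) - \sum_i (z s - z t) ord0 i * dF i (z t)).
  have -> : \sum_i (z s - z t) ord0 i * (dF i (z t) - k i) =
    \sum_i (z s - z t) ord0 i * dF i (z t) - (s - t) * \sum_i (q - p) ord0 i * k i.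
    rewrite mulr_sumr -sumrB; apply: eq_bigr => i _; rewrite zst !mxE; ring.
  rewrite /f; ring.
apply: le_trans (ler_normD _ _) _; apply: lerD.
  apply: le_trans (sum_row_le _ (fun i => hk t i t0 t1)) _.
  by rewrite zst normrZ mulrCA mulrC.
apply: le_trans (T _ _ (bl_seg bp bq t0 t1) (bl_seg bp bq s0 s1)) _.
rewrite zst normrZ exprMn; have -> : `|Q| * `|q - p| ^+ 2 * `|s - t| ^+ 2 = `|Q| * (`|s - t| ^+ 2 * `|q - p| ^+ 2) by ring.
by apply: ler_wpM2r; [rewrite mulr_ge0 // exprn_ge0|exact: ler_norm].
Qed.

Lemma t1_lip c r F dF Q B p q : t1 (bl c r) F dF Q -> (forall i z, bl c r z -> `|dF i z| <= B) ->
  bl c r p -> bl c r q -> `|F q - F p| <= d%:R * B * `|q - p|.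
Proof.
move=> T hB bp bq; have := @t1_mvt c r F dF Q p q (fun=> 0) B T bp bq.
have -> : \sum_i (q - p) ord0 i * (0 : R) = 0 by rewrite big1 // => i _; rewrite mulr0.
by rewrite subr0; apply => t i t0 t1; rewrite subr0 hB //; exact: bl_seg.
Qed.

Lemma cb1_lip c r F B p q : cb 1 (bl c r) B F -> bl c r p -> bl c r q -> `|F q - F p| <= d%:R * B * `|q - p|.
Proof. by move=> [_ [dF [Q [T h]]]] bp bq; apply: (t1_lip T) => // i z; exact: (proj1 (h i)). Qed.

Lemma t1_quad c r F dF Q B : t1 (bl c r) F dF Q -> (forall i, cb 1 (bl c r) B (dF i)) ->
  t1 (bl c r) F dF (d%:R * (d%:R * B)).
Proof.
move=> T h p q bp bq; have -> : d%:R * (d%:R * B) * `|q - p| ^+ 2 = d%:R * (d%:R * B * `|q - p|) * `|q - p| by ring.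
apply: (t1_mvt T bp bq) => t i t0 t1.
apply: le_trans (cb1_lip (h i) bp (bl_seg bp bq t0 t1)) _.
have B0 : 0 <= B by apply: le_trans (cb_bd (h i) bp).
rewrite addrC addKr normrZ ger0_norm // ler_wpM2l ?mulr_ge0 //.
by rewrite ler_piMl.
Qed.

Lemma t1_unique O F dF dF' Q Q' p i : open O -> t1 O F dF Q -> t1 O F dF' Q' -> O p -> dF i p = dF' i p.
Proof.
move=> oO T T' Op; apply/eqP; rewrite -subr_eq0; apply/negPn/negP => ne.
have := open_nbhs_nbhs (conj oO Op); rewrite -nbhs_ballE => -[e /= e0 he].
set D := dF i p - dF' i p in ne; have D0 : 0 < `|D| by rewrite normr_gt0.
pose K := `|Q| + `|Q'| + 1.
have K0 : 0 < K by rewrite ltr_wpDl // addr_ge0.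
pose h := Num.min (e / 2) (`|D| / (2 * K)).
have h0 : 0 < h by rewrite lt_min !divr_gt0 // mulr_gt0.
have he2 : h <= e / 2 by rewrite ge_min lexx.
have hK : K * h <= `|D| / 2.
  have hh : h <= `|D| / (2 * K) by rewrite ge_min lexx orbT.
  apply: le_trans (ler_wpM2l (ltW K0) hh) _; rewrite le_eqVlt; apply/orP; left; apply/eqP; field; by rewrite gt_eqF.
pose q : V := p + h *: delta_mx ord0 i.
have qp : q - p = h *: delta_mx ord0 i by rewrite /q addrC addKr.
have nq : `|q - p| <= h.
  rewrite qp; apply: rV_norm_le; first exact: ltW.
  by move=> j; rewrite !mxE /=; case: eqP => _; rewrite ?mulr1 ?mulr0 ?normr0 ?gtr0_norm // ltW.
have Oq : O q.
  apply: he; rewrite -ball_normE /= distrC; apply: le_lt_trans nq _; lra.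
have E (k : 'I_d -> R) : \sum_j (q - p) ord0 j * k j = h * k i.
  rewrite (bigD1 i) //= qp !mxE !eqxx mulr1 big1 ?addr0 // => j ne'.
  by rewrite !mxE eqxx (negbTE ne') mulr0 mul0r.
have := T p q Op Oq; have := T' p q Op Oq; rewrite !E => h1 h2.
have n2 : `|q - p| ^+ 2 <= h ^+ 2 by rewrite lerXn2r ?nnegrE // ltW.
have b1 Z : Z * `|q - p| ^+ 2 <= `|Z| * h ^+ 2.
  apply: le_trans (_ : `|Z| * `|q - p| ^+ 2 <= _); first by rewrite ler_wpM2r ?exprn_ge0 // ler_norm.
  exact: ler_wpM2l.
have : h * `|D| <= (`|Q| + `|Q'|) * h ^+ 2.
  rewrite -[X in X * `|D|](gtr0_norm h0) -normrM.
  have -> : h * D = (F q - F p - h * dF' i p) - (F q - F p - h * dF i p) by rewrite /D; ring.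
  apply: le_trans (ler_normB _ _) _; have := b1 Q; have := b1 Q'; rewrite mulrDl; lra.
have -> : (`|Q| + `|Q'|) * h ^+ 2 = h * ((`|Q| + `|Q'|) * h) by ring.
rewrite ler_pM2l // => h3; move: hK; rewrite /K mulrDl mul1r; lra.
Qed.

Lemma cb_glue n O O1 O2 B B' F : open O -> open O1 -> open O2 -> O `<=` O1 `|` O2 -> cb n O B' F ->
  cb n (O `&` O1) B F -> cb n (O `&` O2) B F -> cb n O B F.
Proof.
move=> oO o1 o2 cov; elim: n F => [|n IH] F.
  by move=> _ [h1 _] [h2 _]; split=> // p Op; have [h|h] := cov p Op; [exact: h1|exact: h2].
move=> [_ [dF [Q [T h]]]] [h1 [dF1 [Q1 [T1 h1']]]] [h2 [dF2 [Q2 [T2 h2']]]]; split.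
  by move=> p Op; have [h'|h'] := cov p Op; [exact: h1|exact: h2].
exists dF, Q; split=> // i.
have rT O' : t1 (O `&` O') F dF Q by move=> p q [Op _] [Oq _]; exact: T.
apply: (IH (dF i) (h i)).
  by apply: (cb_ext _ (h1' i)) => p Op; exact: (t1_unique i (openI oO o1) T1 (rT O1)).
by apply: (cb_ext _ (h2' i)) => p Op; exact: (t1_unique i (openI oO o2) T2 (rT O2)).
Qed.

Lemma sums_to_sum (I : Type) (s : seq I) (u : I -> nat -> R) (l : I -> R) :
  (forall i, sums_to (u i) (l i)) -> sums_to (fun k => \sum_(i <- s) u i k) (\sum_(i <- s) l i).
Proof.
move=> h; elim: s => [|i s IH].
  move=> e e0; exists 0%N => N _; rewrite big_nil big1 ?subrr ?normr0 ?(ltW e0) // => k _.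
  by rewrite big_nil.
rewrite big_cons (_ : (fun k => _) = (fun k => u i k + \sum_(i <- s) u i k)); first exact: sums_toD.
by apply/funext => k; rewrite big_cons.
Qed.

Lemma cb_series n c r (F : nat -> V -> R) (B : nat -> R) (BB : R) (f : V -> R) :
  (forall j, cb n.+1 (bl c r) (B j) (F j)) -> (forall N, \sum_(j < N) B j <= BB) ->
  (forall p, bl c r p -> sums_to (F^~ p) (f p)) -> cb n (bl c r) BB f.
Proof.
elim: n F f => [|n IH] F f hF hB hf.
  split=> // p bp; apply: sums_to_le (hf p bp) => // j; exact: (cb_bd (hF j) bp).
split; first by move=> p bp; apply: sums_to_le (hf p bp) => // j; exact: (cb_bd (hF j) bp).
have /choice[dF hdF] : forall j, exists dF, (exists Q, t1 (bl c r) (F j) dF Q) /\ forall i, cb n.+1 (bl c r) (B j) (dF i).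
  by move=> j; have [_ [dF [Q [T h]]]] := hF j; exists dF; split=> //; exists Q.
have T j : t1 (bl c r) (F j) (dF j) (d%:R * (d%:R * B j)).
  have [[Q T] h] := hdF j; apply: (t1_quad T) => i; exact: cb_le (h i).
have /choice[df hdf] : forall ip : 'I_d * V, exists l, bl c r ip.2 -> sums_to (fun j => dF j ip.1 ip.2) l.
  move=> [k p] /=; have [bp|nb] := pselect (bl c r p); last by exists 0.
  have [l hl] : exists l, sums_to (fun j => dF j k p) l; last by exists l.
  by apply: summable_sums_to hB => j; have [_ h] := hdF j; exact: (cb_bd (h k) bp).
exists (fun i p => df (i, p)), (d%:R * (d%:R * BB)); split; last first.
  by move=> i; apply: (IH (fun j => dF j i)) => // [j|p bp]; [have [_ h] := hdF j; exact: h|exact: (hdf (i, p))].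
move=> p q bp bq.
pose u j := F j q - F j p - \sum_i (q - p) ord0 i * dF j i p.
have su : sums_to u (f q - f p - \sum_i (q - p) ord0 i * df (i, p)).
  have s1 := sums_toZ (-1) (hf p bp).
  have s2 := sums_toZ (-1) (sums_to_sum (index_enum 'I_d) (fun i => sums_toZ ((q - p) ord0 i) (hdf (i, p) bp))).
  have := sums_toD (sums_toD (hf q bq) s1) s2; rewrite !mulN1r.
  by congr (sums_to _ _); apply/funext => j; rewrite /u !mulN1r.
apply: (sums_to_le (b := fun j => d%:R * (d%:R * B j) * `|q - p| ^+ 2)) su => [j|N]; first exact: T.
rewrite -mulr_suml; apply: ler_wpM2r; first exact: exprn_ge0.
by rewrite -!mulr_sumr ler_wpM2l // ler_wpM2l.
Qed.

End CbBalls.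

Section CbSmooth.
Variables (R : realType) (d : nat).
Local Notation V := 'rV[R]_d.
Implicit Types (O : set V) (F G : V -> R) (p q c : V) (B Q r : R) (n : nat).

Lemma t1_diff O F dF Q p : open O -> t1 O F dF Q -> O p ->
  differentiable F p /\ forall v : V, 'D_v F p = \sum_i v ord0 i * dF i p.
Proof.
move=> oO T Op.
pose L0 (v : V) : R := \sum_i v ord0 i * dF i p.
have lin : linear (L0 : V -> R).
  move=> a u v; rewrite /L0 /= scaler_sumr -big_split /=; apply: eq_bigr => i _.
  by rewrite !mxE mulrDl -mulrA.
pose L : {linear V -> R} := HB.pack L0 (GRing.isLinear.Build _ _ _ _ L0 lin).
have [B B0 hB] := @fin_sum_bound R 'I_d (fun i => `|dF i p|) (fun i => normr_ge0 _).
have cL : continuous L.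
  apply/linear_bounded_continuous/ex_bound; exists (d%:R * B); apply/nbhs_ballP.
  exists 1 => //= v; rewrite -ball_normE /= sub0r normrN => v1.
  apply: le_trans (sum_row_le v hB) _; rewrite ler_piMr ?mulr_ge0 ?(ltW B0) // ltW //.
have oL : F \o shift p = cst (F p) + L +o_ (0 : V) id.
  apply/eqaddoP => e e0.
  have := open_nbhs_nbhs (conj oO Op); rewrite -nbhs_ballE => -[e1 /= e10 he].
  apply/nbhs_ballP; exists (Num.min e1 (e / (`|Q| + 1))) => /=.
    by rewrite lt_min e10 divr_gt0 // ltr_wpDl.
  move=> v; rewrite -ball_normE /= sub0r normrN lt_min => /andP[v1 v2].
  have Oq : O (v + p) by apply: he; rewrite -ball_normE /= opprD addrCA subrr addr0 normrN.
  have := T p (v + p) Op Oq; rewrite addrK => h.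
  have -> : (F \o shift p - (cst (F p) + L)) v = F (v + p) - F p - \sum_i v ord0 i * dF i p.
    by rewrite !fctE /= opprD addrA.
  apply: le_trans h _; rewrite expr2 mulrA ler_wpM2r //.
  apply: le_trans (_ : (`|Q| + 1) * `|v| <= _); last first.
    by move: v2; rewrite ltr_pdivlMr ?ltr_wpDl // mulrC => /ltW.
  by apply: ler_wpM2r => //; have := ler_norm Q; lra.
have dE := diff_unique cL oL.
have df : differentiable F p by apply/diff_locallyP; rewrite dE.
by split => // v; rewrite deriveE // dE.
Qed.

Lemma cb_Ck n O B F G : open O -> cb n.+1 O B F -> (forall p, O p -> G p = F p) -> Ck_on n O G.
Proof.
move=> oO; elim: n B F G => [|n IH] B F G hF FG.
  have [_ [dF [Q [T h]]]] := hF; move=> p Op.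
  have T' : t1 O G dF Q by move=> p' q' Op' Oq'; rewrite !FG //; exact: T.
  by apply: differentiable_continuous; have [] := t1_diff oO T' Op.
have [_ [dF [Q [T h]]]] := hF.
have T' : t1 O G dF Q by move=> p' q' Op' Oq'; rewrite !FG //; exact: T.
split=> [p Op|v]; first by have [] := t1_diff oO T' Op.
apply: (IH (\sum_i `|v ord0 i| * B) (fun p => \sum_i v ord0 i * dF i p)).
  apply: cb_sum => i; have hi : cb n.+1 O B (dF i) := h i; exact: (cb_scale _ hi).
by move=> p Op; have [_ ->] := t1_diff oO T' Op.
Qed.

Lemma derive_partial F p (v : V) : differentiable F p -> 'D_v F p = \sum_i v ord0 i * 'D_(delta_mx ord0 i) F p.
Proof.
move=> df; rewrite deriveE // {1}(row_sum_delta v) linear_sum; apply: eq_bigr => i _.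
by rewrite linearZ /= deriveE.
Qed.

Lemma diff_mvt O F p q : (forall t : R, 0 <= t -> t <= 1 -> O (p + t *: (q - p))) ->
  (forall z, O z -> differentiable F z) -> exists2 t : R, 0 <= t <= 1 &
  F q - F p = \sum_i (q - p) ord0 i * 'D_(delta_mx ord0 i) F (p + t *: (q - p)).
Proof.
move=> seg dF; pose f (t : R) := F (p + t *: (q - p)).
have der (t : R) : 0 <= t -> t <= 1 -> is_derive t (1 : R) (f : R -> R) ('D_(q - p) F (p + t *: (q - p))).
  move=> t0 t1; have := @diff_derivable _ _ _ F _ (q - p) (dF _ (seg t t0 t1)).
  have E : (fun h : R => h^-1 *: ((F \o shift (p + t *: (q - p))) (h *: (q - p)) - F (p + t *: (q - p)))) =
     (fun h : R => h^-1 *: ((f \o shift t) (h *: 1) - f t)).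
    apply/funext => h; rewrite /f /=; congr (_ *: (F _ - _)).
    by rewrite -[h *: 1]/(h * 1) mulr1 scalerDl addrCA.
  move=> dd; split; first by move: dd; rewrite /derivable E.
  by rewrite /derive E.
have [||t] := @MVT_segment R f (fun t => 'D_(q - p) F (p + t *: (q - p))) 0 1 ler01.
- by move=> t; rewrite in_itv /= => /andP[t0 t1]; apply: der; exact: ltW.
- apply: derivable_within_continuous => t; rewrite in_itv /= => /andP[t0 t1].
  by have [] := der t t0 t1.
rewrite in_itv /= => /andP[t0 t1]; rewrite subr0 mulr1 => E; exists t; first by rewrite t0.
rewrite -(derive_partial (q - p) (dF _ (seg t t0 t1))) -E /f scale0r addr0 scale1r.
by rewrite [p + _]addrC subrK.
Qed.

Lemma smooth_cb (U : set V) F x (rho : R) : (forall p, `|p - x| <= rho -> U p) -> smooth_on U F ->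
  forall n, exists2 B, 0 <= B & cb n (bl x rho) B F.
Proof.
move=> hU.
have sD G : smooth_on U G -> forall v : V, smooth_on U (fun y => 'D_v G y).
  by move=> sG v n; have [_ h] := sG n.+1; exact: h.
have dfb G : smooth_on U G -> forall z, bl x rho z -> differentiable G z.
  by move=> sG z bz; have [h _] := sG 1%N; apply: h; apply: hU; exact: ltW.
have bd G : smooth_on U G -> exists2 B, 0 <= B & forall p, bl x rho p -> `|G p| <= B.
  move=> sG; pose K : set V := [set p | `|p - x| <= rho].
  have cK : compact K.
    apply: bounded_closed_compact.
      exists (`|x| + rho); split; first exact: num_real.
      move=> M hM p /= pK; apply: ltW; apply: le_lt_trans hM.
      rewrite -[p](subrK x) addrC; apply: le_trans (ler_normD _ _) _; by rewrite lerD2l.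
    rewrite (_ : K = closed_ball_ Num.norm x rho); first exact: closed_closed_ball_.
    by apply/seteqP; split => p; rewrite /K /closed_ball_ /= distrC.
  have cG : {within K, continuous G}.
    apply/continuous_in_subspaceT => p; rewrite inE => pK.
    exact: (sG 0%N p (hU p pK)).
  have [M [_ hM]] := compact_bounded (continuous_compact cG cK).
  exists (`|M| + 1) => // p bp; apply: (hM (`|M| + 1)); first by have := ler_norm M; lra.
  by exists p => //; exact: ltW.
move=> sF0 n; elim: n F sF0 => [|n IH] F sF.
  by have [B B0 h] := bd F sF; exists B.
pose dF (i : 'I_d) := fun y => 'D_(delta_mx ord0 i : V) F y.
have /choice[B hB] : forall i, exists B, 0 <= B /\ cb n (bl x rho) B (dF i).
  by move=> i; have [B B0 h] := IH (dF i) (sD F sF _); exists B.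
have /choice[B2 hB2] : forall ij : 'I_d * 'I_d, exists B, 0 <= B /\ forall p, bl x rho p ->
   `|'D_(delta_mx ord0 ij.2 : V) (dF ij.1) p| <= B.
  by move=> ij; have [b b0 h] := bd _ (sD _ (sD F sF (delta_mx ord0 ij.1)) (delta_mx ord0 ij.2)); exists b.
have [b1 b10 hb1] := fin_sum_bound (fun i => proj1 (hB i)).
have [b2 b20 hb2] := fin_sum_bound (fun i => proj1 (hB2 i)).
have [b0 b00 hb0] := bd F sF.
exists (b0 + b1); first by rewrite addr_ge0 // ltW.
split; first by move=> p bp; apply: le_trans (hb0 p bp) _; rewrite lerDl ltW.
exists dF, (d%:R * (d%:R * b2)); split; last first.
  move=> i; have [_ h] := hB i; apply: cb_le h => //; have := hb1 i; lra.
move=> p q bp bq.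
have seg t : 0 <= t -> t <= 1 -> bl x rho (p + t *: (q - p)) by exact: bl_seg.
have [t /andP[t0 t1] ->] := diff_mvt seg (dfb F sF).
set z := p + _.
have -> : \sum_i (q - p) ord0 i * 'D_(delta_mx ord0 i) F z - \sum_i (q - p) ord0 i * dF i p =
   \sum_i (q - p) ord0 i * (dF i z - dF i p).
  by rewrite -sumrB; apply: eq_bigr => i _; rewrite mulrBr.
have -> : d%:R * (d%:R * b2) * `|q - p| ^+ 2 = d%:R * (d%:R * b2 * `|q - p|) * `|q - p| by ring.
apply: sum_row_le => i.
have segz s : 0 <= s -> s <= 1 -> bl x rho (p + s *: (z - p)).
  by move=> s0 s1; apply: bl_seg => //; exact: seg.
have [s /andP[s0 s1] ->] := diff_mvt segz (dfb _ (sD F sF (delta_mx ord0 i))).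
apply: le_trans (sum_row_le (B := b2) _ _) _.
  move=> j; apply: le_trans (hb2 (i, j)); exact: (proj2 (hB2 (i, j))) (segz s s0 s1).
rewrite ler_wpM2l ?mulr_ge0 ?(ltW b20) // /z addrC addKr normrZ ger0_norm //.
by rewrite ler_piMl.
Qed.

End CbSmooth.

(** * Taylor polynomials of the quotient *)

Section HomogeneousPolynomials.
Variables (R : realType) (d : nat).
Local Notation V := 'rV[R]_d.
Implicit Types (F G : V -> R) (p q c v b : V) (B Q r : R) (n j : nat).

Fixpoint hp j F : Prop := if j is j'.+1
  then exists Fi : 'I_d -> V -> R, (forall i, hp j' (Fi i)) /\ forall v, F v = \sum_i v ord0 i * Fi i v
  else exists a, forall v, F v = a.

Lemma hp0 j : hp j (fun=> 0).
Proof.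
elim: j => [|j IH] /=; first by exists 0.
by exists (fun _ _ => 0); split=> // v; rewrite big1 // => i _; rewrite mulr0.
Qed.

Lemma hp_scale j F (a : R) : hp j F -> hp j (fun v => a * F v).
Proof.
elim: j F => [|j IH] F /=; first by move=> [b h]; exists (a * b) => v; rewrite h.
move=> [Fi [h1 h2]]; exists (fun i v => a * Fi i v); split; first by move=> i; exact: IH.
by move=> v; rewrite h2 mulr_sumr; apply: eq_bigr => i _; rewrite mulrCA.
Qed.

Lemma hp_hom j F (t : R) v : hp j F -> F (t *: v) = t ^+ j * F v.
Proof.
elim: j F => [|j IH] F /=; first by move=> [b h]; rewrite !h expr0 mul1r.
move=> [Fi [h1 h2]]; rewrite !h2 mulr_sumr; apply: eq_bigr => i _.
by rewrite !mxE IH // exprS; ring.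
Qed.

Lemma hp_poly j F p v : hp j F -> exists2 P : {poly R}, (size P <= j.+1)%N & forall t, P.[t] = F (p + t *: v).
Proof.
elim: j F => [|j IH] F /=.
  by move=> [b h]; exists b%:P => [|t]; rewrite ?size_polyC ?hornerC ?h //; case: eqP.
move=> [Fi [h1 h2]].
have /choice[P hP] : forall i, exists P : {poly R}, (size P <= j.+1)%N /\ forall t, P.[t] = Fi i (p + t *: v).
  by move=> i; have [P s1 s2] := IH _ (h1 i); exists P.
exists (\sum_i ((p ord0 i)%:P + (v ord0 i)%:P * 'X) * P i).
  apply: leq_trans (size_sum _ _ _) _; apply/bigmax_leqP => i _.
  apply: leq_trans (size_polyMleq _ _) _.
  have [s1 _] := hP i.
  have s2 : (size ((p ord0 i)%:P + (v ord0 i)%:P * 'X : {poly R})%R <= 2)%N.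
    apply: leq_trans (size_polyD _ _) _; rewrite geq_max; apply/andP; split.
      by rewrite size_polyC; case: eqP.
    apply: leq_trans (size_polyMleq _ _) _; rewrite size_polyX size_polyC; by case: eqP.
  by lia.
move=> t; rewrite h2 horner_sum; apply: eq_bigr => i _; have [_ hi] := hP i.
by rewrite !hornerE hi !mxE; congr (_ * _); ring.
Qed.

Lemma cb_coord n c r b i : exists2 B, 0 <= B & cb n (bl c r) B (fun p => (p - b) ord0 i).
Proof.
exists (1 + `|c - b| + `|r|); first by rewrite !addr_ge0.
have bd p : bl c r p -> `|(p - b) ord0 i| <= 1 + `|c - b| + `|r|.
  move=> bp; apply: le_trans (rV_coord_le _ _) _.
  have -> : p - b = (c - b) + (p - c) by apply/rowP => k; rewrite !mxE; ring.
  have := ler_norm r; have := ler_normD (c - b) (p - c); move: bp; rewrite /bl /=; lra.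
case: n => [|n]; split=> //.
exists (fun k _ => (k == i)%:R), 0; split.
  move=> p q _ _; rewrite (bigD1 i) //= eqxx mulr1 big1 => [|k ne]; last by rewrite (negbTE ne) mulr0.
  by rewrite addr0 !mxE mul0r le_eqVlt normr_eq0; apply/orP; left; apply/eqP; ring.
move=> k; apply: cb_cst; case: eqP => _; rewrite ?normr1 ?normr0; last by rewrite !addr_ge0.
by rewrite -addrA lerDl addr_ge0.
Qed.

Lemma hp_cb j F n c r b : hp j F -> exists2 B, 0 <= B & cb n (bl c r) B (fun p => F (p - b)).
Proof.
elim: j F => [|j IH] F /=.
  by move=> [a h]; exists `|a| => //; apply: (cb_eq (F := fun=> a)); [move=> p|exact: cb_cst].
move=> [Fi [h1 h2]].
have /choice[B hB] : forall i, exists B, 0 <= B /\ cb n (bl c r) B (fun p => (p - b) ord0 i * Fi i (p - b)).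
  move=> i; have [B1 B10 hB1] := cb_coord n c r b i; have [B2 B20 hB2] := IH _ (h1 i).
  by exists (2 ^+ n * (B1 * B2)); split; [rewrite !mulr_ge0 ?exprn_ge0|exact: (cb_mul hB1 hB2)].
exists (\sum_i B i); first by apply: sumr_ge0 => i _; case: (hB i).
by apply: (cb_eq _ (cb_sum (index_enum 'I_d) (fun i => proj2 (hB i)))) => p; rewrite h2.
Qed.

Lemma pow_tangent j : exists2 C : R, 0 <= C & forall s t : R, 0 <= s -> s <= 1 -> 0 <= t -> t <= 1 ->
  `|s ^+ j.+1 - t ^+ j.+1 - j.+1%:R * (s - t) * t ^+ j| <= C * `|s - t| ^+ 2.
Proof.
elim: j => [|j [C C0 IH]].
  exists 0 => // s t _ _ _ _; rewrite !expr1 expr0 mulr1 mul1r mul0r le_eqVlt normr_eq0.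
  by apply/orP; left; apply/eqP; ring.
exists (C + j.+1%:R); first by rewrite addr_ge0.
move=> s t s0 s1 t0 t1.
have -> : s ^+ j.+2 - t ^+ j.+2 - j.+2%:R * (s - t) * t ^+ j.+1 =
  s * (s ^+ j.+1 - t ^+ j.+1 - j.+1%:R * (s - t) * t ^+ j) + j.+1%:R * t ^+ j * (s - t) ^+ 2.
  by rewrite [s ^+ j.+2]exprS [t ^+ j.+2]exprS [t ^+ j.+1]exprS -[j.+2%:R]natr1; ring.
apply: le_trans (ler_normD _ _) _; rewrite mulrDl; apply: lerD.
  rewrite normrM (ger0_norm s0); apply: le_trans (ler_piMl _ s1) _ => //; exact: IH.
rewrite normrM normrX normrM normr_nat ler_wpM2r ?exprn_ge0 // ler_piMr //.
by rewrite normrX ger0_norm // exprn_ile1.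
Qed.

Lemma taylor n : exists2 K : R, 0 <= K & forall x (rho B : R) F, cb n (bl x rho) B F ->
  forall b, bl x rho b -> exists c : nat -> V -> R, [/\ forall j, hp j (c j),
    forall j v, `|c j v| <= K * B * `|v| ^+ j &
    forall v, bl x rho (b + v) -> `|F (b + v) - \sum_(j < n) c j v| <= K * B * `|v| ^+ n].
Proof.
elim: n => [|n [K K0 IH]].
  exists 1 => // x rho B F [hF _] b bb; exists (fun _ _ => 0); split; first exact: hp0.
    move=> j v; rewrite normr0 mul1r mulr_ge0 ?exprn_ge0 //; exact: le_trans (hF b bb).
  by move=> v bv; rewrite big_ord0 subr0 mul1r expr0 mulr1; exact: hF.
have dK : 0 <= d%:R * K by rewrite mulr_ge0.
exists (1 + d%:R * K); first by rewrite addr_ge0.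
move=> x rho B F [hF [dF [Q [T h]]]] b bb.
have B0 : 0 <= B by exact: le_trans (hF b bb).
have /choice[ci hci] : forall i, exists c : nat -> V -> R, [/\ forall j, hp j (c j),
    forall j v, `|c j v| <= K * B * `|v| ^+ j &
    forall v, bl x rho (b + v) -> `|dF i (b + v) - \sum_(j < n) c j v| <= K * B * `|v| ^+ n].
  by move=> i; exact: IH (h i) b bb.
pose c j := if j is j'.+1 then (fun v => \sum_i v ord0 i * (j'.+1%:R^-1 * ci i j' v)) else (fun=> F b).
exists c; split.
- move=> [|j] /=; first by exists (F b).
  exists (fun i v => j.+1%:R^-1 * ci i j v); split=> // i; apply: hp_scale; by case: (hci i).
- move=> [|j] v.
    rewrite expr0 mulr1 /=; apply: le_trans (hF b bb) _; rewrite mulrDl mul1r lerDl mulr_ge0 //.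
  apply: le_trans (sum_row_le (B := K * B * `|v| ^+ j) _ _) _.
    move=> i; rewrite normrM -[leRHS]mul1r; apply: ler_pM => //; last by case: (hci i).
    by rewrite ger0_norm ?invr_ge0 // invf_le1 ?ltr0n // ler1n.
  have -> : d%:R * (K * B * `|v| ^+ j) * `|v| = d%:R * K * B * `|v| ^+ j.+1 by rewrite exprSr; ring.
  by rewrite ler_wpM2r ?exprn_ge0 // ler_wpM2r // lerDr.
move=> v bv; rewrite big_ord_recl /=.
have bseg t : 0 <= t -> t <= 1 -> bl x rho (b + t *: v).
  by move=> t0 t1; have := bl_seg bb bv t0 t1; rewrite [b + v]addrC addrK.
have /choice[Cj hCj] : forall j, exists C : R, 0 <= C /\ forall s t : R, 0 <= s -> s <= 1 -> 0 <= t -> t <= 1 ->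
  `|s ^+ j.+1 - t ^+ j.+1 - j.+1%:R * (s - t) * t ^+ j| <= C * `|s - t| ^+ 2.
  by move=> j; have [C C0 hC] := pow_tangent j; exists C.
pose S j := \sum_i v ord0 i * (j.+1%:R^-1 * ci i j v).
pose f (t : R) := F (b + t *: v) - \sum_(j < n) t ^+ j.+1 * S j.
have -> : F (b + v) - (F b + \sum_(j < n) S j) = f 1 - f 0.
  rewrite /f scale1r scale0r addr0.
  under [X in _ = _ - X - _]eq_bigr do rewrite expr1n mul1r.
  rewrite [X in _ = _ - (_ - X)]big1 ?subr0 => [|j _]; last by rewrite expr0n mul0r.
  by rewrite opprD addrA addrAC.
apply: (le_trans (y := d%:R * (K * B * `|v| ^+ n) * `|v|)); last first.
  have -> : d%:R * (K * B * `|v| ^+ n) * `|v| = d%:R * K * B * `|v| ^+ n.+1 by rewrite exprSr; ring.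
  by rewrite ler_wpM2r ?exprn_ge0 // ler_wpM2r // lerDr.
apply: (@lip_path _ f _ (`|Q| * `|v| ^+ 2 + \sum_(j < n) Cj j * `|S j|)).
  rewrite addr_ge0 // ?mulr_ge0 ?exprn_ge0 //; apply: sumr_ge0 => j _.
  by rewrite mulr_ge0 //; case: (hCj j).
move=> s t s0 s1 t0 t1.
have zst : (b + s *: v) - (b + t *: v) = (s - t) *: v by apply/rowP => i; rewrite !mxE; ring.
have -> : f s - f t = \sum_i ((s - t) *: v) ord0 i * (dF i (b + t *: v) - \sum_(j < n) ci i j (t *: v)) +
  ((F (b + s *: v) - F (b + t *: v) - \sum_i ((s - t) *: v) ord0 i * dF i (b + t *: v)) -
   \sum_(j < n) (s ^+ j.+1 - t ^+ j.+1 - j.+1%:R * (s - t) * t ^+ j) * S j).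
  have -> : \sum_i ((s - t) *: v) ord0 i * (dF i (b + t *: v) - \sum_(j < n) ci i j (t *: v)) =
    \sum_i ((s - t) *: v) ord0 i * dF i (b + t *: v) - \sum_(j < n) (j.+1%:R * (s - t) * t ^+ j) * S j.
    under eq_bigr do rewrite mulrBr; rewrite sumrB; congr (_ - _).
    under eq_bigr do rewrite mulr_sumr; rewrite exchange_big /=; apply: eq_bigr => j _.
    rewrite /S mulr_sumr; apply: eq_bigr => i _; have [hi _ _] := hci i.
    rewrite (hp_hom _ _ (hi j)) !mxE.
    have : j.+1%:R != 0 :> R by rewrite pnatr_eq0.
    by move: (j.+1%:R : R) => a a0; field.
  under [X in _ = _ + (_ - X)]eq_bigr do rewrite mulrBl mulrBl.
  rewrite !sumrB /f; ring.
apply: le_trans (ler_normD _ _) _; apply: lerD.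
  apply: le_trans (sum_row_le (B := K * B * `|v| ^+ n) _ _) _; last first.
    by rewrite normrZ mulrCA mulrC.
  move=> i; have [_ _ hi] := hci i; apply: le_trans (hi _ (bseg t t0 t1)) _.
  apply: ler_wpM2l; first by rewrite mulr_ge0.
  by rewrite lerXn2r ?nnegrE // normrZ ger0_norm // ler_piMl.
apply: le_trans (ler_normB _ _) _; rewrite mulrDl; apply: lerD.
  have := T _ _ (bseg t t0 t1) (bseg s s0 s1); rewrite zst => h1; apply: le_trans h1 _.
  rewrite normrZ exprMn; have -> : `|Q| * `|v| ^+ 2 * `|s - t| ^+ 2 = `|Q| * (`|s - t| ^+ 2 * `|v| ^+ 2) by ring.
  by apply: ler_wpM2r; [rewrite mulr_ge0 // exprn_ge0|exact: ler_norm].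
apply: le_trans (ler_norm_sum _ _ _) _; rewrite mulr_suml; apply: ler_sum => j _.
rewrite normrM [leRHS]mulrAC ler_wpM2r //; have [_ hj] := hCj j; exact: hj.
Qed.

End HomogeneousPolynomials.

Section ComplexModulus.
Variable R : realType.
Implicit Types z w : R[i].

Lemma cabsE z : `|z| = (cabs z)%:C%C.
Proof. by rewrite normc_def. Qed.

Lemma cabs_ge0 z : 0 <= cabs z.
Proof. exact: sqrtr_ge0. Qed.

Lemma cabsM z w : cabs (z * w) = cabs z * cabs w.
Proof. by apply: complexI; rewrite -cabsE normrM !cabsE rmorphM. Qed.

Lemma cabsD z w : cabs (z + w) <= cabs z + cabs w.
Proof.
have := ler_normD z w; rewrite !cabsE -rmorphD /=; by rewrite lecE /= eqxx.
Qed.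

Lemma cabsN z : cabs (- z) = cabs z.
Proof. by apply: complexI; rewrite -!cabsE normrN. Qed.

Lemma cabs0 : cabs (0 : R[i]) = 0.
Proof. by apply: complexI; rewrite -cabsE normr0. Qed.

Lemma cabs1 : cabs (1 : R[i]) = 1.
Proof. by apply: complexI; rewrite -cabsE normr1. Qed.

Lemma cabsX z n : cabs (z ^+ n) = cabs z ^+ n.
Proof. by elim: n => [|n IH]; rewrite ?expr0 ?cabs1 // !exprS cabsM IH. Qed.

Lemma cabs_eq0 z : (cabs z == 0) = (z == 0).
Proof. by rewrite -(inj_eq (@complexI R)) -cabsE normr_eq0. Qed.

Lemma cabs_gt0 z : (0 < cabs z) = (z != 0).
Proof. by rewrite lt_def cabs_eq0 cabs_ge0 andbT. Qed.

Lemma cabs_sum (I : Type) (s : seq I) (P : pred I) (F : I -> R[i]) :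
  cabs (\sum_(i <- s | P i) F i) <= \sum_(i <- s | P i) cabs (F i).
Proof.
elim/big_ind2: _ => [|z1 x1 z2 x2 h1 h2|i _] //; first by rewrite cabs0.
by apply: le_trans (cabsD _ _) _; exact: lerD.
Qed.

Lemma cabs_real (x : R) : cabs (x%:C%C) = `|x|.
Proof. by rewrite /cabs /= expr0n /= addr0 sqrtr_sqr. Qed.

Lemma cabsB z w : cabs (z - w) <= cabs z + cabs w.
Proof. by rewrite -(cabsN w); exact: cabsD. Qed.

Lemma cabs_dist z w : cabs (z - w) = cabs (w - z).
Proof. by rewrite -cabsN opprB. Qed.

Lemma Re_le_cabs z : `|complex.Re z| <= cabs z.
Proof. by rewrite -sqrtr_sqr ler_sqrt ?lerDl ?sqr_ge0 // addr_ge0 // sqr_ge0. Qed.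

Lemma Im_le_cabs z : `|complex.Im z| <= cabs z.
Proof. by rewrite -sqrtr_sqr ler_sqrt ?lerDr ?sqr_ge0 // addr_ge0 // sqr_ge0. Qed.

Lemma cabs_le z : cabs z <= `|complex.Re z| + `|complex.Im z|.
Proof.
rewrite -[leRHS]ger0_norm ?addr_ge0 // -sqrtr_sqr ler_sqrt ?sqr_ge0 //.
rewrite sqrrD !real_normK ?num_real //; have := mulr_ge0 (normr_ge0 (complex.Re z)) (normr_ge0 (complex.Im z)).
by move=> h; rewrite lerD2r lerDl mulrn_wge0.
Qed.

End ComplexModulus.

Section TruncatedNorm.
Variables (R : realType) (J : nat).
Local Notation K := (R[i]).
Implicit Types P Q : {poly K}.

Definition pn P : R := \sum_(i < J.+1) cabs P`_i.
Definition eqJ P Q := forall i, (i <= J)%N -> P`_i = Q`_i.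

Lemma pn_ge0 P : 0 <= pn P.
Proof. by apply: sumr_ge0 => i _; exact: cabs_ge0. Qed.

Lemma pn_coef P i : (i <= J)%N -> cabs P`_i <= pn P.
Proof.
move=> iJ; rewrite /pn (bigD1 (inord i)) //= inordK // lerDl; apply: sumr_ge0 => k _; exact: cabs_ge0.
Qed.

Lemma pn_eqJ P Q : eqJ P Q -> pn P = pn Q.
Proof. by move=> h; apply: eq_bigr => i _; rewrite h // -ltnS. Qed.

Lemma eqJ_mul P P' Q Q' : eqJ P P' -> eqJ Q Q' -> eqJ (P * Q) (P' * Q').
Proof.
move=> h h' i iJ; rewrite !coefM; apply: eq_bigr => l _; rewrite h ?h' //.
  by apply: leq_trans iJ; exact: leq_subr.
by apply: leq_trans iJ; rewrite -ltnS.
Qed.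

Lemma eqJ_exp P P' n : eqJ P P' -> eqJ (P ^+ n) (P' ^+ n).
Proof.
move=> h; elim: n => [|n IH]; first by move=> i _; rewrite !expr0.
by rewrite !exprS; exact: eqJ_mul.
Qed.

Lemma pnD P Q : pn (P + Q) <= pn P + pn Q.
Proof. by rewrite /pn -big_split /=; apply: ler_sum => i _; rewrite coefD; exact: cabsD. Qed.

Lemma pnN P : pn (- P) = pn P.
Proof. by apply: eq_bigr => i _; rewrite coefN cabsN. Qed.

Lemma pnM P Q : pn (P * Q) <= pn P * pn Q.
Proof.
apply: le_trans (_ : \sum_(i < J.+1) \sum_(l < J.+1 | (l <= i)%N) cabs P`_l * cabs Q`_(i - l) <= _).
  apply: ler_sum => i _; rewrite coefM; apply: le_trans (cabs_sum _ _ _) _.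
  rewrite (big_ord_widen J.+1 (fun l => cabs (P`_l * Q`_(i - l)))) //.
  rewrite (eq_bigl (fun l : 'I_J.+1 => (l <= i)%N)) => [|l]; last by rewrite ltnS.
  by apply: ler_sum => l _; rewrite cabsM.
rewrite (exchange_big_dep xpredT) //= /pn mulr_suml; apply: ler_sum => l _.
rewrite -mulr_sumr; apply: ler_wpM2l; first exact: cabs_ge0.
have -> : \sum_(i < J.+1 | (l <= i)%N) cabs Q`_(i - l) = \sum_(l <= i < J.+1) cabs Q`_(i - l).
  by rewrite big_geq_mkord.
rewrite -{1}[nat_of_ord l]add0n big_addn.
under eq_bigr do rewrite addnK.
rewrite -(big_mkord xpredT (fun i => cabs Q`_i)) (@big_cat_nat _ _ _ (J.+1 - l)%N 0 J.+1) //= ?leq_subr //.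
by rewrite lerDl; apply: sumr_ge0 => i _; exact: cabs_ge0.
Qed.

Lemma pn1 : pn 1 = 1.
Proof.
rewrite /pn big_ord_recl coef1 eqxx cabs1 big1 ?addr0 // => i _.
by rewrite coef1 cabs0.
Qed.

Lemma pnX P n : pn (P ^+ n) <= pn P ^+ n.
Proof.
elim: n => [|n IH]; first by rewrite !expr0 pn1.
rewrite !exprS; apply: le_trans (pnM _ _) _; apply: ler_wpM2l => //; exact: pn_ge0.
Qed.

Lemma pn_sum (I : Type) (s : seq I) (F : I -> {poly K}) : pn (\sum_(i <- s) F i) <= \sum_(i <- s) pn (F i).
Proof.
elim/big_ind2: _ => [|z1 x1 z2 x2 h1 h2|i _] //.
  by rewrite /pn big1 // => i _; rewrite coef0 cabs0.
by apply: le_trans (pnD _ _) _; exact: lerD.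
Qed.

Lemma pnMn P n : pn (P *+ n) <= pn P *+ n.
Proof.
elim: n => [|n IH]; first by rewrite !mulr0n /pn big1 // => i _; rewrite coef0 cabs0.
by rewrite !mulrS; apply: le_trans (pnD _ _) _; rewrite lerD2l.
Qed.

(* Multiplying by [q ^+ m.-1] turns all powers of [r] into bounded series, since
   [q * r] and [r ^+ m] are bounded. *)
Lemma pn_mixed m (C : R) q h p r l : 1 <= C -> (0 < m)%N -> pn q <= C -> pn h <= C -> pn p <= C ->
  eqJ (q * r) h -> eqJ (r ^+ m) p -> pn (q ^+ m.-1 * r ^+ l) <= C ^+ (m.-1 + l).
Proof.
move=> C1 m0 qC hC pC e1 e2; elim/ltn_ind: l => l IH.
have C0 : 0 <= C by lra.
have [lm|ml] := ltnP l m.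
  have -> : q ^+ m.-1 * r ^+ l = q ^+ (m.-1 - l) * (q * r) ^+ l.
    by rewrite exprMn mulrA -exprD subnK // -ltnS prednK.
  rewrite (@pn_eqJ _ (q ^+ (m.-1 - l) * h ^+ l)); last by apply: eqJ_mul => //; exact: eqJ_exp.
  apply: le_trans (pnM _ _) _; apply: le_trans (_ : C ^+ (m.-1 - l) * C ^+ l <= _).
    apply: ler_pM; rewrite ?pn_ge0 //; apply: le_trans (pnX _ _) _; apply: lerXn2r; rewrite ?nnegrE ?pn_ge0 //.
  by rewrite -exprD ler_weXn2l //; lia.
have -> : q ^+ m.-1 * r ^+ l = q ^+ m.-1 * r ^+ (l - m) * r ^+ m by rewrite -mulrA -exprD subnK.
rewrite (@pn_eqJ _ (q ^+ m.-1 * r ^+ (l - m) * p)); last by apply: eqJ_mul.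
apply: le_trans (pnM _ _) _; apply: le_trans (_ : C ^+ (m.-1 + (l - m)) * C <= _).
  by apply: ler_pM; rewrite ?pn_ge0 //; apply: IH; lia.
by rewrite -exprSr ler_weXn2l //; lia.
Qed.

Lemma coef_bound_step m k (C S L : R) q h p r j : 1 <= C -> (0 < m)%N -> (0 < k)%N -> (j * k <= J)%N ->
  pn q <= C -> pn h <= C -> pn p <= C -> eqJ (q * r) h -> eqJ (r ^+ m) p ->
  0 <= L -> 1 <= L ^+ k * cabs q`_0 ^+ m.-1 -> pn (take_poly j r) <= S ->
  cabs r`_j <= L * (C ^+ m * (1 + S)).
Proof.
move=> C1 m0 k0 jk qC hC pC e1 e2 L0 hL hS.
have C0 : 0 <= C by lra.
have S0 : 0 <= S by apply: le_trans hS; exact: pn_ge0.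
set t := take_poly j r in hS; set s := drop_poly j r.
have rE : r - t = s * 'X^j by rewrite -{1}(poly_take_drop j r) addrC addKr.
have c1 : (q ^+ m.-1 * (r - t) ^+ k)`_(j * k) = q`_0 ^+ m.-1 * r`_j ^+ k.
  rewrite rE exprMn -exprM mulrA coefMXn ltnn subnn -!horner_coef0 !hornerE !horner_coef0.
  by rewrite coef_drop_poly add0n.
have b1 : pn (q ^+ m.-1 * (r - t) ^+ k) <= C ^+ (m.-1 + k) * (1 + S) ^+ k.
  rewrite exprDn mulr_sumr; apply: le_trans (pn_sum _ _) _.
  rewrite exprDn mulr_sumr; apply: ler_sum => i _.
  rewrite mulrnAr; apply: le_trans (pnMn _ _) _; rewrite expr1n mul1r mulrnAr lerMn2r; apply/orP; right.
  rewrite mulrA; apply: le_trans (pnM _ _) _; apply: ler_pM; rewrite ?pn_ge0 //.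
    apply: le_trans (pn_mixed (k - i)%N C1 m0 qC hC pC e1 e2) _; rewrite ler_weXn2l //; lia.
  by apply: le_trans (pnX _ _) _; rewrite pnN; apply: lerXn2r; rewrite ?nnegrE ?pn_ge0.
have b2 : cabs q`_0 ^+ m.-1 * cabs r`_j ^+ k <= C ^+ (m.-1 + k) * (1 + S) ^+ k.
  by rewrite -!cabsX -cabsM -c1; apply: le_trans (pn_coef _ jk) b1.
have b3 : cabs r`_j ^+ k <= (L * (C ^+ m * (1 + S))) ^+ k.
  apply: le_trans (_ : L ^+ k * (cabs q`_0 ^+ m.-1 * cabs r`_j ^+ k) <= _).
    by rewrite mulrA ler_peMl // exprn_ge0 // cabs_ge0.
  rewrite !exprMn; apply: ler_wpM2l; first exact: exprn_ge0.
  apply: le_trans b2 _; apply: ler_wpM2r; first by rewrite exprn_ge0 // addr_ge0.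
  rewrite -exprM ler_weXn2l //; nia.
have n0 : 0 <= L * (C ^+ m * (1 + S)).
  by apply: mulr_ge0 => //; apply: mulr_ge0; [exact: exprn_ge0|exact: addr_ge0].
by move: b3; rewrite ler_pXn2r ?nnegrE ?cabs_ge0.
Qed.

Lemma coef_bound m k (C : R) j : 1 <= C -> (0 < m)%N -> (0 < k)%N -> (j * k <= J)%N ->
  exists2 C', 1 <= C' & forall (L : R) q h p r, pn q <= C -> pn h <= C -> pn p <= C ->
    eqJ (q * r) h -> eqJ (r ^+ m) p -> 1 <= L -> 1 <= L ^+ k * cabs q`_0 ^+ m.-1 ->
    forall i, (i <= j)%N -> cabs r`_i <= C' * L ^+ i.+1.
Proof.
move=> C1 m0 k0; elim: j => [|j IH] jk.
  exists (C ^+ m) => [|L q h p r qC hC pC e1 e2 L1 hL i]; first exact: exprn_ege1.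
  rewrite leqn0 => /eqP ->; have L0 : 0 <= L by lra.
  have := @coef_bound_step m k C 0 L q h p r 0 C1 m0 k0 jk qC hC pC e1 e2 L0 hL.
  rewrite addr0 mulr1 expr1 mulrC; apply.
  by rewrite /pn big1 // => i' _; rewrite coef_take_poly ltn0 cabs0.
have jk' : (j * k <= J)%N by apply: leq_trans jk; rewrite leq_mul2r leqnSn orbT.
have [C' C'1 hC'] := IH jk'.
have Cm : 1 <= C ^+ m by exact: exprn_ege1.
pose S0 := J.+1%:R * C'.
have S00 : 0 <= S0 by rewrite mulr_ge0 //; lra.
exists (C ^+ m * (1 + S0) + C').
  by have : 0 <= C ^+ m * (1 + S0); [rewrite mulr_ge0 //; lra|lra].
move=> L q h p r qC hC pC e1 e2 L1 hL i.
have L0 : 0 <= L by lra.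
have bi i' : (i' <= j)%N -> cabs r`_i' <= C' * L ^+ i'.+1 by exact: (hC' L q h p r).
rewrite leq_eqVlt => /orP[/eqP ->|]; last first.
  rewrite ltnS => /bi h1; apply: le_trans h1 _; apply: ler_wpM2r; first exact: exprn_ge0.
  by rewrite lerDr mulr_ge0 //; lra.
have Lj : 1 <= L ^+ j.+1 by exact: exprn_ege1.
have hS : pn (take_poly j.+1 r) <= S0 * L ^+ j.+1.
  apply: le_trans (_ : \sum_(i < J.+1) C' * L ^+ j.+1 <= _); last first.
    by rewrite sumr_const card_ord -[X in X <= _]mulr_natl mulrA.
  apply: ler_sum => i' _; rewrite coef_take_poly; case: ifP => ij; last first.
    by rewrite cabs0 mulr_ge0 ?exprn_ge0 //; lra.
  apply: le_trans (bi _ ij) _; apply: ler_wpM2l; first by lra.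
  by rewrite ler_weXn2l.
have := @coef_bound_step m k C _ L q h p r j.+1 C1 m0 k0 jk qC hC pC e1 e2 L0 hL hS.
move=> h1; apply: le_trans h1 _.
have -> : (C ^+ m * (1 + S0) + C') * L ^+ j.+2 = L * (C ^+ m * (L ^+ j.+1 + S0 * L ^+ j.+1)) + C' * L ^+ j.+2.
  by rewrite [L ^+ j.+2]exprS; ring.
apply: le_trans (_ : L * (C ^+ m * (L ^+ j.+1 + S0 * L ^+ j.+1)) <= _); last first.
  by rewrite lerDl mulr_ge0 ?exprn_ge0 //; lra.
apply: ler_wpM2l => //; apply: ler_wpM2l; first by lra.
by rewrite lerD2r.
Qed.

End TruncatedNorm.

Section ComplexTaylor.
Variables (R : realType) (d : nat).
Local Notation V := 'rV[R]_d.
Local Notation K := (R[i]).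
Implicit Types (F G : V -> K) (v b : V) (n j : nat).

Lemma ReM (z w : K) : complex.Re (z * w) = complex.Re z * complex.Re w - complex.Im z * complex.Im w.
Proof. by case: z w => [a e] [a' e']. Qed.

Lemma ImM (z w : K) : complex.Im (z * w) = complex.Re z * complex.Im w + complex.Im z * complex.Re w.
Proof. by case: z w => [a e] [a' e']. Qed.

Lemma ReD (z w : K) : complex.Re (z + w) = complex.Re z + complex.Re w.
Proof. by case: z w => [a e] [a' e']. Qed.

Lemma ImD (z w : K) : complex.Im (z + w) = complex.Im z + complex.Im w.
Proof. by case: z w => [a e] [a' e']. Qed.

Lemma Re_sum (I : Type) (s : seq I) (f : I -> K) :
  complex.Re (\sum_(i <- s) f i) = \sum_(i <- s) complex.Re (f i).
Proof. by elim/big_rec2: _ => [|i a z _ <-]; rewrite ?ReD. Qed.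

Lemma Im_sum (I : Type) (s : seq I) (f : I -> K) :
  complex.Im (\sum_(i <- s) f i) = \sum_(i <- s) complex.Im (f i).
Proof. by elim/big_rec2: _ => [|i a z _ <-]; rewrite ?ImD. Qed.

Lemma hp_eq j (F G : V -> R) : F =1 G -> hp j F -> hp j G.
Proof. by move=> /funext ->. Qed.

Lemma hp_add j (F G : V -> R) : hp j F -> hp j G -> hp j (fun v => F v + G v).
Proof.
elim: j F G => [|j IH] F G /=.
  by move=> [a ha] [b hb]; exists (a + b) => v; rewrite ha hb.
move=> [Fi [h1 h2]] [Gi [h3 h4]]; exists (fun i v => Fi i v + Gi i v); split; first by move=> i; exact: IH.
by move=> v; rewrite h2 h4 -big_split /=; apply: eq_bigr => i _; rewrite mulrDr.
Qed.

Lemma hp_mul i j (F G : V -> R) : hp i F -> hp j G -> hp (i + j) (fun v => F v * G v).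
Proof.
elim: i F => [|i IH] F /=.
  by move=> [a ha] hG; apply: (hp_eq (F := fun v => a * G v)) => [v|]; rewrite ?ha //; exact: hp_scale.
move=> [Fi [h1 h2]] hG; exists (fun k v => Fi k v * G v); split; first by move=> k; exact: IH.
by move=> v; rewrite h2 mulr_suml; apply: eq_bigr => k _; rewrite mulrA.
Qed.

Definition chp j F := hp j (fun v => complex.Re (F v)) /\ hp j (fun v => complex.Im (F v)).

Lemma chp_eq j F G : F =1 G -> chp j F -> chp j G.
Proof. by move=> /funext ->. Qed.

Lemma chp_cst (z : K) : chp 0 (fun=> z).
Proof. by split; eexists. Qed.

Lemma chp_add j F G : chp j F -> chp j G -> chp j (fun v => F v + G v).
Proof.
move=> [h1 h2] [h3 h4]; split.
  by apply: hp_eq (hp_add h1 h3) => v; rewrite ReD.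
by apply: hp_eq (hp_add h2 h4) => v; rewrite ImD.
Qed.

Lemma chp_mul i j F G : chp i F -> chp j G -> chp (i + j) (fun v => F v * G v).
Proof.
move=> [h1 h2] [h3 h4]; split.
  apply: hp_eq (hp_add (hp_mul h1 h3) (hp_scale (-1) (hp_mul h2 h4))) => v; by rewrite ReM mulN1r.
by apply: hp_eq (hp_add (hp_mul h1 h4) (hp_mul h2 h3)) => v; rewrite ImM.
Qed.

Lemma chp_scale j (z : K) F : chp j F -> chp j (fun v => z * F v).
Proof. by move=> h; have := chp_mul (chp_cst z) h; rewrite add0n. Qed.

Lemma chp_sum j n (F : 'I_n -> V -> K) : (forall i, chp j (F i)) -> chp j (fun v => \sum_(i < n) F i v).
Proof.
move=> h; elim: n F h => [|n IH] F h.
  apply: (chp_eq (F := fun=> 0)); first by move=> v; rewrite big_ord0.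
  by split; exact: hp0.
by apply: chp_eq (chp_add (IH _ (fun i => h (widen_ord (leqnSn n) i))) (h ord_max)) => v; rewrite big_ord_recr.
Qed.

Lemma chp_hom j F (t : R) v : chp j F -> F (t *: v) = (t%:C%C) ^+ j * F v.
Proof.
move=> [h1 h2]; have e1 := hp_hom t v h1; have e2 := hp_hom t v h2.
rewrite -rmorphXn; move: (t ^+ j) e1 e2 => a; case: (F (t *: v)) => x y /=; case: (F v) => x' y' /= -> ->.
by apply/eqP; rewrite eq_complex /= !mul0r subr0 addr0 !eqxx.
Qed.

Definition ccb n (O : set V) (B : R) F :=
  cb n O B (fun v => complex.Re (F v)) /\ cb n O B (fun v => complex.Im (F v)).

Lemma ctaylor n : exists2 A : R, 0 <= A & forall x (rho B : R) F, ccb n (bl x rho) B F ->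
  forall b, bl x rho b -> exists c : nat -> V -> K, [/\ forall j, chp j (c j),
    forall j v, cabs (c j v) <= A * B * `|v| ^+ j &
    forall v, bl x rho (b + v) -> cabs (F (b + v) - \sum_(j < n) c j v) <= A * B * `|v| ^+ n].
Proof.
have [A A0 hA] := taylor R d n; exists (2 * A); first by rewrite mulr_ge0.
move=> x rho B F [h1 h2] b bb.
have [c [c1 c2 c3]] := hA _ _ _ _ h1 b bb; have [e [e1 e2 e3]] := hA _ _ _ _ h2 b bb.
exists (fun j v => (c j v +i* e j v)%C); split => //.
  move=> j v; apply: le_trans (cabs_le _) _ => /=; have := c2 j v; have := e2 j v; lra.
move=> v bv; apply: le_trans (cabs_le _) _.
have := c3 v bv; have := e3 v bv.
have ReN (z : K) : complex.Re (- z) = - complex.Re z by case: z.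
have ImN (z : K) : complex.Im (- z) = - complex.Im z by case: z.
rewrite ReD ImD ReN ImN Re_sum Im_sum /=; lra.
Qed.

Lemma formal_quotient (q h : nat -> V -> K) (q0 : K) : q0 != 0 -> (forall v, q 0%N v = q0) ->
  (forall j, chp j (q j)) -> (forall j, chp j (h j)) -> forall n, exists r : nat -> V -> K,
  (forall j, chp j (r j)) /\ forall j v, (j < n)%N -> \sum_(i < j.+1) q i v * r (j - i)%N v = h j v.
Proof.
move=> q00 hq0 cq ch; elim=> [|n [r [cr hr]]]; first by exists (fun _ _ => 0); split=> // j; split; exact: hp0.
pose rn v := q0^-1 * (h n v + (-1) * \sum_(i < n) q i.+1 v * r (n - i.+1)%N v).
exists (fun j => if j == n then rn else r j); split.
  move=> j; case: eqP => [->|_] //; apply: chp_scale; apply: chp_add => //; apply: chp_scale; apply: chp_sum => i.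
  by have := chp_mul (cq i.+1) (cr (n - i.+1)%N); rewrite subnKC.
move=> j v; rewrite ltnS leq_eqVlt => /orP[/eqP ->|jn].
  rewrite big_ord_recl /= subn0 eqxx hq0 /rn mulrA divff // mul1r mulN1r.
  rewrite [X in _ + X](_ : _ = \sum_(i < n) q i.+1 v * r (n - i.+1)%N v) ?subrK //.
  apply: eq_bigr => i _; rewrite /bump leq0n add1n ifF //; apply/eqP; have := ltn_ord i; lia.
rewrite -hr //; apply: eq_bigr => i _; rewrite ifF //; apply/eqP; lia.
Qed.

End ComplexTaylor.

Section LineExpansion.
Variable R : realType.
Local Notation K := (R[i]).
Implicit Types (F G : R -> K) (N : nat).

Definition cls N F F' := exists C e : R, 0 < e /\ forall t, 0 < t -> t <= e ->
  [/\ cabs (F t) <= C, cabs (F' t) <= C & cabs (F t - F' t) <= C * t ^+ N].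

Lemma cls_mul N F F' G G' : cls N F F' -> cls N G G' -> cls N (fun t => F t * G t) (fun t => F' t * G' t).
Proof.
move=> [C [e [e0 h]]] [C' [e' [e'0 h']]].
exists (`|C| * `|C'| + `|C| * `|C'|), (Num.min e e'); split; first by rewrite lt_min e0.
move=> t t0; rewrite le_min => /andP[te te']; have [a1 a2 a3] := h t t0 te; have [b1 b2 b3] := h' t t0 te'.
have lC (x y z : R) : x <= y * z -> 0 <= z -> x <= `|y| * z.
  by move=> xy z0; apply: le_trans xy _; apply: ler_wpM2r => //; exact: ler_norm.
have CC : 0 <= `|C| * `|C'| by rewrite mulr_ge0.
have n1 (x y : R) : x <= y -> x <= `|y| by move=> xy; apply: le_trans xy (ler_norm _).
have tN : 0 <= t ^+ N by rewrite exprn_ge0 // ltW.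
split.
- rewrite cabsM; apply: le_trans (ler_pM _ _ (n1 _ _ a1) (n1 _ _ b1)) _; rewrite ?cabs_ge0 //; lra.
- rewrite cabsM; apply: le_trans (ler_pM _ _ (n1 _ _ a2) (n1 _ _ b2)) _; rewrite ?cabs_ge0 //; lra.
have -> : F t * G t - F' t * G' t = (F t - F' t) * G t + F' t * (G t - G' t) by ring.
apply: le_trans (cabsD _ _) _; rewrite !cabsM mulrDl; apply: lerD.
  rewrite mulrAC; apply: ler_pM; rewrite ?cabs_ge0 //; [exact: lC|exact: n1].
rewrite -mulrA; apply: ler_pM; rewrite ?cabs_ge0 //; [exact: n1|exact: lC].
Qed.

Lemma cls_exp N F F' n : cls N F F' -> cls N (fun t => F t ^+ n) (fun t => F' t ^+ n).
Proof.
move=> h; elim: n => [|n IH].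
  exists 1, 1; split=> // t t0 t1; rewrite !expr0 cabs1 subrr cabs0 mul1r; split=> //.
  by rewrite exprn_ge0 // ltW.
have := cls_mul h IH; congr (cls _ _ _); by apply/funext => t; rewrite exprS.
Qed.

Lemma cls_eqJ J F (P Q : {poly K}) : cls J.+1 F (fun t => P.[t%:C%C]) -> cls J.+1 F (fun t => Q.[t%:C%C]) ->
  eqJ J P Q.
Proof.
move=> [C [e [e0 h]]] [C' [e' [e'0 h']]] i iJ.
apply/eqP; rewrite -subr_eq0 -coefB; apply/eqP.
apply: (@poly_small_coef0 K (P - Q) ((C + C')%:C%C) ((Num.min e e')%:C%C) J.+1); last by rewrite ltnS.
  by rewrite ltcE /= eqxx lt_min e0.
move=> y y0 ye.
have yE : y = (complex.Re y)%:C%C.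
  by move: y0; rewrite ltcE /= => /andP[/eqP im _]; case: y im {ye} => a a' /= ->.
move: (complex.Re y) yE => t yE; rewrite yE in y0 ye *.
move: y0; rewrite ltcE /= eqxx /= => t0; move: ye; rewrite lecE /= eqxx /= le_min => /andP[te te'].
have [_ _ a] := h t t0 te; have [_ _ b] := h' t t0 te'.
rewrite hornerD hornerN cabsE -rmorphXn -rmorphM lecE /= eqxx /=.
have -> : P.[t%:C%C] - Q.[t%:C%C] = (F t - Q.[t%:C%C]) - (F t - P.[t%:C%C]) by ring.
apply: le_trans (cabsB _ _) _; rewrite mulrDl; lra.
Qed.

Lemma eqJ_cancel J (q A B : {poly K}) : q`_0 != 0 -> eqJ J (q * A) (q * B) -> eqJ J A B.
Proof.
move=> q0 h i; elim/ltn_ind: i => i IH iJ; have := h i iJ; rewrite !coefM !big_ord_recl /= !subn0.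
rewrite (_ : \sum_(l < i) q`_(bump 0 l) * A`_(i - bump 0 l) = \sum_(l < i) q`_(bump 0 l) * B`_(i - bump 0 l)).
  by move=> /addIr /(mulfI q0).
by apply: eq_bigr => l _; rewrite IH //; rewrite /bump leq0n add1n; have := ltn_ord l; lia.
Qed.

End LineExpansion.

Section Weighted.
Variable R : realType.
Local Notation K := (R[i]).
Implicit Types (P Q : {poly K}) (s A : R).

Definition wt s A P := forall i, cabs P`_i <= A * s ^+ i.

Lemma wt_mul s A A' P Q N : 0 <= s -> 0 <= A -> 0 <= A' -> wt s A P -> wt s A' Q -> (size (P * Q)%R <= N)%N ->
  wt s (N%:R * (A * A')) (P * Q).
Proof.
move=> s0 A0 A'0 hP hQ sN i; have [iN|Ni] := ltnP i N; last first.
  by rewrite nth_default ?(leq_trans sN) // cabs0 !mulr_ge0 // exprn_ge0.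
rewrite coefM; apply: le_trans (cabs_sum _ _ _) _.
apply: le_trans (_ : \sum_(l < i.+1) A * A' * s ^+ i <= _).
  apply: ler_sum => l _; rewrite cabsM; apply: le_trans (ler_pM _ _ (hP l) (hQ _)) _; rewrite ?cabs_ge0 //.
  by rewrite mulrACA -exprD subnKC // -ltnS.
rewrite sumr_const card_ord -[leLHS]mulr_natl mulrA ler_wpM2r ?exprn_ge0 // ler_wpM2r ?mulr_ge0 //.
by rewrite ler_nat.
Qed.

Lemma wt_exp a m : exists2 C : R, 1 <= C & forall s A P, 0 <= s -> 1 <= A -> (size P <= a.+1)%N -> wt s A P ->
  (size (P ^+ m)%R <= (a * m).+1)%N /\ wt s (C * A ^+ m) (P ^+ m).
Proof.
elim: m => [|m [C C1 IH]].
  exists 1 => // s A P s0 A1 sP hP; split; first by rewrite expr0 size_poly1.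
  move=> i; rewrite !expr0 coef1; case: i => [|i] /=; first by rewrite cabs1 expr0 !mulr1.
  by rewrite cabs0 !mul1r exprn_ge0.
exists ((a * m.+1).+1%:R * C); first by rewrite mulr_ege1 // ler1n.
move=> s A P s0 A1 sP hP; have [h1 h2] := IH s A P s0 A1 sP hP.
have sz : (size (P ^+ m.+1)%R <= (a * m.+1).+1)%N.
  rewrite exprS; apply: leq_trans (size_polyMleq _ _) _; rewrite mulnS; lia.
split=> //; rewrite [P ^+ m.+1]exprS.
have A0 : 0 <= A by lra.
have CA : 0 <= C * A ^+ m by rewrite mulr_ge0 ?exprn_ge0 //; lra.
rewrite exprS in sz; have := wt_mul s0 A0 CA hP h2 sz.
by move=> h i; apply: le_trans (h i) _; rewrite le_eqVlt exprS; apply/orP; left; apply/eqP; ring.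
Qed.

Lemma wt_sub s A A' P Q : wt s A P -> wt s A' Q -> wt s (A + A') (P - Q).
Proof.
by move=> h h' i; rewrite coefB mulrDl; apply: le_trans (cabsB _ _) _; exact: lerD.
Qed.

Lemma wt_tail s A P D N : 0 <= s -> s <= 1 -> 0 <= A -> wt s A P -> (forall i, (i <= D)%N -> P`_i = 0) ->
  (size P <= N)%N -> cabs P.[1] <= N%:R * A * s ^+ D.+1.
Proof.
move=> s0 s1 A0 hP P0 sN; rewrite (horner_coef_wide _ sN); apply: le_trans (cabs_sum _ _ _) _.
apply: le_trans (_ : \sum_(i < N) A * s ^+ D.+1 <= _); last first.
  by rewrite sumr_const card_ord -[leLHS]mulr_natl mulrA.
apply: ler_sum => i _; rewrite expr1n mulr1; have [iD|Di] := leqP i D.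
  by rewrite P0 // cabs0 mulr_ge0 ?exprn_ge0.
by apply: le_trans (hP i) _; apply: ler_wpM2l => //; apply: ler_wiXn2l.
Qed.

Lemma cls_near N (F F2 F' : R -> K) (e : R) : 0 < e -> (forall t, 0 < t -> t <= e -> F t = F2 t) ->
  cls N F2 F' -> cls N F F'.
Proof.
move=> e0 h [C [e' [e'0 h']]]; exists C, (Num.min e e'); split; first by rewrite lt_min e0.
by move=> t t0; rewrite le_min => /andP[t1 t2]; rewrite h //; exact: h'.
Qed.

End Weighted.

Section Core.
Variables (R : realType) (d : nat).
Local Notation V := 'rV[R]_d.
Local Notation K := (R[i]).
Implicit Types (F G H P : V -> K) (v b : V) (n j : nat).

Definition mkp J (c : nat -> V -> K) v : {poly K} := \poly_(i < J.+1) c i v.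

Lemma mkp_hom J (c : nat -> V -> K) v (t : R) : (forall j, chp j (c j)) ->
  \sum_(j < J.+1) c j (t *: v) = (mkp J c v).[t%:C%C].
Proof.
by move=> h; rewrite horner_poly; apply: eq_bigr => j _; rewrite (chp_hom _ _ (h j)) mulrC.
Qed.

Lemma taylor_cls J x (rho B : R) F b v (c : nat -> V -> K) : 0 < rho -> bl x (rho / 2) b ->
  (forall j, chp j (c j)) -> (forall p, bl x rho p -> cabs (F p) <= B) -> 0 <= B ->
  (forall v, bl x rho (b + v) -> cabs (F (b + v) - \sum_(j < J.+1) c j v) <= B * `|v| ^+ J.+1) ->
  cls J.+1 (fun t : R => F (b + t *: v)) (fun t : R => (mkp J c v).[t%:C%C]).
Proof.
move=> rho0 bb hc hF B0 hT.
have v1 : 0 < `|v| + 1 by rewrite ltr_wpDl.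
exists (B + B * (`|v| + 1) ^+ J.+1), (Num.min 1 (rho / (2 * (`|v| + 1)))); split.
  by rewrite lt_min ltr01 divr_gt0 // mulr_gt0.
move=> t t0; rewrite le_min => /andP[t1 te].
have tv : `|t *: v| < rho / 2.
  rewrite normrZ gtr0_norm //; apply: lt_le_trans (_ : t * (`|v| + 1) <= _); first by rewrite ltr_pM2l // ltrDl.
  by move: te; rewrite ler_pdivlMr ?mulr_gt0 //; lra.
have bt : bl x rho (b + t *: v).
  rewrite /bl /=; have -> : b + t *: v - x = (b - x) + t *: v by rewrite addrAC.
  by apply: le_lt_trans (ler_normD _ _) _; move: bb; rewrite /bl /=; lra.
have := hT _ bt; rewrite mkp_hom // => h.
have E : B * `|t *: v| ^+ J.+1 <= B * (`|v| + 1) ^+ J.+1 * t ^+ J.+1.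
  rewrite -mulrA ler_wpM2l // -exprMn lerXn2r ?nnegrE ?mulr_ge0 ?(ltW t0) ?(ltW v1) //.
  by rewrite normrZ gtr0_norm // mulrC ler_pM2r // lerDl.
have p0 : 0 <= B * (`|v| + 1) ^+ J.+1 by rewrite mulr_ge0 // exprn_ge0 // ltW.
have tJ : t ^+ J.+1 <= 1 by rewrite exprn_ile1 // ltW.
have tJ0 : 0 <= t ^+ J.+1 by rewrite exprn_ge0 // ltW.
have E2 : B * (`|v| + 1) ^+ J.+1 * t ^+ J.+1 <= B * (`|v| + 1) ^+ J.+1 by rewrite ler_piMr.
have bF := hF _ bt; split; first by lra.
  set z := F _ in h bF; set w := _.[_] in h *.
  have -> : w = z - (z - w) by ring.
  apply: le_trans (cabsB _ _) _; lra.
by apply: le_trans h (le_trans E _); rewrite ler_wpM2r // lerDr.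
Qed.

Lemma core_approx x (rho : R) G H P m D s : 0 < rho -> rho <= 1 -> (0 < m)%N ->
  (forall n, exists2 B, 0 <= B & ccb n (bl x rho) B G) ->
  (forall n, exists2 B, 0 <= B & ccb n (bl x rho) B H) ->
  (forall n, exists2 B, 0 <= B & ccb n (bl x rho) B P) ->
  exists2 C : R, 1 <= C & forall b (de : R), bl x (rho / 2) b -> 0 < de -> de <= 1 -> de ^+ s <= cabs (G b) ->
   (exists2 e, 0 < e & forall p, `|p - b| < e -> H p ^+ m = P p * G p ^+ m) ->
   exists r : nat -> V -> K, [/\ forall j, chp j (r j),
     forall j v, (j <= D)%N -> cabs (r j v) <= C / de * `|v| ^+ j &
     forall v, `|v| < rho / 2 ->
       cabs ((\sum_(j < D.+1) r j v) * G (b + v) - H (b + v)) <= C / de * `|v| ^+ D.+1 /\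
       cabs ((\sum_(j < D.+1) r j v) ^+ m - P (b + v)) <= C * de^-1 ^+ m * `|v| ^+ D.+1].
Proof.
move=> rho0 rho1 m0 sG sH sP.
pose k := (D.+1 * (s * m)).+1; pose J := (D * k)%N.
have DJ : (D <= J)%N by rewrite /J leq_pmulr.
have jkJ : (D * k <= J)%N by [].
have k0 : (0 < k)%N by [].
have kE : (D.+1 * (s * m) <= k)%N by rewrite /k.
clearbody J k.
have [A A0 hA] := ctaylor R d J.+1.
have bnd F : (forall n, exists2 B, 0 <= B & ccb n (bl x rho) B F) -> exists2 B, 0 <= B &
   (forall p, bl x rho p -> cabs (F p) <= B) /\ forall b, bl x rho b -> exists c : nat -> V -> K,
   [/\ forall j, chp j (c j), forall j v, cabs (c j v) <= B * `|v| ^+ j &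
    forall v, bl x rho (b + v) -> cabs (F (b + v) - \sum_(j < J.+1) c j v) <= B * `|v| ^+ J.+1].
  move=> /(_ J.+1)[B B0 hB]; exists (A * B + 2 * B); first by rewrite addr_ge0 ?mulr_ge0.
  have AB : A * B <= A * B + 2 * B by rewrite lerDl mulr_ge0.
  split.
    move=> p bp; apply: le_trans (cabs_le _) _; have [h1 h2] := hB.
    have := cb_bd h1 bp; have := cb_bd h2 bp; have : 0 <= A * B by rewrite mulr_ge0.
    lra.
  move=> b bb; have [c [c1 c2 c3]] := hA _ _ _ _ hB b bb; exists c; split=> //.
    by move=> j v; apply: le_trans (c2 j v) _; rewrite ler_wpM2r ?exprn_ge0.
  by move=> v bv; apply: le_trans (c3 v bv) _; rewrite ler_wpM2r ?exprn_ge0.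
have [BG BG0 [bG tG]] := bnd G sG; have [BH BH0 [bH tH]] := bnd H sH; have [BP BP0 [bP tP]] := bnd P sP.
pose B1 := 1 + BG + BH + BP.
have [B11 [lG [lH lP]]] : 1 <= B1 /\ BG <= B1 /\ BH <= B1 /\ BP <= B1 by rewrite /B1; lra.
clearbody B1.
have B10 : 0 <= B1 by lra.
pose C1 := J.+1%:R * B1.
have C11 : 1 <= C1 by rewrite /C1 mulr_ege1 // ler1n.
have [C' C'1 hC'] := @coef_bound R J m k C1 D C11 m0 k0 jkJ.
have C'0 : 0 <= C' by lra.
have [Cm Cm1 hCm] := wt_exp R D m.
pose N : R := (D + J + 3)%:R; pose N2 : R := (D * m + J + 2)%:R.
have N0 : 0 <= N by rewrite ler0n.
have N20 : 0 <= N2 by rewrite ler0n.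
pose Ca := D.+1%:R * C' * B1 + B1 + N * (N * (C' * B1) + B1).
pose Cb := B1 + N2 * (Cm * C' ^+ m + B1).
have Ca0 : 0 <= Ca by rewrite /Ca !addr_ge0 // ?mulr_ge0 // !addr_ge0 // ?mulr_ge0 // mulr_ge0.
have Cb0 : 0 <= Cb.
  have : 0 <= Cm * C' ^+ m by rewrite mulr_ge0 ?exprn_ge0 //; lra.
  by rewrite /Cb => ?; rewrite addr_ge0 // mulr_ge0 // addr_ge0.
exists (C' + Ca + Cb); first by lra.
move=> b de bb de0 de1 hGb [e e0 rel].
have bb' : bl x rho b by move: bb; rewrite /bl /=; lra.
have [q [cq bq rq]] := tG b bb'; have [h [ch bh rh]] := tH b bb'; have [p [cp bp rp]] := tP b bb'.
have qE v : q 0%N v = G b.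
  have [q0 hq0] : exists q0, forall v, q 0%N v = q0.
    have [[a1 h1] [a2 h2]] := cq 0%N; exists (a1 +i* a2)%C => v'; have := h1 v'; have := h2 v'.
    by case: (q 0%N v') => ? ? /= -> ->.
  rewrite !hq0; have := rq 0; rewrite addr0 => /(_ bb'); rewrite normr0 expr0n /= mulr0 => hz.
  have : cabs (G b - q 0%N 0) <= 0.
    apply: le_trans hz; rewrite big_ord_recl big1 ?addr0 // => i _.
    have := chp_hom 0 0 (cq (bump 0 i)); rewrite scale0r => ->.
    by rewrite rmorph0 expr0n /= mul0r.
  rewrite le_eqVlt ltNge cabs_ge0 orbF cabs_eq0 subr_eq0 => /eqP ->; by rewrite hq0.
have Gb0 : G b != 0.
  by rewrite -cabs_gt0; apply: lt_le_trans hGb; rewrite exprn_gt0.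
have [r [cr hr]] := formal_quotient Gb0 qE cq ch J.+1.
have coefm c v i : (i <= J)%N -> (mkp J c v)`_i = c i v by move=> iJ; rewrite coef_poly ltnS iJ.
have coefm0 c v i : (J < i)%N -> (mkp J c v)`_i = 0 by move=> iJ; rewrite coef_poly ltnS leqNgt iJ.
have e1 v : eqJ J (mkp J q v * mkp J r v) (mkp J h v).
  move=> i iJ; rewrite coefm // -hr // coefM; apply: eq_bigr => l _.
  have lJ : (l <= J)%N by apply: leq_trans iJ; rewrite -ltnS.
  have iJ' : (i - l <= J)%N by apply: leq_trans iJ; exact: leq_subr.
  by rewrite !coefm.
have e2 v : eqJ J (mkp J r v ^+ m) (mkp J p v).
  apply: (eqJ_cancel (q := mkp J q v ^+ m)).
    by rewrite -horner_coef0 horner_exp horner_coef0 coefm // qE expf_neq0.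
  have cH := cls_exp m (taylor_cls v rho0 bb ch bH BH0 rh).
  have cPG := cls_mul (taylor_cls v rho0 bb cp bP BP0 rp) (cls_exp m (taylor_cls v rho0 bb cq bG BG0 rq)).
  have v1 : 0 < `|v| + 1 by rewrite ltr_wpDl.
  have eq_hp : eqJ J (mkp J h v ^+ m) (mkp J p v * mkp J q v ^+ m).
    apply: (cls_eqJ (F := fun t => H (b + t *: v) ^+ m)).
      by under [X in cls _ _ X]funext do rewrite horner_exp.
    under [X in cls _ _ X]funext do rewrite hornerM horner_exp.
    apply: (cls_near (e := e / (2 * (`|v| + 1)))) cPG; first by rewrite divr_gt0 // mulr_gt0.
    move=> t t0 te; apply: rel; rewrite addrC addKr normrZ gtr0_norm //.
    apply: le_lt_trans (_ : t * (`|v| + 1) < _); first by rewrite ler_pM2l // lerDl.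
    by move: te; rewrite ler_pdivlMr ?mulr_gt0 //; lra.
  move=> i iJ; rewrite -exprMn (eqJ_exp m (e1 v)) // eq_hp // mulrC //.
pose L := de^-1 `^ (D.+1%:R^-1).
have dei1 : 1 <= de^-1 by rewrite invf_ge1.
have D1 : D.+1%:R != 0 :> R by rewrite pnatr_eq0.
have LD : L ^+ D.+1 = de^-1.
  by rewrite -powR_mulrn ?powR_ge0 // -powRrM mulVf // powRr1 // invr_ge0 ltW.
have L1 : 1 <= L.
  rewrite leNgt; apply/negP => L1; have : L ^+ D.+1 < 1 by rewrite exprn_ilt1 ?powR_ge0.
  by rewrite LD ltNge dei1.
have hL v : 1 <= L ^+ k * cabs (mkp J q v)`_0 ^+ m.-1.
  rewrite coefm // qE.
  apply: le_trans (_ : L ^+ (D.+1 * (s * m.-1)) * (de ^+ s) ^+ m.-1 <= _).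
    by rewrite exprM LD -exprM -exprMn mulVf ?gt_eqF // expr1n.
  apply: ler_pM; rewrite ?exprn_ge0 ?(ltW de0) ?powR_ge0 //.
    rewrite ler_weXn2l //; apply: leq_trans kE; by rewrite leq_mul2l leq_mul2l leq_pred !orbT.
  by rewrite lerXn2r ?nnegrE ?cabs_ge0 // exprn_ge0 // ltW.
have pnb c v : `|v| <= 1 -> (forall j v, cabs (c j v) <= B1 * `|v| ^+ j) -> pn J (mkp J c v) <= C1.
  move=> v1 hc; apply: le_trans (_ : \sum_(i < J.+1) B1 <= _); last by rewrite sumr_const card_ord /C1 mulr_natl.
  apply: ler_sum => i _; have iJ : (i <= J)%N by rewrite -ltnS.
  rewrite coefm //; apply: le_trans (hc i v) _.
  by rewrite ler_piMr // exprn_ile1.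
have bq1 j v : cabs (q j v) <= B1 * `|v| ^+ j by apply: le_trans (bq j v) _; rewrite ler_wpM2r ?exprn_ge0.
have bh1 j v : cabs (h j v) <= B1 * `|v| ^+ j by apply: le_trans (bh j v) _; rewrite ler_wpM2r ?exprn_ge0.
have bp1 j v : cabs (p j v) <= B1 * `|v| ^+ j by apply: le_trans (bp j v) _; rewrite ler_wpM2r ?exprn_ge0.
pose E := C' / de.
have E1 : 1 <= E by rewrite /E mulr_ege1.
have E0 : 0 <= E by lra.
have br1 j v : (j <= D)%N -> `|v| <= 1 -> cabs (r j v) <= E.
  move=> jD v1; have := hC' L _ _ _ _ (pnb q v v1 bq1) (pnb h v v1 bh1) (pnb p v v1 bp1) (e1 v) (e2 v) L1 (hL v) j jD.
  rewrite coefm ?(leq_trans jD) // => h1; apply: le_trans h1 _; rewrite /E -LD ler_wpM2l //.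
  by rewrite ler_weXn2l.
have br j v : (j <= D)%N -> cabs (r j v) <= E * `|v| ^+ j.
  move=> jD; have [->|v0] := eqVneq v 0.
    case: j jD => [|j] jD; first by rewrite expr0 mulr1 br1 // normr0.
    have := chp_hom 0 0 (cr j.+1); rewrite scale0r rmorph0 expr0n /= mul0r => ->.
    by rewrite cabs0 mulr_ge0 // exprn_ge0.
  have nv : 0 < `|v| by rewrite normr_gt0.
  have vE : v = `|v| *: (`|v|^-1 *: v) by rewrite scalerA divff ?gt_eqF // scale1r.
  rewrite {1}vE (chp_hom _ _ (cr j)) cabsM cabsX cabs_real normr_id mulrC ler_wpM2r ?exprn_ge0 //.
  by apply: br1 => //; rewrite normrZ normfV normr_id mulVf // gt_eqF.
have Cde : E <= (C' + Ca + Cb) / de by rewrite /E ler_wpM2r ?invr_ge0 ?(ltW de0) //; clear -C'0 Ca0 Cb0; lra.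
exists r; split=> //.
  by move=> j v jD; apply: le_trans (br j v jD) _; rewrite ler_wpM2r // exprn_ge0.
move=> v vr.
have v1 : `|v| <= 1 by clear -vr rho1 rho0; lra.
have v0 := normr_ge0 v.
have bv : bl x rho (b + v).
  rewrite /bl /=; have -> : b + v - x = (b - x) + v by rewrite addrAC.
  by apply: le_lt_trans (ler_normD _ _) _; move: bb; rewrite /bl /=; clear -vr; lra.
have val c : (mkp J c v).[1] = \sum_(j < J.+1) c j v.
  by rewrite horner_poly; apply: eq_bigr => j _; rewrite expr1n mulr1.
pose RD : {poly K} := \poly_(i < D.+1) r i v.
have valR : \sum_(j < D.+1) r j v = RD.[1].
  by rewrite horner_poly; apply: eq_bigr => j _; rewrite expr1n mulr1.
have wR : wt `|v| E RD.
  move=> i; rewrite coef_poly; case: ifP => iD; first exact: br.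
  by rewrite cabs0 mulr_ge0 // exprn_ge0.
have wc c : (forall j v, cabs (c j v) <= B1 * `|v| ^+ j) -> wt `|v| B1 (mkp J c v).
  move=> hc i; rewrite coef_poly; case: ifP => iD; first exact: hc.
  by rewrite cabs0 mulr_ge0 // exprn_ge0.
have eR : eqJ D RD (mkp J r v).
  by move=> i iD; rewrite coef_poly ltnS iD coefm // (leq_trans iD).
have sJ : `|v| ^+ J.+1 <= `|v| ^+ D.+1 by apply: ler_wiXn2l.
have sR : (size RD <= D.+1)%N by exact: size_poly.
have sm c : (size (mkp J c v) <= J.+1)%N by exact: size_poly.
have vD : 0 <= `|v| ^+ D.+1 by rewrite exprn_ge0.
have absR : cabs RD.[1] <= D.+1%:R * E.
  rewrite -valR; apply: le_trans (cabs_sum _ _ _) _.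
  apply: le_trans (_ : \sum_(j < D.+1) E <= _); last by rewrite sumr_const card_ord mulr_natl.
  by apply: ler_sum => j _; apply: br1 => //; rewrite -ltnS.
rewrite valR; split.
  have sz : (size (RD * mkp J q v)%R <= D + J + 3)%N.
    apply: leq_trans (size_polyMleq _ _) _; apply: leq_trans (leq_pred _) _.
    by apply: leq_trans (leq_add sR (sm q)) _; rewrite addSn addnS addn3.
  have w1 := wt_sub (wt_mul v0 E0 B10 wR (wc q bq1) sz) (wc h bh1).
  have t1 : cabs (RD * mkp J q v - mkp J h v).[1] <= N * (N * (E * B1) + B1) * `|v| ^+ D.+1.
    apply: (wt_tail v0 v1 _ w1); first by apply: addr_ge0 => //; apply: mulr_ge0 => //; exact: mulr_ge0.
      move=> i iD; rewrite coefB; apply/eqP; rewrite subr_eq0; apply/eqP.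
      rewrite mulrC (eqJ_mul (J := D) (P' := mkp J q v) (Q' := mkp J r v) _ eR) // e1 //.
      exact: leq_trans DJ.
    apply: leq_trans (size_polyD _ _) _; rewrite size_polyN geq_max sz /=.
    by apply: leq_trans (sm h) _; rewrite addn3; do 2 apply: leqW; rewrite ltnS leq_addl.
  have -> : RD.[1] * G (b + v) - H (b + v) = RD.[1] * (G (b + v) - \sum_(j < J.+1) q j v) -
     (H (b + v) - \sum_(j < J.+1) h j v) + (RD * mkp J q v - mkp J h v).[1].
    by rewrite hornerD hornerN hornerM !val; ring.
  apply: le_trans (cabsD _ _) _.
  have g1 := cabsB (RD.[1] * (G (b + v) - \sum_(j < J.+1) q j v)) (H (b + v) - \sum_(j < J.+1) h j v).
  have g2 : cabs (RD.[1] * (G (b + v) - \sum_(j < J.+1) q j v)) <= D.+1%:R * E * (B1 * `|v| ^+ D.+1).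
    rewrite cabsM; apply: ler_pM; rewrite ?cabs_ge0 //; apply: le_trans (rq v bv) _.
    by apply: ler_pM => //; rewrite exprn_ge0.
  have g3 : cabs (H (b + v) - \sum_(j < J.+1) h j v) <= B1 * `|v| ^+ D.+1.
    by apply: le_trans (rh v bv) _; apply: ler_pM => //; rewrite exprn_ge0.
  have g4 : D.+1%:R * E * B1 + B1 + N * (N * (E * B1) + B1) <= Ca / de.
    have i1 : 0 <= B1 * (de^-1 - 1) by rewrite mulr_ge0 // subr_ge0.
    have i2 : 0 <= N * B1 * (de^-1 - 1) by rewrite mulr_ge0 ?mulr_ge0 // subr_ge0.
    have -> : Ca / de = D.+1%:R * E * B1 + B1 / de + N * (N * (E * B1) + B1 / de) by rewrite /Ca /E; ring.
    clear -i1 i2; lra.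
  have g5 := ler_wpM2r vD g4.
  have g6 : Ca / de * `|v| ^+ D.+1 <= (C' + Ca + Cb) / de * `|v| ^+ D.+1.
    by rewrite ler_wpM2r // ler_wpM2r ?invr_ge0 ?(ltW de0) //; clear -C'0 Ca0 Cb0; lra.
  lra.
have [sz w2] := hCm _ _ _ v0 E1 sR wR.
have w1 := wt_sub w2 (wc p bp1).
have Em : 0 <= Cm * E ^+ m by rewrite mulr_ge0 ?exprn_ge0 //; clear -Cm1; lra.
have t1 : cabs (RD ^+ m - mkp J p v).[1] <= N2 * (Cm * E ^+ m + B1) * `|v| ^+ D.+1.
  apply: (wt_tail v0 v1 _ w1); first by rewrite addr_ge0.
    move=> i iD; rewrite coefB; apply/eqP; rewrite subr_eq0; apply/eqP.
    by rewrite (eqJ_exp m eR) // e2 //; exact: leq_trans DJ.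
  apply: leq_trans (size_polyD _ _) _; rewrite size_polyN geq_max; apply/andP; split.
    by apply: leq_trans sz _; rewrite addn2; apply: leqW; rewrite ltnS leq_addr.
  by apply: leq_trans (sm p) _; rewrite addn2; apply: leqW; rewrite ltnS leq_addl.
have -> : RD.[1] ^+ m - P (b + v) = (RD ^+ m - mkp J p v).[1] - (P (b + v) - \sum_(j < J.+1) p j v).
  by rewrite hornerD hornerN horner_exp val; ring.
apply: le_trans (cabsB _ _) _.
have g3 : cabs (P (b + v) - \sum_(j < J.+1) p j v) <= B1 * `|v| ^+ D.+1.
  by apply: le_trans (rp v bv) _; apply: ler_pM => //; rewrite exprn_ge0.
have dm1 : 1 <= de^-1 ^+ m by exact: exprn_ege1.
have g4 : B1 + N2 * (Cm * E ^+ m + B1) <= Cb * de^-1 ^+ m.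
  have i1 : 0 <= B1 * (de^-1 ^+ m - 1) by rewrite mulr_ge0 // subr_ge0.
  have i2 : 0 <= N2 * B1 * (de^-1 ^+ m - 1) by rewrite mulr_ge0 ?mulr_ge0 // subr_ge0.
  have -> : Cb * de^-1 ^+ m = B1 * de^-1 ^+ m + N2 * (Cm * E ^+ m + B1 * de^-1 ^+ m).
    by rewrite /Cb /E exprMn; ring.
  clear -i1 i2; lra.
have g5 := ler_wpM2r vD g4.
have g6 : Cb * de^-1 ^+ m * `|v| ^+ D.+1 <= (C' + Ca + Cb) * de^-1 ^+ m * `|v| ^+ D.+1.
  by rewrite ler_wpM2r // ler_wpM2r //; clear -dm1 C'0 Ca0 Cb0; lra.
clear -t1 g3 g5 g6; lra.
Qed.

End Core.

Section Markov.
Variables (R : realType) (d : nat).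
Local Notation V := 'rV[R]_d.
Implicit Types (F : V -> R) (p v c : V).

Definition pdeg D F := forall p v, exists2 P : {poly R}, (size P <= D.+1)%N & forall t, P.[t] = F (p + t *: v).
Definition sp D F := pdeg D F /\ forall c r, exists dF Q, t1 (bl c r) F dF Q.

Definition node D (l : 'I_D.+1) : R := l.+1%:R / D.+1%:R.

Lemma node01 D (l : 'I_D.+1) : 0 <= node l /\ node l <= 1.
Proof.
by split; [rewrite divr_ge0|rewrite ler_pdivrMr ?ltr0n // mul1r ler_nat ltn_ord].
Qed.

Definition Dop D (lam : 'I_D.+1 -> R) i F p := \sum_l lam l * F (p + node l *: delta_mx ord0 i).

Lemma node_shift D (l : 'I_D.+1) (i : 'I_d) c r p : bl c r p -> bl c (r + 1) (p + node l *: delta_mx ord0 i).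
Proof.
move=> bp; rewrite /bl /= addrAC; apply: le_lt_trans (ler_normD _ _) _; apply: ltr_leD => //.
have [l0 l1] := node01 l; rewrite normrZ ger0_norm // -[leRHS]mulr1; apply: ler_pM => //.
by apply: rV_norm_le => // j; rewrite mxE /=; case: eqP => _; rewrite ?normr1 ?normr0.
Qed.

Lemma markov D : exists2 Lam : R, 1 <= Lam & forall n F (B : R) c r, sp D F ->
  (forall p, bl c (r + n%:R) p -> `|F p| <= B) -> 0 <= B -> cb n (bl c r) (Lam ^+ n * B) F.
Proof.
have [L hL] := lagrange_interp R D; pose lam l := (L l)`_1.
have coef1 (P : {poly R}) : (size P <= D.+1)%N -> P`_1 = \sum_l lam l * P.[node l].
  by move=> sP; rewrite {1}(hL P sP) coef_sum; apply: eq_bigr => l _; rewrite coefZ mulrC.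
have der F c r dF Q p i : sp D F -> t1 (bl c r) F dF Q -> bl c r p -> dF i p = Dop lam i F p.
  move=> [pF _] T bp; have [P sP hP] := pF p (delta_mx ord0 i).
  have -> : Dop lam i F p = P`_1 by rewrite coef1 //; apply: eq_bigr => l _; rewrite hP.
  have := open_nbhs_nbhs (conj (@bl_open _ _ c r) bp); rewrite -nbhs_ballE => -[e /= e0 he].
  have c0 : (P - (F p)%:P - (dF i p) *: 'X)`_1 = 0.
    apply: (@poly_small_coef0 R _ `|Q| (e / 2) 2) => //; first by rewrite divr_gt0.
    move=> y y0 ye; rewrite hornerD hornerD !hornerN hornerC hornerZ hornerX hP.
    pose q : V := p + y *: delta_mx ord0 i.
    have qp : q - p = y *: delta_mx ord0 i by rewrite /q addrC addKr.
    have nq : `|q - p| <= y.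
      rewrite qp; apply: rV_norm_le; first exact: ltW.
      by move=> j; rewrite !mxE /=; case: eqP => _; rewrite ?mulr1 ?mulr0 ?normr0 ?gtr0_norm // ltW.
    have bq : bl c r q.
      apply: he; rewrite -ball_normE /= distrC; apply: le_lt_trans nq _; lra.
    have S : \sum_k (q - p) ord0 k * dF k p = dF i p * y.
      rewrite (bigD1 i) //= big1 => [|k ne]; last by rewrite qp !mxE eqxx (negbTE ne) mulr0 mul0r.
      by rewrite addr0 qp !mxE !eqxx mulr1 mulrC.
    have := T p q bp bq; rewrite S => h; apply: le_trans h _.
    apply: le_trans (_ : `|Q| * `|q - p| ^+ 2 <= _); first by rewrite ler_wpM2r ?exprn_ge0 // ler_norm.
    by apply: ler_wpM2l => //; apply: lerXn2r; rewrite ?nnegrE // ltW.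
  move: c0; rewrite !coefB coefC coefZ coefX /= mulr1 subr0 => /eqP; by rewrite subr_eq0 => /eqP.
have spD F i : sp D F -> sp D (Dop lam i F).
  move=> [pF tF]; split.
    move=> p v.
    have /choice[P hP] : forall l : 'I_D.+1, exists P : {poly R}, (size P <= D.+1)%N /\
       forall t, P.[t] = F ((p + node l *: delta_mx ord0 i) + t *: v).
      by move=> l; have [P s1 s2] := pF (p + node l *: delta_mx ord0 i) v; exists P.
    exists (\sum_l lam l *: P l).
      apply: leq_trans (size_sum _ _ _) _; apply/bigmax_leqP => l _.
      by apply: leq_trans (size_scale_leq _ _) _; case: (hP l).
    move=> t; rewrite horner_sum; apply: eq_bigr => l _; rewrite hornerZ; have [_ ->] := hP l.
    by rewrite addrAC.
  move=> c r; have [dF [Q T]] := tF c (r + 1).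
  exists (fun k p => \sum_l lam l * dF k (p + node l *: delta_mx ord0 i)), (\sum_l `|lam l| * Q).
  move=> p q bp bq.
  have -> : Dop lam i F q - Dop lam i F p - \sum_k (q - p) ord0 k * (\sum_l lam l * dF k (p + node l *: delta_mx ord0 i)) =
    \sum_l lam l * (F (q + node l *: delta_mx ord0 i) - F (p + node l *: delta_mx ord0 i) -
      \sum_k (q - p) ord0 k * dF k (p + node l *: delta_mx ord0 i)).
    rewrite /Dop; under [RHS]eq_bigr do rewrite !mulrBr; rewrite !sumrB; congr (_ - _).
    under eq_bigr do rewrite mulr_sumr; rewrite exchange_big /=; apply: eq_bigr => l _.
    by rewrite mulr_sumr; apply: eq_bigr => k _; ring.
  apply: le_trans (ler_norm_sum _ _ _) _; rewrite mulr_suml; apply: ler_sum => l _.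
  rewrite normrM -mulrA ler_wpM2l //.
  have := T _ _ (node_shift l i bp) (node_shift l i bq).
  by have -> : q + node l *: delta_mx ord0 i - (p + node l *: delta_mx ord0 i) = q - p by rewrite opprD addrACA subrr addr0.
pose Lam := 1 + \sum_l `|lam l|.
have L1 : 1 <= Lam by rewrite lerDl sumr_ge0.
exists Lam => //; elim=> [|n IH] F B c r sF hB B0.
  by split=> // p bp; rewrite expr0 mul1r; apply: hB; rewrite addr0.
have Ln : 1 <= Lam ^+ n.+1 by exact: exprn_ege1.
split.
  move=> p bp; apply: le_trans (_ : B <= _); last by rewrite ler_peMl.
  by apply: hB; apply: lt_le_trans bp _; rewrite lerDl.
have [_ tF] := sF; have [dF [Q T]] := tF c r; exists dF, Q; split=> // i.
apply: (cb_ext (F := Dop lam i F)); first by move=> p bp; rewrite (der F c r dF Q p i sF T bp).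
rewrite exprSr -mulrA; apply: IH; [exact: spD| |by rewrite mulr_ge0 //; lra].
move=> p bp; apply: le_trans (ler_norm_sum _ _ _) _.
apply: le_trans (_ : \sum_l `|lam l| * B <= _); last first.
  by rewrite -mulr_suml ler_wpM2r // lerDr.
apply: ler_sum => l _; rewrite normrM ler_wpM2l //; apply: hB.
by have := node_shift l i bp; rewrite -addrA natr1.
Qed.

Lemma sp_sum D (F : 'I_D.+1 -> V -> R) (b : V) : (forall j : 'I_D.+1, hp j (F j)) -> sp D (fun p => \sum_j F j (p - b)).
Proof.
move=> hF; split.
  move=> p v.
  have /choice[P hP] : forall j : 'I_D.+1, exists P : {poly R}, (size P <= D.+1)%N /\
     forall t, P.[t] = F j ((p - b) + t *: v).
    move=> j; have [P s1 s2] := hp_poly (p - b) v (hF j); exists P; split=> //.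
    by apply: leq_trans s1 _; rewrite ltnS -ltnS.
  exists (\sum_j P j).
    by apply: leq_trans (size_sum _ _ _) _; apply/bigmax_leqP => l _; case: (hP l).
  by move=> t; rewrite horner_sum; apply: eq_bigr => l _; have [_ ->] := hP l; rewrite addrAC.
move=> c r.
have /choice[B hB] : forall j, exists B, cb 1 (bl c r) B (fun p => F j (p - b)).
  by move=> j; have [B _ h] := hp_cb 1 c r b (hF j); exists B.
have [_ [dF [Q [T _]]]] := cb_sum (index_enum 'I_D.+1) hB.
by exists dF, Q.
Qed.

End Markov.

Section LocalApprox.
Variables (R : realType) (d : nat).
Local Notation V := 'rV[R]_d.
Local Notation K := (R[i]).

Definition okr (X : set V) (f : V -> R) (kap : nat) (de : R) (a : V) (u : V -> R) :=
  [/\ forall y, X y -> bl a (8 * de) y -> `|f y - u y| <= de ^+ kap,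
      forall n, (n <= kap)%N -> cb n (bl a (8 * de)) (de^-1 ^+ 2) u &
      forall n c r, exists2 B, 0 <= B & cb n (bl c r) B u].

Lemma powR_small (al de : R) (s k : nat) z : 0 < al -> 0 < de -> de <= 1 -> 0 <= z -> z <= de ^+ s ->
  k%:R <= s%:R * al -> z `^ al <= de ^+ k.
Proof.
move=> al0 de0 de1 z0 zs sk; apply: le_trans (_ : (de ^+ s) `^ al <= _).
  by apply: ge0_ler_powR; rewrite ?nnegrE // ?exprn_ge0 // ltW.
rewrite -!powR_mulrn ?(ltW de0) // -powRrM; apply: ger_powR => //; by rewrite de0.
Qed.

Lemma okr_zero (X : set V) (f : V -> R) kap (de : R) a : 0 < de ->
  (forall y, X y -> bl a (8 * de) y -> `|f y| <= de ^+ kap) -> okr X f kap de a (fun=> 0).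
Proof.
move=> de0 h; split.
- by move=> y Xy ay; rewrite subr0; exact: h.
- by move=> n _; apply: cb_cst; rewrite normr0 exprn_ge0 // invr_ge0 ltW.
- by move=> n c r; exists 0 => //; apply: cb_cst; rewrite normr0.
Qed.

Lemma local_approx (X : set V) x (rho : R) (f G H P : V -> K) m (C al : R) :
  X = closure (interior X) -> 0 < rho -> rho <= 1 -> (0 < m)%N -> 0 < C -> 0 < al ->
  (forall n, exists2 B, 0 <= B & ccb n (bl x rho) B G) ->
  (forall n, exists2 B, 0 <= B & ccb n (bl x rho) B H) ->
  (forall n, exists2 B, 0 <= B & ccb n (bl x rho) B P) ->
  (forall y, X y -> bl x rho y -> [/\ H y = f y * G y, P y = f y ^+ m & cabs (f y) <= C * cabs (G y) `^ al]) ->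
  forall kap, exists2 de0, 0 < de0 & forall (de : R) a, 0 < de -> de <= de0 -> X a -> bl x (rho / 4) a ->
    exists u1 u2, okr X (fun y => complex.Re (f y)) kap de a u1 /\ okr X (fun y => complex.Im (f y)) kap de a u2.
Proof.
move=> fX rho0 rho1 m0 C0 al0 sG sH sP hX kap.
pose s := Num.bound (kap.+2%:R / al).
have sal : kap.+2%:R <= s%:R * al.
  by rewrite -ler_pdivrMr //; apply: ltW; apply: archi_boundP; rewrite divr_ge0 // ltW.
clearbody s.
pose D := (s + kap.+2 * m + kap.+2)%N.
have D1 : (s + kap.+1 <= D)%N by rewrite /D -addnA leq_add2l; apply: leq_trans (leq_addl _ _); rewrite leqnSn.
have D2 : (m + (kap.+1 * m).+1 <= D.+1)%N.
  rewrite addnS ltnS -mulSn /D; apply: leq_trans (leq_addr _ _); exact: leq_addl.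
clearbody D.
have [C1 C11 core] := @core_approx R d x rho G H P m D s.+1 rho0 rho1 m0 sG sH sP.
have [Lam L1 mk] := @markov R d D.
pose C2 := C1 * 16 ^+ D.+1.
have C10 : 0 <= C1 by lra.
have C20 : 0 <= C2 by rewrite mulr_ge0 // exprn_ge0.
pose W : R := kap%:R + 1.
have W1 : 1 <= W by rewrite lerDr.
pose C3 := D.+1%:R * (C1 * W ^+ D).
have W0 : 0 <= W by lra.
have C30 : 0 <= C3 by rewrite !mulr_ge0 // exprn_ge0.
pose C4 := Lam ^+ kap * C3.
have C40 : 0 <= C4 by rewrite mulr_ge0 // exprn_ge0 //; lra.
have Cm0 : 0 < C ^+ m by exact: exprn_gt0.
pose Q := 2 + C + 2 * C ^+ m + 2 * C2 + C4 + 64 / rho.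
have i64 : 0 < 64 / rho by rewrite divr_gt0.
have Q0 : 0 < Q by rewrite /Q; lra.
exists (1 / Q); first by rewrite divr_gt0.
move=> de a de0 deQ Xa ax.
have dQ : Q * de <= 1.
  by apply: le_trans (ler_wpM2l (ltW Q0) deQ) _; rewrite mulrCA divff ?gt_eqF ?mulr1.
have small Z : 0 <= Z -> Z <= Q -> Z * de <= 1.
  by move=> Z0 ZQ; apply: le_trans dQ; rewrite ler_pM2r.
have s2 : 2 * de <= 1 by apply: small => //; rewrite /Q; lra.
have sC : (1 + C) * de <= 1 by apply: small; rewrite /Q; lra.
have sCm : 2 * C ^+ m * de <= 1 by apply: small; rewrite /Q; lra.
have sC2 : 2 * C2 * de <= 1 by apply: small; rewrite /Q; lra.
have sC4 : C4 * de <= 1 by apply: small => //; rewrite /Q; lra.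
have srho : 64 * de <= rho.
  have : 64 / rho * de <= 1 by apply: small; rewrite /Q; lra.
  by rewrite mulrAC ler_pdivrMr // mul1r.
have de1 : de <= 1 by lra.
have dk j : 0 < de ^+ j by exact: exprn_gt0.
have in_rho y : bl a (8 * de) y -> bl x rho y.
  move=> ay; rewrite /bl /=; have -> : y - x = (y - a) + (a - x) by rewrite addrA subrK.
  by apply: le_lt_trans (ler_normD _ _) _; move: ay ax; rewrite /bl /=; clear -srho rho0; lra.
have fsmall y : X y -> bl a (8 * de) y -> cabs (G y) <= de ^+ s -> cabs (f y) <= C * de ^+ kap.+2.
  move=> Xy ay Gy; have [_ _ h] := hX y Xy (in_rho y ay); apply: le_trans h _.
  by rewrite ler_pM2l //; apply: powR_small sal => //; exact: cabs_ge0.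
have Ck : C * de ^+ kap.+2 <= de ^+ kap.+1.
  by rewrite [de ^+ kap.+2]exprS mulrA ler_piMl ?(ltW (dk _)) //; lra.
have kk : de ^+ kap.+1 <= de ^+ kap by rewrite exprS ler_piMl // ltW.
have [case1|case2] := pselect (forall y, X y -> bl a (8 * de) y -> cabs (G y) <= de ^+ s).
  have fk y : X y -> bl a (8 * de) y -> cabs (f y) <= de ^+ kap.
    by move=> Xy ay; apply: le_trans (fsmall y Xy ay (case1 y Xy ay)) _; exact: le_trans Ck kk.
  exists (fun=> 0), (fun=> 0); split; apply: okr_zero => // y Xy ay; apply: le_trans (fk y Xy ay).
    exact: Re_le_cabs.
  exact: Im_le_cabs.
have [y0 [Xy0 ay0 Gy0]] : exists y0, [/\ X y0, bl a (8 * de) y0 & de ^+ s < cabs (G y0)].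
  apply: contrapT => hno; apply: case2 => y Xy ay; rewrite leNgt; apply/negP => h; apply: hno.
  by exists y.
have [b [Xb ab Gb]] : exists b, [/\ interior X b, bl a (8 * de) b & de ^+ s.+1 <= cabs (G b)].
  have [B B0 [hB1 hB2]] := sG 1%N.
  pose eta := de ^+ s / (4 * (d%:R * B + 1)).
  have dB : 0 <= d%:R * B by rewrite mulr_ge0.
  have eta0 : 0 < eta by rewrite divr_gt0 // mulr_gt0 // ltr_wpDl.
  have etaE : 4 * (d%:R * B * eta) <= de ^+ s.
    have : 4 * ((d%:R * B + 1) * eta) = de ^+ s by rewrite /eta; field; apply/eqP; lra.
    have := mulr_ge0 dB (ltW eta0); clear -eta0; lra.
  have oab : open (bl a (8 * de) `&` bl y0 eta) by apply: openI; exact: bl_open.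
  have y00 : bl y0 eta y0 by rewrite /bl /= subrr normr0.
  have nb : nbhs y0 (bl a (8 * de) `&` bl y0 eta) by apply: open_nbhs_nbhs; split.
  have cy0 : closure (interior X) y0 by rewrite -fX.
  have [b [Xb [ab yb]]] := cy0 _ nb; exists b; split=> //.
  have l1 := cb1_lip hB1 (in_rho _ ab) (in_rho _ ay0); have l2 := cb1_lip hB2 (in_rho _ ab) (in_rho _ ay0).
  have n1 : `|y0 - b| <= eta by rewrite distrC; exact: ltW.
  have n2 : d%:R * B * `|y0 - b| <= d%:R * B * eta by rewrite ler_wpM2l.
  have : cabs (G y0 - G b) <= 2 * (d%:R * B * eta).
    have ReN (z : K) : complex.Re (- z) = - complex.Re z by case: z.
    have ImN (z : K) : complex.Im (- z) = - complex.Im z by case: z.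
    apply: le_trans (cabs_le _) _; rewrite ReD ImD ReN ImN; clear -l1 l2 n2; lra.
  have sE : de ^+ s.+1 = de * de ^+ s by exact: exprS.
  have tri : cabs (G y0) <= cabs (G b) + cabs (G y0 - G b) by rewrite -[in leLHS](subrK (G b) (G y0)) addrC; exact: cabsD.
  rewrite sE.
  have : de * de ^+ s <= 2^-1 * de ^+ s by rewrite ler_pM2r //; clear -s2; lra.
  clear -tri etaE Gy0; lra.
have bx : bl x (rho / 2) b.
  rewrite /bl /=; have -> : b - x = (b - a) + (a - x) by rewrite addrA subrK.
  by apply: le_lt_trans (ler_normD _ _) _; move: ab ax; rewrite /bl /=; clear -srho rho0; lra.
have rel : exists2 e, 0 < e & forall p, `|p - b| < e -> H p ^+ m = P p * G p ^+ m.
  have obx : open (interior X `&` bl x rho) by apply: openI; [exact: open_interior|exact: bl_open].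
  have := open_nbhs_nbhs (conj obx (conj Xb (in_rho _ ab))); rewrite -nbhs_ballE => -[e /= e0 he].
  exists e => // p pb; have [|Xp bp] := he p; first by rewrite -ball_normE /= distrC.
  by have [-> -> _] := hX p (interior_subset Xp) bp; rewrite exprMn.
have [r [cr br hr]] := core b de bx de0 de1 Gb rel.
pose rf p := \sum_(j < D.+1) r j (p - b).
have near y : bl a (8 * de) y -> `|y - b| < 16 * de.
  move=> ay; have -> : y - b = (y - a) - (b - a) by rewrite opprB addrA subrK.
  by apply: le_lt_trans (ler_normB _ _) _; move: ay ab; rewrite /bl /=; clear; lra.
have appr y : X y -> bl a (8 * de) y -> cabs (f y - rf y) <= de ^+ kap.
  move=> Xy ay; have vy := near y ay; have [hH hP _] := hX y Xy (in_rho y ay).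
  have [|e1 e2] := hr (y - b); first by clear -vy srho de0; lra.
  have byE : b + (y - b) = y by rewrite addrC subrK.
  rewrite byE in e1 e2; rewrite -/(rf y) hH -mulrBl cabsM in e1; rewrite -/(rf y) hP in e2.
  have vD : `|y - b| ^+ D.+1 <= 16 ^+ D.+1 * de ^+ D.+1.
    by rewrite -exprMn lerXn2r ?nnegrE ?mulr_ge0 ?(ltW de0) // ltW.
  have e1' : cabs (rf y - f y) * cabs (G y) <= C2 * de ^+ D.
    apply: le_trans e1 _; apply: le_trans (ler_wpM2l _ vD) _; first by rewrite divr_ge0 // ltW.
    by rewrite /C2 [de ^+ D.+1]exprS le_eqVlt; apply/orP; left; apply/eqP; field; rewrite gt_eqF.
  have e2' : cabs (rf y ^+ m - f y ^+ m) <= C2 * de ^+ (kap.+1 * m).+1.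
    apply: le_trans e2 _; apply: le_trans (ler_wpM2l _ vD) _; first by rewrite mulr_ge0 ?exprn_ge0 // invr_ge0 ltW.
    have -> : C1 * de^-1 ^+ m * (16 ^+ D.+1 * de ^+ D.+1) = C2 * (de^-1 ^+ m * de ^+ D.+1) by rewrite /C2; ring.
    rewrite ler_wpM2l // -(subnKC (leq_trans (leq_addr _ _) D2)) exprD mulrA -exprMn mulVf ?gt_eqF // expr1n mul1r.
    by rewrite ler_wiXn2l ?(ltW de0) // leq_subRL ?(leq_trans _ D2) ?leq_addr.
  rewrite cabs_dist; have [Gl|Gs] := leP (de ^+ s) (cabs (G y)).
    have : cabs (rf y - f y) * de ^+ s <= C2 * de ^+ D.
      by apply: le_trans e1'; rewrite ler_wpM2l // cabs_ge0.
    have : C2 * de ^+ D <= de ^+ kap * de ^+ s.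
      rewrite -exprD; apply: le_trans (_ : C2 * (de * de ^+ (kap + s)) <= _).
        by rewrite ler_wpM2l // -exprS ler_wiXn2l ?(ltW de0) // -addSn addnC.
      rewrite mulrA ler_piMl ?(ltW (dk _)) //; have := mulr_ge0 C20 (ltW de0); clear -sC2; lra.
    by move=> h1 h2; have := le_trans h2 h1; rewrite ler_pM2r.
  have fs := le_trans (fsmall y Xy ay (ltW Gs)) Ck.
  have fm : cabs (f y) ^+ m <= 2^-1 * de ^+ (kap.+1 * m).
    apply: le_trans (_ : (C * de ^+ kap.+2) ^+ m <= _).
      have n1 : 0 <= C * de ^+ kap.+2 by apply: mulr_ge0; apply: ltW.
      by apply: lerXn2r; rewrite ?nnegrE ?cabs_ge0 //; exact: (fsmall y Xy ay (ltW Gs)).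
    rewrite [de ^+ kap.+2]exprS mulrA exprMn -exprM ler_pM2r // exprMn.
    apply: le_trans (_ : C ^+ m * de <= _); last by clear -sCm; lra.
    by rewrite ler_pM2l // -[leRHS]expr1 ler_wiXn2l // ltW.
  have rm : cabs (rf y) ^+ m <= de ^+ kap.+1 ^+ m.
    have tri : cabs (rf y) ^+ m <= cabs (f y) ^+ m + cabs (rf y ^+ m - f y ^+ m).
      rewrite -!cabsX; have -> : rf y ^+ m = f y ^+ m + (rf y ^+ m - f y ^+ m) by ring.
      by rewrite [X in _ <= _ + cabs X](_ : _ = rf y ^+ m - f y ^+ m); [exact: cabsD|ring].
    rewrite -exprM.
    have : C2 * de ^+ (kap.+1 * m).+1 <= 2^-1 * de ^+ (kap.+1 * m).
      by rewrite exprS mulrA ler_pM2r //; clear -sC2; lra.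
    clear -tri fm e2'; lra.
  have rs : cabs (rf y) <= de ^+ kap.+1 by move: rm; rewrite ler_pXn2r ?nnegrE ?cabs_ge0 // ltW.
  apply: le_trans (cabsB _ _) _.
  have : de ^+ kap.+1 + de ^+ kap.+1 <= de ^+ kap by rewrite exprS; have := dk kap; clear -s2; nra.
  clear -fs rs; lra.
have rbd n p : (n <= kap)%N -> bl a (8 * de + n%:R) p -> cabs (rf p) <= C3 / de.
  move=> nk bp; have pb : `|p - b| <= W.
    have -> : p - b = (p - a) - (b - a) by rewrite opprB addrA subrK.
    apply: le_trans (ler_normB _ _) _; have nk' : n%:R <= kap%:R :> R by rewrite ler_nat.
    by move: bp ab; rewrite /bl /= /W; lra.
  apply: le_trans (cabs_sum _ _ _) _; apply: le_trans (_ : \sum_(j < D.+1) (C1 * W ^+ D) / de <= _); last first.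
    by rewrite sumr_const card_ord /C3 -[leLHS]mulr_natl !mulrA.
  apply: ler_sum => j _; have jD : (j <= D)%N by rewrite -ltnS.
  apply: le_trans (br j _ jD) _; rewrite mulrAC ler_pM2r ?invr_gt0 // ler_wpM2l //.
  apply: le_trans (_ : W ^+ j <= _); first by rewrite lerXn2r ?nnegrE.
  by rewrite ler_weXn2l.
have fin (pr : K -> R) : (forall z, `|pr z| <= cabs z) -> sp D (fun p => pr (rf p)) ->
   (forall n c r, exists2 B, 0 <= B & cb n (bl c r) B (fun p => pr (rf p))) -> (forall z w, pr (z - w) = pr z - pr w) ->
   okr X (fun y => pr (f y)) kap de a (fun p => pr (rf p)).
  move=> prl spr scb prB; split=> //.
    by move=> y Xy ay; rewrite -prB; apply: le_trans (prl _) _; exact: appr.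
  move=> n nk; have B0 : 0 <= C3 / de by rewrite divr_ge0 // ltW.
  have := mk n _ (C3 / de) a (8 * de) spr (fun p bp => le_trans (prl _) (rbd n p nk bp)) B0.
  apply: cb_le => //; apply: le_trans (_ : C4 / de <= _).
    by rewrite /C4 mulrA ler_pM2r ?invr_gt0 // ler_wpM2r // ler_weXn2l.
  by rewrite expr2 ler_pM2r ?invr_gt0 // -[leRHS]mul1r ler_pdivlMr.
exists (fun p => complex.Re (rf p)), (fun p => complex.Im (rf p)); split; apply: fin.
- exact: Re_le_cabs.
- have := @sp_sum R d D (fun j v => complex.Re (r j v)) b (fun j => proj1 (cr j)).
  by congr sp; apply/funext => p; rewrite /rf Re_sum.
- move=> n c rr.
  have /choice[B hB] : forall j : 'I_D.+1, exists B, 0 <= B /\ cb n (bl c rr) B (fun p => complex.Re (r j (p - b))).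
    by move=> j; have [B B0 h] := hp_cb n c rr b (proj1 (cr j)); exists B.
  exists (\sum_j B j); first by apply: sumr_ge0 => j _; case: (hB j).
  by apply: (cb_eq _ (cb_sum (index_enum 'I_D.+1) (fun j => proj2 (hB j)))) => p; rewrite /rf Re_sum.
- by move=> [? ?] [? ?].
- exact: Im_le_cabs.
- have := @sp_sum R d D (fun j v => complex.Im (r j v)) b (fun j => proj2 (cr j)).
  by congr sp; apply/funext => p; rewrite /rf Im_sum.
- move=> n c rr.
  have /choice[B hB] : forall j : 'I_D.+1, exists B, 0 <= B /\ cb n (bl c rr) B (fun p => complex.Im (r j (p - b))).
    by move=> j; have [B B0 h] := hp_cb n c rr b (proj2 (cr j)); exists B.
  exists (\sum_j B j); first by apply: sumr_ge0 => j _; case: (hB j).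
  by apply: (cb_eq _ (cb_sum (index_enum 'I_D.+1) (fun j => proj2 (hB j)))) => p; rewrite /rf Im_sum.
- by move=> [? ?] [? ?].
Qed.

End LocalApprox.

(** * Approximation and gluing *)

Section Bump.
Variable R : realType.
Implicit Types (s t : R) (k n : nat).

Definition Ef k t : R := t^-1 ^+ k * expR (- t^-1).
Definition ef k t : R := if 0 < t then Ef k t else 0.

Lemma Ef_bound k t : 0 < t -> 0 <= Ef k t <= k%:R ^+ k.
Proof.
move=> t0; have u0 : 0 < t^-1 by rewrite invr_gt0.
have Eu : 0 < expR (t^-1) by exact: expR_gt0.
rewrite /Ef expRN mulr_ge0 ?exprn_ge0 ?invr_ge0 ?(ltW Eu) ?(ltW t0) //= ler_pdivrMr //.
case: k => [|k]; first by rewrite !expr0 mul1r; apply: le_trans (expR_ge1Dx _); rewrite lerDl ltW.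
have k0 : 0 < k.+1%:R :> R by rewrite ltr0n.
have -> : expR t^-1 = expR (t^-1 / k.+1%:R) ^+ k.+1 by rewrite -expRM_natl mulrCA divff ?gt_eqF ?mulr1.
rewrite -exprMn; apply: lerXn2r; rewrite ?nnegrE ?mulr_ge0 ?(ltW u0) ?expR_ge0 //.
rewrite mulrC -ler_pdivrMr //; apply: le_trans (expR_ge1Dx _); by rewrite lerDr.
Qed.

Lemma ef_bound k t : 0 <= ef k t <= k%:R ^+ k.
Proof. by rewrite /ef; case: ifP => t0; [exact: Ef_bound|rewrite lexx exprn_ge0]. Qed.

Lemma ef_norm k t : `|ef k t| <= k%:R ^+ k.
Proof. by have /andP[h1 h2] := ef_bound k t; rewrite ger0_norm. Qed.

Lemma Ef_shift k j t : 0 < t -> Ef k t = Ef (k + j) t * t ^+ j.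
Proof.
move=> t0; rewrite /Ef exprD -[LHS]mulr1.
have <- : (t^-1 * t) ^+ j = 1 by rewrite mulVf ?gt_eqF // expr1n.
by rewrite exprMn; ring.
Qed.

Definition dEf k t : R := Ef k.+2 t - k%:R * Ef k.+1 t.

Lemma Ef_derive k t : 0 < t -> is_derive t (1 : R) (Ef k) (dEf k t).
Proof.
move=> t0; have tn : t != 0 by rewrite gt_eqF.
have dV : is_derive t (1 : R) (fun x : R => x^-1) (- t ^- 2 *: 1) by apply: is_deriveV.
have dE := @is_derive1_comp R expR (- (fun x : R => x^-1)) t _ _ (is_derive_expR (- t^-1)) (is_deriveN dV).
have := is_deriveM (is_deriveX k dV) dE.
have -> : (fun x : R => x^-1) ^+ k * (expR \o - (fun x : R => x^-1)) = Ef k.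
  apply/funext => x; rewrite /Ef -[LHS]/(((fun x : R => x^-1) ^+ k) x * expR (- x^-1)); congr (_ * _).
  by elim: (k) => [|n IH]; rewrite ?expr0 // !exprS -IH.
congr is_derive; rewrite /dEf /Ef /=.
have -> : ((fun x : R => x^-1) ^+ k) t = t^-1 ^+ k.
  by elim: (k) => [|n IH]; rewrite ?expr0 // !exprS -IH.
rewrite -!exprVn; move: (t^-1) (expR _) => u E; rewrite /GRing.scale /=.
by case: (k) => [|n] /=; rewrite ?expr0 ?mulr1 ?[u ^+ n.+3]exprS ?[u ^+ n.+2]exprS ?[u ^+ n.+1]exprS; ring.
Qed.

Lemma dEf_derive k t : 0 < t -> is_derive t (1 : R) (dEf k) (dEf k.+2 t - k%:R * dEf k.+1 t).
Proof.
move=> t0.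
have := is_deriveB (Ef_derive k.+2 t0) (is_deriveZ k%:R (Ef_derive k.+1 t0)).
by congr is_derive.
Qed.

Lemma pos_mvt (f df : R -> R) s t : 0 < s -> 0 < t -> (forall x : R, 0 < x -> is_derive x (1 : R) f (df x)) ->
  exists2 x, 0 < x /\ `|x - t| <= `|s - t| & f s - f t = df x * (s - t).
Proof.
move=> s0 t0 hf.
have main (a b : R) : 0 < a -> a <= b -> exists2 x, a <= x <= b & f b - f a = df x * (b - a).
  move=> a0 ab; have [||x] := @MVT_segment R f df a b ab.
  - by move=> x; rewrite in_itv /= => /andP[ax _]; apply: hf; exact: lt_trans ax.
  - apply: derivable_within_continuous => x; rewrite in_itv /= => /andP[ax _].
    by have [] := hf x (lt_le_trans a0 ax).
  - by rewrite in_itv /= => xab h; exists x.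
have [st|/ltW ts] := leP s t.
  have [x /andP[h1 h2] h3] := main s t s0 st; exists x.
    split; first exact: lt_le_trans h1.
    by rewrite distrC [leRHS]distrC !ger0_norm ?subr_ge0 // lerB.
  by rewrite -opprB h3 -mulrN opprB.
have [x /andP[h1 h2] h3] := main t s t0 ts; exists x => //.
split; first exact: lt_le_trans h1.
by rewrite !ger0_norm ?subr_ge0 // lerB.
Qed.

Definition def k t : R := ef k.+2 t - k%:R * ef k.+1 t.

Lemma ef_t1 k : exists2 Q : R, 0 <= Q & forall s t, `|ef k s - ef k t - (s - t) * def k t| <= Q * (s - t) ^+ 2.
Proof.
pose b j : R := j%:R ^+ j.
have b0 j : 0 <= b j by rewrite exprn_ge0.
pose Q1 := b k.+4 + k.+2%:R * b k.+3 + k%:R * (b k.+3 + k.+1%:R * b k.+2).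
have Q10 : 0 <= Q1 by rewrite !addr_ge0 // mulr_ge0 // addr_ge0 // mulr_ge0.
pose Q2 := b k.+2 + (b k.+3 + k%:R * b k.+2).
have Q20 : 0 <= Q2 by rewrite !addr_ge0 // mulr_ge0.
exists (Q1 + Q2); first by rewrite addr_ge0.
move=> s t; have sq := sqr_ge0 (s - t).
have i1 := mulr_ge0 Q10 sq.
have QE : (Q1 + Q2) * (s - t) ^+ 2 = Q1 * (s - t) ^+ 2 + (b k.+2 * (s - t) ^+ 2 + (b k.+3 + k%:R * b k.+2) * (s - t) ^+ 2).
  by rewrite /Q2; ring.
have Eb j x : 0 < x -> `|Ef j x| <= b j.
  by move=> x0; have /andP[h1 h2] := Ef_bound j x0; rewrite ger0_norm.
have dEb j x : 0 < x -> `|dEf j x| <= b j.+2 + j%:R * b j.+1.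
  by move=> x0; apply: le_trans (ler_normB _ _) _; rewrite lerD ?Eb // normrM normr_nat ler_wpM2l // Eb.
have q1 x : 0 < x -> Ef k x <= b k.+2 * x ^+ 2.
  move=> x0; rewrite (Ef_shift k 2 x0) addn2 ler_wpM2r ?exprn_ge0 ?(ltW x0) //.
  by have /andP[] := Ef_bound k.+2 x0.
rewrite /def /ef; have [s0|s0] := ltP 0 s; have [t0|t0] := ltP 0 t.
- rewrite -/(dEf k t); have [x [x0 xt] ->] := pos_mvt s0 t0 (@Ef_derive k).
  have [y [y0 yt] e2] := pos_mvt x0 t0 (@dEf_derive k).
  rewrite [(s - t) * _]mulrC -mulrBl e2 !normrM.
  have h1 : `|dEf k.+2 y - k%:R * dEf k.+1 y| <= Q1.
    apply: le_trans (ler_normB _ _) _; apply: lerD; first exact: dEb.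
    by rewrite normrM normr_nat ler_wpM2l // dEb.
  have h2 : `|x - t| * `|s - t| <= (s - t) ^+ 2.
    by rewrite -[leRHS]ger0_norm // normrX expr2 ler_wpM2r.
  rewrite -mulrA; apply: le_trans (ler_pM _ _ h1 h2) _; rewrite ?mulr_ge0 //.
  by apply: ler_wpM2r => //; rewrite lerDl.
- rewrite mulr0 !subr0 mulr0 subr0 ger0_norm; last by have /andP[] := Ef_bound k s0.
  have h1 : s ^+ 2 <= (s - t) ^+ 2 by rewrite lerXn2r ?nnegrE ?subr_ge0 ?(ltW s0) //; lra.
  have := ler_wpM2l (b0 k.+2) h1; have := q1 s s0.
  have : 0 <= (b k.+3 + k%:R * b k.+2) * (s - t) ^+ 2 by rewrite mulr_ge0 // addr_ge0 // mulr_ge0.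
  rewrite QE; lra.
- rewrite sub0r -/(dEf k t).
  have tq : t <= t - s by lra.
  have h1 : t ^+ 2 <= (s - t) ^+ 2 by rewrite -[(s - t) ^+ 2]sqrrN opprB lerXn2r ?nnegrE ?(ltW t0) //; lra.
  have h2 := ler_wpM2l (b0 k.+2) h1; have h3 := q1 t t0.
  have h4 : `|dEf k t| <= (b k.+3 + k%:R * b k.+2) * t.
    rewrite /dEf (Ef_shift k.+2 1 t0) (Ef_shift k.+1 1 t0) !expr1 !addn1 mulrA -mulrBl normrM (gtr0_norm t0).
    rewrite ler_pM2r //; apply: le_trans (ler_normB _ _) _; apply: lerD; first exact: Eb.
    by rewrite normrM normr_nat ler_wpM2l // Eb.
  have h5 : `|(s - t) * dEf k t| <= (b k.+3 + k%:R * b k.+2) * (s - t) ^+ 2.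
    rewrite normrM distrC (gtr0_norm (lt_le_trans t0 tq)) -[(s - t) ^+ 2]sqrrN opprB.
    have p0 : 0 <= b k.+3 + k%:R * b k.+2 by rewrite addr_ge0 // mulr_ge0.
    rewrite expr2 mulrCA; apply: ler_wpM2l; first by lra.
    by apply: le_trans h4 _; apply: ler_wpM2l.
  apply: le_trans (ler_normB _ _) _; rewrite normrN ger0_norm; last by have /andP[] := Ef_bound k t0.
  rewrite QE; lra.
- by rewrite mulr0 !subrr mulr0 subrr normr0 mulr_ge0 // addr_ge0.
Qed.

End Bump.

Section PartitionOfUnity.
Variables (R : realType) (d : nat).
Local Notation V := 'rV[R]_d.
Implicit Types (p x : V) (n k : nat) (i : 'I_d) (O : set V).

Lemma ef_cb n k : exists2 M : R, 0 <= M & forall (a c A : R) i O, 1 <= A -> `|a| <= A ->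
  cb n O (M * A ^+ n) (fun p => ef k (a * p ord0 i + c)).
Proof.
elim: n k => [|n IH] k.
  exists (k%:R ^+ k); first by rewrite exprn_ge0.
  by move=> a c A i O A1 aA; split=> // p _; rewrite expr0 mulr1 ef_norm.
have [M1 M10 h1] := IH k.+2; have [M2 M20 h2] := IH k.+1; have [Q Q0 hQ] := ef_t1 R k.
have kk : 0 <= k%:R ^+ k :> R by rewrite exprn_ge0.
have kM : 0 <= k%:R * M2 by rewrite mulr_ge0.
exists (k%:R ^+ k + (M1 + k%:R * M2)); first by rewrite !addr_ge0.
move=> a c A i O A1 aA; have A0 : 0 <= A by lra.
have An : 1 <= A ^+ n.+1 by exact: exprn_ege1.
split.
  move=> p _; apply: le_trans (ef_norm _ _) _; apply: le_trans (_ : k%:R ^+ k * A ^+ n.+1 <= _); first by rewrite ler_peMr.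
  by apply: ler_wpM2r; [lra|rewrite lerDl addr_ge0].
exists (fun j p => if j == i then a * def k (a * p ord0 i + c) else 0), (Q * A ^+ 2); split.
  move=> p q _ _; rewrite (bigD1 i) //= eqxx big1 ?addr0; last by move=> j /negbTE ->; rewrite mulr0.
  have := hQ (a * q ord0 i + c) (a * p ord0 i + c).
  have -> : a * q ord0 i + c - (a * p ord0 i + c) = a * (q - p) ord0 i by rewrite !mxE; ring.
  rewrite mulrA [(q - p) ord0 i * a]mulrC => h; apply: le_trans h _.
  rewrite -mulrA ler_wpM2l // -exprMn -[leLHS]ger0_norm ?sqr_ge0 // normrX.
  by rewrite lerXn2r ?nnegrE ?mulr_ge0 // normrM ler_pM // rV_coord_le.
move=> j; case: eqP => _; last by apply: cb_cst; rewrite normr0 mulr_ge0 ?addr_ge0 //; lra.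
have An0 : 0 <= A ^+ n by rewrite exprn_ge0.
have := cb_scale a (cb_sub (h1 a c A i O A1 aA) (cb_scale k%:R (h2 a c A i O A1 aA))).
apply: cb_le => //; rewrite normr_nat exprS.
apply: le_trans (_ : A * ((M1 + k%:R * M2) * A ^+ n) <= _).
  rewrite [(M1 + _) * _]mulrDl -mulrA; apply: ler_wpM2r => //; by rewrite !addr_ge0 // ?mulr_ge0.
by rewrite mulrCA; apply: ler_wpM2r; [rewrite mulr_ge0|rewrite lerDr].
Qed.

Definition den (t : R) := ef 0 t + ef 0 (1 - t).
Definition sg (t : R) := ef 0 t * (den t)^-1.
Definition psi (t : R) := sg (t + 1) - sg t.

Lemma den_ge (t : R) : expR (- 2) <= den t.
Proof.
have h (s : R) : 2^-1 <= s -> expR (- 2) <= ef 0 s.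
  move=> hs; have s0 : 0 < s by apply: lt_le_trans hs.
  rewrite /ef s0 /Ef expr0 mul1r ler_expR lerN2 -[leRHS]invrK lef_pV2 ?posrE ?invr_gt0 //.
have e0 (s : R) : 0 <= ef 0 s by have /andP[] := ef_bound 0 s.
have [ht|ht] := leP 2^-1 t; first by have := h t ht; have := e0 (1 - t); rewrite /den; lra.
have := h (1 - t); have := e0 t; rewrite /den => h1 h2; have : expR (- 2) <= ef 0 (1 - t) by apply: h2; lra.
lra.
Qed.

Lemma den_gt0 (t : R) : 0 < den t.
Proof. by apply: lt_le_trans (den_ge t); exact: expR_gt0. Qed.

Lemma sg01 (t : R) : 0 <= sg t /\ sg t <= 1.
Proof.
have /andP[h1 _] := ef_bound 0 t; have /andP[h2 _] := ef_bound 0 (1 - t); have d0 := den_gt0 t.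
split; first by rewrite divr_ge0 // ltW.
by rewrite ler_pdivrMr // mul1r lerDl.
Qed.

Lemma sg_le0 (t : R) : t <= 0 -> sg t = 0.
Proof. by move=> t0; rewrite /sg /ef ltNge t0 mul0r. Qed.

Lemma sg_ge1 (t : R) : 1 <= t -> sg t = 1.
Proof.
move=> t1; have E : den t = ef 0 t by rewrite /den {2}/ef ltNge (_ : 1 - t <= 0) ?addr0 //; lra.
by have := den_gt0 t; rewrite /sg E => d0; rewrite divff // gt_eqF.
Qed.

Lemma psi_supp (t : R) : psi t != 0 -> `|t| < 1.
Proof.
move=> h; rewrite ltNge; apply/negP => t1; move/eqP: h; apply; rewrite /psi.
have [t0|t0] := leP 0 t.
  by move: t1; rewrite ger0_norm // => t1; rewrite !sg_ge1 ?subrr //; lra.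
by move: t1; rewrite ltr0_norm // => t1; rewrite !sg_le0 ?subrr //; lra.
Qed.

Lemma psi_le1 (t : R) : `|psi t| <= 1.
Proof. have := sg01 t; have := sg01 (t + 1); rewrite /psi ler_norml; lra. Qed.

Lemma psi_sum (t : R) M : `|t| <= M%:R -> \sum_(l < (M + M).+1) psi (t - l%:R + M%:R) = 1.
Proof.
move=> tM.
have tele n : \sum_(l < n) psi (t - l%:R + M%:R) = sg (t + M%:R + 1) - sg (t + M%:R + 1 - n%:R).
  elim: n => [|n IH]; first by rewrite big_ord0 subr0 subrr.
  rewrite big_ord_recr /= IH /psi -natr1.
  have -> : t - n%:R + M%:R + 1 = t + M%:R + 1 - n%:R by ring.
  have -> : t - n%:R + M%:R = t + M%:R + 1 - (n%:R + 1) by ring.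
  by ring.
move: tM; rewrite ler_norml => /andP[h1 h2]; rewrite tele sg_ge1; last by lra.
by rewrite sg_le0 ?subr0 // -natr1 natrD; lra.
Qed.

Lemma sg_cb n : exists (M : R) (N : nat), 0 <= M /\ forall (a c A : R) i O, 1 <= A -> `|a| <= A ->
  cb n O (M * A ^+ N) (fun p => sg (a * p ord0 i + c)).
Proof.
have [M M0 hM] := ef_cb n 0; have [K [N [K1 hK]]] := @cb_inv R d n.
pose B0 : R := 2 * M + expR 2.
exists (2 ^+ n * (M * (K * B0 ^+ N))), (n + n * N)%N.
have e2 : 1 <= expR 2 :> R by apply: le_trans (expR_ge1Dx _); rewrite lerDl.
have B01 : 1 <= B0 by rewrite /B0; lra.
split; first by rewrite !mulr_ge0 ?exprn_ge0 //; lra.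
move=> a c A i O A1 aA.
have An : 1 <= A ^+ n by exact: exprn_ege1.
have h1 := hM a c A i O A1 aA.
have h2 : cb n O (M * A ^+ n) (fun p => ef 0 (1 - (a * p ord0 i + c))).
  have aA' : `|- a| <= A by rewrite normrN.
  apply: cb_eq (hM (- a) (1 - c) A i O A1 aA') => p; congr (ef _ _); ring.
have h3 : cb n O (B0 * A ^+ n) (fun p => den (a * p ord0 i + c)).
  apply: (cb_le _ _ _ (cb_add h1 h2)) => //; rewrite /B0 mulrDl.
  have : 0 <= expR 2 * A ^+ n by rewrite mulr_ge0 ?expR_ge0 //; lra.
  lra.
have B1 : 1 <= B0 * A ^+ n by rewrite mulr_ege1.
have h4 := hK O _ _ B1 h3.
have := cb_mul h1 (h4 _); rewrite /sg; have -> : 2 ^+ n * (M * A ^+ n * (K * (B0 * A ^+ n) ^+ N)) =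
   2 ^+ n * (M * (K * B0 ^+ N)) * A ^+ (n + n * N) by rewrite exprD exprM exprMn; ring.
apply => p _; apply: le_trans (den_ge _).
rewrite expRN lef_pV2 ?posrE ?expR_gt0 //; last by lra.
apply: le_trans (_ : B0 <= _); first by rewrite /B0; lra.
by rewrite ler_peMr //; lra.
Qed.

Definition cen x (de : R) M (nu : {ffun 'I_d -> 'I_(M + M).+1}) : V :=
  \row_i (x ord0 i + de * ((nu i)%:R - M%:R)).
Definition pu x (de : R) M (nu : {ffun 'I_d -> 'I_(M + M).+1}) p : R :=
  \prod_i psi ((p ord0 i - x ord0 i) / de - (nu i)%:R + M%:R).

Lemma pu_sum x (de : R) M p : 0 < de -> `|p - x| <= M%:R * de -> \sum_nu @pu x de M nu p = 1.
Proof.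
move=> de0 hp; rewrite /pu -(bigA_distr_bigA (fun i (l : 'I_(M + M).+1) => psi ((p ord0 i - x ord0 i) / de - l%:R + M%:R))).
rewrite big1 // => i _; apply: psi_sum; rewrite normrM normfV (gtr0_norm de0) ler_pdivrMr //.
by apply: le_trans hp; have := rV_coord_le (p - x) i; rewrite !mxE.
Qed.

Lemma pu_supp x (de : R) M nu p : 0 < de -> @pu x de M nu p != 0 -> `|p - cen x de nu| <= de.
Proof.
move=> de0 h; apply: rV_norm_le; first exact: ltW.
move=> i; rewrite !mxE.
have : psi ((p ord0 i - x ord0 i) / de - (nu i)%:R + M%:R) != 0.
  by apply: contraNneq h => h; rewrite /pu (bigD1 i) //= h mul0r.
move=> /psi_supp /ltW h1.
have -> : p ord0 i - (x ord0 i + de * ((nu i)%:R - M%:R)) = ((p ord0 i - x ord0 i) / de - (nu i)%:R + M%:R) * de.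
  by field; rewrite gt_eqF.
by rewrite normrM (gtr0_norm de0) ler_piMl // ltW.
Qed.

Lemma pu_le1 x (de : R) M nu p : `|@pu x de M nu p| <= 1.
Proof. by rewrite /pu normr_prod; apply: prodr_ile1 => i; rewrite normr_ge0 psi_le1. Qed.

Lemma pu_cb n : exists (C : R) (N : nat), 0 <= C /\ forall x (de : R) M nu O, 0 < de -> de <= 1 ->
  cb n O (C * de^-1 ^+ N) (@pu x de M nu).
Proof.
have [C [N [C0 hC]]] := sg_cb n; pose sz := size (index_enum 'I_d).
exists ((2 ^+ n * (1 + (C + C))) ^+ sz), (N * sz)%N; split.
  by rewrite exprn_ge0 // mulr_ge0 ?exprn_ge0 //; lra.
move=> x de M nu O de0 de1.
have A1 : 1 <= de^-1 by rewrite invf_ge1.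
have aA : `|de^-1| <= de^-1 by rewrite gtr0_norm ?invr_gt0.
have AN : 1 <= de^-1 ^+ N by exact: exprn_ege1.
have -> : (2 ^+ n * (1 + (C + C))) ^+ sz * de^-1 ^+ (N * sz) = (2 ^+ n * ((1 + (C + C)) * de^-1 ^+ N)) ^+ sz.
  by rewrite exprM -exprMn mulrA.
apply: cb_prod; first by rewrite mulr_ege1 //; lra.
move=> i.
have h1 := hC de^-1 (- (x ord0 i / de) - (nu i)%:R + M%:R + 1) _ i O A1 aA.
have h2 := hC de^-1 (- (x ord0 i / de) - (nu i)%:R + M%:R) _ i O A1 aA.
have := cb_sub h1 h2 => h3; apply: (cb_le _ _ _ (cb_eq _ h3)) => //; last first.
  by move=> p; rewrite /psi; congr (sg _ - sg _); field; rewrite gt_eqF.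
by rewrite -mulrDl ler_wpM2r //; lra.
Qed.

End PartitionOfUnity.

Section SmallDerivatives.
Variables (R : realType) (d : nat).
Local Notation V := 'rV[R]_d.
Implicit Types (b p q : V) (u : V -> R) (c M : nat).

Lemma landau kp' M c : (0 < M)%N -> exists (kp : nat) (e0 : R), 0 < e0 /\ forall (th : R) b u dF Q,
  0 < th -> th <= e0 -> t1 (bl b (6 * th)) u dF Q -> (forall i, cb 1 (bl b (6 * th)) (th^-1 ^+ c) (dF i)) ->
  (forall p, `|p - b| <= th ^+ M -> `|u p| <= th ^+ kp) ->
  forall i p, `|p - b| <= th ^+ M.+1 -> `|dF i p| <= th ^+ kp'.
Proof.
move=> M0; pose mu := (kp' + M + 2)%N.
have dd : 0 <= d%:R * d%:R :> R by rewrite mulr_ge0.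
exists (c + mu + kp' + 1)%N, (1 / (4 + 2 * (d%:R * d%:R))); split; first by rewrite divr_gt0 //; lra.
move=> th b u dF Q th0 the T hdF hu i p pb.
have thQ : (4 + 2 * (d%:R * d%:R)) * th <= 1.
  by move: the; rewrite ler_pdivlMr; [rewrite mulrC|lra].
have dth : 0 <= d%:R * d%:R * th by rewrite mulr_ge0 // ltW.
have th4 : 4 * th <= 1 by lra.
have th1 : th <= 1 by lra.
have tp n : 0 < th ^+ n by exact: exprn_gt0.
have MM : th ^+ M.+1 + th ^+ M.+1 <= th ^+ M by rewrite exprS; have := tp M; nra.
have M1 : th ^+ M <= th by rewrite -[leRHS]expr1 ler_wiXn2l ?(ltW th0).
pose h := th ^+ (c + mu).
have h0 : 0 < h by exact: tp.
have hM : h <= th ^+ M.+1 by rewrite ler_wiXn2l ?(ltW th0) // /mu; lia.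
pose q := p + h *: delta_mx ord0 i.
have qp : q - p = h *: delta_mx ord0 i by rewrite /q addrC addKr.
have nq : `|q - p| <= h.
  rewrite qp; apply: rV_norm_le; first exact: ltW.
  by move=> j; rewrite !mxE /=; case: eqP => _; rewrite ?mulr1 ?mulr0 ?normr0 ?gtr0_norm // ltW.
have qb : `|q - b| <= th ^+ M.
  have -> : q - b = (q - p) + (p - b) by rewrite addrA subrK.
  apply: le_trans (ler_normD _ _) _; lra.
have pb' : `|p - b| <= th ^+ M by have := tp M.+1; lra.
have bp : bl b (6 * th) p by rewrite /bl /=; lra.
have bq : bl b (6 * th) q by rewrite /bl /=; lra.
have S : \sum_k (q - p) ord0 k * dF k p = h * dF i p.
  rewrite (bigD1 i) //= big1 => [|k ne]; last by rewrite qp !mxE eqxx (negbTE ne) mulr0 mul0r.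
  by rewrite addr0 qp !mxE !eqxx mulr1.
have := t1_quad T hdF bp bq; rewrite S => h1.
have n2 : `|q - p| ^+ 2 <= h ^+ 2 by rewrite lerXn2r ?nnegrE // ltW.
have tc : 0 <= d%:R * (d%:R * th^-1 ^+ c) by rewrite !mulr_ge0 ?exprn_ge0 // invr_ge0 ltW.
have h2 := ler_wpM2l tc n2.
have h3 := hu p pb'; have h4 := hu q qb.
have h5 : h * `|dF i p| <= 2 * th ^+ (c + mu + kp' + 1) + d%:R * (d%:R * th^-1 ^+ c) * h ^+ 2.
  rewrite -[X in X * _](gtr0_norm h0) -normrM.
  have -> : h * dF i p = (u q - u p) - (u q - u p - h * dF i p) by ring.
  apply: le_trans (ler_normB _ _) _; have := ler_normB (u q) (u p); lra.
have e1 : th ^+ (c + mu + kp' + 1) = h * (th ^+ kp' * th) by rewrite addn1 exprSr exprD mulrA.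
have e2 : d%:R * (d%:R * th^-1 ^+ c) * h ^+ 2 = h * (d%:R * d%:R * (th ^+ kp' * (th * (th ^+ M * th)))).
  have -> : h ^+ 2 = h * (th ^+ c * th ^+ mu) by rewrite expr2 {2}/h exprD.
  have -> : d%:R * (d%:R * th^-1 ^+ c) * (h * (th ^+ c * th ^+ mu)) = h * (d%:R * d%:R * ((th^-1 * th) ^+ c * th ^+ mu)).
    by rewrite exprMn; ring.
  rewrite mulVf ?gt_eqF // expr1n mul1r /mu !exprD; congr (_ * (_ * _)); ring.
have : `|dF i p| <= 2 * (th ^+ kp' * th) + d%:R * d%:R * (th ^+ kp' * (th * (th ^+ M * th))).
  by rewrite -(ler_pM2l h0) mulrDr -e2 [h * (2 * _)]mulrCA -e1.
move=> h6; apply: le_trans h6 _.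
have k0 := tp kp'.
have f1 : 2 * (th ^+ kp' * th) <= th ^+ kp' / 2 by have := ler_wpM2l (ltW k0) th4; lra.
have f2 : th ^+ M * th <= 1 by rewrite -exprSr exprn_ile1 // ltW.
have f3 : d%:R * d%:R * (th ^+ kp' * (th * (th ^+ M * th))) <= th ^+ kp' * (d%:R * d%:R * th).
  have -> : d%:R * d%:R * (th ^+ kp' * (th * (th ^+ M * th))) = th ^+ kp' * (d%:R * d%:R * th) * (th ^+ M * th) by ring.
  by rewrite ler_piMr // mulr_ge0 // ltW.
have f4 : th ^+ kp' * (d%:R * d%:R * th) <= th ^+ kp' * (1 / 2) by apply: ler_wpM2l; [exact: ltW|lra].
lra.
Qed.

Lemma sup_small n c M : (0 < M)%N -> exists (kp : nat) (C e0 : R), [/\ 0 <= C, 0 < e0 & forall (th : R) b u,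
  0 < th -> th <= e0 -> cb n.+1 (bl b (6 * th)) (th^-1 ^+ c) u ->
  (forall p, `|p - b| <= th ^+ M -> `|u p| <= th ^+ kp) ->
  forall p, bl b (6 * th) p -> `|u p| <= C * (th ^+ n * th^-1 ^+ c)].
Proof.
elim: n M => [|n IH] M M0.
  exists 0%N, 1, 1; split=> // th b u th0 th1 [hu _] _ p bp; rewrite expr0 !mul1r; exact: hu.
have [kp' [C [e1 [C0 e10 hC]]]] := IH M.+1 isT.
have [kp [e0 [e00 hl]]] := landau kp' c M0.
exists (kp + n.+1)%N, (1 + 6 * (d%:R * C)), (Num.min 1 (Num.min e0 e1)); split.
- by rewrite addr_ge0 // !mulr_ge0.
- by rewrite !lt_min ltr01 e00.
move=> th b u th0; rewrite !le_min => /andP[th1 /andP[te0 te1]] hcb hu p bp.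
have [_ [dF [Q [T h]]]] := hcb.
have tp k : 0 < th ^+ k by exact: exprn_gt0.
have h' i : cb n.+1 (bl b (6 * th)) (th^-1 ^+ c) (dF i) := h i.
have h1 i : cb 1 (bl b (6 * th)) (th^-1 ^+ c) (dF i) by apply: cb_le (h' i).
have hu' p' : `|p' - b| <= th ^+ M -> `|u p'| <= th ^+ kp.
  by move=> /hu hp; apply: le_trans hp _; rewrite ler_wiXn2l ?(ltW th0) // leq_addr.
have sm := hl th b u dF Q th0 te0 T h1 hu'.
have dB i z : bl b (6 * th) z -> `|dF i z| <= C * (th ^+ n * th^-1 ^+ c).
  by apply: (hC th b (dF i) th0 te1 (h' i)) => p' hp'; exact: sm.
have b0 : bl b (6 * th) b by rewrite /bl /= subrr normr0 mulr_gt0.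
have l1 := t1_lip T dB b0 bp.
have ub : `|u b| <= th ^+ (kp + n.+1) by apply: hu; rewrite subrr normr0 ltW.
have ti : 1 <= th^-1 ^+ c by apply: exprn_ege1; rewrite invf_ge1.
have u1 : th ^+ (kp + n.+1) <= th ^+ n.+1 * th^-1 ^+ c.
  apply: le_trans (_ : th ^+ n.+1 <= _); first by rewrite ler_wiXn2l ?(ltW th0) // leq_addl.
  by rewrite ler_peMr // ltW.
have u2 : d%:R * (C * (th ^+ n * th^-1 ^+ c)) * `|p - b| <= 6 * (d%:R * C) * (th ^+ n.+1 * th^-1 ^+ c).
  have -> : 6 * (d%:R * C) * (th ^+ n.+1 * th^-1 ^+ c) = d%:R * (C * (th ^+ n * th^-1 ^+ c)) * (6 * th) by rewrite exprS; ring.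
  apply: ler_wpM2l; last exact: ltW.
  have := tp n; rewrite !mulr_ge0 ?exprn_ge0 ?invr_ge0 ?(ltW th0) //.
have := ler_normD (u b) (u p - u b); rewrite addrC subrK; rewrite mulrDl mul1r; lra.
Qed.

Lemma whitney_small k E c M : (0 < M)%N -> exists (N kp : nat) (e0 : R), 0 < e0 /\ forall (th : R) b u,
  0 < th -> th <= e0 -> cb N (bl b (6 * th)) (th^-1 ^+ c) u ->
  (forall p, `|p - b| <= th ^+ M -> `|u p| <= th ^+ kp) -> cb k (bl b (6 * th)) (th ^+ E) u.
Proof.
elim: k M => [|k IH] M M0; have [kp [C [e1 [C0 e10 hC]]]] := sup_small (E + c).+1 c M0.
  exists (E + c).+2, kp, (Num.min 1 (Num.min e1 (1 / (C + 1)))).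
  have C1 : 0 < C + 1 by rewrite ltr_wpDl.
  split; first by rewrite !lt_min ltr01 e10 divr_gt0.
  move=> th b u th0; rewrite !le_min => /andP[th1 /andP[te1 te2]] hcb hu; split=> // p bp.
  apply: le_trans (hC th b u th0 te1 hcb hu p bp) _.
  rewrite exprS exprD -!mulrA -exprMn mulfV ?gt_eqF // expr1n mulr1 mulrA ler_piMl ?exprn_ge0 ?(ltW th0) //.
  by move: te2; rewrite ler_pdivlMr //; lra.
have [N' [kp' [e2 [e20 hW]]]] := IH M.+1 isT.
have [kpl [e3 [e30 hl]]] := landau kp' c M0.
have C1 : 0 < C + 1 by rewrite ltr_wpDl.
exists ((E + c).+2 + N' + 2)%N, (kp + kpl)%N, (Num.min (Num.min 1 e2) (Num.min e3 (Num.min e1 (1 / (C + 1))))); split.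
  by rewrite !lt_min ltr01 e10 e20 e30 divr_gt0.
move=> th b u th0; rewrite !le_min => /andP[/andP[th1 te2] /andP[te3 /andP[te1 teC]]] hcb hu.
have mono n1 n2 : (n1 <= n2)%N -> th ^+ n2 <= th ^+ n1 by move=> nn; rewrite ler_wiXn2l ?(ltW th0).
have hu1 p : `|p - b| <= th ^+ M -> `|u p| <= th ^+ kp.
  by move=> /hu h; apply: le_trans h _; apply: mono; exact: leq_addr.
have hu2 p : `|p - b| <= th ^+ M -> `|u p| <= th ^+ kpl.
  by move=> /hu h; apply: le_trans h _; apply: mono; exact: leq_addl.
have cE : cb (E + c).+2 (bl b (6 * th)) (th^-1 ^+ c) u by apply: cb_le hcb => //; rewrite -addnA leq_addr.
split.
  move=> p bp; apply: le_trans (hC th b u th0 te1 cE hu1 p bp) _.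
  rewrite exprS exprD -!mulrA -exprMn mulfV ?gt_eqF // expr1n mulr1 mulrA ler_piMl ?exprn_ge0 ?(ltW th0) //.
  by move: teC; rewrite ler_pdivlMr //; lra.
rewrite addn2 in hcb; have [_ [dF [Q [T h]]]] := hcb.
have h' i : cb ((E + c).+2 + N').+1 (bl b (6 * th)) (th^-1 ^+ c) (dF i) := h i.
exists dF, Q; split=> // i; apply: hW => //.
  by apply: cb_le (h' i) => //; apply: leqW; exact: leq_addl.
by move=> p; apply: (hl th b u dF Q) => // j; apply: cb_le (h' j).
Qed.

End SmallDerivatives.

Section Patching.
Variables (R : realType) (d : nat).
Local Notation V := 'rV[R]_d.
Implicit Types (p x a y : V).

Definition gsm (u : V -> R) := forall n c r, exists2 B, 0 <= B & cb n (bl c r) B u.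

Lemma okr_le (X : set V) (f : V -> R) k k' (de : R) a u : 0 < de -> de <= 1 -> (k' <= k)%N ->
  okr X f k de a u -> okr X f k' de a u.
Proof.
move=> de0 de1 kk [h1 h2 h3]; split=> //.
  by move=> y Xy ay; apply: le_trans (h1 y Xy ay) _; rewrite ler_wiXn2l ?(ltW de0).
by move=> n nk; apply: h2; exact: leq_trans kk.
Qed.

Lemma half_small (e : R) : 0 < e -> exists J, forall j, (J <= j)%N -> 2^-1 ^+ j <= e.
Proof.
move=> e0; exists (Num.bound e^-1) => j hj.
have h1 : e^-1 <= j%:R by apply: le_trans (ltW (archi_boundP _)) _; [rewrite invr_ge0 ltW|rewrite ler_nat].
have h2 : j%:R <= 2 ^+ j :> R by rewrite -natrX ler_nat ltnW // ltn_expl.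
by rewrite exprVn -[leRHS]invrK lef_pV2 ?posrE ?invr_gt0 ?exprn_gt0 //; exact: le_trans h2.
Qed.

Lemma uniform_pieces (X : set V) (f : V -> R) x (rho : R) :
  (forall kap, exists2 de0, 0 < de0 & forall (de : R) a, 0 < de -> de <= de0 -> X a -> bl x rho a ->
    exists u, okr X f kap de a u) ->
  exists r : nat -> V -> V -> R, (forall j a, gsm (r j a)) /\
    forall kap, exists J, forall j a, (J <= j)%N -> X a -> bl x rho a -> okr X f kap (2^-1 ^+ j) a (r j a).
Proof.
move=> H.
have /choice[e0 he0] : forall kap, exists e0 : R, 0 < e0 /\ forall (de : R) a, 0 < de -> de <= e0 -> X a -> bl x rho a ->
    exists u, okr X f kap de a u.
  by move=> kap; have [e0 e00 h] := H kap; exists e0.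
pose good j kap := (kap <= j)%N && [forall k : 'I_kap.+1, 2^-1 ^+ j <= e0 k].
have dj j : 0 < 2^-1 ^+ j :> R by rewrite exprn_gt0 // invr_gt0.
have dj1 j : 2^-1 ^+ j <= 1 :> R by rewrite exprn_ile1 // invf_le1 ?ler1n.
have zsm : gsm (fun=> 0) by move=> n c r; exists 0 => //; apply: cb_cst; rewrite normr0.
have /choice[r hr] : forall ja : nat * V, exists u, gsm u /\ (X ja.2 -> bl x rho ja.2 ->
    forall kap, good ja.1 kap -> okr X f kap (2^-1 ^+ ja.1) ja.2 u).
  move=> [j a] /=.
  have [[Xa [ba g0]]|hno] := pselect (X a /\ bl x rho a /\ exists kap, good j kap); last first.
    by exists (fun=> 0); split=> // Xa ba kap g; case: hno; split=> //; split=> //; exists kap.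
  have ub k : good j k -> (k <= j)%N by case/andP.
  case: (ex_maxnP g0 ub) => k gk kmax; have [_ hk] := he0 k.
  have /andP[_ /forallP /(_ ord_max) /= dk] := gk.
  have [u hu] := hk _ a (dj j) dk Xa ba; exists u; split; first by case: hu.
  by move=> _ _ kap /kmax kk; exact: okr_le hu.
exists (fun j a => r (j, a)); split; first by move=> j a; case: (hr (j, a)).
move=> kap; have [m m0 hm] := fin_min_pos (fun k : 'I_kap.+1 => proj1 (he0 k)).
have [J hJ] := half_small m0; exists (maxn J kap) => j a; rewrite geq_max => /andP[Jj kj] Xa ba.
have [_ h] := hr (j, a); apply: (h Xa ba); rewrite /good kj /=; apply/forallP => k.
by apply: le_trans (hJ j Jj) (hm k).
Qed.

Lemma gsm_sub u v : gsm u -> gsm v -> gsm (fun p => u p - v p).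
Proof.
move=> hu hv n c r; have [B B0 h] := hu n c r; have [B' B'0 h'] := hv n c r.
by exists (B + B'); [rewrite addr_ge0|exact: cb_sub].
Qed.

Lemma term_small (X : set V) (f : V -> R) x (rho : R) (r : nat -> V -> V -> R) (M : nat) (rho' : R) n E :
  (0 < M)%N -> 0 < rho' ->
  (forall a (de : R), X a -> bl x rho a -> 0 < de -> de < rho' ->
     exists b, `|b - a| <= de /\ forall y, `|y - b| <= de ^+ M -> X y) ->
  (forall j a, gsm (r j a)) ->
  (forall kap, exists J, forall j a, (J <= j)%N -> X a -> bl x rho a -> okr X f kap (2^-1 ^+ j) a (r j a)) ->
  exists J, forall j (nu : {ffun 'I_d -> 'I_(2 ^ j + 2 ^ j).+1}) (nu' : {ffun 'I_d -> 'I_(2 ^ j.+1 + 2 ^ j.+1).+1}) a a' (c : V) (s : R),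
    (J <= j)%N -> X a -> bl x rho a -> `|a - cen x (2^-1 ^+ j) nu| <= 2^-1 ^+ j ->
    X a' -> bl x rho a' -> `|a' - cen x (2^-1 ^+ j.+1) nu'| <= 2^-1 ^+ j.+1 ->
    cb n (bl c s) (2^-1 ^+ j.+1 ^+ E) (fun p => pu x (2^-1 ^+ j) nu p * pu x (2^-1 ^+ j.+1) nu' p * (r j.+1 a' p - r j a p)).
Proof.
move=> M0 rho'0 wb hr hok.
have [Cp [Np [Cp0 hpu]]] := pu_cb R d n.
pose E' := (E + (Np + Np) + 1)%N.
have [N [kp [e0 [e00 hW]]]] := @whitney_small R d n E' 3 M M0.
pose kap := (N + (kp + kp) + 2)%N.
have kk1 : (kp.+1 <= kap)%N by rewrite /kap addn2; apply: leqW; rewrite ltnS (leq_trans _ (leq_addl _ _)) // leq_addr.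
have kk2 : (2 * kp.+1 <= kap)%N by rewrite /kap addn2 mul2n -addnn addSn addnS !ltnS leq_addl.
have Nk : (N <= kap)%N by rewrite /kap -addnA leq_addr.
clearbody kap.
have [J1 hJ1] := hok kap.
pose K : R := 2 ^+ n * (2 ^+ n * (Cp * Cp)).
have K0 : 0 <= K by rewrite !mulr_ge0 ?exprn_ge0.
have m0 : 0 < Num.min (1 / (4 + K)) (Num.min e0 (rho' / 2)).
  by rewrite !lt_min e00 !divr_gt0 // ltr_wpDr.
have [J2 hJ2] := half_small m0.
exists (maxn J1 J2) => j nu nu' a a' c s; rewrite geq_max => /andP[j1 j2] Xa ba ac Xa' ba' ac'.
have [th thE] : exists th : R, 2^-1 ^+ j.+1 = th by eexists.
have [de dE] : exists de : R, 2^-1 ^+ j = de by eexists.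
rewrite thE in ac' *; rewrite dE in ac *.
have deE : de = 2 * th by rewrite -dE -thE exprS mulrA divff ?mul1r // pnatr_eq0.
have th0 : 0 < th by rewrite -thE exprn_gt0 // invr_gt0.
have de0 : 0 < de by rewrite -dE exprn_gt0 // invr_gt0.
have := hJ2 j.+1 (leqW j2); rewrite thE !le_min => /andP[thK /andP[the thr]].
have thK' : (4 + K) * th <= 1 by move: thK; rewrite ler_pdivlMr ?ltr_wpDr // mulrC.
have Kth : 0 <= K * th by rewrite mulr_ge0 // ltW.
have th4 : 4 * th <= 1 by lra.
have th1 : th <= 1 by lra.
have de1 : de <= 1 by rewrite deE; lra.
set c1 := cen x de nu in ac; set c2 := cen x th nu' in ac'.
set T := (fun p => _).
have ptp k : 0 < th ^+ k by exact: exprn_gt0.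
have [[p0 [z1 z2]]|hno] := pselect (exists p0, pu x de nu p0 != 0 /\ pu x th nu' p0 != 0); last first.
  apply: (cb_ext (F := fun=> 0)) => [p _|]; last by apply: cb_cst; rewrite normr0 ltW.
  rewrite /T; have [->|z1] := eqVneq (pu x de nu p) 0; first by rewrite !mul0r.
  have [->|z2] := eqVneq (pu x th nu' p) 0; first by rewrite mulr0 mul0r.
  by case: hno; exists p.
have p1 : `|p0 - c1| <= de := pu_supp de0 z1.
have p2 : `|p0 - c2| <= th := pu_supp th0 z2.
have aa : `|a - a'| <= 6 * th.
  have -> : a - a' = (a - c1) - (p0 - c1) + (p0 - c2) - (a' - c2) by apply/rowP => i; rewrite !mxE; ring.
  apply: le_trans (ler_normB _ _) _; have := ler_normD ((a - c1) - (p0 - c1)) (p0 - c2).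
  have := ler_normB (a - c1) (p0 - c1); rewrite deE in ac p1; lra.
have [b [bb bX]] : exists b, `|b - a'| <= th /\ forall y, `|y - b| <= th ^+ M -> X y.
  by apply: wb => //; lra.
have [a1 a2 _] := hJ1 j a j1 Xa ba; have [b1 b2 _] := hJ1 j.+1 a' (leqW j1) Xa' ba'.
rewrite thE in b1 b2; rewrite dE in a1 a2.
have sub1 : bl b (6 * th) `<=` bl a' (8 * th).
  move=> p; rewrite /bl /= => hp; have -> : p - a' = (p - b) + (b - a') by rewrite addrA subrK.
  by apply: le_lt_trans (ler_normD _ _) _; lra.
have sub2 : bl b (6 * th) `<=` bl a (8 * de).
  move=> p; rewrite /bl /= => hp; have -> : p - a = ((p - b) + (b - a')) - (a - a').
    by apply/rowP => i; rewrite !mxE; ring.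
  apply: le_lt_trans (ler_normB _ _) _; have := ler_normD (p - b) (b - a'); rewrite deE; lra.
pose u p := r j.+1 a' p - r j a p.
have i2 : 2 * th^-1 ^+ 2 <= th^-1 ^+ 3.
  rewrite [_ ^+ 3]exprS ler_wpM2r ?exprn_ge0 ?invr_ge0 ?(ltW th0) //.
  by rewrite -[leRHS]mul1r ler_pdivlMr //; lra.
have di : de^-1 <= th^-1 by rewrite lef_pV2 ?posrE // deE; lra.
have cu : cb N (bl b (6 * th)) (th^-1 ^+ 3) u.
  have h1 := cb_le (leqnn _) sub1 (lexx _) (b2 N Nk); have h2 := cb_le (leqnn _) sub2 (lexx _) (a2 N Nk).
  apply: (cb_le _ _ _ (cb_sub h1 h2)) => //; apply: le_trans i2; rewrite mulr_natl mulr2n lerD2l.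
  by rewrite lerXn2r ?nnegrE ?invr_ge0 ?(ltW th0) ?(ltW de0).
have M1 : th ^+ M <= th by rewrite -[leRHS]expr1 ler_wiXn2l ?(ltW th0).
have su p : `|p - b| <= th ^+ M -> `|u p| <= th ^+ kp.
  move=> hp; have Xp := bX p hp; have bp : bl b (6 * th) p by rewrite /bl /=; lra.
  have e1 := b1 p Xp (sub1 p bp); have e2 := a1 p Xp (sub2 p bp).
  have f1 : th ^+ kap <= th ^+ kp.+1 by rewrite ler_wiXn2l ?(ltW th0).
  have f2 : de ^+ kap <= th ^+ kp.+1.
    apply: le_trans (_ : de ^+ (2 * kp.+1) <= _); first by rewrite ler_wiXn2l ?(ltW de0).
    rewrite exprM lerXn2r ?nnegrE ?exprn_ge0 ?(ltW th0) ?(ltW de0) // deE expr2; nra.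
  have f3 : 2 * th ^+ kp.+1 <= th ^+ kp by rewrite exprS; have := ptp kp; nra.
  have -> : u p = (f p - r j a p) - (f p - r j.+1 a' p) by rewrite /u; ring.
  apply: le_trans (ler_normB _ _) _; lra.
have small := hW th b u th0 the cu su.
have hp1 O : cb n O (Cp * th^-1 ^+ Np) (pu x de nu).
  apply: cb_le (hpu x de _ nu O de0 de1) => //; rewrite ler_wpM2l // lerXn2r ?nnegrE ?invr_ge0 ?(ltW th0) ?(ltW de0) //.
have hp2 O := hpu x th _ nu' O th0 th1.
pose O1 := bl c2 (2 * th); pose O2 : set V := ~` closed_ball_ Num.norm c2 th.
have oO2 : open O2 by rewrite openC; exact: closed_closed_ball_.
have [Bq Bq0 hq] : exists2 B, 0 <= B & cb n (bl c s) B T.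
  have [B B0 hB] := gsm_sub (hr j.+1 a') (hr j a) n c s.
  eexists; last exact: (cb_mul (cb_mul (hp1 _) (hp2 _)) hB).
  by rewrite !mulr_ge0 ?exprn_ge0 ?invr_ge0 ?(ltW th0).
apply: (cb_glue (O1 := O1) (O2 := O2) _ _ oO2 _ hq); [exact: bl_open|exact: bl_open| | |].
- move=> p _; have [h|h] := ltP `|p - c2| (2 * th); [by left|right].
  by rewrite /O2 /closed_ball_ /= distrC => h'; lra.
- have sub3 : bl c s `&` O1 `<=` bl b (6 * th).
    move=> p [_]; rewrite /O1 /bl /= => hp.
    have -> : p - b = (p - c2) - (a' - c2) - (b - a') by apply/rowP => i; rewrite !mxE; ring.
    by apply: le_lt_trans (ler_normB _ _) _; have := ler_normB (p - c2) (a' - c2); lra.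
  have h3 := cb_mul (cb_mul (hp1 (bl c s `&` O1)) (hp2 (bl c s `&` O1))) (cb_le (leqnn _) sub3 (lexx _) small).
  apply: (cb_le _ _ _ h3) => //.
  have -> : 2 ^+ n * (2 ^+ n * (Cp * th^-1 ^+ Np * (Cp * th^-1 ^+ Np)) * th ^+ E') =
     K * th * th ^+ E * ((th^-1 * th) ^+ Np * (th^-1 * th) ^+ Np).
    by rewrite /K /E' !exprD !exprMn expr1; ring.
  rewrite mulVf ?gt_eqF // expr1n !mulr1 ler_piMl ?(ltW (ptp _)) //; lra.
- apply: (cb_ext (F := fun=> 0)) => [p [_ hp]|]; last by apply: cb_cst; rewrite normr0 ltW.
  rewrite /T; have [->|z] := eqVneq (pu x th nu' p) 0; first by rewrite mulr0 mul0r.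
  by case: hp; rewrite /closed_ball_ /= distrC; exact: pu_supp z.
Qed.

End Patching.

Section Patch.
Variables (R : realType) (d : nat).
Local Notation V := 'rV[R]_d.
Implicit Types (p x a y : V).

Lemma half_gt0 j : 0 < 2^-1 ^+ j :> R.
Proof. by rewrite exprn_gt0 // invr_gt0. Qed.

Lemma half_le1 j : 2^-1 ^+ j <= 1 :> R.
Proof. by rewrite exprn_ile1 // invf_le1 ?ler1n. Qed.

Lemma lattice_card j : (#|{: {ffun 'I_d -> 'I_(2 ^ j + 2 ^ j).+1}}| <= (2 ^ j.+1) ^ (2 * d))%N.
Proof.
rewrite card_ffun !card_ord expnM.
have h : ((2 ^ j + 2 ^ j).+1 <= (2 ^ j.+1) ^ 2)%N.
  rewrite addnn -mul2n -expnS; set t := (2 ^ j.+1)%N.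
  have t2 : (2 <= t)%N by rewrite /t expnS leq_pmulr // expn_gt0.
  by rewrite -mulnn; nia.
by case: (d) => [|n]; [rewrite !expn0|rewrite leq_exp2r].
Qed.

Lemma patch (X : set V) (f : V -> R) x (rho : R) (M : nat) (rho' : R) : 0 < rho -> rho <= 1 ->
  (0 < M)%N -> 0 < rho' ->
  (forall a (de : R), X a -> bl x rho a -> 0 < de -> de < rho' ->
     exists b, `|b - a| <= de /\ forall y, `|y - b| <= de ^+ M -> X y) ->
  (forall kap, exists2 de0, 0 < de0 & forall (de : R) a, 0 < de -> de <= de0 -> X a -> bl x rho a ->
    exists u, okr X f kap de a u) ->
  exists F : V -> R, (forall n, exists B, cb n (bl x (rho / 2)) B F) /\
    forall y, X y -> bl x (rho / 2) y -> F y = f y.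
Proof.
move=> rho0 rho1 M0 rho'0 wb H; have [r [gr hok]] := uniform_pieces H.
pose I j : finType := {ffun 'I_d -> 'I_(2 ^ j + 2 ^ j).+1}.
pose dl j : R := 2^-1 ^+ j.
have dl0 j : 0 < dl j by exact: half_gt0.
have dl1 j : dl j <= 1 by exact: half_le1.
pose act j (nu : I j) a := [/\ X a, bl x rho a & `|a - cen x (dl j) nu| <= dl j].
have /choice[an han] : forall jn : {j : nat & I j}, exists a,
    (exists a', act (projT1 jn) (projT2 jn) a') -> act (projT1 jn) (projT2 jn) a.
  move=> jn; have [[a' h]|h] := pselect (exists a', act (projT1 jn) (projT2 jn) a'); first by exists a'.
  by exists 0 => h'; case: h.
pose ac j (nu : I j) : bool := `[< exists a, act j nu a >].
pose at_ j (nu : I j) := an (existT _ j nu).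
have hat j (nu : I j) : ac j nu -> act j nu (at_ j nu) by move=> /asboolP h; exact: (han (existT _ j nu) h).
pose rr j (nu : I j) := r j (at_ j nu).
pose w j (nu : I j) p := (ac j nu)%:R * pu x (dl j) nu p.
pose U j p := \sum_(nu : I j) w j nu p * rr j nu p.
pose T j (nn : I j * I j.+1) p := w j nn.1 p * w j.+1 nn.2 p * (rr j.+1 nn.2 p - rr j nn.1 p).
pose Dd j p := \sum_(nn : I j * I j.+1) T j nn p.
set Om := bl x (rho / 2).
have wpu j (nu : I j) y : X y -> Om y -> w j nu y = pu x (dl j) nu y.
  move=> Xy Oy; rewrite /w /ac; case: asboolP => [_|h]; first by rewrite mul1r.
  have [->|nz] := eqVneq (pu x (dl j) nu y) 0; first by rewrite mulr0.
  case: h; exists y; split=> //; last exact: (pu_supp (dl0 j) nz).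
  by move: Oy; rewrite /Om /bl /=; lra.
have wsum j y : X y -> Om y -> \sum_(nu : I j) w j nu y = 1.
  move=> Xy Oy; rewrite -[RHS](@pu_sum R d x (dl j) (2 ^ j) y (dl0 j)).
    by apply: eq_bigr => nu _; exact: wpu.
  rewrite natrX /dl exprVn mulfV ?expf_neq0 ?pnatr_eq0 //.
  by move: Oy; rewrite /Om /bl /=; lra.
have tele j y : X y -> Om y -> Dd j y = U j.+1 y - U j y.
  move=> Xy Oy; rewrite /Dd /T.
  rewrite -(pair_big xpredT xpredT (fun nu nu' => w j nu y * w j.+1 nu' y * (rr j.+1 nu' y - rr j nu y))) /=.
  rewrite -[U j.+1 y]mul1r -(wsum j y Xy Oy) -[U j y]mulr1 -(wsum j.+1 y Xy Oy) /U.
  rewrite !big_distrlr /= -sumrB; apply: eq_bigr => nu _; rewrite -sumrB; apply: eq_bigr => nu' _; ring.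
have qw n j (nu : I j) : exists2 B, 0 <= B & cb n Om B (w j nu).
  have [Cp [Np [Cp0 hpu]]] := pu_cb R d n.
  exists (`|(ac j nu)%:R| * (Cp * (dl j)^-1 ^+ Np)); first by rewrite !mulr_ge0 ?exprn_ge0 // invr_ge0 ltW.
  by apply: cb_scale; exact: hpu.
have qT n j nn : exists B, 0 <= B /\ cb n Om B (T j nn).
  have [B1 B10 h1] := qw n j nn.1; have [B2 B20 h2] := qw n j.+1 nn.2.
  have [B3 B30 h3] := gsm_sub (gr j.+1 (at_ j.+1 nn.2)) (gr j (at_ j nn.1)) n x (rho / 2).
  eexists; split; last exact: (cb_mul (cb_mul h1 h2) h3).
  by rewrite !mulr_ge0 ?exprn_ge0.
have qD n j : exists B, 0 <= B /\ cb n Om B (Dd j).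
  have /choice[B hB] := qT n j; exists (\sum_(nn : I j * I j.+1) B nn); split.
    by apply: sumr_ge0 => nn _; case: (hB nn).
  exact: (cb_sum (index_enum (I j * I j.+1)%type) (fun nn => proj2 (hB nn))).
have smD n : exists J, forall j, (J <= j)%N -> cb n Om (dl j.+1) (Dd j).
  pose E := (6 * d).+1.
  have [J hJ] := @term_small R d X f x rho r M rho' n E M0 rho'0 wb gr hok.
  exists J => j Jj.
  have hT nn : cb n Om (dl j.+1 ^+ E) (T j nn).
    have [a1|a1] := boolP (ac j nn.1); last first.
      apply: (cb_eq (F := fun=> 0)) => [p|]; first by rewrite /T /w (negbTE a1) !mul0r.
      by apply: cb_cst; rewrite normr0 exprn_ge0 // ltW.
    have [a2|a2] := boolP (ac j.+1 nn.2); last first.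
      apply: (cb_eq (F := fun=> 0)) => [p|]; first by rewrite /T /w (negbTE a2) mul0r mulr0 mul0r.
      by apply: cb_cst; rewrite normr0 exprn_ge0 // ltW.
    have [x1 x2 x3] := hat _ _ a1; have [y1 y2 y3] := hat _ _ a2.
    apply: cb_eq (hJ j nn.1 nn.2 _ _ x (rho / 2) Jj x1 x2 x3 y1 y2 y3) => p.
    by rewrite /T /w a1 a2 !mul1r.
  apply: cb_le (cb_sum (index_enum (I j * I j.+1)%type) hT) => //.
  rewrite sumr_const -[leLHS]mulr_natl /E [dl j.+1 ^+ _]exprS mulrCA ler_piMr ?(ltW (dl0 _)) //.
  rewrite card_prod /dl -exprM exprVn -natrX ler_pdivrMr ?ltr0n ?expn_gt0 // mul1r ler_nat.
  apply: leq_trans (leq_mul (lattice_card j) (lattice_card j.+1)) _.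
  rewrite -!expnM -expnD leq_exp2l //; nia.
have sumB n : exists (B : nat -> R) (BB : R), (forall j, cb n Om (B j) (Dd j)) /\ forall N, \sum_(j < N) B j <= BB.
  have [J hJ] := smD n; have /choice[bq hbq] := qD n.
  exists (fun j => if (j < J)%N then bq j else dl j.+1), (\sum_(j < J) bq j + 1); split.
    by move=> j; case: ifP => h; [case: (hbq j)|apply: hJ; rewrite leqNgt h].
  move=> N; apply: le_trans (_ : \sum_(j < N) ((if (j < J)%N then bq j else 0) + dl j.+1) <= _).
    by apply: ler_sum => j _; case: ifP => _; rewrite ?add0r // lerDl ltW.
  rewrite big_split /=; apply: lerD.
    elim: N => [|N IH]; first by rewrite big_ord0 sumr_ge0 // => j _; case: (hbq j).
    have [NJ|JN] := ltnP N J; last by rewrite big_ord_recr /= ltnNge JN addr0.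
    rewrite (eq_bigr (fun j : 'I_N.+1 => bq j)) => [|j _]; last first.
      by rewrite (leq_trans (ltn_ord j) NJ).
    rewrite -(big_mkord xpredT bq) -(big_mkord xpredT bq) (@big_cat_nat _ _ _ N.+1 0 J) //= lerDl.
    by apply: sumr_ge0 => j _; case: (hbq j).
  have -> : \sum_(j < N) dl j.+1 = 1 - dl N.
    elim: N => [|N IH]; first by rewrite big_ord0 /dl expr0 subrr.
    rewrite big_ord_recr /= IH /dl exprS; set t := 2^-1 ^+ N; have := half_gt0 N; rewrite -/t; lra.
  by rewrite lerBlDr lerDl ltW.
have [B0 [BB0 [hB0 hBB0]]] := sumB 0%N.
have /choice[S hS] : forall p, exists l, Om p -> sums_to (Dd^~ p) l.
  move=> p; have [Op|nO] := pselect (Om p); last by exists 0.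
  have [l hl] : exists l, sums_to (Dd^~ p) l; last by exists l.
  by apply: (summable_sums_to (b := B0) (B := BB0)) => // j; exact: (cb_bd (hB0 j) Op).
exists (fun p => U 0%N p + S p); split.
  move=> n; have [B [BB [hB hBB]]] := sumB n.+1.
  have cS : cb n Om BB S by apply: (cb_series hB hBB).
  have /choice[B' hB'] : forall nu : I 0%N, exists B', cb n Om B' (fun p => w 0%N nu p * rr 0%N nu p).
    move=> nu; have [b1 _ h1] := qw n 0%N nu; have [b2 _ h2] := gr 0%N (at_ 0%N nu) n x (rho / 2).
    by eexists; exact: (cb_mul h1 h2).
  by eexists; exact: (cb_add (cb_sum (index_enum (I 0%N)) hB') cS).
move=> y Xy Oy.
have UN N : U 0%N y + \sum_(j < N) Dd j y = U N y.
  elim: N => [|N IH]; first by rewrite big_ord0 addr0.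
  by rewrite big_ord_recr /= addrA IH tele // addrC subrK.
apply/eqP; rewrite -subr_eq0 -normr_le0; apply/ler_addgt0Pr => e e0; rewrite add0r.
have e2 : 0 < e / 2 by rewrite divr_gt0.
have [N1 h1] := hS y Oy _ e2.
have [J hJ] := hok (4 * d).+1.
have [N2 h2] := half_small e2.
pose N := maxn N1 (maxn J (maxn N2 1)).
have [n1 [n2 [n3 n4]]] : (N1 <= N)%N /\ (J <= N)%N /\ (N2 <= N)%N /\ (1 <= N)%N by rewrite /N; lia.
have hU : `|U N y - f y| <= e / 2.
  have -> : U N y - f y = \sum_(nu : I N) w N nu y * (rr N nu y - f y).
    under eq_bigr do rewrite mulrBr; rewrite sumrB -mulr_suml wsum // mul1r //.
  apply: le_trans (ler_norm_sum _ _ _) _.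
  apply: le_trans (_ : \sum_(nu : I N) dl N ^+ (4 * d).+1 <= _).
    apply: ler_sum => nu _; rewrite normrM.
    have [->|nz] := eqVneq (w N nu y) 0; first by rewrite normr0 mul0r exprn_ge0 // ltW.
    have an1 : ac N nu by apply/negPn/negP => h; move/eqP: nz; apply; rewrite /w (negbTE h) mul0r.
    have [x1 x2 x3] := hat _ _ an1; have [ok1 _ _] := hJ N _ n2 x1 x2.
    have pz : pu x (dl N) nu y != 0 by rewrite -wpu.
    have ya : bl (at_ N nu) (8 * 2^-1 ^+ N) y.
      rewrite /bl /=; have -> : y - at_ N nu = (y - cen x (dl N) nu) - (at_ N nu - cen x (dl N) nu).
        by rewrite opprB addrA subrK.
      apply: le_lt_trans (ler_normB _ _) _; have := pu_supp (dl0 N) pz; have := dl0 N; rewrite -/(dl N); lra.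
    rewrite -[leRHS]mul1r; apply: ler_pM => //; first by rewrite wpu // pu_le1.
    by rewrite distrC; exact: ok1.
  apply: le_trans (h2 N n3); rewrite sumr_const -[leLHS]mulr_natl [dl N ^+ _]exprS mulrCA ler_piMr ?(ltW (dl0 _)) //.
  rewrite /dl -exprM exprVn -natrX ler_pdivrMr ?ltr0n ?expn_gt0 // mul1r ler_nat.
  apply: leq_trans (lattice_card N) _; rewrite -!expnM leq_exp2l //; nia.
have := h1 N n1; rewrite distrC.
have -> : U 0%N y + S y - f y = (U N y - f y) + (S y - \sum_(j < N) Dd j y) by rewrite -(UN N); ring.
move=> h3; apply: le_trans (ler_normD _ _) _; lra.
Qed.

End Patch.

Section HolderWB.
Variable R : realType.

Lemma enorm_coord d (v : 'rV[R]_d) i : `|v ord0 i| <= enorm v.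
Proof.
rewrite -sqrtr_sqr /enorm ler_sqrt ?sumr_ge0 // => [|j _]; last exact: sqr_ge0.
by rewrite (bigD1 i) //= lerDl sumr_ge0 // => j _; exact: sqr_ge0.
Qed.

Lemma norm_le_enorm d (v : 'rV[R]_d) : `|v| <= enorm v.
Proof. by apply: rV_norm_le => [|i]; [exact: sqrtr_ge0|exact: enorm_coord]. Qed.

Lemma enorm_le n (v : 'rV[R]_n.+1) : enorm v <= n.+1%:R * `|v|.
Proof.
have p0 : 0 <= n.+1%:R * `|v| by rewrite mulr_ge0.
rewrite -[leRHS]ger0_norm // -sqrtr_sqr /enorm ler_sqrt ?sqr_ge0 //.
apply: le_trans (_ : \sum_(i < n.+1) `|v| ^+ 2 <= _).
  by apply: ler_sum => i _; rewrite -real_normK ?num_real // lerXn2r ?nnegrE // rV_coord_le.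
rewrite sumr_const card_ord -[leLHS]mulr_natl exprMn ler_wpM2r ?exprn_ge0 //.
by rewrite -natrX ler_nat -mulnn leq_pmulr.
Qed.

Lemma enorm_orth d (v : 'rV[R]_d) A : orthogonal_mx A -> enorm (v *m A) = enorm v.
Proof.
move=> oA; have E (u : 'rV[R]_d) : \sum_(i < d) u ord0 i ^+ 2 = (u *m u^T) ord0 ord0.
  by rewrite mxE; apply: eq_bigr => i _; rewrite mxE expr2.
by rewrite /enorm !E trmx_mul mulmxA -(mulmxA v) oA mulmx1.
Qed.

Lemma holder_WB d (X : set 'rV[R]_d) x : holder_set X -> X x -> WB X x.
Proof.
move=> [_ [[fX _] [al [al0 [_ cusp]]]]] Xx.
have [ix|nix] := pselect (interior X x).
  have [e /= e0 he] : exists2 e : R, 0 < e & forall y, `|y - x| < e -> X y.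
    move: ix; rewrite /interior -nbhs_ballE => -[e /= e0 he]; exists e => // y yx; apply: he.
    by rewrite -ball_normE /= distrC.
  exists 1%N, (e / 2); split; first by rewrite divr_gt0.
  move=> a de Xa ax de0 de1; exists a; split; first by rewrite subrr normr0 ltW.
  move=> y ya; apply: he; have -> : y - x = (y - a) + (a - x) by rewrite addrA subrK.
  apply: le_lt_trans (ler_normD _ _) _; rewrite expr1 in ya; lra.
have cx : closure (interior X) x by rewrite -fX.
case: d X x fX cusp Xx nix cx => [|n] X x fX cusp Xx nix cx.
  have [y [Xy _]] := cx setT filterT; case: nix.
  by rewrite (_ : x = y) //; apply/rowP => -[].
have [eps [r [h [A [eps0 [r0 [h0 [oA hA]]]]]]]] := cusp x (conj cx nix).
pose D : R := n.+1%:R.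
have D1 : 1 <= D by rewrite ler1n.
have D0 : 0 < D by lra.
pose K : R := h * (D / r) `^ al.
have K0 : 0 <= K by rewrite mulr_ge0 ?powR_ge0 // ltW.
pose M := (Num.bound (2 / al)).+2.
have Mal : 2 <= M%:R * al.
  rewrite -ler_pdivrMr //; apply: le_trans (ltW (archi_boundP _)) _; first by rewrite divr_ge0 // ltW.
  by rewrite ler_nat /M; do 2 apply: leqW.
have M2 : (2 <= M)%N by [].
clearbody M.
pose Q := 4 * D + 4 * K + 1.
have Q0 : 0 < Q by rewrite /Q; lra.
pose rho := Num.min (Num.min (eps / D) (1 / Q)) (Num.min (h / 2) r).
have rho0 : 0 < rho by rewrite !lt_min !divr_gt0.
exists M, rho; split => // a de Xa; rewrite /rho !lt_min => /andP[/andP[ax _] _] de0.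
move=> /andP[/andP[_ deQ] /andP[deh der]].
have deQ' : Q * de < 1 by move: deQ; rewrite ltr_pdivlMr // mulrC.
have Dde : 4 * D * de <= 1.
  by apply: le_trans (ltW deQ'); rewrite ler_pM2r // /Q; lra.
have Kde : 4 * K * de <= 1.
  by apply: le_trans (ltW deQ'); rewrite ler_pM2r // /Q; lra.
have de1 : de <= 1 by have := ler_wpM2r (ltW de0) D1; lra.
have oAT : orthogonal_mx A^T by rewrite /orthogonal_mx trmxK; exact: mulmx1C.
have ATA : A^T *m A = 1%:M by exact: mulmx1C.
pose z0 : 'rV[R]_n.+1 := de *: delta_mx ord0 ord_max.
have z0E i : z0 ord0 i = if i == ord_max then de else 0.
  by rewrite !mxE eqxx /=; case: eqP => _; rewrite ?mulr1 ?mulr0.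
have nz0 : enorm z0 = de.
  rewrite /enorm (bigD1 ord_max) //= z0E eqxx big1 ?addr0 ?sqrtr_sqr ?gtr0_norm // => i ne.
  by rewrite z0E (negbTE ne) expr0n.
pose b := a + z0 *m A; exists b; split.
  by rewrite /b addrC addKr; apply: le_trans (norm_le_enorm _) _; rewrite enorm_orth // nz0.
move=> y yb; pose e := (y - b) *m A^T; pose z := z0 + e.
have zA : a + z *m A = y.
  by rewrite mulmxDl addrA -/b -mulmxA ATA mulmx1 addrC subrK.
rewrite -zA; apply: interior_subset; apply: hA; first by rewrite -fX.
  rewrite /eball /=; apply: le_lt_trans (enorm_le _) _; move: ax; by rewrite ltr_pdivlMr // mulrC.
have ne : enorm e <= D * de ^+ M.
  by rewrite enorm_orth //; apply: le_trans (enorm_le _) _; rewrite ler_pM2l.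
have d2 : de ^+ M <= de ^+ 2 by rewrite ler_wiXn2l // ltW.
have e4 : D * de ^+ M <= de / 4.
  apply: le_trans (ler_wpM2l (ltW D0) d2) _; rewrite expr2; have := ler_wpM2l (ltW de0) Dde; lra.
have xp : xprime_norm z <= D * de ^+ M.
  apply: le_trans ne; rewrite /xprime_norm /enorm ler_sqrt ?sumr_ge0 // => [|j _]; last exact: sqr_ge0.
  rewrite [leRHS](bigID (fun i : 'I_n.+1 => (i.+1 < n.+1)%N)) /=.
  apply: le_trans (_ : \sum_(i < n.+1 | (i.+1 < n.+1)%N) e ord0 i ^+ 2 <= _); last first.
    by rewrite lerDl sumr_ge0 // => j _; exact: sqr_ge0.
  apply: ler_sum => i hi; rewrite [z ord0 i]mxE z0E ifF ?add0r //.
  by apply/negP => /eqP ei; move: hi; rewrite ei /= ltnn.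
have xp0 : 0 <= xprime_norm z by exact: sqrtr_ge0.
have xl : xlast z = de + e ord0 ord_max.
  rewrite /xlast (big_pred1 ord_max) => [|i]; first by rewrite mxE z0E eqxx.
  by rewrite eqSS; apply/eqP/eqP => [h1|->] //; exact: val_inj.
have le4 : `|e ord0 ord_max| <= de / 4 by apply: le_trans (enorm_coord _ _) (le_trans ne e4).
move: le4; rewrite ler_norml => /andP[l1 l2].
split; first by lra.
rewrite xl; split; last by lra.
have p1 : (xprime_norm z / r) `^ al <= (D / r) `^ al * de ^+ 2.
  apply: le_trans (_ : (D / r * de ^+ M) `^ al <= _).
    apply: ge0_ler_powR; rewrite ?nnegrE ?(ltW al0) ?divr_ge0 ?mulr_ge0 ?exprn_ge0 ?invr_ge0 ?(ltW r0) ?(ltW de0) ?(ltW D0) //.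
    by rewrite mulrAC ler_pM2r ?invr_gt0.
  rewrite powRM ?divr_ge0 ?exprn_ge0 ?(ltW r0) ?(ltW de0) ?(ltW D0) //; apply: ler_wpM2l; first exact: powR_ge0.
  by apply: (powR_small al0 de0 de1 _ (lexx _) Mal); rewrite exprn_ge0 // ltW.
have p2 := ler_wpM2l (ltW h0) p1.
have p3 : h * ((D / r) `^ al * de ^+ 2) <= de / 4.
  by rewrite mulrA -/K expr2; have := ler_wpM2l (ltW de0) Kde; lra.
lra.
Qed.

End HolderWB.

Theorem theorem9p5 (R : realType) (d : nat) (X : set 'rV[R]_d)
  (f g : 'rV[R]_d -> R[i]) (m : nat) (C alpha : R) :
  (holder_set X \/ (simple_set X /\ fat X /\ closed X /\ subanalytic X)) ->
  (1 <= m)%N -> 0 < C -> 0 < alpha ->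
  Cinf X g -> Cinf X (fun x => f x * g x) -> Cinf X (fun x => f x ^+ m) ->
  (forall x, X x -> cabs (f x) <= C * cabs (g x) `^ alpha) ->
  Cinf X f.
Proof.
move=> hX m1 C0 al0 sg_ sh sp_ hf x Xx.
have fX : X = closure (interior X) by case: hX => [[_ [[h _] _]]|[_ [[h _] _]]].
have [M [rw [rw0 wb]]] : WB X x.
  case: hX => [h|[_ [_ [_ h]]]]; first exact: holder_WB.
  exact: subanalytic_WB.
have [Vg [oVg [Vgx [G [[G1 G2] hG]]]]] := sg_ x Xx.
have [Vh [oVh [Vhx [H [[H1 H2] hH]]]]] := sh x Xx.
have [Vp [oVp [Vpx [P [[P1 P2] hP]]]]] := sp_ x Xx.
have [e e0 he] : exists2 e : R, 0 < e & forall y, `|y - x| < e -> Vg y /\ Vh y /\ Vp y.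
  have oV : open (Vg `&` (Vh `&` Vp)) by do 2 apply: openI => //.
  have := open_nbhs_nbhs (conj oV (conj Vgx (conj Vhx Vpx))); rewrite -nbhs_ballE => -[e /= e0 he].
  exists e => // y yx; have [|h1 [h2 h3]] := he y; last by [].
  by rewrite -ball_normE /= distrC.
pose rho := Num.min (e / 2) (Num.min 1 rw).
have rho0 : 0 < rho by rewrite !lt_min ltr01 rw0 divr_gt0.
have [r1 [r2 r3]] : rho <= e / 2 /\ rho <= 1 /\ rho <= rw by rewrite /rho !ge_min !lexx ?orbT.
clearbody rho.
have inV p : `|p - x| <= rho -> Vg p /\ Vh p /\ Vp p by move=> h; apply: he; lra.
have ccb_of (V : set 'rV[R]_d) (F : 'rV[R]_d -> R[i]) : (forall p, `|p - x| <= rho -> V p) ->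
    smooth_on V (fun y => complex.Re (F y)) -> smooth_on V (fun y => complex.Im (F y)) ->
    forall n, exists2 B, 0 <= B & ccb n (bl x rho) B F.
  move=> hV s1 s2 n; have [B1 B10 h1] := smooth_cb hV s1 n; have [B2 B20 h2] := smooth_cb hV s2 n.
  exists (B1 + B2); first by rewrite addr_ge0.
  by split; [apply: cb_le h1 => //; rewrite lerDl|apply: cb_le h2 => //; rewrite lerDr].
have cG := ccb_of Vg G (fun p h => proj1 (inV p h)) G1 G2.
have cH := ccb_of Vh H (fun p h => proj1 (proj2 (inV p h))) H1 H2.
have cP := ccb_of Vp P (fun p h => proj2 (proj2 (inV p h))) P1 P2.
have rel y : X y -> bl x rho y -> [/\ H y = f y * G y, P y = f y ^+ m & cabs (f y) <= C * cabs (G y) `^ alpha].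
  move=> Xy /ltW /inV[v1 [v2 v3]]; rewrite (hH y v2 Xy) (hG y v1 Xy) (hP y v3 Xy); split=> //; exact: hf.
have appr := local_approx fX rho0 r2 m1 C0 al0 cG cH cP rel.
have r40 : 0 < rho / 4 by rewrite divr_gt0.
have r41 : rho / 4 <= 1 by lra.
have mr0 : 0 < Num.min rw 1 by rewrite lt_min rw0 ltr01.
have wb' a (de : R) : X a -> bl x (rho / 4) a -> 0 < de -> de < Num.min rw 1 ->
     exists b, `|b - a| <= de /\ forall y, `|y - b| <= de ^+ M.+1 -> X y.
  move=> Xa ax de0; rewrite lt_min => /andP[d1 d2].
  have [|b [h1 h2]] := wb a de Xa _ de0 d1; first by move: ax; rewrite /bl /=; lra.
  exists b; split=> // y hy; apply: h2; apply: le_trans hy _.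
  by rewrite exprS ler_piMl ?exprn_ge0 // ltW.
have pieces (pr : R[i] -> R) : (forall kap, exists2 de0, 0 < de0 & forall (de : R) a, 0 < de -> de <= de0 -> X a ->
    bl x (rho / 4) a -> exists u, okr X (fun y => pr (f y)) kap de a u) ->
    exists F : 'rV[R]_d -> R, smooth_on (bl x (rho / 4 / 2)) F /\ forall y, X y -> bl x (rho / 4 / 2) y -> F y = pr (f y).
  move=> h; have [F [F1 F2]] := patch r40 r41 (ltn0Sn M) mr0 wb' h; exists F; split=> // n.
  by have [B hB] := F1 n.+1; apply: (cb_Ck (@bl_open _ _ _ _) hB).
have [F1 [s1 e1]] : exists F : 'rV[R]_d -> R, smooth_on (bl x (rho / 4 / 2)) F /\
    forall y, X y -> bl x (rho / 4 / 2) y -> F y = complex.Re (f y).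
  apply: pieces => kap; have [de0 de00 h] := appr kap; exists de0 => // de a p1 p2 p3 p4.
  by have [u1 [u2 [h1 h2]]] := h de a p1 p2 p3 p4; exists u1.
have [F2 [s2 e2]] : exists F : 'rV[R]_d -> R, smooth_on (bl x (rho / 4 / 2)) F /\
    forall y, X y -> bl x (rho / 4 / 2) y -> F y = complex.Im (f y).
  apply: pieces => kap; have [de0 de00 h] := appr kap; exists de0 => // de a p1 p2 p3 p4.
  by have [u1 [u2 [h1 h2]]] := h de a p1 p2 p3 p4; exists u2.
exists (bl x (rho / 4 / 2)); split; first exact: bl_open.
split; first by rewrite /bl /= subrr normr0 !divr_gt0.
exists (fun y => (F1 y +i* F2 y)%C); split; first by split.
by move=> y Vy Xy; rewrite (e1 y Xy Vy) (e2 y Xy Vy); case: (f y).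
Qed.
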